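(* Let $q$ be the Hastings–McLeod solution of the Painlevé II equation and let $R(x)=\int_x^\infty q(s)^2\,ds$, $F(x)=\exp\left(-\frac12\int_x^\infty R(s)\,ds\right)$, $E(x)=\exp\left(-\frac12\int_x^\infty q(s)\,ds\right)$. Then for every $x<0$, $$F(x)= 2^{1/48}e^{\frac12 \zeta'(-1)}\,\frac{e^{-\frac{1}{24}|x|^3}}{|x|^{1/16}} \exp\left\{ \frac12\int_{-\infty}^x\left(R(y)-\frac14y^2+\frac1{8y}\right)dy \right\},$$ where $\zeta$ is the Riemann zeta function, and $$E(x) = \frac1{2^{1/4}}\, e^{- \frac{1}{3\sqrt{2}} |x|^{3/2}}\exp\left\{ \frac12 \int_{-\infty}^x \left(q(y)-\sqrt{\frac{|y|}2}\, \right) dy \right\}.$$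
   Context: The Hastings–McLeod solution $q:\mathbb{R}\to\mathbb{R}$ is the unique global real solution of the Painlevé II equation $q''=2q^3+xq$ satisfying $q(x)\sim \mathrm{Ai}(x)$ as $x\to+\infty$, where $\mathrm{Ai}$ is the Airy function. (It is known that such a solution exists and is unique, that $q(x)=\sqrt{-x/2}\,\left(1+\frac{1}{8x^3}+O(|x|^{-6})\right)$ and $R(x)=\frac{x^2}{4}\left(1-\frac{1}{2x^3}+O(|x|^{-6})\right)$ as $x\to-\infty$, so the integrals over $(-\infty,x)$ converge.) *)

(* Defs.v *)
From Stdlib Require Export Reals.
From Coquelicot Require Export Coquelicot.

Open Scope R_scope.

(* Improper Riemann integrals: int_x^{+oo} f and int_{-oo}^x f. *)
Definition int_to_pinfty (f : R -> R) (x : R) : R :=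
  RInt_gen f (at_point x) (Rbar_locally p_infty).

Definition int_from_minfty (f : R -> R) (x : R) : R :=
  RInt_gen f (Rbar_locally m_infty) (at_point x).

(* The improper integral is only conditionally convergent. *)
Definition Ai (x : R) : R :=
  / PI * int_to_pinfty (fun t => cos (t ^ 3 / 3 + x * t)) 0.

(* [ex_derive q] is required explicitly because [Derive] is total: the equation
   on [Derive q] alone would not force q to be differentiable. *)
Definition painleveII (q : R -> R) : Prop :=
  forall x : R,
    ex_derive q x /\ is_derive (Derive q) x (2 * q x ^ 3 + x * q x).

(* [is_equiv F f g] means g - f = o(g) along F. *)
Definition hastings_mcleod (q : R -> R) : Prop :=
  painleveII q /\ is_equiv (Rbar_locally p_infty) q Ai.

Definition hmR (q : R -> R) (x : R) : R :=
  int_to_pinfty (fun s => q s ^ 2) x.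

Definition hmF (q : R -> R) (x : R) : R :=
  exp (- (1 / 2) * int_to_pinfty (hmR q) x).

Definition hmE (q : R -> R) (x : R) : R :=
  exp (- (1 / 2) * int_to_pinfty q x).

Definition Cexp (z : C) : C := (exp (Re z) * cos (Im z), exp (Re z) * sin (Im z)).

(* n^{-s} = exp(-s ln n), for n >= 1. *)
Definition nat_Cpow_opp (n : nat) (s : C) : C :=
  Cexp (Copp (Cmult s (RtoC (ln (INR n))))).

(* zeta is the holomorphic continuation to C \ {1} of the Dirichlet series
   sum_{n >= 1} n^{-s}, Re s > 1.  C \ {1} is connected, so this determines
   zeta there; its value at the pole s = 1 is irrelevant. *)
Definition riemann_zeta (zeta : C -> C) : Prop :=
  (forall s : C, s <> RtoC 1 ->
     ex_derive (K := C_AbsRing) (V := C_NormedModule) zeta s) /\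
  (forall s : C, 1 < Re s ->
     is_series (K := C_AbsRing) (V := C_NormedModule)
       (fun n : nat => nat_Cpow_opp (S n) s) (zeta s)).

(* zeta'(-1) is a complex derivative with real value. *)
Definition zeta_prime_m1 (zeta : C -> C) : R := Re (C_derive zeta (RtoC (-1))).

(* Main.v *)
(** The recurrence [r_(n+1) + r_(n-1) = (n / t) r_n / (1 - r_n ^ 2)] (discrete Painleve II) with [r_0 = 1] and
    [r_1 = I_1(2t) / I_0(2t)] has a positive decaying solution, and [r_k(h ^ -3) / h] tends to [q(x)] when
    [k = 2 h ^ -3 + x / h] and [h -> 0].  On the right this holds because [r_k ~ J_k(2t)] and [J_k(2t) / h -> Ai(x)];
    it propagates to the left by a discrete Gronwall estimate for the Casoratian of [r] and [q].
    The exact sums [sum ln (1 + r_k) = t], [sum ln (1 - r_k ^ 2) = - ln I_0(2t)] and [sum k ln (1 - r_k ^ 2) = - t ^ 2]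
    over [k >= 1] turn the integrals of [q] and [R] over [(x, oo)] into finite sums over [k <= n]; there sub- and
    supersolutions of the recurrence give [r_k ^ 2 = 1 - k / (2t) - ...] so precisely that Stirling's formula and its
    analogue for [sum k ln k] yield the asymptotics of both integrals as [x -> - oo], constants included.
    The constant of [sum k ln k] is [1 / 12 - zeta'(-1)]: the Euler--Maclaurin continuation of [(s - 1) zeta(s)] agrees
    with [zeta] near [-1] by an identity theorem deduced from Goursat's lemma and the maximum principle. *)

Require Import Defs.
From Stdlib Require Import Reals.
From Coquelicot Require Import Coquelicot.
From Stdlib Require Import Lra Lia Psatz Factorial Arith ZArith.

Open Scope R_scope.

(** The constants at [- oo] compare the behaviour of [q] at both ends of the line, which the
    differential equation alone does not show. The discrete system sees both ends at once: its sums
    are exact for every [t > 0], because their [t]-derivatives telescope and all of them vanish at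
    [t = 0]. Up to sign, [r_k] is the value at 0 of the monic orthogonal polynomial of degree [k] on
    the circle for the weight [exp (2 t cos theta)]. Bounds on [r] have to be uniform in [h]; they
    come from a maximum principle for the ratio of [r] to a barrier. The Gronwall estimate needs
    initial data for both the ratio [q / a_k] and its increment, while the Airy asymptotics control
    only the ratio; a step with a small increment is found by a discrete mean value argument. The
    constants of Stirling's formula and of [ln I_0] are never evaluated: the exact sum of
    [ln (1 - r_k ^ 2)] shows that they cancel. *)

(** * Calculus lemmas and tactics *)

Lemma incr_le (f df : R -> R) (a b : R) : a <= b -> (forall x, a <= x <= b -> is_derive f x (df x)) ->
 (forall x, a <= x <= b -> 0 <= df x) -> f a <= f b.
Proof. intros Hab Hd Hp. destruct (MVT_gen f a b df) as [c [Hc He]].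
 - intros x Hx; rewrite Rmin_left, Rmax_right in Hx by lra; apply Hd; lra.
 - intros x Hx; rewrite Rmin_left, Rmax_right in Hx by lra.
  apply continuity_pt_filterlim, (ex_derive_continuous f x); eexists; apply Hd; lra.
 - rewrite Rmin_left, Rmax_right in Hc by lra. specialize (Hp c Hc); nra.
Qed.

Lemma incr_lt (f df : R -> R) (a b : R) : a < b -> (forall x, a <= x <= b -> is_derive f x (df x)) ->
 (forall x, a <= x <= b -> 0 < df x) -> f a < f b.
Proof. intros Hab Hd Hp. destruct (MVT_gen f a b df) as [c [Hc He]].
 - intros x Hx; rewrite Rmin_left, Rmax_right in Hx by lra; apply Hd; lra.
 - intros x Hx; rewrite Rmin_left, Rmax_right in Hx by lra.
  apply continuity_pt_filterlim, (ex_derive_continuous f x); eexists; apply Hd; lra.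
 - rewrite Rmin_left, Rmax_right in Hc by lra. specialize (Hp c Hc); nra.
Qed.

(** Nothing is assumed at 0 itself, because the quantities below contain [1 / t]. The bound [C * s]
    forces [G] to 0 at [0+], so the increasing [G] cannot be negative at [T]: it would stay below
    [G T] all the way down to 0. *)
Lemma nonneg_from_zero (G G' : R -> R) (C e T : R) : 0 < T -> 0 < e ->
 (forall s, 0 < s <= T -> is_derive G s (G' s)) -> (forall s, 0 < s <= T -> 0 <= G' s) ->
 (forall s, 0 < s <= e -> s <= T -> Rabs (G s) <= C * s) -> 0 <= G T.
Proof. intros HT He Hd Hp Hb. destruct (Rle_lt_dec 0 (G T)) as [H|H]; [exact H|exfalso]. assert (HC : 0 <= C).
 { set (s := Rmin e T). assert (Hs : 0 < s <= T) by (unfold s; split; [apply Rmin_glb_lt; lra|apply Rmin_r]).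
  assert (Hs' : s <= e) by apply Rmin_l. assert (H1 := Hb s ltac:(lra) ltac:(lra)).
  assert (H2 := Rabs_pos (G s)). nra. }
 set (s := Rmin (Rmin e T) (- G T / (2 * (C + 1)))).
 assert (Hq : 0 < - G T / (2 * (C + 1))) by (apply Rdiv_lt_0_compat; lra).
 assert (Hs0 : 0 < s) by (unfold s; repeat apply Rmin_glb_lt; lra).
 assert (Hs1 : s <= e) by (unfold s; eapply Rle_trans; [apply Rmin_l|apply Rmin_l]).
 assert (Hs2 : s <= T) by (unfold s; eapply Rle_trans; [apply Rmin_l|apply Rmin_r]).
 assert (Hs3 : s <= - G T / (2 * (C + 1))) by apply Rmin_r. assert (H1 : G s <= G T).
 { apply (incr_le G G'); [lra| |]; intros x Hx; [apply Hd|apply Hp]; lra. }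
 assert (H2 := Hb s ltac:(lra) Hs2). assert (H3 : s * (2 * (C + 1)) <= - G T).
 { apply (Rmult_le_compat_r (2 * (C + 1))) in Hs3; [|lra].
  replace (- G T / (2 * (C + 1)) * (2 * (C + 1))) with (- G T) in Hs3 by (field; lra). lra. }
 assert (H4 := Rle_abs (- G s)). rewrite Rabs_Ropp in H4. nra.
Qed.

Lemma continuous_eps (f : R -> R) (x e : R) : continuous f x -> 0 < e ->
 exists d, 0 < d /\ forall y, Rabs (y - x) < d -> Rabs (f y - f x) < e.
Proof. intros Hc He. destruct (proj1 (filterlim_locally f (f x)) Hc (mkposreal e He)) as [d Hd].
 exists d; split; [apply cond_pos|]. intros y Hy. apply Hd. exact Hy.
Qed.

Lemma is_derive_constR (c t : R) : is_derive (fun _ : R => c) t 0.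
Proof. apply (is_derive_const (V := R_NormedModule) c t). Qed.

Lemma is_derive_plusR (f g : R -> R) (x a b : R) :
 is_derive f x a -> is_derive g x b -> is_derive (fun s => f s + g s) x (a + b).
Proof. intros Hf Hg; exact (is_derive_plus f g x a b Hf Hg). Qed.

Lemma is_derive_minusR (f g : R -> R) (x a b : R) :
 is_derive f x a -> is_derive g x b -> is_derive (fun s => f s - g s) x (a - b).
Proof. intros Hf Hg; exact (is_derive_minus f g x a b Hf Hg). Qed.

Lemma is_derive_multR (f g : R -> R) (x a b : R) :
 is_derive f x a -> is_derive g x b -> is_derive (fun s => f s * g s) x (a * g x + f x * b).
Proof. intros Hf Hg; exact (is_derive_mult f g x a b Hf Hg Rmult_comm). Qed.

Lemma is_derive_idR (x : R) : is_derive (fun s : R => s) x 1.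
Proof. exact (is_derive_id x). Qed.

Lemma is_derive_powR (c : R) (k : nat) (t : R) : is_derive (fun s => c * s ^ S k) t (c * (INR (S k) * t ^ k)).
Proof. apply (is_derive_scal (fun s => s ^ S k)).
 replace (INR (S k) * t ^ k) with (INR (S k) * 1 * t ^ pred (S k)) by (rewrite Rmult_1_r; reflexivity).
 apply (is_derive_pow (fun s => s) (S k) t 1), (is_derive_id t).
Qed.

(** Let [c] be the supremum of the times up to which [f] stays positive. By continuity [f c = 0],
    and then [0 < df c] would make [f] negative just to the left of [c]. *)
Lemma barrier (f df : R -> R) (e : R) : (forall t, 0 < t -> is_derive f t (df t)) ->
 0 < e -> (forall t, 0 < t < e -> 0 < f t) -> (forall t, 0 < t -> f t = 0 -> 0 < df t) -> forall t, 0 < t -> 0 < f t.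
Proof. intros Hd He Hpos Hz t1 Ht1. destruct (Rlt_le_dec 0 (f t1)) as [H|Hneg]; [exact H|exfalso].
 set (E := fun s => 0 < s <= t1 /\ forall s', 0 < s' <= s -> 0 < f s'). assert (Het : e <= t1).
 { destruct (Rle_lt_dec e t1); [assumption|]. specialize (Hpos t1); lra. }
 destruct (completeness E) as [c [Hub Hlub]]. { exists t1; intros s [Hs _]; lra. }
 { exists (e / 2); split; [lra|]. intros s' Hs'; apply Hpos; lra. }
 assert (Hc0 : e / 2 <= c). { apply Hub; split; [lra|]. intros s' Hs'; apply Hpos; lra. }
 assert (Hc1 : c <= t1) by (apply Hlub; intros s [Hs _]; lra). assert (Hleft : forall s, 0 < s < c -> 0 < f s).
 { intros s Hs. destruct (Rlt_le_dec 0 (f s)) as [H|H]; [exact H|exfalso].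
  assert (c <= s); [|lra]. apply Hlub. intros u [Hu1 Hu2].
  destruct (Rle_lt_dec u s); [assumption|]. specialize (Hu2 s); lra. }
 assert (Hcont : continuous f c). { apply (ex_derive_continuous f c). exists (df c); apply Hd; lra. }
 destruct (Rtotal_order (f c) 0) as [Hlt|[Heq|Hgt]].
 - destruct (continuous_eps f c (- f c) Hcont ltac:(lra)) as [d [Hdp Hd']]. set (s := Rmax (c / 2) (c - d / 2)).
  assert (s < c) by (unfold s; apply Rmax_lub_lt; lra).
  assert (c / 2 <= s) by apply Rmax_l. assert (c - d / 2 <= s) by apply Rmax_r.
  assert (Hs : Rabs (f s - f c) < - f c) by (apply Hd'; rewrite Rabs_left1; lra).
  apply Rabs_def2 in Hs. specialize (Hleft s); lra.
 - specialize (Hz c ltac:(lra) Heq). assert (Hdc := Hd c ltac:(lra)). apply is_derive_Reals in Hdc.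
  destruct (Hdc (df c) Hz) as [d Hd']. assert (Hdp := cond_pos d). set (k := - Rmin (c / 2) (d / 2)).
  assert (0 < Rmin (c / 2) (d / 2)) by (apply Rmin_glb_lt; lra).
  assert (Rmin (c / 2) (d / 2) <= c / 2) by apply Rmin_l. assert (Rmin (c / 2) (d / 2) <= d / 2) by apply Rmin_r.
  assert (Hk : k <> 0) by (unfold k; lra). specialize (Hd' k Hk).
  assert (Rabs k < d) by (unfold k; rewrite Rabs_Ropp, Rabs_right; lra).
  specialize (Hd' H2). apply Rabs_def2 in Hd'. rewrite Heq in Hd'. assert (Hfk := Hleft (c + k) ltac:(unfold k; lra)).
  assert ((f (c + k) - 0) / k < 0). { unfold Rdiv. apply (Rmult_lt_reg_r (- k)); [unfold k; lra|].
   replace ((f (c + k) - 0) * / k * - k) with (- f (c + k)) by (field; exact Hk). lra. }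
  lra.
 - destruct (continuous_eps f c (f c) Hcont ltac:(lra)) as [d [Hdp Hd']].
  assert (c < t1) by (destruct (Rle_lt_or_eq_dec _ _ Hc1); [assumption|subst; lra]). set (s := Rmin t1 (c + d / 2)).
  assert (c < s) by (unfold s; apply Rmin_glb_lt; lra).
  assert (s <= t1) by apply Rmin_l. assert (s <= c + d / 2) by apply Rmin_r. assert (s <= c); [|lra].
  apply Hub. split; [lra|]. intros s' Hs'. destruct (Rlt_le_dec s' c); [apply Hleft; lra|].
  assert (Hs : Rabs (f s' - f c) < f c) by (apply Hd'; rewrite Rabs_right; lra). apply Rabs_def2 in Hs. lra.
Qed.

Lemma exp_le_mono (a b : R) : a <= b -> exp a <= exp b.
Proof. intros [H| ->]; [left; apply exp_increasing, H|right; reflexivity]. Qed.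

Ltac pos :=
 match goal with
 | |- 0 < _ * _ => first [apply Rmult_lt_0_compat; pos | lra]
 | |- 0 <= _ * _ => first [apply Rmult_le_pos; pos | lra]
 | |- 0 < _ / _ => first [apply Rdiv_lt_0_compat; pos | lra]
 | |- 0 <= _ / _ => first [apply Rdiv_le_0_compat; pos | lra]
 | |- 0 < / _ => first [apply Rinv_0_lt_compat; pos | lra]
 | |- 0 <= / _ => left; apply Rinv_0_lt_compat; pos
 | |- 0 <= _ ^ 2 => apply pow2_ge_0
 | |- 0 < _ ^ _ => first [apply pow_lt; pos | lra]
 | |- 0 <= _ ^ _ => first [apply pow_le; pos | lra]
 | |- 0 < exp _ => apply exp_pos
 | |- 0 <= exp _ => left; apply exp_pos
 | |- 0 <= INR _ => apply pos_INR
 | |- 0 <= Rabs _ => apply Rabs_pos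
 | |- _ >= 0 => apply Rle_ge; pos
 | |- _ => lra end.

Ltac absle H := apply Rabs_le_between in H.

(** The last case is [lra], so the tactic also closes linear goals and identities that hold after
    normalisation. *)
Ltac mono :=
 match goal with
 | |- _ /\ _ => split; mono
 | |- 0 <= _ => pos
 | |- 0 < _ => pos
 | |- ?a * _ <= ?a * _ => first [apply Rmult_le_compat_l; [pos | mono] | lra]
 | |- _ * ?a <= _ * ?a => first [apply Rmult_le_compat_r; [pos | mono] | lra]
 | |- _ * _ <= _ * _ => first [apply Rmult_le_compat; [pos | pos | mono | mono] | lra]
 | |- _ ^ _ <= _ ^ _ => first [apply pow_incr; split; [pos | mono] | lra]
 | |- / _ <= / _ => first [apply Rinv_le_contravar; [pos | mono] | lra]
 | |- exp _ <= exp _ => apply exp_le_mono; lra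
 | |- _ => lra end.

Lemma le_div_intro (a b c : R) : 0 < c -> a * c <= b -> a <= b / c.
Proof. intros Hc H. apply (Rle_div_r a b c); [exact Hc|exact H]. Qed.

Lemma div_le_intro (a b c : R) : 0 < c -> a <= b * c -> a / c <= b.
Proof. intros Hc H. apply (Rle_div_l a b c); [exact Hc|exact H]. Qed.

(** * The discrete Painleve II sequence *)

(** Taylor coefficients of [I_0(2 sqrt z)], so that [bessel0 (t ^ 2)] is [I_0(2t)] and
    [t * bessel1 (t ^ 2)] is [I_1(2t)]. *)
Definition bes (k : nat) : R := / (INR (fact k)) ^ 2.

Lemma fact_pos (k : nat) : 0 < INR (fact k).
Proof. apply lt_0_INR, lt_O_fact. Qed.

Lemma fact_succ (k : nat) : INR (fact (S k)) = INR (S k) * INR (fact k).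
Proof. rewrite <- mult_INR. reflexivity. Qed.

Lemma INR_S_pos (k : nat) : 0 < INR (S k).
Proof. apply lt_0_INR; lia. Qed.

Lemma bes_pos (k : nat) : 0 < bes k.
Proof. unfold bes; apply Rinv_0_lt_compat, pow_lt, fact_pos. Qed.

Lemma bes_succ (k : nat) : INR (S k) ^ 2 * bes (S k) = bes k.
Proof. unfold bes; rewrite fact_succ. assert (H := fact_pos k); assert (H' := INR_S_pos k). field; lra. Qed.

Lemma bes_radius : CV_radius bes = p_infty.
Proof. apply CV_radius_infinite_DAlembert. { intros n; assert (H := bes_pos n); lra. }
 apply (is_lim_seq_le_le (fun _ => 0) _ (fun n => / INR (S n))).
 - intros n. split; [mono|]. assert (H := INR_S_pos n). assert (Hb := bes_pos (S n)). rewrite <- (bes_succ n).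
  replace (bes (S n) / (INR (S n) ^ 2 * bes (S n))) with (/ INR (S n) ^ 2) by (field; lra). rewrite Rabs_right.
  + apply Rinv_le_contravar; [lra|]. assert (1 <= INR (S n)) by (rewrite S_INR; assert (H1 := pos_INR n); lra). nra.
  + left; apply Rinv_0_lt_compat; nra.
 - apply is_lim_seq_const.
 - apply (is_lim_seq_incr_1 (fun n => / INR n)). replace (Finite 0) with (Rbar_inv p_infty) by reflexivity.
  apply is_lim_seq_inv; [apply is_lim_seq_INR|discriminate].
Qed.

Definition bessel0 (z : R) : R := PSeries bes z.

Definition bessel1 (z : R) : R := PSeries (PS_derive bes) z.

Lemma bessel0_derive (z : R) : is_derive bessel0 z (bessel1 z).
Proof. apply is_derive_PSeries; rewrite bes_radius; exact I. Qed.

Lemma bessel1_derive (z : R) : is_derive bessel1 z (PSeries (PS_derive (PS_derive bes)) z).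
Proof. apply is_derive_PSeries; rewrite CV_radius_derive, bes_radius; exact I. Qed.

Lemma ex_pseries_inf (a : nat -> R) (x : R) : CV_radius a = p_infty -> ex_pseries a x.
Proof. intros H; apply CV_radius_inside; rewrite H; exact I. Qed.

(** The modified Bessel equation of order 0 in the variable [z = t ^ 2]; on coefficients it is
    [bes_succ]. *)
Lemma bes_ode (z : R) : z * PSeries (PS_derive (PS_derive bes)) z + bessel1 z = bessel0 z.
Proof. unfold bessel1, bessel0. rewrite <- PSeries_incr_1, <- PSeries_plus.
 - apply PSeries_ext. intros n. unfold PS_plus, PS_incr_1, PS_derive. destruct n as [|n].
  + unfold plus, zero; simpl. rewrite <- (bes_succ 0). simpl; ring.
  + unfold plus; simpl AbelianMonoid.sort. rewrite <- (bes_succ (S n)). rewrite !S_INR. simpl. ring.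
 - apply ex_pseries_incr_1, ex_pseries_inf. rewrite !CV_radius_derive; apply bes_radius.
 - apply ex_pseries_inf. rewrite !CV_radius_derive; apply bes_radius.
Qed.

Lemma PSeries_le_nonneg (a b : nat -> R) (z : R) :
 0 <= z -> (forall n, 0 <= a n <= b n) -> CV_radius b = p_infty -> PSeries a z <= PSeries b z.
Proof. intros Hz H Hr. unfold PSeries. apply Series_le.
 - intros n. assert (0 <= z ^ n) by pos. specialize (H n). nra.
 - apply ex_series_ext with (2 := proj1 (ex_pseries_R b z) (ex_pseries_inf b z Hr)). reflexivity.
Qed.

Lemma PSeries_ge_head (a : nat -> R) (z : R) :
 0 <= z -> (forall n, 0 <= a n) -> CV_radius a = p_infty -> a O <= PSeries a z.
Proof. intros Hz H Hr. assert (He := proj1 (ex_pseries_R a z) (ex_pseries_inf a z Hr)).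
 unfold PSeries. rewrite Series_incr_1 by exact He. assert (0 <= Series (fun k => a (S k) * z ^ S k)).
 { replace 0 with (0 * Series (fun k => a (S k) * z ^ S k)) by ring. rewrite <- Series_scal_l. apply Series_le.
  - intros n. assert (0 <= z ^ S n) by pos. specialize (H (S n)). nra.
  - apply (ex_series_incr_1 (fun k => a k * z ^ k)); exact He. }
 simpl (z ^ 0). lra.
Qed.

Lemma bessel0_ge_1 (z : R) : 0 <= z -> 1 <= bessel0 z.
Proof. intros Hz. replace 1 with (bes 0) by (unfold bes; simpl; field).
 apply PSeries_ge_head; [exact Hz| |apply bes_radius]. intros n; left; apply bes_pos.
Qed.

Lemma bessel1_ge_1 (z : R) : 0 <= z -> 1 <= bessel1 z.
Proof. intros Hz. replace 1 with (PS_derive bes 0) by (unfold PS_derive, bes; simpl; field).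
 apply PSeries_ge_head; [exact Hz| |rewrite CV_radius_derive; apply bes_radius].
 intros n; unfold PS_derive. apply Rmult_le_pos; [mono|left; apply bes_pos].
Qed.

Lemma bessel1_le_bessel0 (z : R) : 0 <= z -> bessel1 z <= bessel0 z.
Proof. intros Hz. apply PSeries_le_nonneg; [exact Hz| |apply bes_radius].
 intros n; unfold PS_derive. assert (H := bes_pos (S n)). assert (H1 := INR_S_pos n). rewrite <- (bes_succ n).
 assert (1 <= INR (S n)) by (rewrite S_INR; assert (H2 := pos_INR n); lra).
 assert (H2 := Rmult_lt_0_compat _ _ H1 H). split; [lra|].
 replace (INR (S n) ^ 2 * bes (S n)) with (INR (S n) * (INR (S n) * bes (S n))) by ring. nra.
Qed.

Definition r1 (t : R) : R := t * bessel1 (t ^ 2) / bessel0 (t ^ 2).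

(** The recurrence has order two, hence the iteration on consecutive pairs. It runs forward from
    exact initial values, so positivity and decay are not built in and have to be proved through
    [rs_inv]. *)
Fixpoint rpair (n : nat) (t : R) : R * R := match n with
 | O => (1, r1 t)
 | S m => (snd (rpair m t), INR (S m) / t * snd (rpair m t) / (1 - snd (rpair m t) ^ 2) - fst (rpair m t)) end.

Definition rs (n : nat) (t : R) : R := fst (rpair n t).

Lemma rs_0 (t : R) : rs 0 t = 1.
Proof. reflexivity. Qed.

Lemma rs_1 (t : R) : rs 1 t = r1 t.
Proof. reflexivity. Qed.

Lemma rs_SS (n : nat) (t : R) : rs (S (S n)) t = INR (S n) / t * rs (S n) t / (1 - rs (S n) t ^ 2) - rs n t.
Proof. reflexivity. Qed.

Lemma r1_derive (t : R) : 0 < t -> is_derive r1 t (2 - 2 * r1 t ^ 2 - r1 t / t).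
Proof. intros Ht. unfold r1. assert (H0 := bessel0_ge_1 (t ^ 2) ltac:(nra)). assert (Hode := bes_ode (t ^ 2)).
 set (b2 := PSeries (PS_derive (PS_derive bes)) (t ^ 2)) in *.
 assert (D0 : is_derive (fun s => bessel0 (s ^ 2)) t (2 * t * bessel1 (t ^ 2))).
 { apply (is_derive_comp bessel0 (fun s => s ^ 2)); [apply bessel0_derive|]. auto_derive; [exact I|ring]. }
 assert (D1 : is_derive (fun s => bessel1 (s ^ 2)) t (2 * t * b2)).
 { apply (is_derive_comp bessel1 (fun s => s ^ 2)); [apply bessel1_derive|]. auto_derive; [exact I|ring]. }
 assert (D2 : is_derive (fun s => s * bessel1 (s ^ 2)) t (bessel1 (t ^ 2) + t * (2 * t * b2))).
 { replace (bessel1 (t ^ 2) + t * (2 * t * b2))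
   with (plus (mult 1 (bessel1 (t ^ 2))) (mult t (2 * t * b2))) by (unfold plus, mult; simpl; ring).
  apply (is_derive_mult (fun s => s) (fun s => bessel1 (s ^ 2)));
   [apply (is_derive_id t)|exact D1|intros; apply Rmult_comm]. }
 replace (2 - 2 * (t * bessel1 (t ^ 2) / bessel0 (t ^ 2)) ^ 2 - t * bessel1 (t ^ 2) / bessel0 (t ^ 2) / t)
  with (((bessel1 (t ^ 2) + t * (2 * t * b2)) * bessel0 (t ^ 2)
     - t * bessel1 (t ^ 2) * (2 * t * bessel1 (t ^ 2))) / (bessel0 (t ^ 2)) ^ 2).
 - apply (is_derive_div (fun s => s * bessel1 (s ^ 2)) (fun s => bessel0 (s ^ 2))); [exact D2|exact D0|lra]. -
  replace (t * (2 * t * b2)) with (2 * (bessel0 (t ^ 2) - bessel1 (t ^ 2))) by mono. field; lra.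
Qed.

Lemma one_minus_sq_pos (r : R) : 0 <= r < 1 -> 0 < 1 - r ^ 2.
Proof. intros; nra. Qed.

(* The pair of first-order equations in [t] is the Baecklund transformation of
 discrete Painleve II; the invariant below is what it propagates in [n]. *)
Definition rs_inv (n : nat) : Prop := forall t, 0 < t ->
  is_derive (rs (S n)) t (2 * rs n t * (1 - rs (S n) t ^ 2) - INR (S n) / t * rs (S n) t) /\
  is_derive (rs n) t (INR n / t * rs n t - 2 * rs (S n) t * (1 - rs n t ^ 2)) /\
  0 < rs (S n) t < 1 /\ 0 < rs n t <= 1 /\ rs (S n) t <= t ^ S n / INR (fact (S n)) /\ rs n t <= t ^ n / INR (fact n).

Lemma rs_inv_0 : rs_inv 0.
Proof. assert (Hub : forall t, 0 < t -> 0 < r1 t <= t). { intros t Ht. unfold r1.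
  assert (H1 := bessel1_ge_1 (t ^ 2) ltac:(nra)). assert (H2 := bessel1_le_bessel0 (t ^ 2) ltac:(nra)).
  split; [mono|]. apply Rle_div_l; nra. }
 (* Where [r1 = 1], the Riccati equation gives [r1' = - 1 / t < 0], so [r1] cannot cross 1. *)
 assert (Hlt : forall t, 0 < t -> 0 < 1 - r1 t).
 { apply (barrier (fun t => 1 - r1 t) (fun t => 0 - (2 - 2 * r1 t ^ 2 - r1 t / t)) 1).
  - intros t Ht. apply (is_derive_minus (fun _ => 1) r1 t 0 (2 - 2 * r1 t ^ 2 - r1 t / t));
    [apply is_derive_constR|apply r1_derive, Ht].
  - lra.
  - intros t Ht; specialize (Hub t ltac:(lra)); lra.
  - intros t Ht H. replace (r1 t) with 1 by lra. assert (0 < 1 / t) by pos. lra. }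
 intros t Ht. rewrite rs_0, rs_1. specialize (Hub t Ht). specialize (Hlt t Ht). assert (D := r1_derive t Ht).
 simpl (fact _); simpl (t ^ _); simpl (INR 1); simpl (INR 0). split; [|split; [|mono]].
 - replace (2 * 1 * (1 - r1 t * (r1 t * 1)) - 1 / t * r1 t) with (2 - 2 * r1 t ^ 2 - r1 t / t) by mono.
  replace (2 * 1 * (1 - r1 t ^ 2) - 1 / t * r1 t) with (2 - 2 * r1 t ^ 2 - r1 t / t) by mono. exact D.
 - replace (0 / t * 1 - 2 * r1 t * (1 - 1 ^ 2)) with 0 by mono. apply (is_derive_constR 1).
Qed.

(** The recurrence writes [r_(n+2)] as a difference of two terms that nearly cancel as [t -> 0], so
    it does not reveal the sign. The differential equation does: [t ^ (n+2) r_(n+2)] has derivative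
    [2 t ^ (n+2) r_(n+1) (1 - r_(n+2) ^ 2)] and tends to 0 at 0. This settles small [t], and
    [barrier] carries positivity and the bound 1 to all [t]. *)
Lemma rs_inv_succ (n : nat) : rs_inv n -> rs_inv (S n).
Proof. intros IH. set (f := rs (S (S n))). set (a := rs n). set (b := rs (S n)). set (m := INR (S n)).
 assert (Hm : 1 <= m) by (unfold m; rewrite S_INR; assert (H := pos_INR n); lra).
 assert (Hm2 : INR (S (S n)) = m + 1) by (unfold m; rewrite (S_INR (S n)); reflexivity).
 assert (Hmn : INR n = m - 1) by (unfold m; rewrite S_INR; ring).
 assert (Hf : forall t, f t = m / t * b t / (1 - b t ^ 2) - a t) by (intros t; apply rs_SS).
 assert (Hb' : forall t, 0 < t -> is_derive b t (m / t * b t - 2 * f t * (1 - b t ^ 2))).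
 { intros t Ht. destruct (IH t Ht) as [D [_ [Hb _]]]. fold b m a in D, Hb.
  assert (Hs := one_minus_sq_pos (b t) ltac:(lra)). replace (m / t * b t - 2 * f t * (1 - b t ^ 2))
   with (2 * a t * (1 - b t ^ 2) - m / t * b t); [exact D|]. rewrite Hf. field; lra. }
 assert (Hf' : forall t, 0 < t -> is_derive f t (2 * b t * (1 - f t ^ 2) - (m + 1) / t * f t)).
 { intros t Ht. destruct (IH t Ht) as [D [Da [Hb _]]]. fold b m a in D, Da, Hb. rewrite Hmn in Da.
  assert (Hs := one_minus_sq_pos (b t) ltac:(lra)).
  apply (is_derive_ext (fun s => m / s * b s / (1 - b s ^ 2) - a s)). { intros s; symmetry; apply Hf. }
  set (db := 2 * a t * (1 - b t ^ 2) - m / t * b t) in *.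
  set (da := (m - 1) / t * a t - 2 * b t * (1 - a t ^ 2)) in *. assert (Eb : ex_derive b t) by (exists db; exact D).
  assert (Ea : ex_derive a t) by (exists da; exact Da). auto_derive.
  - simpl in Hs. repeat match goal with |- _ /\ _ => split end; try exact I; try assumption; lra.
  - replace (Derive (fun x => b x) t) with db by (symmetry; apply is_derive_unique, D).
   replace (Derive (fun x => a x) t) with da by (symmetry; apply is_derive_unique, Da).
   rewrite Hf. unfold db, da. field. mono. }
 (* A crude bound to start from: [m * b t <= t] keeps the quotient at most 2 in spite of the factor
    [1 / t]. *)
 assert (Hsmall : forall t, 0 < t <= / 2 -> Rabs (f t) <= 3).
 { intros t Ht. destruct (IH t ltac:(lra)) as [_ [_ [Hb [Ha [Hbt _]]]]]. fold b a m in Hb, Ha, Hbt.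
  assert (Hs := one_minus_sq_pos (b t) ltac:(lra)). assert (Hp : t ^ n <= 1).
  { rewrite <- (pow1 n). apply pow_incr; lra. }
  assert (Hp0 : 0 < t ^ n) by pos. assert (Hf1 : 1 <= INR (fact n)). { apply (le_INR 1). apply lt_O_fact. }
  assert (Hmb : m * b t <= t). { apply Rle_trans with (t * t ^ n / INR (fact n)).
   - rewrite fact_succ in Hbt. fold m in Hbt. apply Rle_trans with (m * (t ^ S n / (m * INR (fact n)))).
    + mono.
    + right. simpl. field. lra.
   - apply Rle_div_l; [lra|]. mono. }
  assert (Hb2 : b t <= / 2) by nra. rewrite Hf. assert (0 < m / t * b t / (1 - b t ^ 2) <= 2); [|apply Rabs_le; lra].
  split.
  - mono.
  - apply Rle_div_l; [lra|]. apply Rle_trans with 1; [|nra].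
   replace (m / t * b t) with (m * b t / t) by mono. apply Rle_div_l; lra. }
 assert (Hg' : forall t, 0 < t -> is_derive (fun s => s ^ S (S n) * f s) t (2 * t ^ S (S n) * b t * (1 - f t ^ 2))).
 { intros t Ht. assert (D := Hf' t Ht). replace (2 * t ^ S (S n) * b t * (1 - f t ^ 2)) with
   (plus (mult (INR (S (S n)) * 1 * t ^ S n) (f t))
      (mult (t ^ S (S n)) (2 * b t * (1 - f t ^ 2) - (m + 1) / t * f t))).
  - apply (is_derive_mult (fun s => s ^ S (S n)) f); [|exact D|intros; apply Rmult_comm].
   replace (INR (S (S n)) * 1 * t ^ S n) with (1 * (INR (S (S n)) * t ^ S n)) by ring.
   apply (is_derive_ext (fun s => 1 * s ^ S (S n))); [intros; apply Rmult_1_l|apply is_derive_powR].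
  - rewrite Hm2. unfold plus, mult; simpl. field. lra. }
 assert (Hgs : forall s, 0 < s <= / 2 -> Rabs (s ^ S (S n) * f s) <= 3 * s). { intros s Hs. rewrite Rabs_mult.
  assert (Hp0 : 0 < s ^ S n) by pos. assert (Hp : s ^ S n <= 1) by (rewrite <- (pow1 (S n)); apply pow_incr; lra).
  assert (H3 := Hsmall s Hs). rewrite (Rabs_right (s ^ S (S n))) by (simpl; simpl in Hp0; nra).
  replace (s ^ S (S n)) with (s * s ^ S n) by reflexivity. assert (0 <= s * s ^ S n) by nra. nra. }
 assert (Hup : forall t, 0 < t -> f t <= t ^ S (S n) / INR (fact (S (S n)))). { intros t Ht.
  set (F := INR (fact (S (S n)))). assert (HF : 0 < F) by apply fact_pos.
  assert (HF1 : F = (m + 1) * INR (fact (S n))) by (unfold F; rewrite fact_succ, Hm2; reflexivity).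
  assert (Hfp := fact_pos (S n)). assert (H : 0 <= t ^ (S (S n) + S (S n)) / F - t ^ S (S n) * f t).
  { apply (nonneg_from_zero (fun s => s ^ (S (S n) + S (S n)) / F - s ^ S (S n) * f s)
    (fun s => 2 * s ^ S (S n) * (s ^ S n / INR (fact (S n))) -
         2 * s ^ S (S n) * b s * (1 - f s ^ 2)) (1 / F + 3) (/ 2)); [lra|lra| | |].
   - intros s Hs. apply (is_derive_minus (fun s => s ^ (S (S n) + S (S n)) / F)).
    + apply (is_derive_ext (fun s => / F * s ^ S (S (S n) + S n))).
     { intros x. replace (S (S (S n) + S n)) with (S (S n) + S (S n))%nat by lia. mono. }
     replace (2 * s ^ S (S n) * (s ^ S n / INR (fact (S n))))
      with (/ F * (INR (S (S (S n) + S n)) * s ^ (S (S n) + S n))); [apply is_derive_powR|].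
     rewrite S_INR, plus_INR, Hm2, pow_add, HF1. fold m. field. lra.
    + apply Hg'; lra.
   - intros s Hs. destruct (IH s ltac:(lra)) as [_ [_ [Hb [_ [Hbs _]]]]]. fold b in Hb, Hbs.
    assert (Hp0 : 0 < s ^ S (S n)) by pos. assert (b s * (1 - f s ^ 2) <= s ^ S n / INR (fact (S n))) by nra. nra.
   - intros s Hs _. assert (Hp0 : 0 < s ^ (S n + S (S n))) by pos. assert (Hp : s ^ (S n + S (S n)) <= 1).
    { rewrite <- (pow1 (S n + S (S n))); apply pow_incr; lra. }
    unfold Rminus. eapply Rle_trans; [apply Rabs_triang|]. rewrite Rabs_Ropp. assert (H3 := Hgs s Hs).
    assert (Rabs (s ^ (S (S n) + S (S n)) / F) <= 1 / F * s); [|lra].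
    replace (s ^ (S (S n) + S (S n))) with (s * s ^ (S n + S (S n))) by reflexivity. rewrite Rabs_right.
    + unfold Rdiv. assert (0 < / F) by pos.
     replace (s * s ^ (S n + S (S n)) * / F) with (/ F * s * s ^ (S n + S (S n))) by ring.
     assert (0 < / F * s) by nra. nra.
    + left. apply Rdiv_lt_0_compat; nra. }
  rewrite pow_add in H. assert (Hp0 : 0 < t ^ S (S n)) by pos. apply (Rmult_le_reg_l (t ^ S (S n))); [lra|]. mono. }
 (* From [|f| <= 3] comes [1 - f ^ 2 >= -8]; integrated against [s ^ (n+2)] this yields
    [f t >= - 8 t]. *)
 assert (Hlow : forall t, 0 < t <= / 16 -> - (1 / 2) <= f t). { intros t Ht.
  assert (H : 0 <= t ^ S (S n) * f t + 8 * t ^ S (S (S n))).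
  { apply (nonneg_from_zero (fun s => s ^ S (S n) * f s + 8 * s ^ S (S (S n)))
    (fun s => 2 * s ^ S (S n) * b s * (1 - f s ^ 2) + 8 * (m + 2) * s ^ S (S n)) 11 (/ 2)); [lra|lra| | |].
   - intros s Hs. apply (is_derive_plus (fun s => s ^ S (S n) * f s)).
    + apply Hg'; lra.
    + replace (8 * (m + 2) * s ^ S (S n)) with (8 * (INR (S (S (S n))) * s ^ S (S n)))
      by (rewrite (S_INR (S (S n))), Hm2; ring). apply is_derive_powR.
   - intros s Hs. destruct (IH s ltac:(lra)) as [_ [_ [Hb _]]]. fold b in Hb. assert (Hp0 : 0 < s ^ S (S n)) by pos.
    assert (H3 := Hsmall s ltac:(lra)). apply Rabs_le_between in H3. assert (- 8 <= b s * (1 - f s ^ 2)).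
    2:{ assert (0 <= s ^ S (S n) * (2 * (b s * (1 - f s ^ 2)) + 8 * (m + 2))) by pos. lra. }
    assert (-8 <= 1 - f s ^ 2) by nra. nra.
   - intros s Hs _. eapply Rle_trans; [apply Rabs_triang|]. assert (H3 := Hgs s Hs).
    assert (Hp0 : 0 < s ^ S (S n)) by pos.
    assert (Hp : s ^ S (S n) <= 1) by (rewrite <- (pow1 (S (S n))); apply pow_incr; lra).
    rewrite (Rabs_right (8 * s ^ S (S (S n)))).
    + replace (s ^ S (S (S n))) with (s * s ^ S (S n)) by reflexivity. nra.
    + replace (s ^ S (S (S n))) with (s * s ^ S (S n)) by reflexivity. nra. }
  replace (t ^ S (S (S n))) with (t * t ^ S (S n)) in H by reflexivity. assert (Hp0 : 0 < t ^ S (S n)) by pos.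
  assert (0 <= f t + 8 * t) by nra. lra. }
 (* Now [|f| <= 1 / 2], so the derivative of [t ^ (n+2) f] is positive and strict positivity
    follows. *)
 assert (Hsm : forall t, 0 < t <= / 16 -> 0 < f t < 1). { assert (Hh : forall t, 0 < t <= / 16 -> f t <= 1 / 2).
  { intros t Ht. eapply Rle_trans; [apply Hup; lra|].
   assert (1 <= INR (fact (S (S n)))) by (apply (le_INR 1), lt_O_fact). apply Rle_div_l; [lra|].
   assert (t ^ S n <= 1) by (rewrite <- (pow1 (S n)); apply pow_incr; lra).
   replace (t ^ S (S n)) with (t * t ^ S n) by reflexivity. nra. }
  assert (Hd : forall s, 0 < s <= / 16 -> 0 < 2 * s ^ S (S n) * b s * (1 - f s ^ 2)).
  { intros s Hs. destruct (IH s ltac:(lra)) as [_ [_ [Hb _]]]. fold b in Hb. assert (Hp0 : 0 < s ^ S (S n)) by pos.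
   specialize (Hh s Hs). specialize (Hlow s Hs). assert (0 < 1 - f s ^ 2) by nra. mono. }
  assert (Hnn : forall t, 0 < t <= / 16 -> 0 <= t ^ S (S n) * f t).
  { intros t Ht. apply (nonneg_from_zero (fun s => s ^ S (S n) * f s)
    (fun s => 2 * s ^ S (S n) * b s * (1 - f s ^ 2)) 3 (/ 2)); [lra|lra| | |].
   - intros s Hs; apply Hg'; lra.
   - intros s Hs; left; apply Hd; lra.
   - intros s Hs _; apply Hgs, Hs. }
  intros t Ht. specialize (Hh t Ht). split; [|lra]. assert (Hp0 : 0 < t ^ S (S n)) by pos.
  assert (H1 := Hnn (t / 2) ltac:(lra)). assert (H2 : (t / 2) ^ S (S n) * f (t / 2) < t ^ S (S n) * f t).
  { apply (incr_lt (fun s => s ^ S (S n) * f s) (fun s => 2 * s ^ S (S n) * b s * (1 - f s ^ 2)));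
    [lra| |]; intros s Hs; [apply Hg'|apply Hd]; lra. }
  nra. }
 assert (Hpos : forall t, 0 < t -> 0 < f t).
 { apply (barrier f (fun t => 2 * b t * (1 - f t ^ 2) - (m + 1) / t * f t) (/ 16)).
  - exact Hf'.
  - lra.
  - intros t Ht; apply Hsm; lra.
  - intros t Ht H0. rewrite H0. destruct (IH t Ht) as [_ [_ [Hb _]]]. fold b in Hb.
   replace (2 * b t * (1 - 0 ^ 2) - (m + 1) / t * 0) with (2 * b t) by ring. lra. }
 assert (Hlt : forall t, 0 < t -> 0 < 1 - f t). { apply (barrier (fun t => 1 - f t)
   (fun t => 0 - (2 * b t * (1 - f t ^ 2) - (m + 1) / t * f t)) (/ 16)).
  - intros t Ht. apply (is_derive_minus (fun _ => 1) f t 0); [apply is_derive_constR|apply Hf', Ht].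
  - lra.
  - intros t Ht; specialize (Hsm t ltac:(lra)); lra.
  - intros t Ht H0. replace (f t) with 1 by lra. assert (0 < (m + 1) / t) by pos. lra. }
 intros t Ht. destruct (IH t Ht) as [_ [_ [Hb [_ [Hbt _]]]]].
 fold f b m. fold b in Hb, Hbt. rewrite Hm2. specialize (Hpos t Ht). specialize (Hlt t Ht).
 split; [apply Hf', Ht|]. split; [apply Hb', Ht|]. split; [lra|]. split; [lra|]. split; [apply Hup, Ht|exact Hbt].
Qed.

Lemma rs_inv_all (n : nat) : rs_inv n.
Proof. induction n; [apply rs_inv_0|apply rs_inv_succ; assumption]. Qed.

Lemma rs_pos (n : nat) (t : R) : 0 < t -> 0 < rs n t.
Proof. intros Ht; destruct (rs_inv_all n t Ht) as (_ & _ & _ & H & _); lra. Qed.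

Lemma rs_lt_1 (n : nat) (t : R) : 0 < t -> rs (S n) t < 1.
Proof. intros Ht; destruct (rs_inv_all n t Ht) as (_ & _ & H & _); lra. Qed.

Lemma rs_le_fact (n : nat) (t : R) : 0 < t -> rs n t <= t ^ n / INR (fact n).
Proof. intros Ht; destruct (rs_inv_all n t Ht) as (_ & _ & _ & _ & _ & H); exact H. Qed.

Lemma rs_rec (n : nat) (t : R) : 0 < t ->
 rs (S (S n)) t + rs n t = INR (S n) / t * (rs (S n) t / (1 - rs (S n) t ^ 2)).
Proof. intros Ht; rewrite rs_SS; unfold Rdiv; ring. Qed.

Lemma rs_riccati (n : nat) (t : R) : 0 < t ->
 is_derive (rs (S n)) t (2 * rs n t * (1 - rs (S n) t ^ 2) - INR (S n) / t * rs (S n) t).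
Proof. intros Ht; destruct (rs_inv_all n t Ht) as (H & _); exact H. Qed.

(** The Schur flow. In this difference form, obtained by inserting the recurrence into the Riccati
    equation, the [t]-derivatives of the sums below telescope. *)
Lemma rs_flow (n : nat) (t : R) : 0 < t -> is_derive (rs (S n)) t ((1 - rs (S n) t ^ 2) * (rs n t - rs (S (S n)) t)).
Proof. intros Ht. assert (D := rs_riccati n t Ht). replace ((1 - rs (S n) t ^ 2) * (rs n t - rs (S (S n)) t))
  with (2 * rs n t * (1 - rs (S n) t ^ 2) - INR (S n) / t * rs (S n) t); [exact D|].
 assert (H := rs_lt_1 n t Ht). assert (H0 := rs_pos (S n) t Ht).
 assert (Hs := one_minus_sq_pos (rs (S n) t) ltac:(lra)). rewrite rs_SS. field; lra.
Qed.

(** * Exact sums *)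

Lemma ln_le_sub_1 (y : R) : 0 < y -> ln y <= y - 1.
Proof. intros Hy. assert (H := exp_ineq1_le (ln y)). rewrite exp_ln in H by exact Hy. lra. Qed.

Lemma ln_ge_1_sub (y : R) : 0 < y -> 1 - / y <= ln y.
Proof. intros Hy. assert (H := ln_le_sub_1 (/ y) ltac:(apply Rinv_0_lt_compat; exact Hy)).
 rewrite ln_Rinv in H by exact Hy. lra.
Qed.

Fixpoint bsum (f : nat -> R) (n : nat) : R := match n with O => 0 | S m => bsum f m + f (S m) end.

Lemma bsum_ext (f g : nat -> R) (n : nat) : (forall k, (1 <= k <= n)%nat -> f k = g k) -> bsum f n = bsum g n.
Proof. induction n as [|n IH]; intros H; [reflexivity|]. simpl. rewrite IH, H; [mono|lia|]. intros k Hk; apply H; lia.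
Qed.

Lemma bsum_le (f g : nat -> R) (n : nat) : (forall k, (1 <= k <= n)%nat -> f k <= g k) -> bsum f n <= bsum g n.
Proof. induction n as [|n IH]; intros H; [simpl; lra|]. simpl. apply Rplus_le_compat.
 - apply IH; intros k Hk; apply H; lia.
 - apply H; lia.
Qed.

Lemma bsum_plus (f g : nat -> R) (n : nat) : bsum (fun k => f k + g k) n = bsum f n + bsum g n.
Proof. induction n as [|n IH]; simpl; [ring|mono]. Qed.

Lemma bsum_scal (c : R) (f : nat -> R) (n : nat) : bsum (fun k => c * f k) n = c * bsum f n.
Proof. induction n as [|n IH]; simpl; [ring|mono]. Qed.

Lemma bsum_minus (f g : nat -> R) (n : nat) : bsum (fun k => f k - g k) n = bsum f n - bsum g n.
Proof. induction n as [|n IH]; simpl; [ring|mono]. Qed.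

Lemma bsum_const (c : R) (n : nat) : bsum (fun _ => c) n = INR n * c.
Proof. induction n as [|n IH]; [simpl; ring|]. rewrite S_INR; simpl bsum; rewrite IH; ring. Qed.

Lemma bsum_abs (f : nat -> R) (n : nat) : Rabs (bsum f n) <= bsum (fun k => Rabs (f k)) n.
Proof. induction n as [|n IH]; simpl; [rewrite Rabs_R0; lra|]. eapply Rle_trans; [apply Rabs_triang|]. lra. Qed.

Lemma bsum_add (f : nat -> R) (n m : nat) : bsum f (n + m) = bsum f n + bsum (fun k => f (n + k)%nat) m.
Proof. induction m as [|m IH]; [rewrite Nat.add_0_r; simpl; ring|].
 rewrite Nat.add_succ_r. simpl. rewrite IH, Nat.add_succ_r. ring.
Qed.

(** Form used for the exact sums: the defect of a partial sum vanishes at [t = 0], and its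
    derivative lies in [[0, c]] with [c] tending to 0 as the number of terms grows. *)
Lemma from_zero_bounds (G G' : R -> R) (c C e T : R) : 0 < T -> 0 < e ->
 (forall s, 0 < s <= T -> is_derive G s (G' s)) -> (forall s, 0 < s <= T -> 0 <= G' s <= c) ->
 (forall s, 0 < s <= e -> s <= T -> Rabs (G s) <= C * s) -> 0 <= G T <= c * T.
Proof. intros HT He Hd Hb H0. split.
 - apply (nonneg_from_zero G G' C e); try assumption. intros s Hs; apply Hb, Hs.
 - assert (0 <= c * T - G T); [|lra].
  apply (nonneg_from_zero (fun s => c * s - G s) (fun s => c - G' s) (Rabs c + C) e); try assumption.
  + intros s Hs. apply (is_derive_minus (fun s => c * s) G s c (G' s)); [|apply Hd, Hs]. auto_derive; [exact I|ring].
  + intros s Hs; specialize (Hb s Hs); lra.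
  + intros s Hs HsT. specialize (H0 s Hs HsT). unfold Rminus.
   eapply Rle_trans; [apply Rabs_triang|]. rewrite Rabs_Ropp, Rabs_mult, (Rabs_right s) by lra. lra.
Qed.

Definition sumA (n : nat) (t : R) : R := bsum (fun k => ln (1 + rs k t)) n.

Definition sumB (n : nat) (t : R) : R := bsum (fun k => ln (1 - rs k t ^ 2)) n.

(** Enters through the derivative of [sumC]; its own limit in [n] is [t]. *)
Definition sumT (n : nat) (t : R) : R := bsum (fun k => rs (pred k) t * rs k t) n.

Definition sumC (n : nat) (t : R) : R := bsum (fun k => INR k * ln (1 - rs k t ^ 2)) n.

Definition logbes (t : R) : R := ln (bessel0 (t ^ 2)).

Lemma rs_le_1 (n : nat) (t : R) : 0 < t -> rs n t <= 1.
Proof. intros Ht. destruct n; [rewrite rs_0; lra|]. left; apply rs_lt_1, Ht. Qed.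

Lemma one_minus_rs_sq (n : nat) (t : R) : 0 < t -> 0 < 1 - rs (S n) t ^ 2.
Proof. intros Ht. apply one_minus_sq_pos. split; [left; apply rs_pos, Ht|apply rs_lt_1, Ht]. Qed.

Lemma is_derive_ln_comp (u : R -> R) (t du : R) :
 is_derive u t du -> 0 < u t -> is_derive (fun s => ln (u s)) t (du / u t).
Proof. intros D H. apply (is_derive_comp ln u t (/ u t) du); [|exact D]. auto_derive; [exact H|ring]. Qed.

Lemma ln_one_plus_rs_derive (n : nat) (t : R) : 0 < t ->
 is_derive (fun s => ln (1 + rs (S n) s)) t ((1 - rs (S n) t) * (rs n t - rs (S (S n)) t)).
Proof. intros Ht. assert (D := rs_flow n t Ht). assert (Hp := rs_pos (S n) t Ht).
 replace ((1 - rs (S n) t) * (rs n t - rs (S (S n)) t)) with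
  ((0 + (1 - rs (S n) t ^ 2) * (rs n t - rs (S (S n)) t)) / (1 + rs (S n) t)) by (field; lra).
 apply (is_derive_ln_comp (fun s => 1 + rs (S n) s)); [|lra].
 apply (is_derive_plus (fun _ => 1) (rs (S n)) t 0); [apply is_derive_constR|exact D].
Qed.

Lemma ln_one_minus_rs_derive (n : nat) (t : R) : 0 < t ->
 is_derive (fun s => ln (1 - rs (S n) s ^ 2)) t (- 2 * rs (S n) t * (rs n t - rs (S (S n)) t)).
Proof. intros Ht. assert (D := rs_flow n t Ht). assert (Hp := one_minus_rs_sq n t Ht).
 set (d := (1 - rs (S n) t ^ 2) * (rs n t - rs (S (S n)) t)) in *.
 replace (- 2 * rs (S n) t * (rs n t - rs (S (S n)) t)) with
  ((0 - INR 2 * d * rs (S n) t ^ pred 2) / (1 - rs (S n) t ^ 2)) by (unfold d; simpl; field; simpl in Hp; lra).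
 apply (is_derive_ln_comp (fun s => 1 - rs (S n) s ^ 2)); [|lra].
 apply (is_derive_minus (fun _ => 1) (fun s => rs (S n) s ^ 2) t 0); [apply is_derive_constR|].
 apply is_derive_pow, D.
Qed.

(** The sum telescopes to [(1 - r_n) (1 - r_(n+1))]. This is 0 for [n = 0], since [r_0 = 1], and
    tends to 1 as [n] grows, which is why the full sum is [t]. *)
Lemma sumA_derive (n : nat) (t : R) : 0 < t -> is_derive (sumA n) t ((1 - rs n t) * (1 - rs (S n) t)).
Proof. intros Ht. induction n as [|n IH].
 - rewrite rs_0. replace ((1 - 1) * (1 - rs 1 t)) with 0 by ring. apply is_derive_constR.
 - replace ((1 - rs (S n) t) * (1 - rs (S (S n)) t)) with
   (plus ((1 - rs n t) * (1 - rs (S n) t)) ((1 - rs (S n) t) * (rs n t - rs (S (S n)) t)))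
   by (unfold plus; simpl AbelianMonoid.sort; simpl; ring).
  apply (is_derive_plus (sumA n)); [exact IH|apply ln_one_plus_rs_derive, Ht].
Qed.

Lemma sumB_derive (n : nat) (t : R) : 0 < t -> is_derive (sumB n) t (2 * rs n t * rs (S n) t - 2 * r1 t).
Proof. intros Ht. induction n as [|n IH].
 - rewrite rs_0, rs_1. replace (2 * 1 * r1 t - 2 * r1 t) with 0 by ring. apply is_derive_constR.
 - replace (2 * rs (S n) t * rs (S (S n)) t - 2 * r1 t) with
   (plus (2 * rs n t * rs (S n) t - 2 * r1 t) (- 2 * rs (S n) t * (rs n t - rs (S (S n)) t)))
   by (unfold plus; simpl AbelianMonoid.sort; simpl; ring).
  apply (is_derive_plus (sumB n)); [exact IH|apply ln_one_minus_rs_derive, Ht].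
Qed.

Lemma sumT_derive (n : nat) (t : R) : 0 < t ->
 is_derive (sumT (S n)) t ((1 - rs (S n) t ^ 2) * (1 - rs n t * rs (S (S n)) t)).
Proof. intros Ht. induction n as [|n IH].
 - rewrite rs_0. apply (is_derive_ext (rs 1)). { intros s. change (rs 1 s = 0 + 1 * rs 1 s :> R). ring. }
  replace ((1 - rs 1 t ^ 2) * (1 - 1 * rs 2 t)) with ((1 - rs 1 t ^ 2) * (rs 0 t - rs 2 t)) by (rewrite rs_0; ring).
  apply rs_flow, Ht.
 - assert (D1 := rs_flow n t Ht). assert (D2 := rs_flow (S n) t Ht).
  replace ((1 - rs (S (S n)) t ^ 2) * (1 - rs (S n) t * rs (S (S (S n))) t)) with
  (plus ((1 - rs (S n) t ^ 2) * (1 - rs n t * rs (S (S n)) t))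
   (plus (mult ((1 - rs (S n) t ^ 2) * (rs n t - rs (S (S n)) t)) (rs (S (S n)) t))
      (mult (rs (S n) t) ((1 - rs (S (S n)) t ^ 2) * (rs (S n) t - rs (S (S (S n))) t)))))
   by (unfold plus, mult; simpl AbelianMonoid.sort; simpl; ring). apply (is_derive_plus (sumT (S n))); [exact IH|].
  apply (is_derive_mult (rs (S n)) (rs (S (S n)))); [exact D1|exact D2|intros; apply Rmult_comm].
Qed.

(** Abel summation: the weights [k] turn the telescoping sum into [- 2 sumT]. Since [sumT] tends to
    [t], the full sum is [- t ^ 2]. *)
Lemma sumC_derive (n : nat) (t : R) : 0 < t -> is_derive (sumC n) t (2 * INR n * rs n t * rs (S n) t - 2 * sumT n t).
Proof. intros Ht. induction n as [|n IH].
 - simpl INR. unfold sumT; simpl bsum. replace (2 * 0 * rs 0 t * rs 1 t - 2 * 0) with 0 by ring.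
  apply is_derive_constR.
 - replace (2 * INR (S n) * rs (S n) t * rs (S (S n)) t - 2 * sumT (S n) t) with
   (plus (2 * INR n * rs n t * rs (S n) t - 2 * sumT n t)
      (INR (S n) * (- 2 * rs (S n) t * (rs n t - rs (S (S n)) t)))).
  + apply (is_derive_plus (sumC n)); [exact IH|].
   apply (is_derive_scal (fun s => ln (1 - rs (S n) s ^ 2))), ln_one_minus_rs_derive, Ht.
  + rewrite S_INR. unfold sumT; simpl bsum. simpl pred. unfold plus; simpl AbelianMonoid.sort; simpl. ring.
Qed.

Lemma r1_bounds (t : R) : 0 <= t -> 0 <= r1 t <= t.
Proof. intros Ht. unfold r1.
 assert (H1 := bessel1_ge_1 (t ^ 2) (pow2_ge_0 t)). assert (H2 := bessel1_le_bessel0 (t ^ 2) (pow2_ge_0 t)).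
 split; [pos|]. apply Rle_div_l; [lra|]. mono.
Qed.

Lemma logbes_derive (t : R) : is_derive logbes t (2 * r1 t).
Proof. unfold logbes, r1. assert (H0 := bessel0_ge_1 (t ^ 2) (pow2_ge_0 t)).
 assert (D0 : is_derive (fun s => bessel0 (s ^ 2)) t (2 * t * bessel1 (t ^ 2))).
 { apply (is_derive_comp bessel0 (fun s => s ^ 2)); [apply bessel0_derive|]. auto_derive; [exact I|ring]. }
 replace (2 * (t * bessel1 (t ^ 2) / bessel0 (t ^ 2))) with (2 * t * bessel1 (t ^ 2) / bessel0 (t ^ 2)) by mono.
 apply (is_derive_ln_comp (fun s => bessel0 (s ^ 2))); [exact D0|lra].
Qed.

Lemma logbes_small (s : R) : 0 <= s <= 1 -> 0 <= logbes s <= 2 * s.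
Proof. intros Hs. assert (H00 : logbes 0 = 0).
 { unfold logbes. replace (0 ^ 2) with 0 by ring. unfold bessel0. rewrite PSeries_0.
  unfold bes; simpl. replace (/ (1 * (1 * 1))) with 1 by field. apply ln_1. }
 split.
 - rewrite <- H00. apply (incr_le logbes (fun u => 2 * r1 u)); [lra|intros; apply logbes_derive|].
  intros x Hx. assert (H := r1_bounds x ltac:(lra)); lra.
 - assert (H : 2 * 0 - logbes 0 <= 2 * s - logbes s); [|lra].
  apply (incr_le (fun u => 2 * u - logbes u) (fun u => 2 - 2 * r1 u)); [lra| |].
  + intros x _. apply (is_derive_minus (fun u => 2 * u)); [|apply logbes_derive]. auto_derive; [exact I|ring].
  + intros x Hx. assert (H := r1_bounds x ltac:(lra)); lra.
Qed.

Lemma rs_small (k : nat) (s : R) : (1 <= k)%nat -> 0 < s <= 1 -> 0 < rs k s <= s.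
Proof. intros Hk Hs. split; [apply rs_pos; lra|]. eapply Rle_trans; [apply rs_le_fact; lra|].
 destruct k as [|k]; [lia|]. assert (Hf : 1 <= INR (fact (S k))) by (apply (le_INR 1), lt_O_fact).
 apply Rle_div_l; [lra|]. simpl. assert (s ^ k <= 1) by (rewrite <- (pow1 k); apply pow_incr; lra). simpl in Hf. nra.
Qed.

Lemma ln_one_minus_sq_small (s : R) : 0 <= s <= 1 / 2 -> - (2 * s ^ 2) <= ln (1 - s ^ 2) <= 0.
Proof. intros Hs. assert (0 < 1 - s ^ 2) by nra. split.
 - eapply Rle_trans; [|apply ln_ge_1_sub; assumption]. assert (/ (1 - s ^ 2) <= 1 + 2 * s ^ 2); [|lra].
  apply (Rmult_le_reg_l (1 - s ^ 2)); [mono|]. rewrite Rinv_r by lra.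
  assert (0 <= s ^ 2 * (1 - 2 * s ^ 2)) by (apply Rmult_le_pos; nra). nra.
 - eapply Rle_trans; [apply ln_le_sub_1; assumption|]. nra.
Qed.

Lemma sumA_small (n : nat) (s : R) : 0 < s <= 1 -> 0 <= sumA n s <= INR n * s.
Proof. intros Hs. unfold sumA. split.
 - replace 0 with (bsum (fun _ => 0) n) by (rewrite bsum_const; ring).
  apply bsum_le. intros k Hk. assert (H := rs_small k s ltac:(lia) Hs). rewrite <- ln_1. apply ln_le; lra.
 - rewrite <- bsum_const. apply bsum_le. intros k Hk. assert (H := rs_small k s ltac:(lia) Hs).
  assert (H1 := ln_le_sub_1 (1 + rs k s) ltac:(lra)). lra.
Qed.

Lemma ln_one_minus_rs_small (k : nat) (s : R) : (1 <= k)%nat -> 0 < s <= 1 / 2 -> Rabs (ln (1 - rs k s ^ 2)) <= 2 * s.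
Proof. intros Hk Hs. assert (H := rs_small k s Hk ltac:(lra)).
 assert (H1 := ln_one_minus_sq_small (rs k s) ltac:(lra)).
 rewrite Rabs_left1 by lra. assert (rs k s ^ 2 <= s) by nra. lra.
Qed.

Lemma sumB_small (n : nat) (s : R) : 0 < s <= 1 / 2 -> Rabs (sumB n s) <= INR n * (2 * s).
Proof. intros Hs. eapply Rle_trans; [apply bsum_abs|]. rewrite <- bsum_const. apply bsum_le.
 intros k Hk. apply ln_one_minus_rs_small; [lia|lra].
Qed.

Lemma sumC_small (n : nat) (s : R) : 0 < s <= 1 / 2 -> Rabs (sumC n s) <= INR n * (INR n * (2 * s)).
Proof. intros Hs. eapply Rle_trans; [apply bsum_abs|]. rewrite <- bsum_const. apply bsum_le.
 intros k Hk. rewrite Rabs_mult, (Rabs_right (INR k)) by pos. apply Rmult_le_compat; [mono|mono|apply le_INR; lia|].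
 apply ln_one_minus_rs_small; [lia|lra].
Qed.

Lemma sumT_small (n : nat) (s : R) : 0 < s <= 1 -> 0 <= sumT n s <= INR n * s.
Proof. intros Hs. unfold sumT. split.
 - replace 0 with (bsum (fun _ => 0) n) by (rewrite bsum_const; ring).
  apply bsum_le. intros k Hk. assert (H := rs_pos k s ltac:(lra)). assert (H' := rs_pos (pred k) s ltac:(lra)). nra.
 - rewrite <- bsum_const. apply bsum_le. intros k Hk. assert (H := rs_small k s ltac:(lia) Hs).
  assert (H1 := rs_le_1 (pred k) s ltac:(lra)). nra.
Qed.

Definition tau (T : R) (n : nat) : R := T ^ n / INR (fact n).

Lemma rs_le_tau (n : nat) (s T : R) : 0 < s <= T -> rs n s <= tau T n.
Proof. intros Hs. eapply Rle_trans; [apply rs_le_fact; lra|]. unfold tau.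
 apply Rmult_le_compat_r; [left; apply Rinv_0_lt_compat, fact_pos|]. apply pow_incr; lra.
Qed.

Lemma tau_pos (T : R) (n : nat) : 0 < T -> 0 < tau T n.
Proof. intros HT; apply Rdiv_lt_0_compat; [pos|apply fact_pos]. Qed.

Lemma tau_lim (T : R) : is_lim_seq (tau T) 0.
Proof. apply is_lim_seq_Reals. exact (cv_speed_pow_fact T). Qed.

Lemma tau_lim_succ (T : R) : is_lim_seq (fun n => tau T (S n)) 0.
Proof. apply (is_lim_seq_incr_1 (tau T)), tau_lim. Qed.

Lemma tau_lim_INR (T : R) : is_lim_seq (fun n => INR n * tau T n) 0.
Proof. apply is_lim_seq_incr_1. apply (is_lim_seq_ext (fun n => T * tau T n)).
 - intros n. unfold tau. rewrite fact_succ. simpl (T ^ S n).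
  assert (H := fact_pos n). assert (H1 := INR_S_pos n). field; lra.
 - replace (Finite 0) with (Rbar_mult T 0) by (simpl; f_equal; ring). apply is_lim_seq_scal_l, tau_lim.
Qed.

Lemma sumA_bound (n : nat) (t : R) : 0 < t -> 0 <= t - sumA n t <= (tau t n + tau t (S n)) * t.
Proof. intros Ht. apply (from_zero_bounds (fun s => s - sumA n s) (fun s => 1 - (1 - rs n s) * (1 - rs (S n) s))
  _ (1 + INR n) 1); [exact Ht|lra| | |].
 - intros s Hs. apply is_derive_minusR; [apply is_derive_idR|]. apply sumA_derive; lra.
 - intros s Hs. assert (H1 := rs_pos n s ltac:(lra)). assert (H2 := rs_pos (S n) s ltac:(lra)).
  assert (H3 := rs_le_tau n s t Hs). assert (H4 := rs_le_tau (S n) s t Hs). assert (H6 := rs_le_1 (S n) s ltac:(lra)).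
  split; nra.
 - intros s Hs _. assert (H := sumA_small n s Hs). apply Rabs_le. nra.
Qed.

Lemma sumB_bound (n : nat) (t : R) : 0 < t -> 0 <= logbes t + sumB n t <= 2 * tau t n * t.
Proof. intros Ht. apply (from_zero_bounds (fun s => logbes s + sumB n s) (fun s => 2 * rs n s * rs (S n) s)
  _ (2 + INR n * 2) (1 / 2)); [exact Ht|lra| | |].
 - intros s Hs. replace (2 * rs n s * rs (S n) s) with
   (plus (2 * r1 s) (2 * rs n s * rs (S n) s - 2 * r1 s)) by (unfold plus; simpl AbelianMonoid.sort; simpl; ring).
  apply (is_derive_plus logbes); [apply logbes_derive|apply sumB_derive; lra].
 - intros s Hs. assert (H1 := rs_pos n s ltac:(lra)). assert (H2 := rs_pos (S n) s ltac:(lra)).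
  assert (H3 := rs_le_tau n s t Hs). assert (H6 := rs_le_1 (S n) s ltac:(lra)). split; nra.
 - intros s Hs _. assert (H := sumB_small n s Hs). assert (H' := logbes_small s ltac:(lra)).
  eapply Rle_trans; [apply Rabs_triang|]. rewrite (Rabs_right (logbes s)) by lra. lra.
Qed.

Lemma sumT_bound (n : nat) (t T : R) : 0 < t <= T -> 0 <= t - sumT (S n) t <= (tau T (S n) + tau T (S (S n))) * t.
Proof. intros Ht. apply (from_zero_bounds (fun s => s - sumT (S n) s)
  (fun s => 1 - (1 - rs (S n) s ^ 2) * (1 - rs n s * rs (S (S n)) s)) _ (1 + INR (S n)) 1); [lra|lra| | |].
 - intros s Hs. apply is_derive_minusR; [apply is_derive_idR|]. apply sumT_derive; lra.
 - intros s Hs. assert (H1 := rs_pos n s ltac:(lra)). assert (H2 := rs_pos (S n) s ltac:(lra)).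
  assert (H0 := rs_pos (S (S n)) s ltac:(lra)).
  assert (H3 := rs_le_tau (S (S n)) s T ltac:(lra)). assert (H4 := rs_le_tau (S n) s T ltac:(lra)).
  assert (H5 := rs_le_1 n s ltac:(lra)). assert (H6 := rs_lt_1 n s ltac:(lra)).
  assert (H7 := rs_le_1 (S (S n)) s ltac:(lra)).
  assert (0 < rs n s * rs (S (S n)) s <= tau T (S (S n))) by (split; nra).
  
  assert (rs (S n) s ^ 2 <= 1) by nra. split; nra.
 - intros s Hs _. assert (H := sumT_small (S n) s Hs). apply Rabs_le. nra.
Qed.

Lemma sumC_bound (n : nat) (t : R) : 0 < t -> 0 <= sumC (S n) t + t ^ 2 <=
 (2 * ((tau t (S n) + tau t (S (S n))) * t) + 2 * (INR (S n) * tau t (S n))) * t.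
Proof. intros Ht. apply (from_zero_bounds (fun s => sumC (S n) s + s ^ 2)
  (fun s => 2 * INR (S n) * rs (S n) s * rs (S (S n)) s - 2 * sumT (S n) s + 2 * s)
  _ (INR (S n) * (INR (S n) * 2) + 1) (1 / 2)); [exact Ht|lra| | |].
 - intros s Hs. apply (is_derive_plus (sumC (S n)) (fun s => s ^ 2)); [apply sumC_derive; lra|].
  auto_derive; [exact I|ring].
 - intros s Hs. assert (H := sumT_bound n s t Hs). assert (H2 := rs_pos (S n) s ltac:(lra)).
  assert (H0 := rs_pos (S (S n)) s ltac:(lra)). assert (H4 := rs_le_tau (S n) s t ltac:(lra)).
  assert (H7 := rs_le_1 (S (S n)) s ltac:(lra)).
  assert (0 <= rs (S n) s * rs (S (S n)) s <= tau t (S n)) by (split; nra).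
  assert (0 <= INR (S n) * (rs (S n) s * rs (S (S n)) s) <= INR (S n) * tau t (S n)) by mono. split; nra.
 - intros s Hs _. assert (H := sumC_small (S n) s Hs).
  eapply Rle_trans; [apply Rabs_triang|]. rewrite (Rabs_right (s ^ 2)) by nra. nra.
Qed.

Lemma squeeze_0 (u c : nat -> R) : (forall n, 0 <= u n <= c n) -> is_lim_seq c 0 -> is_lim_seq u 0.
Proof. intros H Hc. apply (is_lim_seq_le_le (fun _ => 0) u c); [exact H|apply is_lim_seq_const|exact Hc]. Qed.

Lemma lim_scal_0 (c : R) (u : nat -> R) : is_lim_seq u 0 -> is_lim_seq (fun n => c * u n) 0.
Proof. intros H. replace (Finite 0) with (Rbar_mult c 0) by (simpl; f_equal; ring). apply is_lim_seq_scal_l, H. Qed.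

Lemma lim_plus_0 (u v : nat -> R) : is_lim_seq u 0 -> is_lim_seq v 0 -> is_lim_seq (fun n => u n + v n) 0.
Proof. intros H H'. replace (Finite 0) with (Finite (0 + 0)) by (f_equal; ring). apply is_lim_seq_plus'; assumption.
Qed.

Lemma lim_of_diff (u : nat -> R) (l : R) : is_lim_seq (fun n => u n - l) 0 -> is_lim_seq u l.
Proof. intros H. apply (is_lim_seq_ext (fun n => (u n - l) + l)); [intros; ring|].
 replace (Finite l) with (Finite (0 + l)) by (f_equal; ring).
 apply is_lim_seq_plus'; [exact H|apply is_lim_seq_const].
Qed.

Lemma sumA_lim (t : R) : 0 < t -> is_lim_seq (fun n => sumA n t) t.
Proof. intros Ht. apply lim_of_diff.
 apply (is_lim_seq_ext (fun n => -1 * (t - sumA n t))); [intros; ring|]. apply lim_scal_0.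
 apply (squeeze_0 _ (fun n => t * (tau t n + tau t (S n)))).
 - intros n. rewrite (Rmult_comm t). apply sumA_bound, Ht.
 - apply lim_scal_0, lim_plus_0; [apply tau_lim|apply tau_lim_succ].
Qed.

Lemma sumB_lim (t : R) : 0 < t -> is_lim_seq (fun n => sumB n t) (- logbes t).
Proof. intros Ht. apply lim_of_diff. apply (squeeze_0 _ (fun n => 2 * t * tau t n)).
 - intros n. assert (H := sumB_bound n t Ht). lra.
 - apply lim_scal_0, tau_lim.
Qed.

Lemma sumC_lim (t : R) : 0 < t -> is_lim_seq (fun n => sumC n t) (- t ^ 2).
Proof. intros Ht. apply is_lim_seq_incr_1, lim_of_diff.
 apply (squeeze_0 _ (fun n => (2 * t * t) * (tau t (S n) + tau t (S (S n))) + (2 * t) * (INR (S n) * tau t (S n)))).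
 - intros n. assert (H := sumC_bound n t Ht). lra.
 - apply lim_plus_0; apply lim_scal_0.
  + apply lim_plus_0; [apply tau_lim_succ|]. apply (is_lim_seq_incr_1 (fun n => tau t (S n))), tau_lim_succ.
  + apply (is_lim_seq_incr_1 (fun n => INR n * tau t n)), tau_lim_INR.
Qed.

Lemma bsum_weighted (f : nat -> R) (n m : nat) : bsum (fun j => INR j * f (n + j)%nat) m =
 (bsum (fun k => INR k * f k) (n + m) - bsum (fun k => INR k * f k) n)
 - INR n * (bsum f (n + m) - bsum f n).
Proof. rewrite !bsum_add. replace (bsum (fun k => INR (n + k) * f (n + k)%nat) m) with
  (INR n * bsum (fun k => f (n + k)%nat) m + bsum (fun j => INR j * f (n + j)%nat) m); [ring|].
 rewrite <- bsum_scal, <- bsum_plus. apply bsum_ext. intros k _. rewrite plus_INR. ring.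
Qed.

Lemma tail_A (n : nat) (t : R) : 0 < t ->
 is_lim_seq (fun m => bsum (fun j => ln (1 + rs (n + j) t)) m) (t - sumA n t).
Proof. intros Ht. apply (is_lim_seq_ext (fun m => sumA (m + n) t - sumA n t)).
 - intros m. rewrite Nat.add_comm. unfold sumA. rewrite bsum_add. ring.
 - apply is_lim_seq_minus'; [|apply is_lim_seq_const]. apply (is_lim_seq_incr_n (fun m => sumA m t)), sumA_lim, Ht.
Qed.

Lemma tail_B (n : nat) (t : R) : 0 < t ->
 is_lim_seq (fun m => bsum (fun j => ln (1 - rs (n + j) t ^ 2)) m) (- logbes t - sumB n t).
Proof. intros Ht. apply (is_lim_seq_ext (fun m => sumB (m + n) t - sumB n t)).
 - intros m. rewrite Nat.add_comm. unfold sumB. rewrite bsum_add. ring.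
 - apply is_lim_seq_minus'; [|apply is_lim_seq_const]. apply (is_lim_seq_incr_n (fun m => sumB m t)), sumB_lim, Ht.
Qed.

Lemma tail_P (n : nat) (t : R) : 0 < t -> is_lim_seq (fun m => bsum (fun j => INR j * ln (1 - rs (n + j) t ^ 2)) m)
  (- t ^ 2 + INR n * logbes t + bsum (fun k => (INR n - INR k) * ln (1 - rs k t ^ 2)) n).
Proof. intros Ht. apply (is_lim_seq_ext (fun m => (sumC (m + n) t - sumC n t) - INR n * (sumB (m + n) t - sumB n t))).
 - intros m. rewrite (Nat.add_comm m n). unfold sumC, sumB.
  rewrite (bsum_weighted (fun k => ln (1 - rs k t ^ 2))). reflexivity.
 - replace (- t ^ 2 + INR n * logbes t + bsum (fun k => (INR n - INR k) * ln (1 - rs k t ^ 2)) n)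
   with ((- t ^ 2 - sumC n t) - INR n * (- logbes t - sumB n t)).
  + apply is_lim_seq_minus'.
   * apply is_lim_seq_minus'; [|apply is_lim_seq_const]. apply (is_lim_seq_incr_n (fun m => sumC m t)), sumC_lim, Ht.
   * apply (is_lim_seq_scal_l (fun m => sumB (m + n) t - sumB n t) (INR n) (- logbes t - sumB n t)).
    apply is_lim_seq_minus'; [|apply is_lim_seq_const]. apply (is_lim_seq_incr_n (fun m => sumB m t)), sumB_lim, Ht.
  + unfold sumC, sumB. replace (bsum (fun k => (INR n - INR k) * ln (1 - rs k t ^ 2)) n) with
    (INR n * bsum (fun k => ln (1 - rs k t ^ 2)) n - bsum (fun k => INR k * ln (1 - rs k t ^ 2)) n).
   * ring.
   * rewrite <- bsum_scal, <- bsum_minus. apply bsum_ext. intros; ring.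
Qed.

Lemma le_of_div_le (a b c : R) : 0 < b -> a / b <= c -> a <= c * b.
Proof. intros Hb H. apply (Rle_div_l a c b) in H; [exact H|exact Hb]. Qed.

(** * Comparison and Airy scaling *)

Lemma finite_max (f : nat -> R) (n : nat) : exists k, (k <= n)%nat /\ forall i, (i <= n)%nat -> f i <= f k.
Proof. induction n as [|n [k [Hk H]]].
 - exists O; split; [lia|]. intros i Hi; replace i with O by lia; lra.
 - destruct (Rle_lt_dec (f (S n)) (f k)) as [Hle|Hlt].
  + exists k; split; [lia|]. intros i Hi. destruct (Nat.eq_dec i (S n)); [subst; exact Hle|apply H; lia].
  + exists (S n); split; [lia|]. intros i Hi. destruct (Nat.eq_dec i (S n)); [subst; lra|].
   specialize (H i ltac:(lia)); lra.
Qed.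

(* Comparison principle for discrete Painleve II: at a maximum of [rs / U] above 1
 the recurrence contradicts the monotonicity of [r -> 1 / (1 - r ^ 2)]. *)
Lemma compare_upper (t : R) (n : nat) (U : nat -> R) : 0 < t -> (forall j, 0 < U j) -> rs n t <= U O ->
 (exists K, forall j, (K <= j)%nat -> rs (n + j) t <= U j) -> (forall j, rs (n + S j) t <= U (S j) \/
  (U (S j) < 1 /\ U (S (S j)) + U j <= INR (n + S j) / t * (U (S j) / (1 - U (S j) ^ 2)))) ->
 forall j, rs (n + j) t <= U j.
Proof. intros Ht HU H0 [K HK] Hs j0. destruct (Rle_lt_dec (rs (n + j0) t) (U j0)) as [H|Hbad]; [exact H|exfalso].
 destruct (finite_max (fun j => rs (n + j) t / U j) (K + j0)) as [k [Hk Hmax]]. set (l := rs (n + k) t / U k) in *.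
 assert (1 < l). { specialize (Hmax j0 ltac:(lia)). assert (1 < rs (n + j0) t / U j0); [|lra].
  apply Rlt_div_r; [apply HU|lra]. }
 assert (Hrk : rs (n + k) t = l * U k). { unfold l; field. specialize (HU k); lra. }
 assert (Hall : forall j, rs (n + j) t <= l * U j). { intros j. destruct (le_dec j (K + j0)) as [Hj|Hj].
  - specialize (Hmax j Hj). apply le_of_div_le; [apply HU|exact Hmax].
  - specialize (HK j ltac:(lia)). specialize (HU j). nra. }
 destruct k as [|k]. { rewrite Nat.add_0_r in Hrk. specialize (HU O). nra. }
 destruct (Hs k) as [Hle|[HU1 Hsup]]. { specialize (HU (S k)). nra. }
 assert (Hrec := rs_rec (n + k) t Ht). replace (S (n + k)) with (n + S k)%nat in Hrec by lia.
 replace (S (n + S k)) with (n + S (S k))%nat in Hrec by lia. assert (H1 := Hall k). assert (H2 := Hall (S (S k))).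
 assert (Hkap : 0 < INR (n + S k) / t). { apply Rdiv_lt_0_compat; [apply lt_0_INR; lia|exact Ht]. }
 set (kap := INR (n + S k) / t) in *. assert (rs (n + S k) t < 1) by (rewrite Nat.add_succ_r; apply rs_lt_1, Ht).
 assert (HUp := HU (S k)). set (u := U (S k)) in *. set (r := rs (n + S k) t) in *. assert (u < r) by nra.
 assert (0 < 1 - u ^ 2) by nra. assert (0 < 1 - r ^ 2) by nra.
 assert (Hc : kap * (r / (1 - r ^ 2)) <= l * (kap * (u / (1 - u ^ 2)))) by nra.
 replace (l * (kap * (u / (1 - u ^ 2)))) with (kap * (r / (1 - u ^ 2))) in Hc by (rewrite Hrk; field; lra).
 apply Rmult_le_reg_l in Hc; [|exact Hkap]. unfold Rdiv in Hc. apply Rmult_le_reg_l in Hc; [|lra].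
 assert (/ (1 - u ^ 2) < / (1 - r ^ 2)); [|lra]. apply Rinv_lt_contravar; nra.
Qed.

(** Mirror image of [compare_upper], with the ratio [L / rs]. The barrier may take any sign, since
    it is positive wherever the ratio exceeds 1. The left disjunct covers the indices at which the
    bound is already known, so that barriers can be cut off or glued. *)
Lemma compare_lower (t : R) (n : nat) (L : nat -> R) : 0 < t -> L O <= rs n t ->
 (exists K, forall j, (K <= j)%nat -> L j <= rs (n + j) t) -> (forall j, L (S j) <= rs (n + S j) t \/
  (L (S j) < 1 /\ INR (n + S j) / t * (L (S j) / (1 - L (S j) ^ 2)) <= L (S (S j)) + L j)) ->
 forall j, L j <= rs (n + j) t.
Proof. intros Ht H0 [K HK] Hs j0. assert (HU : forall j, 0 < rs (n + j) t) by (intros; apply rs_pos, Ht).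
 destruct (Rle_lt_dec (L j0) (rs (n + j0) t)) as [H|Hbad]; [exact H|exfalso].
 destruct (finite_max (fun j => L j / rs (n + j) t) (K + j0)) as [k [Hk Hmax]]. set (l := L k / rs (n + k) t) in *.
 assert (1 < l). { specialize (Hmax j0 ltac:(lia)). assert (1 < L j0 / rs (n + j0) t); [|lra].
  apply Rlt_div_r; [apply HU|lra]. }
 assert (Hrk : L k = l * rs (n + k) t). { unfold l; field. specialize (HU k); lra. }
 assert (Hall : forall j, L j <= l * rs (n + j) t). { intros j. destruct (le_dec j (K + j0)) as [Hj|Hj].
  - specialize (Hmax j Hj). apply le_of_div_le; [apply HU|exact Hmax].
  - specialize (HK j ltac:(lia)). specialize (HU j). nra. }
 destruct k as [|k]. { rewrite Nat.add_0_r in Hrk. specialize (HU O). rewrite Nat.add_0_r in HU. nra. }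
 destruct (Hs k) as [Hle|[HU1 Hsup]]. { specialize (HU (S k)). nra. }
 assert (Hrec := rs_rec (n + k) t Ht). replace (S (n + k)) with (n + S k)%nat in Hrec by lia.
 replace (S (n + S k)) with (n + S (S k))%nat in Hrec by lia. assert (H1 := Hall k). assert (H2 := Hall (S (S k))).
 assert (Hkap : 0 < INR (n + S k) / t). { apply Rdiv_lt_0_compat; [apply lt_0_INR; lia|exact Ht]. }
 set (kap := INR (n + S k) / t) in *. assert (HUp := HU (S k)). set (u := L (S k)) in *.
 set (r := rs (n + S k) t) in *. assert (r < u) by nra. assert (0 < 1 - u ^ 2) by nra. assert (0 < 1 - r ^ 2) by nra.
 assert (Hc : kap * (u / (1 - u ^ 2)) <= l * (kap * (r / (1 - r ^ 2)))) by nra.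
 replace (l * (kap * (r / (1 - r ^ 2)))) with (kap * (u / (1 - r ^ 2))) in Hc by (rewrite Hrk; field; lra).
 apply Rmult_le_reg_l in Hc; [|exact Hkap]. unfold Rdiv in Hc. apply Rmult_le_reg_l in Hc; [|lra].
 assert (/ (1 - r ^ 2) < / (1 - u ^ 2)); [|lra]. apply Rinv_lt_contravar; nra.
Qed.

Lemma rs_lim (t : R) : 0 < t -> is_lim_seq (fun n => rs n t) 0.
Proof. intros Ht. apply (squeeze_0 _ (tau t)); [|apply tau_lim].
 intros n; split; [left; apply rs_pos, Ht|apply rs_le_tau; lra].
Qed.

Lemma lim_0_eventually (u : nat -> R) (e : R) :
 is_lim_seq u 0 -> 0 < e -> exists K, forall n, (K <= n)%nat -> Rabs (u n) < e.
Proof. intros H He. apply is_lim_seq_Reals in H. destruct (H e He) as [K HK].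
 exists K; intros n Hn. specialize (HK n Hn). unfold Rdist in HK. rewrite Rminus_0_r in HK. exact HK.
Qed.

(** For [n >= 2 t] the recurrence gives [r_(n+2) + r_n >= 2 r_(n+1)]: the sequence is convex there,
    and a convex sequence with limit 0 decreases. *)
Lemma rs_decr_eventually (t : R) : 0 < t -> exists K, forall n, (K <= n)%nat -> rs (S n) t <= rs n t.
Proof. intros Ht. destruct (nfloor_ex (2 * t) ltac:(lra)) as [K [_ HK]].
 exists K. intros n Hn. replace n with (n - K + K)%nat by lia. generalize (n - K)%nat as m. clear n Hn.
 assert (Hdec : forall m, 0 <= rs (m + K) t - rs (S (m + K)) t).
 { apply (is_lim_seq_decr_compare (fun m => rs (m + K) t - rs (S (m + K)) t) 0).
  - replace (Finite 0) with (Finite (0 - 0)) by (f_equal; ring). apply is_lim_seq_minus'.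
   + apply (is_lim_seq_incr_n (fun n => rs n t)), rs_lim, Ht.
   + apply (is_lim_seq_incr_n (fun n => rs (S n) t)), (is_lim_seq_incr_1 (fun n => rs n t)), rs_lim, Ht.
  - intros m. simpl (S m + K)%nat. assert (Hrec := rs_rec (m + K) t Ht).
   assert (Hd := one_minus_rs_sq (m + K) t Ht). assert (Hp := rs_pos (S (m + K)) t Ht).
   set (r := rs (S (m + K)) t) in *. assert (2 <= INR (S (m + K)) / t).
   { apply Rle_div_r; [exact Ht|]. rewrite S_INR, plus_INR. assert (H := pos_INR m). lra. }
   assert (r <= r / (1 - r ^ 2)). { apply Rle_div_r; [exact Hd|]. nra. }
   nra. }
 intros m. specialize (Hdec m). lra.
Qed.

(** Comparison with the shifted sequence [r_(j-1)]: it solves the recurrence with a coefficient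
    smaller by [1 / t], hence is a supersolution, and at index 1 its value is [r_0 = 1]. *)
Lemma rs_decr (n : nat) (t : R) : 0 < t -> rs (S n) t <= rs n t.
Proof. intros Ht. apply (compare_upper t 0 (fun j => rs (pred j) t)) with (j := S n).
 - exact Ht.
 - intros j; apply rs_pos, Ht.
 - simpl; lra.
 - destruct (rs_decr_eventually t Ht) as [K HK]. exists (S K). intros j Hj.
  destruct j as [|j]; [lia|]. simpl. apply HK; lia.
 - intros [|j]; simpl.
  + left. apply rs_le_1, Ht.
  + right. split; [apply rs_lt_1, Ht|]. rewrite rs_rec by exact Ht.
   assert (Hd := one_minus_rs_sq j t Ht). assert (Hp := rs_pos (S j) t Ht). apply Rmult_le_compat_r; [mono|].
   unfold Rdiv. apply Rmult_le_compat_r; [pos|]. change (INR (S j) <= INR (S (S j))). rewrite (S_INR (S j)). lra.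
Qed.

Lemma rs_antitone (n m : nat) (t : R) : 0 < t -> (n <= m)%nat -> rs m t <= rs n t.
Proof. intros Ht H. induction H as [|m H IH]; [lra|]. assert (H' := rs_decr m t Ht). lra. Qed.

(* Airy scaling [t = h ^ -3], [k = 2 t + x / h]. *)
Definition th (h : R) : R := / h ^ 3.

Definition xk (h : R) (k : nat) : R := INR k * h - 2 / h ^ 2.

Definition ak (h : R) (k : nat) : R := rs k (th h) / h.

Lemma th_pos (h : R) : 0 < h -> 0 < th h.
Proof. intros H; apply Rinv_0_lt_compat, pow_lt, H. Qed.

Lemma kappa_xk (h : R) (k : nat) : 0 < h -> INR k / th h = 2 + xk h k * h ^ 2.
Proof. intros H. unfold th, xk. field. lra. Qed.

Lemma xk_S (h : R) (k : nat) : xk h (S k) = xk h k + h.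
Proof. unfold xk. rewrite S_INR. ring. Qed.

Lemma xk_add (h : R) (n j : nat) : xk h (n + j) = xk h n + INR j * h.
Proof. unfold xk. rewrite plus_INR. ring. Qed.

Lemma xk_lower (h : R) (k : nat) : 0 < h -> - 2 <= xk h k * h ^ 2.
Proof. intros H. unfold xk. assert (H' := pos_INR k).
 replace ((INR k * h - 2 / h ^ 2) * h ^ 2) with (INR k * h ^ 3 - 2) by (field; lra). assert (0 < h ^ 3) by pos. nra.
Qed.

Lemma rs_ak (h : R) (k : nat) : 0 < h -> rs k (th h) = h * ak h k.
Proof. intros H. unfold ak. field. lra. Qed.

Lemma ak_pos (h : R) (k : nat) : 0 < h -> 0 < ak h k.
Proof. intros H. apply Rdiv_lt_0_compat; [apply rs_pos, th_pos, H|exact H]. Qed.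

Lemma ak_antitone (h : R) (n m : nat) : 0 < h -> (n <= m)%nat -> ak h m <= ak h n.
Proof. intros H Hnm. unfold ak, Rdiv. apply Rmult_le_compat_r.
 - left; apply Rinv_0_lt_compat, H.
 - apply rs_antitone; [apply th_pos, H|exact Hnm].
Qed.

(** * Crude barriers in the Airy scaling *)

(** The positive root of [v (v + x / 2) = 1 / 8]. It behaves like [- x / 2] at [- oo] and like
    [1 / (4 x)] at [+ oo], and serves as a barrier for [a_k ^ 2] on the whole grid. *)
Definition vup (x : R) : R := (sqrt (x ^ 2 + 2) - x) / 4.

Lemma sqrt_shift (x : R) : x < sqrt (x ^ 2 + 2) /\ - x < sqrt (x ^ 2 + 2) /\ 1 <= sqrt (x ^ 2 + 2) /\
 sqrt (x ^ 2 + 2) ^ 2 = x ^ 2 + 2 /\ 1 + x / 2 <= sqrt (x ^ 2 + 2).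
Proof. assert (Hs : sqrt (x ^ 2 + 2) ^ 2 = x ^ 2 + 2) by (apply pow2_sqrt; nra). assert (H0 := sqrt_pos (x ^ 2 + 2)).
 set (s := sqrt (x ^ 2 + 2)) in *. assert (H1 : 1 <= s) by nra. assert (Hlt : forall y, y ^ 2 < s ^ 2 -> y < s).
 { intros y Hy. destruct (Rlt_le_dec y s) as [H|H]; [exact H|exfalso]. nra. }
 split; [|split; [|split; [|split]]].
 - apply Hlt; lra.
 - apply Hlt; nra.
 - exact H1.
 - exact Hs.
 - left; apply Hlt. nra.
Qed.

Lemma vup_pos (x : R) : 0 < vup x.
Proof. unfold vup. assert (H := sqrt_shift x). lra. Qed.

(** With [s], [p], [m] the three roots, [p ^ 2 + m ^ 2 = 2 s ^ 2 + 2 h ^ 2], and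
    [2 s p <= s ^ 2 + p ^ 2], [2 s m <= s ^ 2 + m ^ 2]. *)
Lemma sqrt_midpoint (x h : R) :
 sqrt ((x + h) ^ 2 + 2) + sqrt ((x - h) ^ 2 + 2) <= 2 * sqrt (x ^ 2 + 2) + h ^ 2 / sqrt (x ^ 2 + 2).
Proof. destruct (sqrt_shift x) as (_ & _ & H1 & H2 & _). destruct (sqrt_shift (x + h)) as (_ & _ & Hp1 & Hp2 & _).
 destruct (sqrt_shift (x - h)) as (_ & _ & Hm1 & Hm2 & _).
 set (s := sqrt (x ^ 2 + 2)) in *. set (p := sqrt ((x + h) ^ 2 + 2)) in *. set (m := sqrt ((x - h) ^ 2 + 2)) in *.
 apply (Rmult_le_reg_r s); [lra|]. replace ((2 * s + h ^ 2 / s) * s) with (2 * s ^ 2 + h ^ 2) by (field; lra).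
 assert (Q1 := pow2_ge_0 (p - s)). assert (Q2 := pow2_ge_0 (m - s)). clear H1 Hp1 Hm1. nra.
Qed.

(** The supersolution inequality for [h sqrt (vup x)], squared by means of
    [(p + m) ^ 2 <= 2 (p ^ 2 + m ^ 2)]. With [w = (s + x) / 4] one has [v w = 1 / 8] and
    [1 - h ^ 2 v = u - h ^ 2 w]; the gain from this product beats the second difference of the root
    because [u <= s]. *)
Lemma vup_super (x h : R) : 0 < h <= 1 -> -2 <= x * h ^ 2 -> h ^ 2 * vup x < 1 ->
 2 * (vup (x + h) + vup (x - h)) * (1 - h ^ 2 * vup x) ^ 2 <= (2 + x * h ^ 2) ^ 2 * vup x.
Proof. intros Hh Hx HV. assert (Hm := sqrt_midpoint x h). destruct (sqrt_shift x) as (Ha & Hb & H1 & H2 & H3).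
 assert (Hv : vup x = (sqrt (x ^ 2 + 2) - x) / 4) by reflexivity.
 set (s := sqrt (x ^ 2 + 2)) in *. set (v := vup x) in *. set (w := (s + x) / 4). set (u := 1 + x * h ^ 2 / 2).
 assert (Hvw : v * w = 1 / 8) by (rewrite Hv; unfold w; nra).
 assert (vup (x + h) + vup (x - h) <= 2 * v + h ^ 2 / (4 * s)).
 { unfold vup. rewrite Hv. replace (h ^ 2 / (4 * s)) with (h ^ 2 / s / 4) by (field; lra). lra. }
 assert (Hu1 : 1 - h ^ 2 * v = u - h ^ 2 * w) by (rewrite Hv; unfold u, w; field). assert (0 < h ^ 2 <= 1) by nra.
 assert (0 < h ^ 2 * w) by nra. assert (u <= s) by (unfold u; destruct (Rle_lt_dec 0 x); nra).
 rewrite Hu1. replace (2 + x * h ^ 2) with (2 * u) by (unfold u; field).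
 assert ((u - h ^ 2 * w) ^ 2 <= u ^ 2 - u * (h ^ 2 * w)) by nra. assert (0 <= (u - h ^ 2 * w) ^ 2) by nra.
 assert (0 < h ^ 2 / (4 * s)) by pos.
 apply Rle_trans with (2 * (2 * v + h ^ 2 / (4 * s)) * (u ^ 2 - u * (h ^ 2 * w))).
 - assert (2 * (vup (x + h) + vup (x - h)) * (u - h ^ 2 * w) ^ 2
   <= 2 * (2 * v + h ^ 2 / (4 * s)) * (u - h ^ 2 * w) ^ 2). { mono. }
  assert (2 * (2 * v + h ^ 2 / (4 * s)) * (u - h ^ 2 * w) ^ 2
   <= 2 * (2 * v + h ^ 2 / (4 * s)) * (u ^ 2 - u * (h ^ 2 * w))). { mono. }
  lra.
 - assert (E : 2 * (2 * v + h ^ 2 / (4 * s)) * (u ^ 2 - u * (h ^ 2 * w)) =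
   (2 * u) ^ 2 * v - u * h ^ 2 / 2 * (1 - u / s) - u * (h ^ 2 * w) * (2 * (h ^ 2 / (4 * s)))).
  { replace (2 * (2 * v + h ^ 2 / (4 * s)) * (u ^ 2 - u * (h ^ 2 * w))) with
   ((2 * u) ^ 2 * v - 4 * (v * w) * (u * h ^ 2) + 2 * (h ^ 2 / (4 * s)) * u ^ 2
    - u * (h ^ 2 * w) * (2 * (h ^ 2 / (4 * s)))) by ring. rewrite Hvw. field. lra. }
  rewrite E. assert (u / s <= 1) by (apply Rle_div_l; lra). assert (0 <= u * h ^ 2 / 2 * (1 - u / s)) by mono.
  assert (0 <= u * (h ^ 2 * w) * (2 * (h ^ 2 / (4 * s)))) by mono. lra.
Qed.

Lemma super_of_squares (p m c k : R) : 0 < p -> 0 < m -> 0 < c -> c < 1 -> 0 <= k ->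
 2 * (p ^ 2 + m ^ 2) * (1 - c ^ 2) ^ 2 <= k ^ 2 * c ^ 2 -> p + m <= k * (c / (1 - c ^ 2)).
Proof. intros Hp Hm Hc Hc1 Hk H. assert (Hd : 0 < 1 - c ^ 2) by nra.
 replace (k * (c / (1 - c ^ 2))) with (k * c / (1 - c ^ 2)) by mono. apply Rle_div_r; [exact Hd|].
 apply Rsqr_incr_0_var; [|pos]. unfold Rsqr. apply Rle_trans with (2 * (p ^ 2 + m ^ 2) * (1 - c ^ 2) ^ 2).
 - assert (Q := pow2_ge_0 (p - m)). assert (Q1 := pow2_ge_0 (1 - c ^ 2)).
  replace ((p + m) * (1 - c ^ 2) * ((p + m) * (1 - c ^ 2))) with ((p + m) ^ 2 * (1 - c ^ 2) ^ 2) by ring. mono.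
 - eapply Rle_trans; [exact H|]. right; ring.
Qed.

Lemma exp_mult_INR (x : R) (n : nat) : exp (x * INR n) = exp x ^ n.
Proof. induction n as [|n IH].
 - simpl. rewrite Rmult_0_r. apply exp_0.
 - rewrite S_INR, Rmult_plus_distr_l, exp_plus, IH, Rmult_1_r. simpl. ring.
Qed.

(** Factorial decay at fixed [t]. It supplies the tail hypothesis of [compare_upper] for barriers
    that decay polynomially or exponentially. *)
Lemma rs_eventually_le (t c b : R) : 0 < t -> 0 < c -> 0 < b ->
 exists K, forall k, (K <= k)%nat -> (INR k + 1) * rs k t <= c /\ rs k t <= c * exp (- b * INR k).
Proof. intros Ht Hc Hb. assert (H1 : is_lim_seq (fun n => INR n * tau t n + tau t n) 0).
 { apply lim_plus_0; [apply tau_lim_INR|apply tau_lim]. }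
 destruct (lim_0_eventually _ c H1 Hc) as [K1 HK1].
 destruct (lim_0_eventually _ c (tau_lim (t * exp b)) Hc) as [K2 HK2]. exists (max K1 K2). intros k Hk.
 assert (Hr := rs_le_tau k t t ltac:(lra)). assert (Hkp := pos_INR k). split.
 - specialize (HK1 k ltac:(lia)). apply Rabs_def2 in HK1. nra.
 - specialize (HK2 k ltac:(lia)). apply Rabs_def2 in HK2. assert (E : tau (t * exp b) k = tau t k * exp (b * INR k)).
  { unfold tau. rewrite Rpow_mult_distr, exp_mult_INR. mono. }
  rewrite E in HK2. replace (- b * INR k) with (- (b * INR k)) by ring. rewrite exp_Ropp.
  apply Rle_div_r; [apply exp_pos|]. assert (He := exp_pos (b * INR k)). nra.
Qed.

Lemma ak_upper (h : R) (k : nat) : 0 < h <= 1 -> ak h k ^ 2 <= vup (xk h k).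
Proof. intros Hh. assert (Ht := th_pos h ltac:(lra)). assert (Hv := vup_pos).
 assert (HUsq : forall j, (h * sqrt (vup (xk h j))) ^ 2 = h ^ 2 * vup (xk h j)).
 { intros j. rewrite Rpow_mult_distr, pow2_sqrt; [mono|left; apply Hv]. }
 assert (HUp : forall j, 0 < h * sqrt (vup (xk h j))).
 { intros j. apply Rmult_lt_0_compat; [lra|apply sqrt_lt_R0, Hv]. }
 assert (Hmain : rs (0 + k) (th h) <= h * sqrt (vup (xk h k))).
 { apply (compare_upper (th h) 0 (fun j => h * sqrt (vup (xk h j)))); try assumption.
  - rewrite rs_0. apply Rsqr_incr_0_var; [|left; apply HUp].
   unfold Rsqr. replace (h * sqrt (vup (xk h 0)) * (h * sqrt (vup (xk h 0)))) with
    ((h * sqrt (vup (xk h 0))) ^ 2) by ring. rewrite HUsq. unfold vup. destruct (sqrt_shift (xk h 0)) as (_ & Hs & _).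
   assert (E : xk h 0 * h ^ 2 = -2) by (unfold xk; simpl INR; field; lra). nra.
  - assert (Hc0 : 0 < h ^ 2 / 4) by nra. destruct (rs_eventually_le (th h) (h ^ 2 / 4) 1 Ht Hc0 ltac:(lra)) as [K HK].
   destruct (nfloor_ex (2 / h ^ 3)) as [K' [_ HK']]. { mono. }
   exists (max K (S K')). intros j Hj. simpl Nat.add. destruct (HK j ltac:(lia)) as [H1 _].
   assert (Hr := rs_pos j (th h) Ht). assert (Hr1 := rs_le_1 j (th h) Ht). apply Rsqr_incr_0_var; [|left; apply HUp].
   unfold Rsqr. replace (h * sqrt (vup (xk h j)) * (h * sqrt (vup (xk h j)))) with
    ((h * sqrt (vup (xk h j))) ^ 2) by ring. rewrite HUsq. assert (Hx : 0 <= xk h j <= INR j).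
   { unfold xk. assert (Hjk : INR K' + 1 <= INR j) by (rewrite <- S_INR; apply le_INR; lia).
    assert (0 < 2 / h ^ 2) by mono. split; [|assert (H' := pos_INR j); nra].
    replace (2 / h ^ 2) with (2 / h ^ 3 * h) by (field; lra). nra. }
   destruct (sqrt_shift (xk h j)) as (Ha & Hb & Hc & Hd & _). assert (Hw : / (4 * (INR j + 1)) <= vup (xk h j)).
   { unfold vup. set (s := sqrt (xk h j ^ 2 + 2)) in *. set (x := xk h j) in *. assert (s <= x + 2) by nra.
    replace ((s - x) / 4) with (/ (2 * (s + x))).
    - mono.
    - apply (Rmult_eq_reg_r (2 * (s + x))); [|lra]. rewrite Rinv_l by lra.
     replace ((s - x) / 4 * (2 * (s + x))) with ((s ^ 2 - x ^ 2) / 2) by field. rewrite Hd. field. }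
   assert (Hj0 := pos_INR j). apply Rle_trans with (h ^ 2 * / (4 * (INR j + 1))).
   + replace (h ^ 2 * / (4 * (INR j + 1))) with (h ^ 2 / 4 / (INR j + 1)) by (field; lra).
    apply Rle_trans with (rs j (th h)); [nra|]. apply Rle_div_r; lra.
   + mono.
  (* Where the barrier is at least 1 the bound [r <= 1] suffices; elsewhere it is a
     supersolution. *)
  - intros j. simpl Nat.add. destruct (Rlt_le_dec (h * sqrt (vup (xk h (S j)))) 1) as [H1|H1].
   2:{ left. apply Rle_trans with 1; [apply rs_le_1, Ht|exact H1]. }
   right. split; [exact H1|]. rewrite kappa_xk by lra. assert (Hx := xk_lower h (S j) ltac:(lra)).
   assert (Ex : xk h (S (S j)) = xk h (S j) + h) by apply xk_S.
   assert (Ex' : xk h j = xk h (S j) - h) by (rewrite xk_S; ring).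
   apply super_of_squares; try apply HUp; [exact H1|lra|]. rewrite !HUsq, Ex, Ex'.
   assert (Hsup := vup_super (xk h (S j)) h Hh Hx). assert (HV : h ^ 2 * vup (xk h (S j)) < 1).
   { rewrite <- HUsq. assert (H2 := HUp (S j)). nra. }
   specialize (Hsup HV). assert (0 < h ^ 2) by nra. apply (Rmult_le_compat_l (h ^ 2)) in Hsup; [|lra]. lra. }
 simpl Nat.add in Hmain. rewrite rs_ak in Hmain by lra. apply Rmult_le_reg_l in Hmain; [|lra].
 assert (Ha := ak_pos h k ltac:(lra)). rewrite <- (pow2_sqrt (vup (xk h k))) by (left; apply Hv). nra.
Qed.

Lemma exp_sum_le (h : R) : 0 <= h <= 1 / 2 -> exp h + exp (- h) <= 2 + 3 * h ^ 2.
Proof. intros Hh. assert (H1 : exp h <= / (1 - h)).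
 { assert (H := exp_ineq1_le (- h)). rewrite <- (Ropp_involutive h) at 1. rewrite exp_Ropp. mono. }
 assert (H2 : exp (- h) <= / (1 + h)). { assert (H := exp_ineq1_le h). rewrite exp_Ropp. mono. }
 assert (E : / (1 - h) + / (1 + h) = 2 / (1 - h ^ 2)) by (field; nra).
 assert (2 / (1 - h ^ 2) <= 2 + 3 * h ^ 2); [|lra]. assert (Hq : h ^ 2 <= 1 / 4) by nra. assert (Q := pow2_ge_0 h).
 apply Rle_div_l; [lra|]. set (q := h ^ 2) in *. nra.
Qed.

(** The constant is [27 = 3 ^ 3 >= e ^ 3], so that [27 e ^ (- x) >= 1] up to [x = 3], the point from
    which the exponential is a supersolution. *)
Lemma vup_exp (x : R) : vup x <= (27 * exp (- x)) ^ 2 \/ 3 < x.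
Proof. destruct (Rlt_le_dec 3 x) as [H|H]; [mono|left].
 destruct (sqrt_shift x) as (Ha & Hb & Hc & Hd & _). unfold vup. set (s := sqrt (x ^ 2 + 2)) in *.
 assert (He := exp_ineq1_le (- x)). destruct (Rle_lt_dec x 0) as [H0|H0].
 - nra.
 - assert (/ 27 <= exp (- x)). { rewrite exp_Ropp. apply Rinv_le_contravar; [mono|].
   apply Rle_trans with (exp (1 * INR 3)).
   - destruct (Req_dec x 3) as [->|Hne].
    + right. f_equal. simpl. ring.
    + left. apply exp_increasing. simpl. lra.
   - rewrite exp_mult_INR. assert (H1 := exp_le_3). assert (H2 := exp_pos 1).
    replace 27 with (3 ^ 3) by ring. apply pow_incr. lra. }
  assert (1 <= 27 * exp (- x)) by lra. nra.
Qed.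

(** For [x > 3] the coefficient [2 + x h ^ 2] exceeds [2 + 3 h ^ 2 >= e ^ h + e ^ (- h)], so an
    exponential is a supersolution; for [x <= 3] the bound follows from [ak_upper]. *)
Lemma ak_exp (h : R) (k : nat) : 0 < h <= 1 / 2 -> ak h k <= 27 * exp (- xk h k).
Proof. intros Hh. assert (Ht := th_pos h ltac:(lra)).
 assert (Hlow : forall j, xk h j <= 3 -> ak h j <= 27 * exp (- xk h j)).
 { intros j Hj. assert (Hu := ak_upper h j ltac:(lra)). destruct (vup_exp (xk h j)) as [H|H]; [|lra].
  assert (Hp := exp_pos (- xk h j)). apply Rsqr_incr_0_var; [unfold Rsqr; lra|lra]. }
 assert (Hmain : rs (0 + k) (th h) <= h * (27 * exp (- xk h k))).
 { apply (compare_upper (th h) 0 (fun j => h * (27 * exp (- xk h j)))); [exact Ht| | | |].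
  - intros j. assert (Hp := exp_pos (- xk h j)). nra.
  - rewrite rs_ak by lra. apply Rmult_le_compat_l; [lra|]. apply Hlow.
   unfold xk; simpl INR. assert (0 < 2 / h ^ 2) by mono. lra.
  - assert (Hc0 : 0 < h * 27) by lra. destruct (rs_eventually_le (th h) (h * 27) h Ht Hc0 ltac:(lra)) as [K HK].
   exists K. intros j Hj. simpl Nat.add. destruct (HK j Hj) as [_ H1].
   eapply Rle_trans; [exact H1|]. rewrite Rmult_assoc. apply Rmult_le_compat_l; [lra|].
   apply Rmult_le_compat_l; [lra|]. unfold xk. assert (0 < 2 / h ^ 2) by mono. left. apply exp_increasing. lra.
  - intros j. simpl Nat.add. destruct (Rle_lt_dec (xk h (S j)) 3) as [H3|H3].
   { left. rewrite rs_ak by lra. apply Rmult_le_compat_l; [lra|]. apply Hlow, H3. }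
   destruct (Rlt_le_dec (h * (27 * exp (- xk h (S j)))) 1) as [H1|H1].
   2:{ left. apply Rle_trans with 1; [apply rs_le_1, Ht|exact H1]. }
   right. split; [exact H1|]. rewrite kappa_xk by lra. assert (Ex : xk h (S (S j)) = xk h (S j) + h) by apply xk_S.
   assert (Ex' : xk h j = xk h (S j) - h) by (rewrite xk_S; ring). rewrite Ex, Ex'. set (x := xk h (S j)) in *.
   assert (Hp := exp_pos (- x)). set (e := exp (- x)) in *.
   replace (- (x + h)) with (- x + - h) by ring. replace (- (x - h)) with (- x + h) by ring.
   rewrite !exp_plus. fold e. assert (Hs := exp_sum_le h ltac:(lra)).
   set (U := h * (27 * e)) in *. assert (HU : 0 < U) by (unfold U; nra).
   replace (h * (27 * (e * exp (- h))) + h * (27 * (e * exp h))) with (U * (exp h + exp (- h))) by (unfold U; ring).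
   clearbody U. assert (HU2 : 0 < 1 - U ^ 2) by nra. assert (U <= U / (1 - U ^ 2)).
   { apply Rle_div_r; [exact HU2|]. nra. }
   apply Rle_trans with (U * (2 + 3 * h ^ 2)); [mono|].
   apply Rle_trans with ((2 + x * h ^ 2) * U); [|apply Rmult_le_compat_l; nra].
   rewrite Rmult_comm. apply Rmult_le_compat_r; [lra|]. nra. }
 simpl Nat.add in Hmain. rewrite rs_ak in Hmain by lra. apply Rmult_le_reg_l in Hmain; [exact Hmain|lra].
Qed.

Lemma cos_lower (h : R) : 0 <= h -> 1 - h ^ 2 / 2 <= cos h.
Proof. intros Hh. replace h with (2 * (h / 2)) at 2 by field. rewrite cos_2a_sin.
 assert (sin (h / 2) ^ 2 <= (h / 2) ^ 2); [|nra]. destruct (Rle_lt_or_eq_dec 0 h Hh) as [H|<-].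
 - assert (H1 := sin_lt_x (h / 2) ltac:(lra)). assert (- (h / 2) <= sin (h / 2)).
  { destruct (Rle_lt_dec (h / 2) PI) as [Hp|Hp].
   - assert (0 <= sin (h / 2)) by (apply sin_ge_0; lra). lra.
   - assert (H3 := SIN_bound (h / 2)). assert (H4 := PI2_1). lra. }
  nra.
 - replace (0 / 2) with 0 by field. rewrite sin_0. lra.
Qed.

Lemma cos_add_sub (a h : R) : cos (a + h) + cos (a - h) = 2 * (cos a * cos h).
Proof. rewrite cos_plus, cos_minus; ring. Qed.

(* Compactly supported subsolution [h c cos (h (j - k))]. *)
Lemma ak_lower (h : R) (k : nat) : 0 < h <= 1 / 2 -> - xk h k / 2 - 3 <= ak h k ^ 2.
Proof. intros Hh. assert (Ht := th_pos h ltac:(lra)). assert (Ha := ak_pos h k ltac:(lra)). set (s := - xk h k).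
 (* The amplitude satisfies [al ^ 2 = s / 2 - 3]. The slack 3 pays for [1 - cos h] and for the
    growth of the coefficient across the bump, whose half-width [PI / 2] in [x] is below 2. *)
 destruct (Rle_lt_dec (s / 2 - 3) 0) as [Hneg|Hpos]; [nra|]. set (al := sqrt (s / 2 - 3)).
 assert (Hal : 0 < al) by (apply sqrt_lt_R0, Hpos). assert (Hal2 : al ^ 2 = s / 2 - 3) by (apply pow2_sqrt; lra).
 set (c := h * al). assert (Hc : 0 < c) by (unfold c; nra).
 assert (Hc2 : c ^ 2 = h ^ 2 * (s / 2 - 3)) by (unfold c; rewrite <- Hal2; ring).
 assert (Hx := xk_lower h k ltac:(lra)). assert (Hh2 : 0 < h ^ 2 <= 1 / 4) by nra.
 assert (Hsh : s * h ^ 2 <= 2) by (unfold s; lra). assert (Hc1 : c < 1) by nra.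
 assert (HPI := PI_4). assert (HPI' := PI2_1). set (ph := fun j : nat => (INR j - INR k) * h).
 set (L := fun j : nat => if Rle_dec (Rabs (ph j)) (PI / 2) then c * cos (ph j) else 0).
 assert (HLc : forall j, L j <= c).
 { intros j. unfold L. destruct (Rle_dec _ _); [|lra]. assert (H := COS_bound (ph j)). nra. }
 assert (Hmain : L k <= rs (0 + k) (th h)). { apply (compare_lower (th h) 0 L); [exact Ht| | |].
  - rewrite rs_0. specialize (HLc O). lra.
  - destruct (nfloor_ex (INR k + PI / 2 / h)) as [K [_ HK]].
   { assert (0 < PI / 2 / h) by pos. assert (Hk0 := pos_INR k). lra. }
   exists (S K). intros j Hj. unfold L. destruct (Rle_dec _ _) as [H|H].
   + exfalso. assert (Hjk : INR K + 1 <= INR j) by (rewrite <- S_INR; apply le_INR; lia).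
    assert (H1 := Rle_abs (ph j)). assert (PI / 2 < ph j); [|lra].
    unfold ph. replace (PI / 2) with (PI / 2 / h * h) by (field; lra). apply Rmult_lt_compat_r; lra.
   + left. apply rs_pos, Ht.
  - intros j. simpl Nat.add. destruct (Rle_dec (Rabs (ph (S j))) (PI / 2)) as [H|H].
   2:{ left. unfold L. destruct (Rle_dec _ _); [mono|]. left; apply rs_pos, Ht. }
   right. assert (HL := HLc (S j)). split; [lra|]. assert (EL : L (S j) = c * cos (ph (S j))).
   { unfold L. destruct (Rle_dec _ _); [mono|mono]. }
   set (p := ph (S j)) in *. absle H. assert (Hcos : 0 <= cos p) by (apply cos_ge_0; lra).
   assert (E1 : ph (S (S j)) = p + h) by (unfold p, ph; rewrite !S_INR; ring).
   assert (E2 : ph j = p - h) by (unfold p, ph; rewrite !S_INR; ring).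
   assert (HLn : forall i, Rabs (ph i) <= PI / 2 + h -> c * cos (ph i) <= L i).
   { intros i Hi. unfold L. destruct (Rle_dec _ _) as [H'|H']; [lra|]. assert (cos (ph i) <= 0); [|nra].
    unfold Rabs in *. destruct (Rcase_abs (ph i)).
    - rewrite <- cos_neg. apply cos_le_0; lra.
    - apply cos_le_0; lra. }
   assert (H1 := HLn (S (S j)) ltac:(rewrite E1; apply Rabs_le; lra)).
   assert (H2 := HLn j ltac:(rewrite E2; apply Rabs_le; lra)). rewrite E1 in H1. rewrite E2 in H2.
   assert (Hsum : 2 * cos h * L (S j) <= L (S (S j)) + L j). { rewrite EL. assert (E := cos_add_sub p h). nra. }
   eapply Rle_trans; [|exact Hsum]. assert (HL0 : 0 <= L (S j)) by (rewrite EL; nra).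
   clearbody L. set (l := L (S j)) in *. assert (Hd : 0 < 1 - l ^ 2) by nra.
   replace (INR (S j) / th h * (l / (1 - l ^ 2))) with (INR (S j) / th h / (1 - l ^ 2) * l) by mono.
   apply Rmult_le_compat_r; [exact HL0|]. apply Rle_div_l; [exact Hd|]. rewrite kappa_xk by lra.
   assert (Ex : xk h (S j) = - s + p). { unfold s, p, ph, xk. ring. }
   rewrite Ex. assert (Hch := cos_lower h ltac:(lra)).
   assert (Hm : (1 - h ^ 2 / 2) * (1 - h ^ 2 * (s / 2 - 3)) <= cos h * (1 - l ^ 2)). { apply Rmult_le_compat; nra. }
   assert (p <= 2) by lra. nra. }
 simpl Nat.add in Hmain. rewrite rs_ak in Hmain by lra. assert (EL : L k = c).
 { unfold L. assert (E : ph k = 0) by (unfold ph; ring). rewrite E, Rabs_R0, cos_0. destruct (Rle_dec _ _); lra. }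
 rewrite EL in Hmain. unfold c in Hmain. apply Rmult_le_reg_l in Hmain; [|lra]. rewrite <- Hal2. nra.
Qed.

Lemma exp_sum_ge (y : R) : 0 <= y -> 2 + y ^ 2 / 4 <= exp y + exp (- y).
Proof. intros Hy. set (z := y / 2). replace y with (z + z) by (unfold z; field).
 replace (- (z + z)) with (- z + - z) by ring. rewrite !exp_plus.
 assert (H1 := exp_ineq1_le z). assert (Hz : 0 <= z) by (unfold z; lra).
 assert (exp z * exp (- z) = 1) by (rewrite <- exp_plus, Rplus_opp_r; apply exp_0). assert (exp (- z) <= 1).
 { rewrite <- exp_0. destruct Hz as [Hz|<-]; [mono|mono]. }
 assert (H3 := exp_pos (- z)). nra.
Qed.

Lemma base_index (h y : R) : 0 < h <= 1 -> y * h ^ 2 <= 2 -> exists n, - y - 1 <= xk h n <= - y.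
Proof. intros Hh Hy. destruct (nfloor_ex ((2 / h ^ 2 - y) / h)) as [n [H1 H2]]. { apply Rdiv_le_0_compat; [|lra].
  assert (y <= 2 / h ^ 2); [|lra]. apply Rle_div_r; nra. }
 exists n. unfold xk. assert (E : (2 / h ^ 2 - y) / h * h = 2 / h ^ 2 - y) by (field; lra).
 apply (Rmult_le_compat_r h) in H1; [|lra]. apply (Rmult_lt_compat_r h) in H2; [|lra]. rewrite E in *. lra.
Qed.

(** Exponential subsolution [c0 (e ^ (- b x) - F)], which vanishes at [x = X + 1]. Its second
    difference carries the factor [b ^ 2 h ^ 2], so a large [b] beats the coefficient [2 + x h ^ 2]
    up to [X + 1]. Uniformity in [h] matters because later estimates divide by [a_k]. *)
Lemma ak_lower_right (X : R) : 0 <= X ->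
 exists c, 0 < c /\ forall h, 0 < h <= 1 / 4 -> forall k, xk h k <= X -> c <= ak h k.
Proof. intros HX. set (b := 2 * (3 * X + 10)). set (c0 := exp (- (9 * b))).
 exists (c0 * (exp (- (b * X)) - exp (- (b * (X + 1))))). assert (Hb : 0 < b) by (unfold b; lra).
 assert (Hc0 : 0 < c0) by apply exp_pos.
 assert (HE : exp (- (b * (X + 1))) < exp (- (b * X))) by (apply exp_increasing; nra). split; [nra|].
 (* Since [8 / 2 - 3 = 1], [ak_lower] gives [a >= 1] at the base point in [[-9, -8]], while [c0]
    keeps the barrier at most [h] from [x = -9] on. *)
 intros h Hh k Hk. assert (Ht := th_pos h ltac:(lra)). destruct (base_index h 8) as [n Hn]; [lra|nra|].
 assert (Han : 1 <= ak h n). { assert (H := ak_lower h n ltac:(lra)). assert (Hp := ak_pos h n ltac:(lra)). nra. }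
 destruct (le_lt_dec n k) as [Hnk|Hnk]. 2:{ assert (H := ak_antitone h k n ltac:(lra) ltac:(lia)).
   assert (H1 : exp (- (b * X)) <= 1). { rewrite <- exp_0. destruct (Rle_lt_or_eq_dec 0 (b * X)) as [H2|H2]; [nra| |].
    - left; apply exp_increasing; lra.
    - right; f_equal; lra. }
   assert (H2 : c0 <= 1). { rewrite <- exp_0. left; apply exp_increasing; lra. }
   assert (H3 := exp_pos (- (b * (X + 1)))). nra. }
 set (F := exp (- (b * (X + 1)))) in *. assert (HF : 0 < F) by apply exp_pos. set (e := fun x => exp (- (b * x))).
 assert (He9 : forall x, -9 <= x -> c0 * e x <= 1).
 { intros x Hx. unfold c0, e. rewrite <- exp_plus. rewrite <- exp_0. apply exp_le_mono. nra. }
 set (L := fun j : nat => h * (c0 * (e (xk h (n + j)) - F))). assert (HLh : forall j, L j <= h).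
 { intros j. unfold L. rewrite xk_add. assert (H0 : 0 <= INR j * h) by pos.
  specialize (He9 (xk h n + INR j * h) ltac:(lra)). assert (0 < c0 * F) by pos. rewrite <- (Rmult_1_r h) at 4. mono. }
 assert (Hmain : L (k - n)%nat <= rs (n + (k - n)) (th h)). { apply (compare_lower (th h) n L); [exact Ht| | |].
  - rewrite rs_ak by lra. specialize (HLh O). nra.
  - destruct (nfloor_ex ((X + 10) / h)) as [K [_ HK]]; [pos|].
   exists (S K). intros j Hj. assert (Hr := rs_pos (n + j) (th h) Ht). assert (L j <= 0); [|lra].
   assert (Hjk : INR K + 1 <= INR j) by (rewrite <- S_INR; apply le_INR; lia). assert (X + 10 <= INR j * h).
   { replace (X + 10) with ((X + 10) / h * h) by (field; lra). mono. }
   assert (e (xk h (n + j)) <= F). { unfold e, F. rewrite xk_add. apply exp_le_mono. nra. }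
   unfold L. assert (c0 * (e (xk h (n + j)) - F) <= 0) by nra. nra.
  - intros j. assert (Hr := rs_pos (n + S j) (th h) Ht). destruct (Rle_lt_dec (L (S j)) 0) as [H0|H0]; [mono|right].
   assert (HL := HLh (S j)). split; [lra|]. assert (Ex : xk h (n + S (S j)) = xk h (n + S j) + h).
   { rewrite Nat.add_succ_r. apply xk_S. }
   assert (Ex' : xk h (n + j) = xk h (n + S j) - h). { rewrite Nat.add_succ_r, xk_S. ring. }
   rewrite kappa_xk by lra. assert (Hx1 : xk h (n + S j) < X + 1).
   { destruct (Rlt_le_dec (xk h (n + S j)) (X + 1)) as [H|H]; [exact H|exfalso]. assert (e (xk h (n + S j)) <= F).
    { unfold e, F. apply exp_le_mono. nra. }
    unfold L in H0. assert (c0 * (e (xk h (n + S j)) - F) <= 0) by nra. nra. }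
   assert (Hsum : L (S (S j)) + L j =
    2 * L (S j) + h * c0 * e (xk h (n + S j)) * (exp (b * h) + exp (- (b * h)) - 2)).
   { unfold L. rewrite Ex, Ex'. set (x := xk h (n + S j)). unfold e.
    replace (- (b * (x + h))) with (- (b * x) + - (b * h)) by ring.
    replace (- (b * (x - h))) with (- (b * x) + b * h) by ring. rewrite !exp_plus. ring. }
   rewrite Hsum. assert (Hbh : 0 <= b * h) by pos. assert (Hes := exp_sum_ge (b * h) Hbh).
   assert (HLe : L (S j) <= h * c0 * e (xk h (n + S j))) by (unfold L; assert (0 < h * (c0 * F)) by mono; lra).
   apply Rle_trans with (L (S j) * (2 + (b * h) ^ 2 / 4)). 2:{ assert (L (S j) * ((b * h) ^ 2 / 4) <=
      h * c0 * e (xk h (n + S j)) * (exp (b * h) + exp (- (b * h)) - 2)); [|lra].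
     assert (Q := pow2_ge_0 (b * h)). mono. }
   clearbody L. set (l := L (S j)) in *. assert (Hd : 0 < 1 - l ^ 2) by nra.
   replace ((2 + xk h (n + S j) * h ^ 2) * (l / (1 - l ^ 2)))
    with (l * ((2 + xk h (n + S j) * h ^ 2) / (1 - l ^ 2))) by mono. apply Rmult_le_compat_l; [lra|].
   apply Rle_div_l; [exact Hd|]. assert (Hl2 : l ^ 2 <= h ^ 2) by nra. assert (Hh2 : 0 < h ^ 2 <= / 16) by nra.
   set (q := h ^ 2) in *. set (Y := 3 * X + 10).
   replace ((b * h) ^ 2 / 4) with (Y ^ 2 * q) by (unfold b, q, Y; field).
   assert (HY : 10 * Y <= Y ^ 2) by (unfold Y; nra).
   apply Rle_trans with ((2 + Y ^ 2 * q) * (1 - q)); [|apply Rmult_le_compat_l; nra].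
   apply Rle_trans with (2 + (X + 1) * q); [nra|]. assert (X + 1 <= Y ^ 2 * (1 - q) - 2); [|nra].
   assert (Y ^ 2 * (15 / 16) <= Y ^ 2 * (1 - q)) by mono. unfold Y in *. lra. }
 replace (n + (k - n))%nat with k in Hmain by lia. rewrite rs_ak in Hmain by lra. unfold L in Hmain.
 replace (n + (k - n))%nat with k in Hmain by lia. apply Rmult_le_reg_l in Hmain; [|lra].
 eapply Rle_trans; [|exact Hmain]. apply Rmult_le_compat_l; [lra|]. assert (exp (- (b * X)) <= e (xk h k)); [|lra].
 unfold e. apply exp_le_mono. nra.
Qed.

(** * Second-order barriers on the left *)

(** Reduces two roots to a single root in the sum and the difference, which [sqrt_upper] and
    [sqrt_lower] expand. *)
Lemma sqrt_sum_sq (p m : R) : 0 < p -> 0 < m -> (sqrt p + sqrt m) ^ 2 = (p + m) + sqrt ((p + m) ^ 2 - (p - m) ^ 2).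
Proof. intros Hp Hm. replace ((p + m) ^ 2 - (p - m) ^ 2) with (Rsqr 2 * (p * m)) by (unfold Rsqr; ring).
 rewrite sqrt_mult, sqrt_Rsqr, sqrt_mult; try lra; try (apply Rle_0_sqr); try nra.
 replace ((sqrt p + sqrt m) ^ 2) with (sqrt p ^ 2 + sqrt m ^ 2 + 2 * (sqrt p * sqrt m)) by ring.
 rewrite !pow2_sqrt by lra. ring.
Qed.

Lemma sqrt_upper (M D : R) : 0 < M -> D ^ 2 <= M ^ 2 -> sqrt (M ^ 2 - D ^ 2) <= M - D ^ 2 / (2 * M).
Proof. intros HM HD. assert (Q := pow2_ge_0 (D ^ 2 / (2 * M))). assert (H0 : 0 <= M - D ^ 2 / (2 * M)).
 { assert (D ^ 2 / (2 * M) <= M); [|lra]. apply div_le_intro; nra. }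
 rewrite <- (sqrt_pow2 (M - D ^ 2 / (2 * M))) by exact H0. apply sqrt_le_1_alt.
 replace ((M - D ^ 2 / (2 * M)) ^ 2) with (M ^ 2 - D ^ 2 + (D ^ 2 / (2 * M)) ^ 2) by (field; lra). lra.
Qed.

Lemma sqrt_lower (M D : R) : 0 < M -> D ^ 2 <= M ^ 2 ->
 M - D ^ 2 / (2 * M) - D ^ 4 / (2 * M ^ 3) <= sqrt (M ^ 2 - D ^ 2).
Proof. intros HM HD. set (x := D ^ 2 / M ^ 2). assert (HM2 : 0 < M ^ 2) by nra. assert (Hx : 0 <= x <= 1).
 { unfold x; split; [mono|]. apply div_le_intro; lra. }
 replace (M - D ^ 2 / (2 * M) - D ^ 4 / (2 * M ^ 3)) with (M * (1 - x / 2 - x ^ 2 / 2)) by (unfold x; field; lra).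
 replace (M ^ 2 - D ^ 2) with (M ^ 2 * (1 - x)) by (unfold x; field; lra). rewrite sqrt_mult, sqrt_pow2 by lra.
 apply Rmult_le_compat_l; [lra|]. destruct (Rle_lt_dec 0 (1 - x / 2 - x ^ 2 / 2)) as [H|H].
 - rewrite <- (sqrt_pow2 _ H). apply sqrt_le_1_alt. nra.
 - assert (Hs := sqrt_pos (1 - x)). lra.
Qed.

(** With [y = h w] and [q = 1 / (1 - y ^ 2)] the reciprocals are [a = w (1 - y) q] and
    [b = w (1 + y) q], so every difference is a power of [w] times a power of [y] times a factor
    near a constant. *)
Lemma inv_diffs (s h : R) : 100 <= s -> 0 < h <= 1 / 2 -> let a := / (s + h) in let b := / (s - h) in let w := / s in
 (0 <= b - a <= 3 * h * w ^ 2 /\ 0 <= b ^ 2 - a ^ 2 <= 21 / 5 * h * w ^ 3 /\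
 0 <= b ^ 3 - a ^ 3 <= 13 / 2 * h * w ^ 4) /\
 (0 <= a + b - 2 * w <= 3 * h ^ 2 * w ^ 3 /\ 0 <= a ^ 2 + b ^ 2 - 2 * w ^ 2 <= 7 * h ^ 2 * w ^ 4 /\
 0 <= a ^ 3 + b ^ 3 - 2 * w ^ 3 <= 13 * h ^ 2 * w ^ 5).
Proof. intros Hs Hh a b w. assert (0 < w) by (apply Rinv_0_lt_compat; lra).
 assert (Hsw : s * w = 1) by (apply Rinv_r; lra). set (y := h * w). assert (0 < y <= / 100).
 { unfold y; split; [nra|]. nra. }
 set (q := / (1 - y ^ 2)). assert (q * (1 - y ^ 2) = 1) by (apply Rinv_l; nra). assert (1 <= q <= 101 / 100).
 { assert (0 <= y ^ 2 <= / 10000) by nra. nra. }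
 assert (Hd : 1 - y ^ 2 <> 0) by nra.
 assert (Ey : h = y * s) by (unfold y; rewrite Rmult_assoc, (Rmult_comm w), Hsw; ring).
 assert (1 + y <> 0 /\ 1 - y <> 0) by lra. assert (Ea : a = w * ((1 - y) * q)).
 { unfold a, w, q. rewrite Ey. field. repeat split; nra. }
 assert (Eb : b = w * ((1 + y) * q)). { unfold b, w, q. rewrite Ey. field. repeat split; nra. }
 assert (Eq : q - 1 = y ^ 2 * q) by lra. clearbody a b q. clear Hd. assert (0 <= y ^ 2 <= / 10000) by nra.
 assert (1 <= q ^ 2 <= 103 / 100) by nra. assert (1 <= q ^ 3 <= 105 / 100) by nra.
 assert (E1 : b - a = w * y * (2 * q)) by mono.
 assert (E2 : b ^ 2 - a ^ 2 = w ^ 2 * y * (4 * q ^ 2)) by (rewrite Ea, Eb; ring).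
 assert (E3 : b ^ 3 - a ^ 3 = w ^ 3 * y * (6 * q ^ 3 + 2 * y ^ 2 * q ^ 3)) by (rewrite Ea, Eb; ring).
 assert (F1 : a + b - 2 * w = w * y ^ 2 * (2 * q)).
 { rewrite Ea, Eb. transitivity (2 * w * (q - 1)); [ring|]. rewrite Eq; ring. }
 assert (F2 : a ^ 2 + b ^ 2 - 2 * w ^ 2 = w ^ 2 * y ^ 2 * (2 * q * (q + 1) + 2 * q ^ 2)).
 { rewrite Ea, Eb. transitivity (w ^ 2 * (2 * ((q - 1) * (q + 1)) + 2 * y ^ 2 * q ^ 2)); [ring|]. rewrite Eq; ring. }
 assert (F3 : a ^ 3 + b ^ 3 - 2 * w ^ 3 = w ^ 3 * y ^ 2 * (2 * q * (q ^ 2 + q + 1) + 6 * q ^ 3)).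
 { rewrite Ea, Eb. transitivity (w ^ 3 * (2 * ((q - 1) * (q ^ 2 + q + 1)) + 6 * y ^ 2 * q ^ 3)); [ring|].
  rewrite Eq; ring. }
 assert (0 < w * y) by nra. assert (0 < w ^ 2 * y) by nra. assert (0 < w ^ 3 * y) by mono.
 assert (0 < w * y ^ 2) by mono. assert (0 < w ^ 2 * y ^ 2) by mono. assert (0 < w ^ 3 * y ^ 2) by mono.
 assert (G : forall p c C : R, 0 < p -> 0 <= c <= C -> 0 <= p * c <= C * p). { intros p c C Hp Hc; split; nra. }
 replace (3 * h * w ^ 2) with (3 * (w * y)) by (unfold y; ring).
 replace (21 / 5 * h * w ^ 3) with (21 / 5 * (w ^ 2 * y)) by (unfold y; ring).
 replace (13 / 2 * h * w ^ 4) with (13 / 2 * (w ^ 3 * y)) by (unfold y; ring).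
 replace (3 * h ^ 2 * w ^ 3) with (3 * (w * y ^ 2)) by (unfold y; ring).
 replace (7 * h ^ 2 * w ^ 4) with (7 * (w ^ 2 * y ^ 2)) by (unfold y; ring).
 replace (13 * h ^ 2 * w ^ 5) with (13 * (w ^ 3 * y ^ 2)) by (unfold y; ring). rewrite E1, E2, E3, F1, F2, F3.
 split; (split; [|split]); apply G; try assumption; split; nra.
Qed.

(** Here [c], [p], [m] stand for barrier values at [s], [s + h], [s - h], all close to [s / 2], and
    [e] for the correction in [1 - h ^ 2 c]. At order [h ^ 2] the concavity of the root contributes
    about [- 1 / (2 s)] and the term [8 e c] at most [1 / (2 s) + E - 3 G]. The remaining errors are
    multiples of [E], absorbed by [G >= 500 E]. *)
Lemma core_super (s h c p m e E G : R) :
 1000 <= s -> 0 < h <= 1 / 2 -> s * h ^ 2 <= 2 -> 0 <= E <= 6 -> 500 * E <= G ->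
 0 < p -> 0 < m -> Rabs (c - s / 2) <= E -> Rabs (p + m - s) <= 3 * E ->
 Rabs (p - m - h) <= 11 * h * (E / s) -> Rabs (p + m - 2 * c) <= 20 * h ^ 2 * (E / s) ->
 Rabs e <= E -> 8 * e * c <= 1 / (2 * s) + E - 3 * G -> (1 + h ^ 2 * e) * (sqrt p + sqrt m) <= 2 * sqrt c.
Proof. intros Hs Hh Hsh HE HG Hp Hm Hc HM HD HX He Hec. absle Hc. absle HM. absle HD. absle HX. absle He.
 set (x := E / s) in *. assert (Hx : 0 <= x <= 6 / 1000). { unfold x; split; [mono|]. apply div_le_intro; lra. }
 assert (Exs : x * s = E) by (unfold x; field; lra).
 set (q := h ^ 2) in *. assert (Hq0 : 0 < q) by (apply pow_lt; lra).
 assert (Hq : 0 < q <= 2 / 1000) by (split; [exact Hq0|nra]).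
 set (ep := q * e). assert (Hep : - (q * E) <= ep <= q * E) by (unfold ep; split; nra).
 assert (HqE : 0 <= q * E <= 12 / 1000) by (split; nra). set (M := p + m) in *. set (D := p - m) in *.
 set (dl := M - 2 * c) in *. assert (HMb : 98 / 100 * s <= M <= 102 / 100 * s) by lra.
 assert (HDlow : h * (1 - 11 * x) <= D <= h * (1 + 11 * x)) by lra. assert (HD0 : 0 < D) by nra.
 assert (HD2 : q * (1 - 22 * x) <= D ^ 2 <= 2 * q). { unfold q. split.
  - apply Rle_trans with ((h * (1 - 11 * x)) ^ 2); [|mono].
   rewrite Rpow_mult_distr. apply Rmult_le_compat_l; [mono|nra].
  - apply Rle_trans with ((h * (1 + 11 * x)) ^ 2); [mono|].
   rewrite Rpow_mult_distr. replace (2 * h ^ 2) with (h ^ 2 * 2) by ring. apply Rmult_le_compat_l; [mono|nra]. }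
 assert (HM0 : 0 < M) by lra. assert (HDM : D ^ 2 <= M ^ 2) by nra. set (Q := D ^ 2 / (2 * M)).
 assert (HQ : q * (1 - 25 * x) / (2 * s) <= Q <= q / 100). { unfold Q. split.
  - apply le_div_intro; [lra|]. apply Rle_trans with (q * (1 - 22 * x)); [|lra].
   replace (q * (1 - 25 * x) / (2 * s) * (2 * M)) with (q * ((1 - 25 * x) * (M / s))) by (field; lra).
   apply Rmult_le_compat_l; [lra|]. assert (M / s <= 1 + 3 * x) by (apply div_le_intro; [lra|]; nra). nra.
  - apply div_le_intro; [lra|]. nra. }
 assert (Hsq := sqrt_sum_sq p m Hp Hm). fold M D in Hsq. assert (Hup := sqrt_upper M D HM0 HDM). fold Q in Hup.
 assert (Hc0 : 0 < c) by lra. apply Rsqr_incr_0_var; [|assert (H := sqrt_pos c); lra]. unfold Rsqr.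
 replace ((1 + ep) * (sqrt p + sqrt m) * ((1 + ep) * (sqrt p + sqrt m)))
  with ((1 + ep) ^ 2 * (sqrt p + sqrt m) ^ 2) by ring.
 replace (2 * sqrt c * (2 * sqrt c)) with (4 * sqrt c ^ 2) by ring. rewrite pow2_sqrt by lra. rewrite Hsq.
 apply Rle_trans with ((1 + ep) ^ 2 * (4 * c + 2 * dl - Q)). { apply Rmult_le_compat_l; [mono|]. unfold dl; lra. }
 assert (Hz : q * (1 - 25 * x) / (2 * s) = q * (1 / (2 * s)) - 25 / 2 * q * (x / s)) by (field; lra).
 assert (Hxs : 0 <= x / s <= E / 1000). { split; [mono|]. unfold x. apply div_le_intro; [lra|].
  apply div_le_intro; [lra|]. replace (E / 1000 * s * s) with (E * (s * s / 1000)) by field.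
  assert (1 <= s * s / 1000) by nra. nra. }
 assert (Hlin : 4 * c * (2 * ep) <= q * (1 / (2 * s) + E - 3 * G)).
 { replace (4 * c * (2 * ep)) with (q * (8 * e * c)) by (unfold ep; ring). mono. }
 assert (Hquad : 4 * c * ep ^ 2 <= q * (26 * E)).
 { assert (ep ^ 2 <= (q * E) ^ 2) by (apply pow_maj_Rabs, Rabs_le; lra).
  apply Rle_trans with (4 * c * (q * E) ^ 2); [mono|].
  replace (4 * c * (q * E) ^ 2) with (q * (E * (4 * c * q * E))) by ring.
  apply Rmult_le_compat_l; [lra|]. rewrite (Rmult_comm 26). apply Rmult_le_compat_l; [lra|].
  assert (4 * c * q <= 41 / 10). { apply Rle_trans with (203 / 100 * (s * q)); [|lra].
   replace (203 / 100 * (s * q)) with (203 / 100 * s * q) by ring. mono. }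
  assert (0 <= 4 * c * q) by mono. nra. }
 assert (Hcross : (2 * ep + ep ^ 2) * (2 * dl - Q) <= q * (1 / 10 * E)).
 { assert (HQ0 : 0 <= Q) by (apply Rdiv_le_0_compat; [mono|lra]). assert (Hep2 : 0 <= ep ^ 2 <= q * E).
  { split; [mono|]. clearbody ep. clear - Hep HqE. set (z := q * E) in *. nra. }
  assert (H1 : Rabs (2 * ep + ep ^ 2) <= 3 * (q * E)) by (apply Rabs_le; split; lra).
  assert (Hx20 : 20 * q * x <= q / 5) by (clear - Hq Hx; nra).
  assert (H2 : Rabs (2 * dl - Q) <= 1 / 100) by (apply Rabs_le; split; lra).
  eapply Rle_trans; [apply Rle_abs|]. rewrite Rabs_mult. apply Rle_trans with (3 * (q * E) * (1 / 100)); [|lra].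
  mono. }
 assert (Hdl : 2 * dl <= q * (40 * (E / 1000))).
 { assert (x <= E / 1000) by (unfold x; apply div_le_intro; [lra|]; clear - HE Hs; nra).
  assert (q * x <= q * (E / 1000)) by mono. lra. }
 assert (Hqxs : q * (x / s) <= q * (E / 1000)) by mono. assert (HqG : q * (500 * E) <= q * G) by mono.
 assert (Hfin : (1 + ep) ^ 2 * (4 * c + 2 * dl - Q) = 4 * c + (4 * c * (2 * ep) + 4 * c * ep ^ 2
  + (2 * ep + ep ^ 2) * (2 * dl - Q) + 2 * dl - Q)) by ring. rewrite Hfin. lra.
Qed.

(** Mirror image of [core_super]. The lower expansion of the root has the extra term
    [D ^ 4 / (2 M ^ 3)], which [/ s ^ 2 <= 8 * E] makes small. *)
Lemma core_sub (s h c p m e E G : R) : 1000 <= s -> 0 < h <= 1 / 2 -> s * h ^ 2 <= 2 -> 0 <= E <= 6 -> 500 * E <= G ->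
 / s ^ 2 <= 8 * E -> 0 < p -> 0 < m -> Rabs (c - s / 2) <= E -> Rabs (p + m - s) <= 3 * E ->
 Rabs (p - m - h) <= 11 * h * (E / s) -> Rabs (p + m - 2 * c) <= 20 * h ^ 2 * (E / s) ->
 0 <= e <= E -> 1 / (2 * s) - E + 3 * G <= 8 * e * c -> 2 * sqrt c <= (1 + h ^ 2 * e) * (sqrt p + sqrt m).
Proof. intros Hs Hh Hsh HE HG HEs Hp Hm Hc HM HD HX He Hec. absle Hc. absle HM. absle HD. absle HX.
 set (x := E / s) in *. assert (Hx : 0 <= x <= 6 / 1000). { unfold x; split; [mono|]. apply div_le_intro; lra. }
 assert (Exs : x * s = E) by (unfold x; field; lra).
 set (q := h ^ 2) in *. assert (Hq0 : 0 < q) by (apply pow_lt; lra).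
 assert (Hq : 0 < q <= 2 / 1000) by (split; [exact Hq0|nra]).
 set (ep := q * e). assert (Hep : 0 <= ep <= q * E) by (unfold ep; split; nra).
 assert (HqE : 0 <= q * E <= 12 / 1000) by (split; nra). set (M := p + m) in *. set (D := p - m) in *.
 set (dl := M - 2 * c) in *. assert (HMb : 98 / 100 * s <= M <= 102 / 100 * s) by lra.
 assert (HDlow : h * (1 - 11 * x) <= D <= h * (1 + 11 * x)) by lra. assert (HD0 : 0 < D) by nra.
 assert (HD2 : D ^ 2 <= q * (1 + 23 * x) /\ D ^ 2 <= 2 * q). { assert (H : D ^ 2 <= q * (1 + 23 * x)).
  { apply Rle_trans with ((h * (1 + 11 * x)) ^ 2); [mono|].
   rewrite Rpow_mult_distr. unfold q. apply Rmult_le_compat_l; [mono|nra]. }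
  split; [exact H|]. nra. }
 destruct HD2 as [HD2 HD2']. assert (HM0 : 0 < M) by lra. assert (HDM : D ^ 2 <= M ^ 2) by nra.
 set (Q := D ^ 2 / (2 * M)). assert (HQ0 : 0 <= Q) by (apply Rdiv_le_0_compat; [mono|lra]).
 assert (HQ : Q <= q * (1 + 30 * x) / (2 * s)). { unfold Q. apply div_le_intro; [lra|].
  apply Rle_trans with (q * (1 + 23 * x)); [lra|].
  replace (q * (1 + 30 * x) / (2 * s) * (2 * M)) with (q * ((1 + 30 * x) * (M / s))) by (field; lra).
  apply Rmult_le_compat_l; [lra|]. assert (1 - 3 * x <= M / s) by (apply le_div_intro; [lra|]; nra). nra. }
 set (T := D ^ 4 / (2 * M ^ 3)). assert (HT : T <= q * (E / 2)).
 { unfold T. assert (HM3 : (98 / 100 * s) ^ 3 <= M ^ 3) by mono. assert (Hs3 : 0 < s ^ 3) by mono.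
  assert (HM3' : s ^ 3 / 2 <= M ^ 3) by mono. apply div_le_intro; [lra|]. apply Rle_trans with (4 * q ^ 2).
  - replace (D ^ 4) with ((D ^ 2) ^ 2) by ring. replace (4 * q ^ 2) with ((2 * q) ^ 2) by ring.
   apply pow_incr; split; [mono|lra].
  - apply Rle_trans with (q * (E / 2) * (s ^ 3)); [|mono]. assert (1 <= 8 * E * s ^ 2).
   { apply (Rmult_le_compat_r (s ^ 2)) in HEs; [|mono]. rewrite Rinv_l in HEs; nra. }
   replace (q * (E / 2) * s ^ 3) with (q * ((8 * E * s ^ 2) * (s / 16))) by field.
   replace (4 * q ^ 2) with (q * (4 * q)) by ring. apply Rmult_le_compat_l; [lra|]. nra. }
 assert (HT0 : 0 <= T). { apply Rdiv_le_0_compat; [|mono]. apply pow_le; lra. }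
 assert (Hsq := sqrt_sum_sq p m Hp Hm). fold M D in Hsq. assert (Hlo := sqrt_lower M D HM0 HDM). fold Q T in Hlo.
 assert (Hc0 : 0 < c) by lra. assert (Hsp := sqrt_pos p). assert (Hsm := sqrt_pos m). apply Rsqr_incr_0_var; [|mono].
 unfold Rsqr. replace ((1 + ep) * (sqrt p + sqrt m) * ((1 + ep) * (sqrt p + sqrt m)))
  with ((1 + ep) ^ 2 * (sqrt p + sqrt m) ^ 2) by ring.
 replace (2 * sqrt c * (2 * sqrt c)) with (4 * sqrt c ^ 2) by ring. rewrite pow2_sqrt by lra. rewrite Hsq.
 apply Rle_trans with ((1 + ep) ^ 2 * (4 * c + 2 * dl - Q - T)).
 2:{ apply Rmult_le_compat_l; [mono|]. unfold dl; lra. }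
 assert (Hz : q * (1 + 30 * x) / (2 * s) = q * (1 / (2 * s)) + 15 * q * (x / s)) by (field; lra).
 assert (Hxs : 0 <= x / s <= E / 1000). { split; [mono|]. unfold x. apply div_le_intro; [lra|].
  apply div_le_intro; [lra|]. replace (E / 1000 * s * s) with (E * (s * s / 1000)) by field.
  assert (1 <= s * s / 1000) by nra. nra. }
 assert (Hlin : q * (1 / (2 * s) - E + 3 * G) <= 4 * c * (2 * ep)).
 { replace (4 * c * (2 * ep)) with (q * (8 * e * c)) by (unfold ep; ring). mono. }
 assert (Hquad : 0 <= 4 * c * ep ^ 2). { mono. }
 assert (Hxq : x <= E / 1000) by (unfold x; apply div_le_intro; [lra|]; clear - HE Hs; nra).
 assert (Hdl : - (q * (40 * (E / 1000))) <= 2 * dl). { assert (q * x <= q * (E / 1000)) by mono. lra. }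
 assert (Hs2 : 1 / (2 * s) <= / 2000). { apply div_le_intro; lra. }
 assert (Hqs : q * (1 / (2 * s)) <= q * / 2000) by mono. assert (Hqxs : q * (x / s) <= q * (E / 1000)) by mono.
 assert (Hcross : - (q * E) <= (2 * ep + ep ^ 2) * (2 * dl - Q - T)). { assert (Hep2 : 0 <= ep ^ 2 <= q * E).
  { split; [mono|]. clearbody ep. clear - Hep HqE. set (z := q * E) in *. nra. }
  assert (H1 : 0 <= 2 * ep + ep ^ 2 <= 3 * (q * E)) by mono. assert (H2 : - (1 / 10) <= 2 * dl - Q - T) by lra.
  clear - H1 H2 HqE. set (z := 2 * ep + ep ^ 2) in *. set (y := 2 * dl - Q - T) in *. nra. }
 assert (HqG : q * (500 * E) <= q * G) by mono.
 assert (Hfin : (1 + ep) ^ 2 * (4 * c + 2 * dl - Q - T) = 4 * c + (4 * c * (2 * ep) + 4 * c * ep ^ 2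
  + (2 * ep + ep ^ 2) * (2 * dl - Q - T) + 2 * dl - Q - T)) by ring. rewrite Hfin. lra.
Qed.

(* Second-order approximation of [a_k ^ 2] at [x_k = - s], with error term [sg * bB / s ^ 3];
 [uu] is [k / (2 t)]. *)
Definition uu (h s : R) : R := 1 - s * h ^ 2 / 2.

Definition ef (sg B s : R) : R := (/ s) ^ 2 / 8 - sg * B * (/ s) ^ 3.

(** The factor [uu] makes [1 - h ^ 2 * vv] a multiple of [k / (2 t)], see [one_minus_vv]. It then
    cancels the coefficient [k / t] of the recurrence, and the barrier equals [r_0 = 1] at
    [k = 0]. *)
Definition vv (sg B h s : R) : R := s / 2 - uu h s * ef sg B s.

(** Chosen so that near [s = 1000] the term [bB / s ^ 3] is about 5, enough to push the refined
    barriers outside the crude bounds to which they are glued there. *)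
Definition bB : R := 5 * 1000 ^ 3.

Lemma ef_abs (sg s : R) : Rabs sg <= 1 -> 0 < s -> Rabs (ef sg bB s) <= (/ s) ^ 2 / 8 + bB * (/ s) ^ 3.
Proof. intros Hsg Hs. unfold ef. assert (0 < / s) by pos. set (w := / s) in *.
 assert (0 < bB * w ^ 3) by (apply Rmult_lt_0_compat; [unfold bB; lra|pos]). assert (H2 := pow2_ge_0 w).
 replace (sg * bB * w ^ 3) with (sg * (bB * w ^ 3)) by ring.
 eapply Rle_trans; [apply Rabs_triang|]. rewrite Rabs_Ropp, Rabs_mult.
 rewrite (Rabs_right (w ^ 2 / 8)), (Rabs_right (bB * w ^ 3)) by lra. nra.
Qed.

Lemma uu_bounds (h s : R) : 0 < s -> s * h ^ 2 <= 2 -> 0 <= uu h s <= 1.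
Proof. intros Hs H. unfold uu. nra. Qed.

Lemma uef_abs (sg h s : R) : Rabs sg <= 1 -> 0 < s -> s * h ^ 2 <= 2 ->
 Rabs (uu h s * ef sg bB s) <= (/ s) ^ 2 / 8 + bB * (/ s) ^ 3.
Proof. intros Hsg Hs Hsh. assert (H := ef_abs sg s Hsg Hs). assert (Hu := uu_bounds h s Hs Hsh).
 rewrite Rabs_mult, (Rabs_right (uu h s)) by lra. assert (H0 := Rabs_pos (ef sg bB s)). nra.
Qed.

Lemma E_bounds (s : R) : 1000 <= s -> let E := (/ s) ^ 2 / 8 + bB * (/ s) ^ 3 in
 0 <= E <= 6 /\ 500 * E <= bB * (/ s) ^ 2 /\ (/ s) ^ 2 <= 8 * E.
Proof. intros Hs E. assert (0 < / s <= / 1000). { mono. }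
 set (w := / s) in *. assert (H2 : 0 < w ^ 2) by pos. assert (H3 : w ^ 3 <= (/ 1000) ^ 3) by mono.
 assert (0 < w ^ 3) by pos. assert (w ^ 2 <= (/ 1000) ^ 2) by mono. assert (w ^ 3 <= w ^ 2 * / 1000).
 { replace (w ^ 3) with (w ^ 2 * w) by ring. mono. }
 unfold E, bB in *. repeat split; lra.
Qed.

Lemma Rabs_lin_le (x y p q : R) : Rabs x <= p -> Rabs y <= q -> Rabs (x + y) <= p + q.
Proof. intros H1 H2. eapply Rle_trans; [apply Rabs_triang|lra]. Qed.

Lemma sg_abs_le (sg y q : R) : Rabs sg <= 1 -> 0 <= y <= q -> Rabs (sg * y) <= q.
Proof. intros H1 H2. rewrite Rabs_mult, (Rabs_right y) by lra. nra. Qed.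

(** Supplies the hypotheses of [core_super] and [core_sub], with [G = bB / s ^ 2]. In the last item
    the main part [4 s ef] of [8 ef c] is [1 / (2 s) - 4 sg G]; one of the four [G] is given up to
    the error, which leaves the [3 G] of those lemmas. *)
Lemma vv_hyps (sg h s : R) : Rabs sg <= 1 -> 1001 <= s -> 0 < h <= 1 / 2 -> (s + h) * h ^ 2 <= 2 ->
 let E := (/ s) ^ 2 / 8 + bB * (/ s) ^ 3 in
 let c := vv sg bB h s in let p := vv sg bB h (s + h) in let m := vv sg bB h (s - h) in
 0 < p /\ 0 < m /\ Rabs (c - s / 2) <= E /\ Rabs (p + m - s) <= 3 * E /\
 Rabs (p - m - h) <= 11 * h * (E / s) /\ Rabs (p + m - 2 * c) <= 20 * h ^ 2 * (E / s) /\
 Rabs (8 * ef sg bB s * c - (1 / (2 * s) - 4 * sg * bB * (/ s) ^ 2)) <= E + bB * (/ s) ^ 2.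
Proof. intros Hsg Hs Hh Hsh E c p m. assert (Hh2 := pow2_ge_0 h). assert (Hsh0 : s * h ^ 2 <= 2) by nra.
 assert (Hshm : (s - h) * h ^ 2 <= 2) by nra. destruct (E_bounds s ltac:(lra)) as (HE & HEG & _). fold E in HE, HEG.
 assert (Hf := uef_abs sg h s Hsg ltac:(lra) Hsh0). fold E in Hf.
 assert (Hfp := uef_abs sg h (s + h) Hsg ltac:(lra) Hsh). assert (Hfm := uef_abs sg h (s - h) Hsg ltac:(lra) Hshm).
 destruct (E_bounds (s - h) ltac:(lra)) as (HEm & _). destruct (E_bounds (s + h) ltac:(lra)) as (HEp & _).
 destruct (inv_diffs s h ltac:(lra) Hh) as ((D1 & D2 & D3) & (S1 & S2 & S3)). assert (0 < / (s + h)) by pos.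
 assert (0 < / (s - h)) by pos. assert (0 < / s <= / 1000). { mono. }
 assert (Hsw : s * / s = 1) by (apply Rinv_r; lra). assert (0 < bB) by (unfold bB; lra).
 assert (Hvp : p = (s + h) / 2 - uu h (s + h) * ef sg bB (s + h)) by reflexivity.
 assert (Hvm : m = (s - h) / 2 - uu h (s - h) * ef sg bB (s - h)) by reflexivity.
 assert (Hvc : c = s / 2 - uu h s * ef sg bB s) by reflexivity. assert (uu h (s + h) * ef sg bB (s + h) =
  ((/ (s + h)) ^ 2 / 8 - sg * bB * (/ (s + h)) ^ 3) - h ^ 2 / 2 * (/ (s + h) / 8 - sg * bB * (/ (s + h)) ^ 2)).
 { unfold uu, ef. field. lra. }
 assert (uu h (s - h) * ef sg bB (s - h) =
  ((/ (s - h)) ^ 2 / 8 - sg * bB * (/ (s - h)) ^ 3) - h ^ 2 / 2 * (/ (s - h) / 8 - sg * bB * (/ (s - h)) ^ 2)).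
 { unfold uu, ef. field. lra. }
 assert (uu h s * ef sg bB s = ((/ s) ^ 2 / 8 - sg * bB * (/ s) ^ 3) - h ^ 2 / 2 * (/ s / 8 - sg * bB * (/ s) ^ 2)).
 { unfold uu, ef. field. lra. }
 replace (E / s) with ((/ s) ^ 3 / 8 + bB * (/ s) ^ 4) by (unfold E; field; lra).
 assert (Ewf : 1 / (2 * s) = / s / 2) by (field; lra). rewrite Ewf.
 assert (Eef : ef sg bB s = (/ s) ^ 2 / 8 - sg * bB * (/ s) ^ 3) by reflexivity.
 assert (Hefa := ef_abs sg s Hsg ltac:(lra)). fold E in Hefa.
 assert (E = (/ s) ^ 2 / 8 + bB * (/ s) ^ 3) by reflexivity. clearbody E.
 set (w := / s) in *. set (a := / (s + h)) in *. set (b := / (s - h)) in *.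
 set (fp := uu h (s + h) * ef sg bB (s + h)) in *. set (fm := uu h (s - h) * ef sg bB (s - h)) in *.
 set (fc := uu h s * ef sg bB s) in *. set (e := ef sg bB s) in *. assert (h ^ 2 <= 2 * w).
 { apply (Rmult_le_compat_r w) in Hsh0; [|lra]. replace (s * h ^ 2 * w) with (s * w * h ^ 2) in Hsh0 by ring.
  rewrite Hsw in Hsh0. lra. }
 assert (0 < w ^ 2) by pos. assert (0 < w ^ 3) by pos. assert (0 < w ^ 4) by pos. assert (0 < w ^ 5) by pos.
 absle Hfp. absle Hfm.
 split; [lra|]. split; [lra|]. split; [rewrite Hvc; replace (s / 2 - fc - s / 2) with (- fc) by ring;
  rewrite Rabs_Ropp; exact Hf|]. assert (h ^ 2 <= / 4) by nra. split; [|split; [|split]].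
 - rewrite Hvp, Hvm. apply Rabs_le. assert (h ^ 2 * w ^ 4 <= / 4 * w ^ 4) by mono.
  assert (h ^ 2 * w ^ 5 <= / 4 * w ^ 5) by mono. assert (w ^ 4 <= w ^ 2 * (/ 1000) ^ 2).
  { replace (w ^ 4) with (w ^ 2 * w ^ 2) by ring. mono. }
  assert (w ^ 5 <= w ^ 3 * (/ 1000) ^ 2). { replace (w ^ 5) with (w ^ 3 * w ^ 2) by ring. mono. }
  assert (bB * (a ^ 3 + b ^ 3) <= bB * (3 * w ^ 3)) by mono. lra.
 - rewrite Hvp, Hvm. replace ((s + h) / 2 - fp - ((s - h) / 2 - fm) - h) with
   (((b ^ 2 - a ^ 2) / 8 + h ^ 2 / 2 * (- ((b - a) / 8))) +
   (sg * (- (bB * (b ^ 3 - a ^ 3))) + sg * (h ^ 2 / 2 * (bB * (b ^ 2 - a ^ 2))))) by mono.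
  replace (11 * h * (w ^ 3 / 8 + bB * w ^ 4)) with
   ((4 / 5 * (h * w ^ 3) + 23 / 40 * (h * w ^ 3)) + (13 / 2 * (bB * (h * w ^ 4)) + 9 / 2 * (bB * (h * w ^ 4))))
   by field. assert (HW3 : 0 < h * w ^ 3) by pos. assert (HW4 : 0 < bB * (h * w ^ 4)) by mono.
  apply Rabs_lin_le; apply Rabs_lin_le.
  + apply Rabs_le; lra.
  + replace (h ^ 2 / 2 * (- ((b - a) / 8))) with (- (h ^ 2 / 2 * ((b - a) / 8))) by ring.
   rewrite Rabs_Ropp, Rabs_right by pos. apply Rle_trans with (w * (3 * h * w ^ 2 / 8)); [mono|].
   replace (w * (3 * h * w ^ 2 / 8)) with (3 / 8 * (h * w ^ 3)) by field. lra.
  + replace (sg * - (bB * (b ^ 3 - a ^ 3))) with (- (sg * (bB * (b ^ 3 - a ^ 3)))) by ring.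
   rewrite Rabs_Ropp. apply sg_abs_le; [exact Hsg|]. split; [pos|].
   replace (13 / 2 * (bB * (h * w ^ 4))) with (bB * (13 / 2 * h * w ^ 4)) by ring. mono.
  + apply sg_abs_le; [exact Hsg|]. split; [mono|]. apply Rle_trans with (w * (bB * (21 / 5 * h * w ^ 3))).
   * mono.
   * replace (w * (bB * (21 / 5 * h * w ^ 3))) with (21 / 5 * (bB * (h * w ^ 4))) by ring. lra.
 - rewrite Hvp, Hvm, Hvc. replace ((s + h) / 2 - fp + ((s - h) / 2 - fm) - 2 * (s / 2 - fc)) with
   ((- ((a ^ 2 + b ^ 2 - 2 * w ^ 2) / 8) + h ^ 2 / 2 * ((a + b - 2 * w) / 8)) +
   (sg * (bB * (a ^ 3 + b ^ 3 - 2 * w ^ 3)) + - (sg * (h ^ 2 / 2 * (bB * (a ^ 2 + b ^ 2 - 2 * w ^ 2)))))) by mono.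
  replace (20 * h ^ 2 * (w ^ 3 / 8 + bB * w ^ 4)) with
   ((1 * (h ^ 2 * w ^ 3) + 3 / 2 * (h ^ 2 * w ^ 3)) + (13 * (bB * (h ^ 2 * w ^ 4)) + 7 * (bB * (h ^ 2 * w ^ 4))))
   by field. assert (0 < h ^ 2) by pos. assert (0 < h ^ 2 * w ^ 3) by pos. assert (0 < bB * (h ^ 2 * w ^ 4)) by mono.
  assert (h ^ 2 * w ^ 4 <= h ^ 2 * w ^ 3 / 1000).
  { replace (h ^ 2 * w ^ 4) with (h ^ 2 * w ^ 3 * w) by ring. apply Rmult_le_compat_l; lra. }
  assert (h ^ 2 * w ^ 5 <= h ^ 2 * w ^ 4). { replace (h ^ 2 * w ^ 5) with (h ^ 2 * w ^ 4 * w) by ring.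
   assert (0 < h ^ 2 * w ^ 4) by pos. nra. }
  apply Rabs_lin_le; apply Rabs_lin_le.
  + rewrite Rabs_Ropp. apply Rabs_le; lra.
  + rewrite Rabs_right by pos. mono.
  + apply sg_abs_le; [exact Hsg|]. split; [pos|]. apply Rle_trans with (bB * (13 * h ^ 2 * w ^ 5)); [mono|].
   replace (bB * (13 * h ^ 2 * w ^ 5)) with (13 * (bB * (h ^ 2 * w ^ 5))) by ring. mono.
  + rewrite Rabs_Ropp. apply sg_abs_le; [exact Hsg|]. split; [mono|].
   apply Rle_trans with (w * (bB * (7 * h ^ 2 * w ^ 4))).
   * mono.
   * replace (w * (bB * (7 * h ^ 2 * w ^ 4))) with (7 * (bB * (h ^ 2 * w ^ 5))) by ring. mono.
 - assert (E8 : 8 * e * c - (w / 2 - 4 * sg * bB * w ^ 2) = - (8 * (e * fc))).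
  { rewrite Hvc. transitivity (4 * s * e - w / 2 + 4 * sg * bB * w ^ 2 - 8 * (e * fc)); [field|].
   rewrite Eef. replace (4 * s * (w ^ 2 / 8 - sg * bB * w ^ 3)) with (s * w * (w / 2 - 4 * sg * bB * w ^ 2)) by field.
   rewrite Hsw. ring. }
  rewrite E8, Rabs_Ropp, Rabs_mult, (Rabs_right 8) by lra. rewrite Rabs_mult.
  assert (Rabs e * Rabs fc <= E * E) by mono. nra.
Qed.

Lemma vv_super (h s : R) : 1001 <= s -> 0 < h <= 1 / 2 -> (s + h) * h ^ 2 <= 2 ->
 (1 + h ^ 2 * ef 1 bB s) * (sqrt (vv 1 bB h (s + h)) + sqrt (vv 1 bB h (s - h))) <= 2 * sqrt (vv 1 bB h s).
Proof. intros Hs Hh Hsh. assert (Hsg : Rabs 1 <= 1) by (rewrite Rabs_R1; lra).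
 destruct (vv_hyps 1 h s Hsg Hs Hh Hsh) as (Hp & Hm & Hc & HM & HD & HX & He).
 destruct (E_bounds s ltac:(lra)) as (HE & HEG & _). assert (Hef := ef_abs 1 s Hsg ltac:(lra)).
 apply (core_super s h _ _ _ _ _ (bB * (/ s) ^ 2)) with (5 := HEG) (4 := HE); try assumption; [lra|nra|].
 absle He. lra.
Qed.

Lemma vv_sub (h s : R) : 1001 <= s -> 0 < h <= 1 / 2 -> (s + h) * h ^ 2 <= 2 -> 2 * sqrt (vv (-1) bB h s) <=
 (1 + h ^ 2 * ef (-1) bB s) * (sqrt (vv (-1) bB h (s + h)) + sqrt (vv (-1) bB h (s - h))).
Proof. intros Hs Hh Hsh. assert (Hsg : Rabs (-1) <= 1) by (rewrite Rabs_left; lra).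
 destruct (vv_hyps (-1) h s Hsg Hs Hh Hsh) as (Hp & Hm & Hc & HM & HD & HX & He).
 destruct (E_bounds s ltac:(lra)) as (HE & HEG & HEs). assert (Hef := ef_abs (-1) s Hsg ltac:(lra)).
 apply (core_sub s h _ _ _ _ _ (bB * (/ s) ^ 2)) with (5 := HEG) (4 := HE); try assumption; [lra|nra| | |].
 - rewrite <- pow_inv. exact HEs.
 - absle Hef. split; [|lra]. unfold ef. assert (0 < (/ s) ^ 2) by pos. assert (0 < (/ s) ^ 3) by pos. unfold bB. lra.
 - absle He. lra.
Qed.

Lemma vv_pos (sg h s : R) : Rabs sg <= 1 -> 1000 <= s -> s * h ^ 2 <= 2 -> 0 < vv sg bB h s.
Proof. intros Hsg Hs Hsh. assert (H := uef_abs sg h s Hsg ltac:(lra) Hsh).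
 destruct (E_bounds s Hs) as (HE & _). absle H. unfold vv. lra.
Qed.

Lemma one_minus_vv (sg h s : R) : 1 - h ^ 2 * vv sg bB h s = uu h s * (1 + h ^ 2 * ef sg bB s).
Proof. unfold vv, uu. field. Qed.

Lemma one_plus_ef_pos (sg h s : R) : Rabs sg <= 1 -> 0 < h <= 1 / 100 -> 1000 <= s -> 0 < 1 + h ^ 2 * ef sg bB s.
Proof. intros Hsg Hh Hs. assert (H := ef_abs sg s Hsg ltac:(lra)). destruct (E_bounds s Hs) as (HE & _). absle H. nra.
Qed.

(** The crude bounds lie within [s / 2 - 3] and [s / 2 + 1 / 4], so a displacement of 4 puts the
    refined barriers on the correct side of them. *)
Lemma near_1000 (sg h s : R) : (sg = 1 \/ sg = -1) -> 0 < h <= 1 / 100 -> 1000 <= s <= 1002 ->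
 4 <= - sg * (uu h s * ef sg bB s).
Proof. intros Hsg Hh Hs. assert (9 / 10 <= uu h s <= 1) by (unfold uu; nra). assert (/ 1002 <= / s <= / 1000) by mono.
 set (w := / s) in *. assert ((/ 1002) ^ 3 <= w ^ 3) by mono. assert (H2 : w ^ 2 <= (/ 1000) ^ 2) by mono.
 assert (H2' := pow2_ge_0 w). assert (48 / 10 <= - sg * ef sg bB s).
 { unfold ef. fold w. unfold bB. destruct Hsg as [-> | ->]; lra. }
 replace (- sg * (uu h s * ef sg bB s)) with (uu h s * (- sg * ef sg bB s)) by ring. nra.
Qed.

Lemma uu_xk (h : R) (k : nat) : 0 < h -> uu h (- xk h (S k)) = INR (S k) * h ^ 3 / 2.
Proof. intros H. unfold uu, xk. field. lra. Qed.

Lemma ak_fine_upper (h : R) (k : nat) : 0 < h <= 1 / 100 -> 1000 <= - xk h k -> ak h k ^ 2 <= vv 1 bB h (- xk h k).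
Proof. intros Hh Hk. assert (Ht := th_pos h ltac:(lra)). assert (Hsg : Rabs 1 <= 1) by (rewrite Rabs_R1; lra).
 assert (Hsh : forall j, - xk h j * h ^ 2 <= 2). { intros j. assert (H := xk_lower h j ltac:(lra)). lra. }
 set (v := fun j => vv 1 bB h (- xk h j)).
 (* To the right of [x = -1000] the barrier is [r] itself and the comparison is trivial. On
    [1000 <= s <= 1002] the crude bound decides, so the supersolution inequality is invoked only
    where both neighbours are still in the range. *)
 set (U := fun j => if Rle_dec 1000 (- xk h j) then h * sqrt (v j) else rs j (th h)).
 assert (HUe : forall j, 1000 <= - xk h j -> U j = h * sqrt (v j)).
 { intros j Hj. unfold U. destruct (Rle_dec _ _); [mono|mono]. }
 assert (Hvp : forall j, 1000 <= - xk h j -> 0 < v j) by (intros; apply vv_pos; auto).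
 assert (HUp : forall j, 0 < U j). { intros j. unfold U. destruct (Rle_dec _ _) as [H|H]; [|apply rs_pos, Ht].
  apply Rmult_lt_0_compat; [lra|apply sqrt_lt_R0, Hvp, H]. }
 assert (HUsq : forall j, 1000 <= - xk h j -> U j ^ 2 = h ^ 2 * v j).
 { intros j Hj. rewrite HUe, Rpow_mult_distr, pow2_sqrt by (try apply Rlt_le, Hvp; assumption). reflexivity. }
 assert (Hmain : rs (0 + k) (th h) <= U k). { apply (compare_upper (th h) 0 U); [exact Ht|exact HUp| | |].
  (* At [k = 0] the factor [uu] vanishes, hence the barrier equals [r_0 = 1] exactly. *)
  - assert (E0 : - xk h 0 = 2 / h ^ 2) by (unfold xk; simpl INR; field; lra). assert (H1000 : 1000 <= - xk h 0).
   { rewrite E0. apply le_div_intro; nra. }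
   rewrite rs_0. assert (E1 : U O ^ 2 = 1).
   { rewrite HUsq by exact H1000. assert (H := one_minus_vv 1 h (- xk h 0)). fold (v O) in H.
    assert (Hu : uu h (- xk h 0) = 0) by (rewrite E0; unfold uu; field; lra). rewrite Hu in H. lra. }
   specialize (HUp O). nra.
  - destruct (nfloor_ex (2 / h ^ 2 / h)) as [K [_ HK]]. { mono. }
   exists (S K). intros j Hj. simpl Nat.add. unfold U. destruct (Rle_dec _ _) as [H|H]; [exfalso|lra].
   assert (INR K + 1 <= INR j) by (rewrite <- S_INR; apply le_INR; lia). assert (0 <= xk h j); [|lra]. unfold xk.
   replace (2 / h ^ 2) with (2 / h ^ 2 / h * h) by (field; lra). nra.
  - intros j. simpl Nat.add. destruct (Rle_dec 1000 (- xk h (S j))) as [H|H].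
   2:{ left. unfold U. destruct (Rle_dec _ _); [mono|lra]. }
   set (s := - xk h (S j)) in *. destruct (Rle_lt_dec s 1002) as [H2|H2].
   + left. rewrite HUe by exact H. rewrite rs_ak by lra. apply Rmult_le_compat_l; [lra|].
    assert (Hc := ak_upper h (S j) ltac:(lra)). assert (Ha := ak_pos h (S j) ltac:(lra)).
    assert (vup (xk h (S j)) <= v (S j)).
    { unfold v, vv. fold s. assert (Hn := near_1000 1 h s (or_introl eq_refl) Hh ltac:(lra)).
     unfold vup. replace (xk h (S j)) with (- s) by (unfold s; ring). assert (sqrt ((- s) ^ 2 + 2) <= s + 1); [|lra].
     rewrite <- (sqrt_pow2 (s + 1)) by lra. apply sqrt_le_1_alt. nra. }
    rewrite <- (sqrt_pow2 (ak h (S j))) by lra. apply sqrt_le_1_alt. lra.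
   + right. assert (Es1 : - xk h (S (S j)) = s - h) by (unfold s; rewrite (xk_S h (S j)); ring).
    assert (Es2 : - xk h j = s + h) by (unfold s; rewrite (xk_S h j); ring). assert (0 < uu h s).
    { unfold s. rewrite uu_xk by lra. assert (Hi := INR_S_pos j). assert (0 < h ^ 3) by pos. nra. }
    assert (He := one_plus_ef_pos 1 h s Hsg Hh H). assert (E1 := one_minus_vv 1 h s).
    assert (HU2 := HUsq (S j) H). unfold v in HU2. fold s in HU2. assert (HUlt : U (S j) < 1) by nra.
    split; [exact HUlt|]. rewrite kappa_xk, HU2, E1 by lra.
    replace (2 + xk h (S j) * h ^ 2) with (2 * uu h s) by (unfold uu, s; field).
    replace (2 * uu h s * (U (S j) / (uu h s * (1 + h ^ 2 * ef 1 bB s)))) with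
     (2 * U (S j) / (1 + h ^ 2 * ef 1 bB s)) by (field; lra). apply le_div_intro; [exact He|].
    rewrite !HUe by (rewrite ?Es1, ?Es2; fold s; lra). unfold v. rewrite Es1, Es2. fold s.
    assert (Hs := vv_super h s ltac:(lra) ltac:(lra)). assert (Hj := Hsh j). rewrite Es2 in Hj. specialize (Hs Hj).
    apply (Rmult_le_compat_l h) in Hs; [|lra]. lra. }
 simpl Nat.add in Hmain. rewrite HUe in Hmain by exact Hk. rewrite rs_ak in Hmain by lra.
 apply Rmult_le_reg_l in Hmain; [|lra]. fold (v k). rewrite <- (pow2_sqrt (v k)) by (left; apply Hvp, Hk).
 assert (Ha := ak_pos h k ltac:(lra)). apply pow_incr; lra.
Qed.

(** As [ak_fine_upper], with [sg = -1] and the crude lower bound [s / 2 - 3] on the gluing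
    window. *)
Lemma ak_fine_lower (h : R) (k : nat) : 0 < h <= 1 / 100 -> 1000 <= - xk h k -> vv (-1) bB h (- xk h k) <= ak h k ^ 2.
Proof. intros Hh Hk. assert (Ht := th_pos h ltac:(lra)). assert (Hsg : Rabs (-1) <= 1) by (rewrite Rabs_left; lra).
 assert (Hsh : forall j, - xk h j * h ^ 2 <= 2). { intros j. assert (H := xk_lower h j ltac:(lra)). lra. }
 set (v := fun j => vv (-1) bB h (- xk h j)).
 set (U := fun j => if Rle_dec 1000 (- xk h j) then h * sqrt (v j) else rs j (th h)).
 assert (HUe : forall j, 1000 <= - xk h j -> U j = h * sqrt (v j)).
 { intros j Hj. unfold U. destruct (Rle_dec _ _); [mono|mono]. }
 assert (Hvp : forall j, 1000 <= - xk h j -> 0 < v j) by (intros; apply vv_pos; auto).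
 assert (HUp : forall j, 0 < U j). { intros j. unfold U. destruct (Rle_dec _ _) as [H|H]; [|apply rs_pos, Ht].
  apply Rmult_lt_0_compat; [lra|apply sqrt_lt_R0, Hvp, H]. }
 assert (HUsq : forall j, 1000 <= - xk h j -> U j ^ 2 = h ^ 2 * v j).
 { intros j Hj. rewrite HUe, Rpow_mult_distr, pow2_sqrt by (try apply Rlt_le, Hvp; assumption). reflexivity. }
 assert (Hmain : U k <= rs (0 + k) (th h)). { apply (compare_lower (th h) 0 U); [exact Ht| | |].
  - assert (E0 : - xk h 0 = 2 / h ^ 2) by (unfold xk; simpl INR; field; lra). assert (H1000 : 1000 <= - xk h 0).
   { rewrite E0. apply le_div_intro; nra. }
   rewrite rs_0. assert (E1 : U O ^ 2 = 1).
   { rewrite HUsq by exact H1000. assert (H := one_minus_vv (-1) h (- xk h 0)). fold (v O) in H.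
    assert (Hu : uu h (- xk h 0) = 0) by (rewrite E0; unfold uu; field; lra). rewrite Hu in H. lra. }
   specialize (HUp O). nra.
  - destruct (nfloor_ex (2 / h ^ 2 / h)) as [K [_ HK]]. { mono. }
   exists (S K). intros j Hj. simpl Nat.add. unfold U. destruct (Rle_dec _ _) as [H|H]; [exfalso|lra].
   assert (INR K + 1 <= INR j) by (rewrite <- S_INR; apply le_INR; lia). assert (0 <= xk h j); [|lra]. unfold xk.
   replace (2 / h ^ 2) with (2 / h ^ 2 / h * h) by (field; lra). nra.
  - intros j. simpl Nat.add. destruct (Rle_dec 1000 (- xk h (S j))) as [H|H].
   2:{ left. unfold U. destruct (Rle_dec _ _); [mono|lra]. }
   set (s := - xk h (S j)) in *. destruct (Rle_lt_dec s 1002) as [H2|H2].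
   + left. rewrite HUe by exact H. rewrite rs_ak by lra. apply Rmult_le_compat_l; [lra|].
    assert (Hc := ak_lower h (S j) ltac:(lra)). assert (Ha := ak_pos h (S j) ltac:(lra)). fold s in Hc.
    assert (v (S j) <= s / 2 - 3).
    { unfold v, vv. fold s. assert (Hn := near_1000 (-1) h s (or_intror eq_refl) Hh ltac:(lra)). lra. }
    rewrite <- (sqrt_pow2 (ak h (S j))) by lra. apply sqrt_le_1_alt. lra.
   + right. assert (Es1 : - xk h (S (S j)) = s - h) by (unfold s; rewrite (xk_S h (S j)); ring).
    assert (Es2 : - xk h j = s + h) by (unfold s; rewrite (xk_S h j); ring). assert (0 < uu h s).
    { unfold s. rewrite uu_xk by lra. assert (Hi := INR_S_pos j). assert (0 < h ^ 3) by pos. nra. }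
    assert (He := one_plus_ef_pos (-1) h s Hsg Hh H). assert (E1 := one_minus_vv (-1) h s).
    assert (HU2 := HUsq (S j) H). unfold v in HU2. fold s in HU2. assert (HUlt : U (S j) < 1) by nra.
    split; [exact HUlt|]. rewrite kappa_xk, HU2, E1 by lra.
    replace (2 + xk h (S j) * h ^ 2) with (2 * uu h s) by (unfold uu, s; field).
    replace (2 * uu h s * (U (S j) / (uu h s * (1 + h ^ 2 * ef (-1) bB s)))) with
     (2 * U (S j) / (1 + h ^ 2 * ef (-1) bB s)) by (field; lra). apply div_le_intro; [exact He|].
    rewrite !HUe by (rewrite ?Es1, ?Es2; fold s; lra). unfold v. rewrite Es1, Es2. fold s.
    assert (Hs := vv_sub h s ltac:(lra) ltac:(lra)). assert (Hj := Hsh j). rewrite Es2 in Hj. specialize (Hs Hj).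
    apply (Rmult_le_compat_l h) in Hs; [|lra]. lra. }
 simpl Nat.add in Hmain. rewrite HUe in Hmain by exact Hk. rewrite rs_ak in Hmain by lra.
 apply Rmult_le_reg_l in Hmain; [|lra]. fold (v k). rewrite <- (pow2_sqrt (v k)) by (left; apply Hvp, Hk).
 assert (Hq := sqrt_pos (v k)). apply pow_incr; lra.
Qed.

(** * Bessel integrals and the Airy function *)

Definition bint (k : nat) (t th : R) : R := cos (INR k * th - 2 * t * sin th).

(* [bj k t] is the Bessel function value [J_k (2 t)]. *)
Definition bj (k : nat) (t : R) : R := / PI * RInt (bint k t) 0 PI.

Lemma ex_RInt_derivable (f : R -> R) (a b : R) : (forall x, ex_derive f x) -> ex_RInt f a b.
Proof. intros H. apply (ex_RInt_continuous (V := R_CompleteNormedModule)).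
 intros z _. apply (ex_derive_continuous f z), H.
Qed.

Lemma bint_ex_derive (k : nat) (t th : R) : ex_derive (bint k t) th.
Proof. unfold bint. auto_derive. exact I. Qed.

Lemma bint_ex_RInt (k : nat) (t : R) : ex_RInt (bint k t) 0 PI.
Proof. apply ex_RInt_derivable, bint_ex_derive. Qed.

Lemma sin_INR_PI (k : nat) : sin (INR k * PI) = 0.
Proof. induction k as [|k IH]; [simpl; rewrite Rmult_0_l; apply sin_0|].
 rewrite S_INR, Rmult_plus_distr_r, Rmult_1_l, neg_sin, IH. ring.
Qed.

(** The derivative in [theta] of [sin ((k+1) theta - 2 t sin theta)] integrates to 0 over [[0, PI]];
    the addition formula turns this into the three-term recurrence. *)
Lemma bj_rec (k : nat) (t : R) : 0 < t -> bj (S (S k)) t + bj k t = INR (S k) / t * bj (S k) t.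
Proof. intros Ht. assert (H1 : is_RInt (fun th => (INR (S k) - 2 * t * cos th) * bint (S k) t th) 0 PI 0).
 { set (F := fun th => sin (INR (S k) * th - 2 * t * sin th)). replace 0 with (F PI - F 0) at 2.
  - apply (is_RInt_derive F).
   + intros x _. unfold F, bint. generalize (INR (S k)); intros c. auto_derive; [exact I|]. unfold Rminus. ring.
   + intros x _. apply (ex_derive_continuous (fun th => (INR (S k) - 2 * t * cos th) * bint (S k) t th)).
    unfold bint. generalize (INR (S k)); intros c. auto_derive. exact I.
  - unfold F. rewrite sin_0, sin_PI, Rmult_0_r, !Rmult_0_r, !Rminus_0_r, sin_0, sin_INR_PI. ring. }
 assert (H2 : is_RInt (fun th => bint (S (S k)) t th + bint k t th) 0 PI
  (RInt (bint (S (S k)) t) 0 PI + RInt (bint k t) 0 PI)).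
 { apply (is_RInt_plus (V := R_NormedModule)); apply (RInt_correct (V := R_CompleteNormedModule));
  apply bint_ex_RInt. }
 assert (H3 : is_RInt (fun th => INR (S k) / t * bint (S k) t th - / t * ((INR (S k) - 2 * t * cos th) * bint (S k) t th)) 0 PI
  (INR (S k) / t * RInt (bint (S k) t) 0 PI - / t * 0)).
 { apply (is_RInt_minus (V := R_NormedModule)); apply (is_RInt_scal (V := R_NormedModule)); [|exact H1].
  apply (RInt_correct (V := R_CompleteNormedModule)), bint_ex_RInt. }
 assert (H4 : RInt (bint (S (S k)) t) 0 PI + RInt (bint k t) 0 PI
  = INR (S k) / t * RInt (bint (S k) t) 0 PI - / t * 0).
 { rewrite <- (is_RInt_unique _ _ _ _ H2), <- (is_RInt_unique _ _ _ _ H3).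
  apply RInt_ext. intros x _. unfold bint. rewrite !S_INR.
  replace ((INR k + 1 + 1) * x - 2 * t * sin x) with (((INR k + 1) * x - 2 * t * sin x) + x) by ring.
  replace (INR k * x - 2 * t * sin x) with (((INR k + 1) * x - 2 * t * sin x) - x) by ring.
  set (p := (INR k + 1) * x - 2 * t * sin x). rewrite (cos_plus p x), (cos_minus p x).
  change (cos p * cos x - sin p * sin x + (cos p * cos x + sin p * sin x) =
   (INR k + 1) / t * cos p - / t * ((INR k + 1 - 2 * t * cos x) * cos p) :> R). field. lra. }
 unfold bj. replace (INR (S k) / t * (/ PI * RInt (bint (S k) t) 0 PI)) with
  (/ PI * (INR (S k) / t * RInt (bint (S k) t) 0 PI - / t * 0)) by ring. rewrite <- H4. ring.
Qed.

Lemma bj_flow (k : nat) (t : R) : is_derive (bj (S k)) t (bj k t - bj (S (S k)) t).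
Proof. unfold bj. replace (/ PI * RInt (bint k t) 0 PI - / PI * RInt (bint (S (S k)) t) 0 PI) with
  (/ PI * (RInt (bint k t) 0 PI - RInt (bint (S (S k)) t) 0 PI)) by ring.
 apply (is_derive_scal (fun u => RInt (bint (S k) u) 0 PI)).
 assert (HD : forall u th, is_derive (fun z => bint (S k) z th) u
  (2 * sin th * sin (INR (S k) * th - 2 * u * sin th))).
 { intros u th. unfold bint. generalize (INR (S k)); intros c. auto_derive; [exact I|]. unfold Rminus. ring. }
 replace (RInt (bint k t) 0 PI - RInt (bint (S (S k)) t) 0 PI) with
  (RInt (fun th => Derive (fun u => bint (S k) u th) t) 0 PI).
 - apply (is_derive_RInt_param (bint (S k)) 0 PI t).
  + exists (mkposreal 1 Rlt_0_1). intros y _ th _. eexists. apply HD.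
  + intros th _. apply (continuity_2d_pt_ext (fun u v => 2 * sin v * sin (INR (S k) * v - 2 * u * sin v))).
   { intros u v. symmetry. apply is_derive_unique, HD. }
   assert (Hs : continuity_2d_pt (fun _ v => sin v) t th).
   { apply (continuity_1d_2d_pt_comp sin (fun _ v => v)); [apply continuity_sin|apply continuity_2d_pt_id2]. }
   apply continuity_2d_pt_mult.
   * apply continuity_2d_pt_mult; [apply continuity_2d_pt_const|exact Hs].
   * apply (continuity_1d_2d_pt_comp sin (fun u v => INR (S k) * v - 2 * u * sin v)); [apply continuity_sin|].
    apply continuity_2d_pt_minus; apply continuity_2d_pt_mult.
    -- apply continuity_2d_pt_const.
    -- apply continuity_2d_pt_id2.
    -- apply continuity_2d_pt_mult; [apply continuity_2d_pt_const|apply continuity_2d_pt_id1].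
    -- exact Hs.
  + exists (mkposreal 1 Rlt_0_1). intros y _. apply bint_ex_RInt.
 - rewrite <- (RInt_minus (V := R_CompleteNormedModule)) by apply bint_ex_RInt.
  apply RInt_ext. intros x _. etransitivity; [apply is_derive_unique, HD|]. unfold bint. rewrite !S_INR.
  replace ((INR k + 1 + 1) * x - 2 * t * sin x) with (((INR k + 1) * x - 2 * t * sin x) + x) by ring.
  replace (INR k * x - 2 * t * sin x) with (((INR k + 1) * x - 2 * t * sin x) - x) by ring.
  set (p := (INR k + 1) * x - 2 * t * sin x). rewrite (cos_plus p x), (cos_minus p x).
  change (2 * sin x * sin p = (cos p * cos x + sin p * sin x) - (cos p * cos x - sin p * sin x) :> R). ring.
Qed.

Lemma RInt_bounds (f : R -> R) (a b m M : R) : a <= b -> ex_RInt f a b ->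
 (forall x, a < x < b -> m <= f x <= M) -> m * (b - a) <= RInt f a b <= M * (b - a).
Proof. intros Hab Hf H. split.
 - replace (m * (b - a)) with (RInt (fun _ => m) a b) by (rewrite RInt_const; apply Rmult_comm).
  apply RInt_le; [exact Hab|apply ex_RInt_const|exact Hf|]. intros x Hx; apply H, Hx.
 - replace (M * (b - a)) with (RInt (fun _ => M) a b) by (rewrite RInt_const; apply Rmult_comm).
  apply RInt_le; [exact Hab|exact Hf|apply ex_RInt_const|]. intros x Hx; apply H, Hx.
Qed.

Lemma bj_abs (k : nat) (t : R) : Rabs (bj k t) <= 1.
Proof. unfold bj. assert (HPI := PI_RGT_0).
 assert (H := RInt_bounds (bint k t) 0 PI (-1) 1 ltac:(lra) (bint_ex_RInt k t)).
 assert (-1 * (PI - 0) <= RInt (bint k t) 0 PI <= 1 * (PI - 0)). { apply H. intros x _. apply COS_bound. }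
 apply Rabs_le. split.
 - apply (Rmult_le_reg_l PI); [lra|]. rewrite <- Rmult_assoc, Rinv_r by lra. lra.
 - apply (Rmult_le_reg_l PI); [lra|]. rewrite <- Rmult_assoc, Rinv_r by lra. lra.
Qed.

Lemma bj_0_lower (t : R) : 1 - 2 * t ^ 2 <= bj 0 t.
Proof. unfold bj. assert (HPI := PI_RGT_0).
 assert (H := RInt_bounds (bint 0 t) 0 PI (1 - 2 * t ^ 2) 1 ltac:(lra) (bint_ex_RInt 0 t)).
 assert ((1 - 2 * t ^ 2) * (PI - 0) <= RInt (bint 0 t) 0 PI). { apply H. intros x _. split; [|apply COS_bound].
  unfold bint. simpl INR. rewrite Rmult_0_l. replace (cos (0 - 2 * t * sin x)) with (cos (Rabs (2 * t * sin x))).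
  - eapply Rle_trans; [|apply cos_lower, Rabs_pos].
   rewrite pow2_abs. assert (Hs := SIN_bound x). assert (sin x ^ 2 <= 1) by nra. nra.
  - unfold Rabs. destruct (Rcase_abs _); [|rewrite <- cos_neg]; f_equal; ring. }
 apply (Rmult_le_reg_l PI); [lra|]. rewrite <- Rmult_assoc, Rinv_r by lra. lra.
Qed.

(** The integrating factor already used for [r]; the two equations differ only by the factor
    [1 - r ^ 2], which is why both sequences share the leading behaviour [t ^ k / k!]. *)
Lemma pow_bj_derive (k : nat) (t : R) : 0 < t -> is_derive (fun s => s ^ S k * bj (S k) s) t (2 * t ^ S k * bj k t).
Proof. intros Ht. replace (2 * t ^ S k * bj k t) with
  ((1 * (INR (S k) * t ^ k)) * bj (S k) t + t ^ S k * (bj k t - bj (S (S k)) t)).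
 - apply is_derive_multR; [|apply bj_flow].
  apply (is_derive_ext (fun s => 1 * s ^ S k)); [intros; apply Rmult_1_l|apply is_derive_powR].
 - assert (H := bj_rec k t Ht). replace (bj (S (S k)) t) with (INR (S k) / t * bj (S k) t - bj k t) by lra.
  simpl (t ^ S k). field. lra.
Qed.

Lemma pow_bj_small (k : nat) (s : R) : 0 < s <= 1 -> Rabs (s ^ S k * bj (S k) s) <= s.
Proof. intros Hs. rewrite Rabs_mult. assert (H := bj_abs (S k) s). assert (0 < s ^ k) by pos.
 assert (s ^ k <= 1) by (rewrite <- (pow1 k); apply pow_incr; lra). simpl (s ^ S k). rewrite Rabs_right by nra.
 assert (0 <= s * s ^ k) by nra. nra.
Qed.

Lemma pow_le_self (k : nat) (s : R) : 0 < s <= 1 -> 0 < s ^ S k <= s.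
Proof. intros Hs. assert (0 < s ^ k) by pos. assert (s ^ k <= 1) by (rewrite <- (pow1 k); apply pow_incr; lra).
 simpl. nra.
Qed.

Lemma div_fact_small (s : R) (k m : nat) : 0 < s <= 1 -> 0 < s ^ S k / INR (fact m) <= s.
Proof. intros Hs. assert (H := pow_le_self k s Hs). assert (1 <= INR (fact m)) by (apply (le_INR 1), lt_O_fact).
 split; [pos|]. apply div_le_intro; nra.
Qed.

Lemma bj_le_fact (k : nat) (t : R) : 0 < t -> bj k t <= t ^ k / INR (fact k).
Proof. revert t. induction k as [|k IH]; intros t Ht.
 - simpl. replace (1 / 1) with 1 by field. assert (H := bj_abs 0 t). absle H. lra.
 - assert (Hf := fact_pos k). assert (HS := INR_S_pos k).
  assert (H : 0 <= / INR (fact (S k)) * t ^ S (k + S k) - t ^ S k * bj (S k) t).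
  { apply (nonneg_from_zero (fun s => / INR (fact (S k)) * s ^ S (k + S k) - s ^ S k * bj (S k) s)
   (fun s => / INR (fact (S k)) * (INR (S (k + S k)) * s ^ (k + S k)) - 2 * s ^ S k * bj k s) 2 1); [exact Ht|lra| | |].
   - intros s Hs. apply is_derive_minusR; [apply is_derive_powR|apply pow_bj_derive; lra].
   - intros s Hs. assert (Hi := IH s ltac:(lra)). assert (Hp : 0 < s ^ S k) by pos.
    replace (/ INR (fact (S k)) * (INR (S (k + S k)) * s ^ (k + S k))) with (2 * s ^ S k * (s ^ k / INR (fact k))).
    + assert (2 * s ^ S k * bj k s <= 2 * s ^ S k * (s ^ k / INR (fact k))); [|lra]. mono.
    + rewrite fact_succ, pow_add. replace (INR (S (k + S k))) with (2 * INR (S k)); [field; lra|].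
     rewrite (S_INR (k + S k)), plus_INR, !S_INR. ring.
   - intros s Hs _. replace (/ INR (fact (S k)) * s ^ S (k + S k)) with (s ^ S (k + S k) / INR (fact (S k))) by mono.
    assert (H1 := div_fact_small s (k + S k) (S k) Hs). assert (H2 := pow_bj_small k s Hs).
    absle H2. apply Rabs_le; lra. }
  assert (Hp : 0 < t ^ S k) by pos. apply (Rmult_le_reg_l (t ^ S k)); [exact Hp|].
  replace (t ^ S (k + S k)) with (t ^ S k * t ^ S k) in H by (rewrite <- pow_add; f_equal; lia). mono.
Qed.

Lemma bj_ge_fact (k : nat) (t : R) : 0 < t -> t ^ k / INR (fact k) * (1 - 2 * t ^ 2 / INR (S k)) <= bj k t.
Proof. revert t. induction k as [|k IH]; intros t Ht.
 - simpl INR. simpl (t ^ 0). assert (H := bj_0_lower t). simpl (fact 0). simpl INR.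
  replace (1 / 1 * (1 - 2 * t ^ 2 / 1)) with (1 - 2 * t ^ 2) by field. exact H.
 - assert (Hf := fact_pos k). assert (HS := INR_S_pos k). assert (HS2 := INR_S_pos (S k)).
  set (c := 2 / (INR (S (S k)) * INR (fact (S k)))).
  assert (H : 0 <= t ^ S k * bj (S k) t - (/ INR (fact (S k)) * t ^ S (k + S k) - c * t ^ S (S (S (k + S k))))).
  { apply (nonneg_from_zero (fun s => s ^ S k * bj (S k) s - (/ INR (fact (S k)) * s ^ S (k + S k) - c * s ^ S (S (S (k + S k)))))
   (fun s => 2 * s ^ S k * bj k s - (/ INR (fact (S k)) * (INR (S (k + S k)) * s ^ (k + S k)) -
     c * (INR (S (S (S (k + S k)))) * s ^ (S (S (k + S k)))))) (2 + c) 1); [exact Ht|lra| | |].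
   - intros s Hs. apply is_derive_minusR; [apply pow_bj_derive; lra|]. apply is_derive_minusR; apply is_derive_powR.
   - intros s Hs. assert (Hi := IH s ltac:(lra)). assert (Hp : 0 < s ^ S k) by pos.
    replace (/ INR (fact (S k)) * (INR (S (k + S k)) * s ^ (k + S k)) -
     c * (INR (S (S (S (k + S k)))) * s ^ (S (S (k + S k))))) with
     (2 * s ^ S k * (s ^ k / INR (fact k) * (1 - 2 * s ^ 2 / INR (S k)))).
    + assert (2 * s ^ S k * (s ^ k / INR (fact k) * (1 - 2 * s ^ 2 / INR (S k))) <= 2 * s ^ S k * bj k s); [|lra].
     mono.
    + unfold c. rewrite fact_succ. replace (s ^ S (S (k + S k))) with (s ^ S k * s ^ k * s ^ 2)
      by (rewrite <- !pow_add; f_equal; lia). rewrite pow_add. replace (INR (S (k + S k))) with (2 * INR (S k))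
      by (rewrite (S_INR (k + S k)), plus_INR, !S_INR; ring).
     replace (INR (S (S (S (k + S k))))) with (2 * INR (S (S k)))
      by (rewrite (S_INR (S (S (k + S k)))), (S_INR (S (k + S k))), (S_INR (k + S k)), plus_INR, !S_INR; ring).
     field. lra.
   - intros s Hs _. replace (/ INR (fact (S k)) * s ^ S (k + S k)) with (s ^ S (k + S k) / INR (fact (S k))) by mono.
    assert (H1 := div_fact_small s (k + S k) (S k) Hs). assert (H2 := pow_bj_small k s Hs).
    assert (H3 := pow_le_self (S (S (k + S k))) s Hs). assert (0 < c).
    { apply Rdiv_lt_0_compat; [lra|]. apply Rmult_lt_0_compat; [exact HS2|apply fact_pos]. }
    assert (0 < c * s ^ S (S (S (k + S k))) <= c * s) by mono. absle H2. apply Rabs_le; lra. }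
  assert (Hp : 0 < t ^ S k) by pos. apply (Rmult_le_reg_l (t ^ S k)); [exact Hp|].
  replace (t ^ S (k + S k)) with (t ^ S k * t ^ S k) in H by (rewrite <- pow_add; f_equal; lia).
  replace (t ^ S (S (S (k + S k)))) with (t ^ S k * t ^ S k * t ^ 2) in H by (rewrite <- !pow_add; f_equal; lia).
  replace (t ^ S k * (t ^ S k / INR (fact (S k)) * (1 - 2 * t ^ 2 / INR (S (S k))))) with
   (/ INR (fact (S k)) * (t ^ S k * t ^ S k) - c * (t ^ S k * t ^ S k * t ^ 2)); [lra|].
  unfold c. assert (Hf' := fact_pos (S k)). field. lra.
Qed.

(* For the lower bound [r_n >= t^n / n! (1 - O(1 / n))]. *)
Fixpoint lossS (T : R) (n : nat) : R := match n with O => 0 | S m => lossS T m + T ^ (2 * m) / INR (fact m) end.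

Lemma lossS_le (T : R) (n : nat) : lossS T n <= exp (T ^ 2).
Proof. set (u := fun m => / INR (fact m) * (T ^ 2) ^ m). assert (Hu : forall m, 0 <= u m).
 { intros m. apply Rmult_le_pos; [left; apply Rinv_0_lt_compat, fact_pos|pos]. }
 assert (Hlim : is_lim_seq (sum_n u) (exp (T ^ 2))). { exact (proj1 (is_pseries_R _ _ _) (is_exp_Reals (T ^ 2))). }
 destruct n as [|n]; [left; apply exp_pos|]. replace (lossS T (S n)) with (sum_n u n).
 - apply (is_lim_seq_incr_compare (sum_n u)); [exact Hlim|].
  intros m. rewrite sum_Sn. assert (H := Hu (S m)). change (sum_n u m <= sum_n u m + u (S m)). lra.
 - induction n as [|n IH].
  + rewrite sum_O. unfold u. simpl. field.
  + rewrite sum_Sn, IH. change (lossS T (S (S n))) with (lossS T (S n) + T ^ (2 * S n) / INR (fact (S n))).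
   rewrite pow_mult. unfold u, Rdiv. rewrite (Rmult_comm ((T ^ 2) ^ S n)). reflexivity.
Qed.

(** As for [bj_ge_fact], but each step also loses the factor [1 - r ^ 2]. These losses add up to
    [lossS], bounded by [exp (T ^ 2)], so after division by [n + 1] they vanish in the limit. *)
Lemma rs_ge_fact (T : R) (n : nat) (t : R) : 0 < t <= T ->
 t ^ n / INR (fact n) * (1 - t ^ 2 * (lossS T n / INR (S n))) <= rs n t.
Proof. revert t. induction n as [|n IH]; intros t Ht.
 - simpl. rewrite rs_0. right; field.
 - assert (Hf := fact_pos n). assert (HS := INR_S_pos n). assert (HS2 := INR_S_pos (S n)).
  assert (Hf' := fact_pos (S n)). assert (HfE := fact_succ n). set (d := T ^ (2 * n) / INR (fact n)).
  set (c := lossS T (S n) / (INR (S (S n)) * INR (fact (S n)))). assert (Hd : 0 <= d).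
  { apply Rdiv_le_0_compat; [pos|exact Hf]. }
  assert (Hl : forall m, 0 <= lossS T m). { induction m as [|m Hm]; [simpl; lra|]. simpl.
   assert (0 <= T ^ (m + (m + 0)) / INR (fact m)); [|lra]. apply Rdiv_le_0_compat; [pos|apply fact_pos]. }
  assert (H : 0 <= t ^ S n * rs (S n) t - (/ INR (fact (S n)) * t ^ S (n + S n) - c * t ^ S (S (S (n + S n))))).
  { apply (nonneg_from_zero (fun s => s ^ S n * rs (S n) s - (/ INR (fact (S n)) * s ^ S (n + S n) - c * s ^ S (S (S (n + S n)))))
   (fun s => 2 * s ^ S n * rs n s * (1 - rs (S n) s ^ 2) - (/ INR (fact (S n)) * (INR (S (n + S n)) * s ^ (n + S n)) -
     c * (INR (S (S (S (n + S n)))) * s ^ (S (S (n + S n)))))) (2 + c) 1); [lra|lra| | |].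
   - intros s Hs. apply is_derive_minusR; [|apply is_derive_minusR; apply is_derive_powR].
    replace (2 * s ^ S n * rs n s * (1 - rs (S n) s ^ 2)) with
     ((1 * (INR (S n) * s ^ n)) * rs (S n) s + s ^ S n * (2 * rs n s * (1 - rs (S n) s ^ 2) - INR (S n) / s * rs (S n) s))
     by (simpl (s ^ S n); field; lra). apply is_derive_multR; [|apply rs_riccati; lra].
    apply (is_derive_ext (fun s => 1 * s ^ S n)); [intros; apply Rmult_1_l|apply is_derive_powR].
   - intros s Hs. assert (Hi := IH s ltac:(lra)). assert (Hp : 0 < s ^ S n) by pos.
    assert (Hup := rs_le_fact n s ltac:(lra)). assert (Hup' := rs_le_fact (S n) s ltac:(lra)).
    assert (Hr0 := rs_pos n s ltac:(lra)). assert (Hr1 := rs_pos (S n) s ltac:(lra)).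
    set (A := s ^ n / INR (fact n)) in *. replace (/ INR (fact (S n)) * (INR (S (n + S n)) * s ^ (n + S n)) -
     c * (INR (S (S (S (n + S n)))) * s ^ (S (S (n + S n))))) with
     (2 * s ^ S n * (A * (1 - s ^ 2 * (lossS T (S n) / INR (S n))))).
    2:{ unfold c, A. rewrite HfE. replace (s ^ S (S (n + S n))) with (s ^ S n * s ^ n * s ^ 2)
      by (rewrite <- !pow_add; f_equal; lia). rewrite pow_add. replace (INR (S (n + S n))) with (2 * INR (S n))
      by (rewrite (S_INR (n + S n)), plus_INR, !S_INR; ring).
     replace (INR (S (S (S (n + S n))))) with (2 * INR (S (S n)))
      by (rewrite (S_INR (S (S (n + S n)))), (S_INR (S (n + S n))), (S_INR (n + S n)), plus_INR, !S_INR; ring).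
     field. lra. }
    assert (Hsq : rs (S n) s ^ 2 <= s ^ 2 * (d / INR (S n))).
    { assert (Hn1 : 1 <= INR (S n)) by (rewrite S_INR; assert (H0 := pos_INR n); lra).
     apply Rle_trans with ((s ^ S n / INR (fact (S n))) ^ 2); [mono|]. rewrite HfE. unfold d.
     replace ((s ^ S n / (INR (S n) * INR (fact n))) ^ 2) with (s ^ 2 * (s ^ (2 * n) / INR (fact n) / INR (S n) * / (INR (S n) * INR (fact n)))).
     - apply Rmult_le_compat_l; [mono|]. assert (Hsn : s ^ (2 * n) <= T ^ (2 * n)) by mono.
      assert (Hs0 : 0 < s ^ (2 * n)) by pos. assert (Hff : 1 <= INR (fact n)) by (apply (le_INR 1), lt_O_fact).
      assert (/ (INR (S n) * INR (fact n)) <= 1). { rewrite <- Rinv_1. apply Rinv_le_contravar; nra. }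
      apply Rle_trans with (s ^ (2 * n) / INR (fact n) / INR (S n) * 1).
      + mono.
      + rewrite Rmult_1_r. unfold Rdiv. mono.
     - replace (s ^ S n) with (s * s ^ n) by reflexivity. replace (2 * n)%nat with (n + n)%nat by lia.
      rewrite pow_add. field. lra. }
    assert (Hls : lossS T (S n) = lossS T n + d) by reflexivity.
    assert (Hprod : A * (1 - s ^ 2 * (lossS T (S n) / INR (S n))) <= rs n s * (1 - rs (S n) s ^ 2)).
    { rewrite Hls. replace ((lossS T n + d) / INR (S n)) with (lossS T n / INR (S n) + d / INR (S n)) by mono.
     set (y := s ^ 2 * (lossS T n / INR (S n))) in *. set (z := s ^ 2 * (d / INR (S n))) in *.
     assert (rs n s * rs (S n) s ^ 2 <= A * z) by mono.
     replace (s ^ 2 * (lossS T n / INR (S n) + d / INR (S n))) with (y + z) by (unfold y, z; ring). lra. }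
    assert (2 * s ^ S n * (A * (1 - s ^ 2 * (lossS T (S n) / INR (S n)))) <= 2 * s ^ S n * (rs n s * (1 - rs (S n) s ^ 2))).
    { mono. }
    lra.
   - intros s Hs _. replace (/ INR (fact (S n)) * s ^ S (n + S n)) with (s ^ S (n + S n) / INR (fact (S n))) by mono.
    assert (H1 := div_fact_small s (n + S n) (S n) Hs).
    assert (H3 := pow_le_self (S (S (n + S n))) s Hs). assert (H4 := pow_le_self n s Hs).
    assert (H5 := rs_pos (S n) s ltac:(lra)). assert (H6 := rs_lt_1 n s ltac:(lra)). assert (Hc : 0 <= c).
    { apply Rdiv_le_0_compat; [apply Hl|]. mono. }
    assert (0 <= c * s ^ S (S (S (n + S n))) <= c * s) by mono.
    assert (0 < s ^ S n * rs (S n) s <= s) by (split; nra). apply Rabs_le; lra. }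
  assert (Hp : 0 < t ^ S n) by pos. apply (Rmult_le_reg_l (t ^ S n)); [exact Hp|].
  replace (t ^ S (n + S n)) with (t ^ S n * t ^ S n) in H by (rewrite <- pow_add; f_equal; lia).
  replace (t ^ S (S (S (n + S n)))) with (t ^ S n * t ^ S n * t ^ 2) in H by (rewrite <- !pow_add; f_equal; lia).
  replace (t ^ S n * (t ^ S n / INR (fact (S n)) * (1 - t ^ 2 * (lossS T (S n) / INR (S (S n)))))) with
   (/ INR (fact (S n)) * (t ^ S n * t ^ S n) - c * (t ^ S n * t ^ S n * t ^ 2)); [lra|]. unfold c. field. lra.
Qed.

Lemma inv_INR_eventually (c e : R) : 0 <= c -> 0 < e -> exists K, forall k, (K <= k)%nat -> c / INR (S k) <= e.
Proof. intros Hc He. destruct (nfloor_ex (c / e)) as [K [_ HK]]; [mono|].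
 exists K. intros k Hk. apply div_le_intro; [apply INR_S_pos|].
 assert (INR K <= INR k) by (apply le_INR; lia). rewrite S_INR.
 replace c with (e * (c / e)) at 1 by (field; lra). mono.
Qed.

Lemma bj_tau_eventually (t e : R) : 0 < t -> 0 < e ->
 exists K, forall k, (K <= k)%nat -> tau t k * (1 - e) <= bj k t <= tau t k.
Proof. intros Ht He. destruct (inv_INR_eventually (2 * t ^ 2) e) as [K HK]; [nra|exact He|].
 exists K. intros k Hk. split; [|apply bj_le_fact, Ht].
 eapply Rle_trans; [|apply bj_ge_fact, Ht]. specialize (HK k Hk).
 apply Rmult_le_compat_l; [left; apply tau_pos, Ht|lra].
Qed.

Lemma rs_tau_eventually (t e : R) : 0 < t -> 0 < e ->
 exists K, forall k, (K <= k)%nat -> tau t k * (1 - e) <= rs k t <= tau t k.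
Proof. intros Ht He. assert (Hexp := exp_pos (t ^ 2)).
 destruct (inv_INR_eventually (t ^ 2 * exp (t ^ 2)) e) as [K HK]; [nra|exact He|].
 exists K. intros k Hk. split; [|apply rs_le_fact, Ht].
 eapply Rle_trans; [|apply (rs_ge_fact t); lra]. specialize (HK k Hk).
 apply Rmult_le_compat_l; [left; apply tau_pos, Ht|].
 assert (t ^ 2 * (lossS t k / INR (S k)) <= t ^ 2 * exp (t ^ 2) / INR (S k)); [|lra].
 unfold Rdiv. rewrite <- Rmult_assoc. apply Rmult_le_compat_r; [left; apply Rinv_0_lt_compat, INR_S_pos|].
 apply Rmult_le_compat_l; [mono|apply lossS_le].
Qed.

Lemma bj_lim (t : R) : 0 < t -> is_lim_seq (fun k => bj k t) 0.
Proof. intros Ht. destruct (bj_tau_eventually t 1 Ht ltac:(lra)) as [K HK].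
 apply (is_lim_seq_incr_n _ K). apply (squeeze_0 _ (fun k => tau t (k + K))).
 - intros n. specialize (HK (n + K)%nat ltac:(lia)). lra.
 - apply (is_lim_seq_incr_n (tau t) K), tau_lim.
Qed.

(** Past [k = 2 t] the recurrence makes the sequence convex wherever it is nonnegative. Positivity
    and decrease are known far out, from the factorial bounds and the limit 0, and are carried down
    to [k] one index at a time. *)
Lemma bj_mono (k : nat) (t : R) : 0 < t -> 2 * t <= INR k -> 0 < bj k t /\ bj (S k) t <= bj k t.
Proof. intros Ht Hk. assert (Hstep : forall m, 2 * t <= INR m -> 0 <= bj (S m) t ->
  bj (S m) t - bj (S (S m)) t <= bj m t - bj (S m) t). { intros m Hm Hb. assert (Hrec := bj_rec m t Ht).
  assert (2 <= INR (S m) / t) by (apply le_div_intro; [exact Ht|]; rewrite S_INR; lra). nra. }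
 destruct (bj_tau_eventually t (1 / 2) Ht ltac:(lra)) as [K HK]. assert (Hpos : forall m, (K <= m)%nat -> 0 < bj m t).
 { intros m Hm. specialize (HK m Hm). assert (H := tau_pos t m Ht). lra. }
 assert (Hfar : forall m, (K <= m)%nat -> 2 * t <= INR m -> 0 < bj m t /\ bj (S m) t <= bj m t).
 { intros m Hm Hm2. split; [apply Hpos, Hm|]. assert (H : 0 <= bj (0 + m) t - bj (S (0 + m)) t); [|simpl in H; lra].
  apply (is_lim_seq_decr_compare (fun i => bj (i + m) t - bj (S (i + m)) t) 0).
  - replace (Finite 0) with (Finite (0 - 0)) by (f_equal; ring). apply is_lim_seq_minus'.
   + apply (is_lim_seq_incr_n (fun n => bj n t)), bj_lim, Ht.
   + apply (is_lim_seq_incr_n (fun n => bj (S n) t)), (is_lim_seq_incr_1 (fun n => bj n t)), bj_lim, Ht.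
  - intros i. simpl (S i + m)%nat. apply Hstep.
   + rewrite plus_INR. assert (H := pos_INR i). lra.
   + left; apply Hpos; lia. }
 assert (Hdown : forall i m, (m + i = k + K)%nat -> (k <= m)%nat -> 0 < bj m t /\ bj (S m) t <= bj m t).
 { induction i as [|i IH]; intros m Hm Hkm; assert (INR k <= INR m) by (apply le_INR, Hkm).
  - apply Hfar; [lia|lra].
  - destruct (IH (S m) ltac:(lia) ltac:(lia)) as [H1 H2]. assert (H3 := Hstep m ltac:(lra) ltac:(lra)). lra. }
 apply (Hdown K k); lia.
Qed.

Lemma bj_antitone (n m : nat) (t : R) : 0 < t -> 2 * t <= INR n -> (n <= m)%nat -> bj m t <= bj n t.
Proof. intros Ht Hn H. induction H as [|m H IH]; [lra|]. assert (INR n <= INR m) by (apply le_INR, H).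
 destruct (bj_mono m t Ht ltac:(lra)). lra.
Qed.

(** * The ratio of the discrete solution to the Bessel functions *)

Definition rho (k : nat) (t : R) : R := rs k t / bj k t.

(** Both sequences are [t ^ k / k!] up to a factor tending to 1. *)
Lemma rho_lim (t : R) : 0 < t -> is_lim_seq (fun k => rho k t) 1.
Proof. intros Ht. apply is_lim_seq_Reals. intros e He. set (d := Rmin (e / 4) (1 / 2)). assert (0 < d <= 1 / 2).
 { unfold d; split; [apply Rmin_glb_lt; lra|apply Rmin_r]. }
 assert (d <= e / 4) by apply Rmin_l. destruct (bj_tau_eventually t d Ht ltac:(lra)) as [K1 HK1].
 destruct (rs_tau_eventually t d Ht ltac:(lra)) as [K2 HK2].
 exists (max K1 K2). intros k Hk. specialize (HK1 k ltac:(lia)). specialize (HK2 k ltac:(lia)).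
 assert (Htau := tau_pos t k Ht). unfold Rdist, rho. assert (Hb : 0 < bj k t) by nra.
 assert (1 - d <= rs k t / bj k t). { apply le_div_intro; [exact Hb|]. nra. }
 assert (rs k t / bj k t <= 1 + 2 * d). { apply div_le_intro; [exact Hb|]. nra. }
 apply Rabs_def1; lra.
Qed.

Definition casW (k : nat) (t : R) : R := rs k t * bj (S k) t - rs (S k) t * bj k t.

(** Two solutions of the linear recurrence would have a constant Casoratian; the only source is the
    nonlinearity [r / (1 - r ^ 2) - r], of third order in [r]. *)
Lemma casW_step (k : nat) (t : R) : 0 < t ->
 casW (S k) t = casW k t - INR (S k) / t * bj (S k) t * rs (S k) t ^ 3 / (1 - rs (S k) t ^ 2).
Proof. intros Ht. unfold casW. assert (H1 := rs_rec k t Ht). assert (H2 := bj_rec k t Ht).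
 assert (Hd := one_minus_rs_sq k t Ht).
 replace (rs (S (S k)) t) with (INR (S k) / t * (rs (S k) t / (1 - rs (S k) t ^ 2)) - rs k t) by lra.
 replace (bj (S (S k)) t) with (INR (S k) / t * bj (S k) t - bj k t) by lra. field. lra.
Qed.

Lemma casW_lim (t : R) : 0 < t -> is_lim_seq (fun k => casW k t) 0.
Proof. intros Ht. replace (Finite 0) with (Finite (0 * 0 - 0 * 0)) by (f_equal; ring).
 apply is_lim_seq_minus'; apply is_lim_seq_mult'.
 - apply rs_lim, Ht.
 - apply (is_lim_seq_incr_1 (fun k => bj k t)), bj_lim, Ht.
 - apply (is_lim_seq_incr_1 (fun k => rs k t)), rs_lim, Ht.
 - apply bj_lim, Ht.
Qed.

(** Beyond [k = 2 t] the cubic source has a fixed sign, so the Casoratian decreases towards its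
    limit 0. *)
Lemma casW_nonneg (k : nat) (t : R) : 0 < t -> 2 * t <= INR k -> 0 <= casW k t.
Proof. intros Ht Hk. change (0 <= casW (0 + k) t). apply (is_lim_seq_decr_compare (fun i => casW (i + k) t) 0).
 - apply (is_lim_seq_incr_n (fun n => casW n t)), casW_lim, Ht.
 - intros i. simpl (S i + k)%nat. rewrite casW_step by exact Ht.
  assert (H0 : 2 * t <= INR (S (i + k))) by (rewrite S_INR, plus_INR; assert (H := pos_INR i); lra).
  destruct (bj_mono (S (i + k)) t Ht H0) as [Hb _].
  assert (Hr := rs_pos (S (i + k)) t Ht). assert (Hd := one_minus_rs_sq (i + k) t Ht).
  assert (0 <= INR (S (i + k)) / t * bj (S (i + k)) t * rs (S (i + k)) t ^ 3 / (1 - rs (S (i + k)) t ^ 2)); [|lra].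
  mono.
Qed.

Lemma rho_step (k : nat) (t : R) : 0 < t -> 2 * t <= INR k ->
 rho k t - rho (S k) t = casW k t / (bj k t * bj (S k) t).
Proof. intros Ht Hk. destruct (bj_mono k t Ht Hk) as [Hb _].
 destruct (bj_mono (S k) t Ht ltac:(rewrite S_INR; lra)) as [Hb' _]. unfold rho, casW. field. lra.
Qed.

Lemma rho_antitone_step (k : nat) (t : R) : 0 < t -> 2 * t <= INR k -> rho (S k) t <= rho k t.
Proof. intros Ht Hk. assert (H := rho_step k t Ht Hk). assert (HW := casW_nonneg k t Ht Hk).
 destruct (bj_mono k t Ht Hk) as [Hb _]. destruct (bj_mono (S k) t Ht ltac:(rewrite S_INR; lra)) as [Hb' _].
 assert (0 <= casW k t / (bj k t * bj (S k) t)); [|lra]. mono.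
Qed.

Lemma rho_antitone (n m : nat) (t : R) : 0 < t -> 2 * t <= INR n -> (n <= m)%nat -> rho m t <= rho n t.
Proof. intros Ht Hn H. induction H as [|m H IH]; [lra|]. assert (INR n <= INR m) by (apply le_INR, H).
 assert (H1 := rho_antitone_step m t Ht ltac:(lra)). lra.
Qed.

Lemma rho_ge_1 (k : nat) (t : R) : 0 < t -> 2 * t <= INR k -> 1 <= rho k t.
Proof. intros Ht Hk. change (1 <= rho (0 + k) t). apply (is_lim_seq_decr_compare (fun i => rho (i + k) t) 1).
 - apply (is_lim_seq_incr_n (fun n => rho n t)), rho_lim, Ht.
 - intros i. simpl (S i + k)%nat. apply rho_antitone_step; [exact Ht|].
  rewrite plus_INR. assert (H := pos_INR i). lra.
Qed.

Lemma two_th_le (h : R) (k : nat) : 0 < h -> 0 <= xk h k -> 2 * th h <= INR k.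
Proof. intros Hh Hx. unfold xk in Hx. unfold th.
 replace (2 * / h ^ 3) with (2 / h ^ 2 / h) by (field; lra). apply div_le_intro; lra.
Qed.

Lemma exp_xk_lim (h : R) : 0 < h -> is_lim_seq (fun k => exp (- xk h k)) 0.
Proof. intros Hh. apply (is_lim_seq_ext (fun k => exp (2 / h ^ 2) * exp (- h) ^ k)).
 - intros k. rewrite <- exp_mult_INR, <- exp_plus. f_equal. unfold xk. ring.
 - apply lim_scal_0, is_lim_seq_geom. rewrite Rabs_right by (left; apply exp_pos).
  rewrite <- exp_0. apply exp_increasing. lra.
Qed.

Lemma one_minus_exp_ge (h : R) : 0 <= h <= 1 -> h / 2 <= 1 - exp (- h).
Proof. intros Hh. assert (H := exp_ineq1_le h). rewrite exp_Ropp. assert (/ exp h <= / (1 + h)) by mono.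
 assert (/ (1 + h) <= 1 - h / 2); [|lra]. apply (Rmult_le_reg_l (1 + h)); [lra|]. rewrite Rinv_r by lra. nra.
Qed.

(** The constant is [2916 = 2 * 2 * 27 ^ 2]: from [ak_exp] squared, from [1 / (1 - r ^ 2) <= 2], and
    from [(2 + x) e ^ (- x) <= 2]. *)
Lemma cubic_term_le (h : R) (k : nat) : 0 < h <= 1 / 40 -> 0 <= xk h (S k) ->
 INR (S k) / th h * (rs (S k) (th h) ^ 2 / (1 - rs (S k) (th h) ^ 2)) <= 2916 * h ^ 2 * exp (- xk h (S k)).
Proof. intros Hh Hx. assert (Ha := ak_exp h (S k) ltac:(lra)). assert (Hap := ak_pos h (S k) ltac:(lra)).
 rewrite kappa_xk, rs_ak by lra. set (x := xk h (S k)) in *. set (a := ak h (S k)) in *. set (e := exp (- x)) in *.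
 assert (He1 : e <= 1) by (unfold e; rewrite <- exp_0; apply exp_le_mono; lra). assert (Hxe : (1 + x) * e <= 1).
 { assert (H := exp_ineq1_le x). assert (E : exp x * e = 1).
  { unfold e. rewrite <- exp_plus, Rplus_opp_r. apply exp_0. } nra. }
 assert (Hh2 : 0 < h ^ 2 <= / 1600) by nra. assert (Ha2 : 0 < a ^ 2 <= 729 * e ^ 2).
 { split; [mono|]. replace (729 * e ^ 2) with ((27 * e) ^ 2) by ring. apply pow_incr; lra. }
 rewrite Rpow_mult_distr. assert (Hr : h ^ 2 * a ^ 2 <= 1 / 2) by nra. assert (Hr0 : 0 < h ^ 2 * a ^ 2) by nra.
 apply Rle_trans with ((2 + x) * (2 * (h ^ 2 * (729 * e ^ 2)))).
 - apply Rmult_le_compat.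
  + assert (0 <= x * h ^ 2) by nra. lra.
  + mono.
  + assert (x * h ^ 2 <= x * 1) by mono. lra.
  + apply div_le_intro; [lra|]. nra.
 - replace ((2 + x) * (2 * (h ^ 2 * (729 * e ^ 2)))) with (1458 * h ^ 2 * e * ((2 + x) * e)) by ring.
  replace (2916 * h ^ 2 * e) with (1458 * h ^ 2 * e * 2) by ring. mono.
Qed.

(** The Casoratian is the sum of the sources beyond [n], which decay like [h ^ 2 e ^ (- x)]. Instead
    of summing, [casW] minus the claimed bound is shown to increase to 0, each step using
    [e ^ h >= 1 + h]. *)
Lemma casW_upper (h : R) (n : nat) : 0 < h <= 1 / 40 -> 0 <= xk h n ->
 casW n (th h) <= rho n (th h) * bj n (th h) * bj (S n) (th h) * (2916 * h) * exp (- xk h n).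
Proof. intros Hh Hx. assert (Ht := th_pos h ltac:(lra)). assert (Hn := two_th_le h n ltac:(lra) Hx).
 set (t := th h) in *. destruct (bj_mono n t Ht Hn) as [Hb _].
 destruct (bj_mono (S n) t Ht ltac:(rewrite S_INR; lra)) as [Hb' _]. assert (Hrho := rho_ge_1 n t Ht Hn).
 set (R0 := rho n t * bj n t * bj (S n) t). assert (HR0 : 0 < R0) by (apply Rmult_lt_0_compat; [mono|]; lra).
 set (Y := fun i => casW (i + n) t - R0 * (2916 * h) * exp (- xk h (i + n))).
 assert (H : Y O <= 0); [|unfold Y in H; simpl in H; lra]. apply (is_lim_seq_incr_compare Y 0).
 - replace (Finite 0) with (Finite (0 - 0)) by (f_equal; ring). apply is_lim_seq_minus'.
  + apply (is_lim_seq_incr_n (fun n => casW n t)), casW_lim, Ht.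
  + apply lim_scal_0. apply (is_lim_seq_incr_n (fun n => exp (- xk h n))), exp_xk_lim; lra.
 - intros i. unfold Y. simpl (S i + n)%nat. set (m := (i + n)%nat). rewrite casW_step by exact Ht.
  assert (Hm : 2 * t <= INR (S m)). { unfold m. rewrite S_INR, plus_INR. assert (H := pos_INR i). lra. }
  destruct (bj_mono (S m) t Ht Hm) as [Hbm _]. assert (Hxm : 0 <= xk h (S m)).
  { unfold m. rewrite xk_S, Nat.add_comm, xk_add. assert (H := pos_INR i). assert (0 <= INR i * h) by mono. lra. }
  assert (Hc := cubic_term_le h m Hh Hxm). fold t in Hc.
  assert (Hd := one_minus_rs_sq m t Ht). assert (Hr := rs_pos (S m) t Ht).
  assert (Hb1 : bj (S m) t <= bj (S n) t) by (apply bj_antitone; [exact Ht|rewrite S_INR; lra|unfold m; lia]).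
  assert (Hb2 : bj (S m) t <= bj n t) by (apply bj_antitone; [exact Ht|lra|unfold m; lia]).
  assert (Hrm : rs (S m) t <= rho n t * bj n t). { assert (H := rho_antitone n (S m) t Ht Hn ltac:(unfold m; lia)).
   assert (E : rs (S m) t = rho (S m) t * bj (S m) t) by (unfold rho; field; lra).
   rewrite E. assert (H' := rho_ge_1 (S m) t Ht Hm). mono. }
  assert (Hz0 : 0 <= INR (S m) / t * (rs (S m) t ^ 2 / (1 - rs (S m) t ^ 2))). { mono. }
  assert (Hterm : INR (S m) / t * bj (S m) t * rs (S m) t ^ 3 / (1 - rs (S m) t ^ 2) <=
   R0 * (2916 * h ^ 2 * exp (- xk h (S m)))).
  { replace (INR (S m) / t * bj (S m) t * rs (S m) t ^ 3 / (1 - rs (S m) t ^ 2)) with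
    (rs (S m) t * bj (S m) t * (INR (S m) / t * (rs (S m) t ^ 2 / (1 - rs (S m) t ^ 2)))) by mono.
   apply Rmult_le_compat; [nra|exact Hz0| |exact Hc]. unfold R0. mono. }
  assert (Ee : exp (- xk h m) = exp (- xk h (S m)) * exp h). { rewrite <- exp_plus. f_equal. rewrite xk_S. ring. }
  rewrite Ee. assert (He := exp_pos (- xk h (S m))). assert (Hh1 := exp_ineq1_le h).
  set (e := exp (- xk h (S m))) in *. assert (R0 * (2916 * h) * (e * (1 + h)) <= R0 * (2916 * h) * (e * exp h)).
  { mono. }
  lra.
Qed.

(** The product [rho (1 - 5832 e ^ (- x))] increases to 1. Here [5832 = 2 * 2916], the factor 2
    coming from [1 - e ^ (- h) >= h / 2]. The bound is uniform in [h] and makes [r] and the Bessel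
    function agree for large [x]. *)
Lemma rs_bj_ratio (h : R) (k : nat) : 0 < h <= 1 / 40 -> 0 <= xk h k -> 5832 * exp (- xk h k) <= 1 ->
 0 < bj k (th h) <= rs k (th h) /\ rs k (th h) * (1 - 5832 * exp (- xk h k)) <= bj k (th h).
Proof. intros Hh Hx HD. assert (Ht := th_pos h ltac:(lra)). assert (Hn := two_th_le h k ltac:(lra) Hx).
 set (t := th h) in *. destruct (bj_mono k t Ht Hn) as [Hb _]. assert (Hrho := rho_ge_1 k t Ht Hn).
 assert (E : rs k t = rho k t * bj k t) by (unfold rho; field; lra). split; [rewrite E; nra|].
 assert (rho k t * (1 - 5832 * exp (- xk h k)) <= 1).
 2:{ rewrite E. replace (rho k t * bj k t * (1 - 5832 * exp (- xk h k))) with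
   (rho k t * (1 - 5832 * exp (- xk h k)) * bj k t) by ring. nra. }
 set (Y := fun i => rho (i + k) t * (1 - 5832 * exp (- xk h (i + k)))).
 change (Y O <= 1). apply (is_lim_seq_incr_compare Y 1).
 - replace (Finite 1) with (Finite (1 * (1 - 0))) by (f_equal; ring). apply is_lim_seq_mult'.
  + apply (is_lim_seq_incr_n (fun n => rho n t)), rho_lim, Ht.
  + apply is_lim_seq_minus'; [apply is_lim_seq_const|]. apply lim_scal_0.
   apply (is_lim_seq_incr_n (fun n => exp (- xk h n))), exp_xk_lim; lra.
 - intros i. unfold Y. simpl (S i + k)%nat. set (m := (i + k)%nat). assert (xk h k <= xk h m).
  { unfold m. rewrite Nat.add_comm, xk_add. assert (0 <= INR i * h) by mono. lra. }
  assert (Hm : 2 * t <= INR m) by (apply two_th_le; lra). assert (HW := casW_upper h m Hh ltac:(lra)). fold t in HW.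
  assert (Hst := rho_step m t Ht Hm). destruct (bj_mono m t Ht Hm) as [Hbm _].
  destruct (bj_mono (S m) t Ht ltac:(rewrite S_INR; lra)) as [Hbm' _]. assert (Hr1 := rho_ge_1 m t Ht Hm).
  assert (Hbb : 0 < bj m t * bj (S m) t) by mono.
  assert (rho m t - rho (S m) t <= rho m t * (2916 * h) * exp (- xk h m)).
  { rewrite Hst. apply div_le_intro; [exact Hbb|]. lra. }
  assert (Ee : exp (- xk h (S m)) = exp (- xk h m) * exp (- h)). { rewrite <- exp_plus. f_equal. rewrite xk_S. ring. }
  rewrite Ee. assert (He := exp_pos (- xk h m)). assert (exp (- xk h m) <= exp (- xk h k)) by mono.
  set (e := exp (- xk h m)) in *.
  assert (Hoe := one_minus_exp_ge h ltac:(lra)). assert (Hep := exp_pos (- h)). set (g := exp (- h)) in *.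
  assert (0 <= 1 - 5832 * (e * g)). { assert (e * g <= e * 1) by mono. lra. }
  apply Rle_trans with ((rho m t - rho m t * (2916 * h) * e) * (1 - 5832 * (e * g))).
  2:{ apply Rmult_le_compat_r; lra. }
  replace ((rho m t - rho m t * (2916 * h) * e) * (1 - 5832 * (e * g))) with
   (rho m t * (1 - 5832 * e) + rho m t * e * (5832 * (1 - g) - 2916 * h + 2916 * h * (5832 * (e * g)))) by ring.
  assert (0 <= rho m t * e * (5832 * (1 - g) - 2916 * h + 2916 * h * (5832 * (e * g)))); [|lra].
  apply Rmult_le_pos; [mono|]. assert (0 <= 2916 * h * (5832 * (e * g))); [|lra]. assert (0 < e * g) by mono. mono.
Qed.

(** * Improper integrals and the Airy integral *)

Lemma int_to_pinfty_lim (f : R -> R) (x l : R) : (forall b, x <= b -> ex_RInt f x b) ->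
 (forall e, 0 < e -> exists M, forall b, M < b -> x <= b -> Rabs (RInt f x b - l) < e) -> int_to_pinfty f x = l.
Proof. intros Hex Hl. unfold int_to_pinfty. apply is_RInt_gen_unique.
 intros P [e HP]. destruct (Hl e (cond_pos e)) as [M HM]. unfold filtermapi.
 apply (Filter_prod _ _ _ (fun a => a = x) (fun b => Rmax M x < b)).
 - reflexivity.
 - exists (Rmax M x). intros b Hb; exact Hb.
 - intros a b Ha Hb. simpl in *. subst a. assert (H1 := Rmax_l M x). assert (H2 := Rmax_r M x).
  exists (RInt f x b). split.
  + apply (RInt_correct (V := R_CompleteNormedModule)), Hex. lra.
  + apply HP. apply HM; lra.
Qed.

Lemma int_from_minfty_lim (f : R -> R) (x l : R) : (forall b, b <= x -> ex_RInt f b x) ->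
 (forall e, 0 < e -> exists M, forall b, b < M -> b <= x -> Rabs (RInt f b x - l) < e) -> int_from_minfty f x = l.
Proof. intros Hex Hl. unfold int_from_minfty. apply is_RInt_gen_unique.
 intros P [e HP]. destruct (Hl e (cond_pos e)) as [M HM]. unfold filtermapi.
 apply (Filter_prod _ _ _ (fun b => b < Rmin M x) (fun a => a = x)).
 - exists (Rmin M x). intros b Hb; exact Hb.
 - reflexivity.
 - intros b a Hb Ha. simpl in *. subst a. assert (H1 := Rmin_l M x). assert (H2 := Rmin_r M x).
  exists (RInt f b x). split.
  + apply (RInt_correct (V := R_CompleteNormedModule)), Hex. lra.
  + apply HP. apply HM; lra.
Qed.

Lemma RInt_derive_upper (f : R -> R) (a b : R) : (forall x, ex_derive f x) -> is_derive (fun s => RInt f a s) b (f b).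
Proof. intros H. apply (is_derive_RInt f (fun s => RInt f a s) a b).
 - exists (mkposreal 1 Rlt_0_1). intros y _. apply (RInt_correct (V := R_CompleteNormedModule)), ex_RInt_derivable, H.
 - apply (ex_derive_continuous f b), H.
Qed.

(** Integration by parts in differential form: [H], the integral minus [sin p / p'], has derivative
    [sin p * p'' / p' ^ 2], which is dominated by the derivative of [K = - 1 / p']. Hence [K + H]
    and [K - H] both increase. *)
Lemma van_der_corput (p p' p'' : R -> R) (a b : R) : a <= b ->
 (forall s, is_derive p s (p' s)) -> (forall s, is_derive p' s (p'' s)) ->
 (forall s, a <= s <= b -> 0 <= p'' s) -> 0 < p' a -> Rabs (RInt (fun s => cos (p s)) a b) <= 2 / p' a.
Proof. intros Hab Hp Hp' Hp'' Ha. assert (Hpos : forall s, a <= s <= b -> p' a <= p' s).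
 { intros s Hs. apply (incr_le p' p''); [lra|intros; apply Hp'|]. intros x Hx; apply Hp''; lra. }
 assert (Hcos : forall s, is_derive (fun s => cos (p s)) s (- sin (p s) * p' s)).
 { intros s. replace (- sin (p s) * p' s) with (p' s * - sin (p s)) by ring.
  apply (is_derive_comp cos p s (- sin (p s)) (p' s)); [|apply Hp]. auto_derive; [exact I|ring]. }
 set (H := fun s => RInt (fun s => cos (p s)) a s - sin (p s) * / p' s). set (K := fun s => - / p' s).
 assert (DK : forall s, a <= s <= b -> is_derive K s (p'' s / p' s ^ 2)).
 { intros s Hs. specialize (Hpos s Hs). unfold K. replace (p'' s / p' s ^ 2) with (- (- p'' s / p' s ^ 2)) by mono.
  apply (is_derive_opp (fun s => / p' s)). apply (is_derive_inv p' s (p'' s)); [apply Hp'|lra]. }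
 assert (DH : forall s, a <= s <= b -> is_derive H s (sin (p s) * (p'' s / p' s ^ 2))).
 { intros s Hs. specialize (Hpos s Hs). unfold H. replace (sin (p s) * (p'' s / p' s ^ 2)) with
   (cos (p s) - ((p' s * cos (p s)) * / p' s + sin (p s) * (- p'' s / p' s ^ 2))) by (field; lra).
  apply is_derive_minusR.
  - apply (RInt_derive_upper (fun s => cos (p s))). intros x; eexists; apply Hcos.
  - apply (is_derive_multR (fun s => sin (p s)) (fun s => / p' s)).
   + apply (is_derive_comp sin p s (cos (p s)) (p' s)); [|apply Hp]. auto_derive; [exact I|ring].
   + apply (is_derive_inv p' s (p'' s)); [apply Hp'|lra]. }
 assert (Hq : forall s, a <= s <= b -> 0 <= p'' s / p' s ^ 2).
 { intros s Hs. specialize (Hpos s Hs). apply Rdiv_le_0_compat; [apply Hp'', Hs|pos]. }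
 assert (H1 : K a - H a <= K b - H b).
 { apply (incr_le (fun s => K s - H s) (fun s => p'' s / p' s ^ 2 - sin (p s) * (p'' s / p' s ^ 2))); [lra| |].
  - intros s Hs. apply is_derive_minusR; [apply DK|apply DH]; lra.
  - intros s Hs. specialize (Hq s Hs). assert (Hb := SIN_bound (p s)). nra. }
 assert (H2 : K a + H a <= K b + H b).
 { apply (incr_le (fun s => K s + H s) (fun s => p'' s / p' s ^ 2 + sin (p s) * (p'' s / p' s ^ 2))); [lra| |].
  - intros s Hs. apply is_derive_plusR; [apply DK|apply DH]; lra.
  - intros s Hs. specialize (Hq s Hs). assert (Hb := SIN_bound (p s)). nra. }
 assert (0 < / p' a) by pos. assert (0 < / p' b) by (apply Rinv_0_lt_compat; specialize (Hpos b ltac:(lra)); lra).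
 unfold H, K in H1, H2. rewrite RInt_point in H1, H2. change (@zero R_CompleteNormedModule) with 0 in *.
 assert (Sa := SIN_bound (p a)). assert (Sb := SIN_bound (p b)).
 assert (- / p' a <= sin (p a) * / p' a <= / p' a) by (split; nra).
 assert (- / p' b <= sin (p b) * / p' b <= / p' b) by (split; nra). unfold Rdiv. apply Rabs_le. lra.
Qed.

Definition aphase (x s : R) : R := s ^ 3 / 3 + x * s.

Definition aint (x s : R) : R := cos (aphase x s).

Lemma aint_ex_derive (x s : R) : ex_derive (aint x) s.
Proof. unfold aint, aphase. auto_derive. exact I. Qed.

Lemma aint_ex_RInt (x a b : R) : ex_RInt (aint x) a b.
Proof. apply ex_RInt_derivable, aint_ex_derive. Qed.

Lemma RInt_chasles_R (f : R -> R) (a b c : R) : ex_RInt f a b -> ex_RInt f b c ->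
 RInt f a b + RInt f b c = RInt f a c.
Proof. intros H1 H2. exact (RInt_Chasles f a b c H1 H2). Qed.

Lemma aint_tail (x a b : R) : 0 <= a <= b -> 0 < a ^ 2 + x -> Rabs (RInt (aint x) a b) <= 2 / (a ^ 2 + x).
Proof. intros Hab Ha. apply (van_der_corput (aphase x) (fun s => s ^ 2 + x) (fun s => 2 * s)); [lra| | | |exact Ha].
 - intros s. unfold aphase. auto_derive; [exact I|]. field.
 - intros s. auto_derive; [exact I|]. ring.
 - intros s Hs. lra.
Qed.

(** Convergence of the Airy integral is proved along the way: by [aint_tail] the integrals up to
    integers form a Cauchy sequence, and the same estimate gives the rate. *)
Lemma Ai_approx (x S0 : R) : 0 < S0 -> 0 < S0 ^ 2 + x -> Rabs (RInt (aint x) 0 S0 - PI * Ai x) <= 2 / (S0 ^ 2 + x).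
Proof. intros HS Hx. set (u := fun n : nat => RInt (aint x) 0 (INR n)).
 assert (Hdiff : forall a b, 0 <= a <= b -> 0 < a ^ 2 + x ->
  Rabs (RInt (aint x) 0 b - RInt (aint x) 0 a) <= 2 / (a ^ 2 + x)).
 { intros a b Hab Ha. rewrite <- (RInt_chasles_R (aint x) 0 a b) by apply aint_ex_RInt.
  eapply Rle_trans; [|apply (aint_tail x a b); assumption]. right; f_equal. mono. }
 assert (Hsmall : forall e, 0 < e -> exists M, 0 < M /\ forall a, M <= a -> 0 < a ^ 2 + x /\ 2 / (a ^ 2 + x) < e).
 { intros e He. exists (Rabs x + 2 / e + 1). assert (H2e : 0 < 2 / e) by pos. assert (Hax := Rabs_pos x).
  split; [lra|]. intros a Ha.
  assert (Hx1 : - Rabs x <= x) by (assert (H := Rle_abs (- x)); rewrite Rabs_Ropp in H; lra).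
  assert (Hal : 2 / e < a ^ 2 + x) by nra. split; [lra|]. apply (Rmult_lt_reg_r (a ^ 2 + x)); [lra|].
  replace (2 / (a ^ 2 + x) * (a ^ 2 + x)) with (e * (2 / e)) by (field; lra). apply Rmult_lt_compat_l; lra. }
 assert (Hc : ex_finite_lim_seq u).
 { apply ex_lim_seq_cauchy_corr. intros e. destruct (Hsmall e (cond_pos e)) as [M [HM0 HM]].
  destruct (nfloor_ex M ltac:(lra)) as [N [_ HN]]. exists (S N).
  assert (Hmon : forall n m, (S N <= n)%nat -> (n <= m)%nat -> Rabs (u m - u n) < e).
  { intros n m Hn Hnm. assert (INR N + 1 <= INR n) by (rewrite <- S_INR; apply le_INR, Hn).
   assert (INR n <= INR m) by (apply le_INR, Hnm). destruct (HM (INR n) ltac:(lra)) as [H1 H2].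
   eapply Rle_lt_trans; [|exact H2]. apply Hdiff; [|exact H1]. lra. }
  intros n m Hn Hm. destruct (le_lt_dec n m) as [H|H].
  - rewrite Rabs_minus_sym. apply Hmon; assumption.
  - apply Hmon; [assumption|lia]. }
 destruct Hc as [l Hl].
 assert (Hlim : forall a, 0 <= a -> 0 < a ^ 2 + x -> Rabs (RInt (aint x) 0 a - l) <= 2 / (a ^ 2 + x)).
 { intros a Ha Hax. destruct (nfloor_ex a Ha) as [N [_ HN]].
  assert (HL : is_lim_seq (fun n => Rabs (RInt (aint x) 0 a - u n)) (Rabs (RInt (aint x) 0 a - l))).
  { apply (is_lim_seq_abs (fun n => RInt (aint x) 0 a - u n) (RInt (aint x) 0 a - l)).
   apply is_lim_seq_minus'; [apply is_lim_seq_const|exact Hl]. }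
  apply (is_lim_seq_incr_n _ (S N)) in HL.
  assert (HR : Rbar_le (Rabs (RInt (aint x) 0 a - l)) (2 / (a ^ 2 + x))); [|exact HR].
  apply (is_lim_seq_le (fun n => Rabs (RInt (aint x) 0 a - u (n + S N)%nat)) (fun _ => 2 / (a ^ 2 + x)));
   [|exact HL|apply is_lim_seq_const]. intros n. rewrite Rabs_minus_sym. apply Hdiff; [|exact Hax].
  assert (INR N + 1 <= INR (n + S N)) by (rewrite <- S_INR; apply le_INR; lia). lra. }
 assert (HA : PI * Ai x = l). { unfold Ai. rewrite <- Rmult_assoc, Rinv_r, Rmult_1_l by (assert (H := PI_RGT_0); lra).
  apply (int_to_pinfty_lim (aint x)).
  - intros; apply aint_ex_RInt.
  - intros e He. destruct (Hsmall e He) as [M [HM0 HM]]. exists M. intros b Hb _.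
   destruct (HM b ltac:(lra)) as [H1 H2]. eapply Rle_lt_trans; [|exact H2]. apply Hlim; lra. }
 rewrite HA. apply Hlim; lra.
Qed.

Lemma sin_lower (y : R) : 0 <= y -> y - y ^ 3 / 6 <= sin y.
Proof. intros Hy. assert (H : sin 0 - (0 - 0 ^ 3 / 6) <= sin y - (y - y ^ 3 / 6)).
 { apply (incr_le (fun s => sin s - (s - s ^ 3 / 6)) (fun s => cos s - (1 - s ^ 2 / 2))); [exact Hy| |].
  - intros x _. auto_derive; [exact I|]. field.
  - intros x Hx. assert (H := cos_lower x ltac:(lra)). lra. }
 rewrite sin_0 in H. lra.
Qed.

Lemma cos_upper (y : R) : 0 <= y -> cos y <= 1 - y ^ 2 / 2 + y ^ 4 / 24.
Proof. intros Hy. assert (H : (1 - 0 ^ 2 / 2 + 0 ^ 4 / 24) - cos 0 <= (1 - y ^ 2 / 2 + y ^ 4 / 24) - cos y).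
 { apply (incr_le (fun s => (1 - s ^ 2 / 2 + s ^ 4 / 24) - cos s) (fun s => sin s - (s - s ^ 3 / 6))); [exact Hy| |].
  - intros x _. auto_derive; [exact I|]. field.
  - intros x Hx. assert (H := sin_lower x ltac:(lra)). lra. }
 rewrite cos_0 in H. lra.
Qed.

Lemma sin_upper (y : R) : 0 <= y -> sin y <= y - y ^ 3 / 6 + y ^ 5 / 120.
Proof. intros Hy. assert (H : (0 - 0 ^ 3 / 6 + 0 ^ 5 / 120) - sin 0 <= (y - y ^ 3 / 6 + y ^ 5 / 120) - sin y).
 { apply (incr_le (fun s => (s - s ^ 3 / 6 + s ^ 5 / 120) - sin s) (fun s => (1 - s ^ 2 / 2 + s ^ 4 / 24) - cos s)); [exact Hy| |].
  - intros x _. auto_derive; [exact I|]. field.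
  - intros x Hx. assert (H := cos_upper x ltac:(lra)). lra. }
 rewrite sin_0 in H. lra.
Qed.

Lemma cos_diff_le (a b : R) : Rabs (cos a - cos b) <= Rabs (a - b).
Proof. destruct (MVT_gen cos b a (fun x => - sin x)) as [c [_ Hc]].
 - intros x _. auto_derive; [exact I|ring].
 - intros x _. apply continuity_cos.
 - rewrite Hc, Rabs_mult, Rabs_Ropp. assert (H := SIN_bound c).
  assert (Rabs (sin c) <= 1) by (apply Rabs_le; lra). assert (Hyy := Rabs_pos (a - b)). nra.
Qed.

(* The phase of [bj k (th h)] after the substitution [theta = h s]. *)
Definition bphase (h x s : R) : R := x * s + 2 / h ^ 3 * (h * s - sin (h * s)).

Lemma bphase_derive (h x s : R) : 0 < h -> is_derive (bphase h x) s (x + 2 / h ^ 2 * (1 - cos (h * s))).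
Proof. intros Hh. unfold bphase. auto_derive; [exact I|]. field. lra. Qed.

Lemma bj_scaled (h : R) (k : nat) : 0 < h ->
 PI * (bj k (th h) / h) = RInt (fun s => cos (bphase h (xk h k) s)) 0 (PI / h).
Proof. intros Hh. unfold bj. assert (HPI := PI_RGT_0).
 replace (PI * (/ PI * RInt (bint k (th h)) 0 PI / h)) with (/ h * RInt (bint k (th h)) 0 PI) by (field; lra).
 assert (H := RInt_comp (V := R_CompleteNormedModule) (bint k (th h)) (fun s => h * s) (fun _ => h) 0 (PI / h)).
 cbv beta in H. replace (h * 0) with 0 in H by ring. replace (h * (PI / h)) with PI in H by (field; lra).
 rewrite <- H.
 - assert (ex_RInt (fun s => cos (bphase h (xk h k) s)) 0 (PI / h)).
  { apply (ex_RInt_derivable (fun s => cos (bphase h (xk h k) s))). intros s. unfold bphase. auto_derive. exact I. }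
  rewrite <- (RInt_scal (V := R_CompleteNormedModule) _ _ _ (/ h)).
  + apply RInt_ext. intros s _. unfold scal; simpl; unfold mult; simpl.
   replace (bphase h (xk h k) s) with (INR k * (h * s) - 2 * th h * sin (h * s)).
   * unfold bint. field. lra.
   * unfold bphase, xk, th. field. lra.
  + apply (ex_RInt_ext (fun s => h * bint k (th h) (h * s))); [intros; reflexivity|].
   apply (ex_RInt_derivable (fun s => h * bint k (th h) (h * s))). intros s. unfold bint. auto_derive. exact I.
 - intros s _. apply (ex_derive_continuous (bint k (th h))), bint_ex_derive.
 - intros s _. split; [auto_derive; [exact I|ring]|]. apply continuous_const.
Qed.

(** Split at [S0]. Beyond it both oscillatory integrals are small by [van_der_corput], applicable up
    to [PI / h] because [sin (h s) >= 0] there. On [[0, S0]] the two phases differ by at most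
    [h ^ 2 S0 ^ 5 / 60]. *)
Lemma bj_Ai_bound (h S0 : R) (k : nat) : 0 < h -> 0 < S0 -> h * S0 <= 1 -> 0 < S0 ^ 2 / 2 + xk h k ->
 Rabs (PI * (bj k (th h) / h) - PI * Ai (xk h k)) <= 4 / (S0 ^ 2 / 2 + xk h k) + S0 * (h ^ 2 * S0 ^ 5 / 60).
Proof. intros Hh HS HhS Hx. set (x := xk h k) in *. assert (HPI2 := PI2_1). assert (Hp2 : 0 < S0 ^ 2) by pos.
 rewrite bj_scaled by exact Hh. fold x. assert (Hex : forall a b, ex_RInt (fun s => cos (bphase h x s)) a b).
 { intros a b. apply (ex_RInt_derivable (fun s => cos (bphase h x s))).
  intros s. unfold bphase. auto_derive. exact I. }
 rewrite <- (RInt_chasles_R _ 0 S0 (PI / h)) by apply Hex.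
 assert (HSp : S0 <= PI / h) by (apply le_div_intro; [exact Hh|]; lra).
 assert (H1 : Rabs (RInt (fun s => cos (bphase h x s)) S0 (PI / h)) <= 2 / (S0 ^ 2 / 2 + x)).
 { assert (Hd : S0 ^ 2 / 2 + x <= x + 2 / h ^ 2 * (1 - cos (h * S0))).
  { assert (Hc := cos_upper (h * S0) ltac:(apply Rmult_le_pos; lra)). assert (Hy : (h * S0) ^ 4 <= (h * S0) ^ 2).
   { assert (H0 : 0 < h * S0) by pos. set (y := h * S0) in *.
    replace (y ^ 4) with (y ^ 2 * y ^ 2) by ring. assert (Hy2 : 0 <= y ^ 2 <= 1) by (split; [mono|]; rewrite <- (pow1 2); apply pow_incr; lra).
    rewrite <- (Rmult_1_r (y ^ 2)) at 3. mono. }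
   assert (Hh2 : 0 < 2 / h ^ 2) by pos. assert (2 / h ^ 2 * ((h * S0) ^ 2 / 4) <= 2 / h ^ 2 * (1 - cos (h * S0))).
   { apply Rmult_le_compat_l; [lra|]. clear - Hc Hy. set (y := h * S0) in *. clearbody y. assert (Hq := pow2_ge_0 y). lra. }
   replace (2 / h ^ 2 * ((h * S0) ^ 2 / 4)) with (S0 ^ 2 / 2) in H by (field; lra). lra. }
  apply Rle_trans with (2 / (x + 2 / h ^ 2 * (1 - cos (h * S0)))).
  - apply (van_der_corput (bphase h x) (fun s => x + 2 / h ^ 2 * (1 - cos (h * s))) (fun s => 2 / h * sin (h * s))).
   + exact HSp.
   + intros s; apply bphase_derive, Hh.
   + intros s. auto_derive; [exact I|]. field. lra.
   + intros s Hs. apply Rmult_le_pos; [pos|]. assert (Hs2 : s * h <= PI).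
    { destruct Hs as [_ Hs]. apply (Rmult_le_compat_r h) in Hs; [|lra].
     replace (PI / h * h) with PI in Hs by (field; lra). exact Hs. }
    apply sin_ge_0; nra.
   + lra.
  - unfold Rdiv. mono. }
 assert (H2 : Rabs (RInt (fun s => cos (bphase h x s)) 0 S0 - RInt (aint x) 0 S0) <= S0 * (h ^ 2 * S0 ^ 5 / 60)).
 { rewrite <- (RInt_minus (V := R_CompleteNormedModule)) by (apply Hex || apply aint_ex_RInt).
  replace (S0 * (h ^ 2 * S0 ^ 5 / 60)) with ((S0 - 0) * (h ^ 2 * S0 ^ 5 / 60)) by ring.
  apply abs_RInt_le_const; [lra| |].
  - apply (ex_RInt_minus (V := R_NormedModule)); [apply Hex|apply aint_ex_RInt].
  - intros s Hs. change (Rabs (cos (bphase h x s) - cos (aphase x s)) <= h ^ 2 * S0 ^ 5 / 60).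
   eapply Rle_trans; [apply cos_diff_le|]. assert (Hy : 0 <= h * s) by pos.
   assert (Hs1 := sin_lower (h * s) Hy). assert (Hs2 := sin_upper (h * s) Hy).
   set (D := sin (h * s) - (h * s - (h * s) ^ 3 / 6)).
   replace (bphase h x s - aphase x s) with (- (2 / h ^ 3 * D)) by (unfold bphase, aphase, D; field; lra).
   rewrite Rabs_Ropp. assert (Hh3 : 0 < 2 / h ^ 3) by pos.
   rewrite Rabs_right by (apply Rle_ge, Rmult_le_pos; unfold D; lra).
   apply Rle_trans with (2 / h ^ 3 * ((h * s) ^ 5 / 120)).
   + apply Rmult_le_compat_l; unfold D; lra.
   + replace (2 / h ^ 3 * ((h * s) ^ 5 / 120)) with (h ^ 2 * s ^ 5 / 60) by (field; lra).
    assert (s ^ 5 <= S0 ^ 5) by mono. nra. }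
 assert (H3 := Ai_approx x S0 HS ltac:(lra)). assert (H4 : 2 / (S0 ^ 2 + x) <= 2 / (S0 ^ 2 / 2 + x)).
 { unfold Rdiv. mono. }
 replace (4 / (S0 ^ 2 / 2 + x)) with (2 / (S0 ^ 2 / 2 + x) + 2 / (S0 ^ 2 / 2 + x)) by mono.
 absle H1. absle H2. absle H3. apply Rabs_le. lra.
Qed.

(** [S0] is taken so large that the tails cost [e], then [h] so small that the phase error costs
    [e]; division by [PI >= 2] leaves [e] in all. *)
Lemma bj_Ai_lim (A e : R) : 0 <= A -> 0 < e ->
 exists h0, 0 < h0 /\ forall h, 0 < h <= h0 -> forall k, - A <= xk h k -> Rabs (bj k (th h) / h - Ai (xk h k)) <= e.
Proof. intros HA He. assert (HPI2 := PI2_1). set (S0 := 2 * A + 8 / e + 1). assert (0 < 8 / e) by pos.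
 assert (HS : 0 < S0) by (unfold S0; lra). assert (1 <= S0) by (unfold S0; lra). assert (4 / e + A <= S0 ^ 2 / 2).
 { assert (S0 <= S0 ^ 2) by nra. unfold S0 in *. replace (4 / e) with (8 / e / 2) by mono. lra. }
 set (c := S0 * (S0 ^ 5 / 60)). assert (0 < c). { apply Rmult_lt_0_compat; [exact HS|]. mono. }
 exists (Rmin (/ S0) (Rmin 1 (e / c))). assert (0 < e / c) by pos. assert (0 < / S0) by pos.
 split; [repeat apply Rmin_glb_lt; lra|]. intros h [Hh Hh0] k Hk.
 assert (Hh1 : h <= / S0) by (eapply Rle_trans; [exact Hh0|apply Rmin_l]). assert (h <= 1).
 { eapply Rle_trans; [exact Hh0|]. eapply Rle_trans; [apply Rmin_r|apply Rmin_l]. }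
 assert (Hh3 : h <= e / c). { eapply Rle_trans; [exact Hh0|]. eapply Rle_trans; [apply Rmin_r|apply Rmin_r]. }
 assert (0 < 4 / e) by pos. assert (Hb := bj_Ai_bound h S0 k Hh HS). assert (HhS : h * S0 <= 1).
 { apply (Rmult_le_compat_r S0) in Hh1; [|lra]. rewrite Rinv_l in Hh1 by lra. exact Hh1. }
 specialize (Hb HhS ltac:(lra)). assert (4 / (S0 ^ 2 / 2 + xk h k) <= e).
 { apply div_le_intro; [lra|]. replace 4 with (e * (4 / e)) at 1 by (field; lra). mono. }
 assert (S0 * (h ^ 2 * S0 ^ 5 / 60) <= e).
 { replace (S0 * (h ^ 2 * S0 ^ 5 / 60)) with (h * (h * c)) by (unfold c; field). assert (h * c <= e).
  { apply (Rmult_le_compat_r c) in Hh3; [|lra]. replace (e / c * c) with e in Hh3 by (field; lra). exact Hh3. }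
  assert (0 < h * c) by pos. nra. }
 rewrite <- Rmult_minus_distr_l, Rabs_mult, (Rabs_right PI) in Hb by lra. nra.
Qed.

(** * Convergence to [q] *)

Lemma continuous_bounded (f : R -> R) (a b : R) : (forall x, continuous f x) ->
 exists M, 0 < M /\ forall x, a <= x <= b -> Rabs (f x) <= M.
Proof. intros Hc. destruct (Rle_lt_dec a b) as [Hab|Hab].
 - destruct (continuity_ab_maj (fun x => Rabs (f x)) a b Hab) as [m [Hm _]].
  + intros c _. apply continuity_pt_filterlim. apply continuous_comp with (g := Rabs).
   * apply Hc.
   * apply continuous_Rabs.
  + exists (Rabs (f m) + 1). split; [assert (H := Rabs_pos (f m)); lra|]. intros x Hx. specialize (Hm x Hx). lra.
 - exists 1. split; [lra|]. intros x Hx; lra.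
Qed.

Definition qrhs (q : R -> R) (x : R) : R := 2 * q x ^ 3 + x * q x.

Lemma q_derive (q : R -> R) (x : R) (Hq : painleveII q) : is_derive q x (Derive q x).
Proof. apply Derive_correct, (proj1 (Hq x)). Qed.

Lemma q_derive2 (q : R -> R) (x : R) (Hq : painleveII q) : is_derive (Derive q) x ((qrhs q) x).
Proof. apply (proj2 (Hq x)). Qed.

Lemma q_cont (q : R -> R) (x : R) (Hq : painleveII q) : continuous q x.
Proof. apply (ex_derive_continuous q x). eexists; apply (q_derive _ _ Hq). Qed.

Lemma q'_cont (q : R -> R) (x : R) (Hq : painleveII q) : continuous (Derive q) x.
Proof. apply (ex_derive_continuous (Derive q) x). eexists; apply (q_derive2 _ _ Hq). Qed.

Definition qrhs' (q : R -> R) (x : R) : R := (6 * q x ^ 2 + x) * Derive q x + q x.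

Lemma qrhs_derive (q : R -> R) (x : R) (Hq : painleveII q) : is_derive (qrhs q) x ((qrhs' q) x).
Proof. unfold qrhs. replace ((qrhs' q) x) with (2 * (INR 3 * Derive q x * q x ^ pred 3) + (1 * q x + x * Derive q x))
  by (unfold qrhs'; simpl; ring). apply is_derive_plusR.
 - apply (is_derive_scal (fun s => q s ^ 3)). apply is_derive_pow, (q_derive _ _ Hq).
 - apply is_derive_multR; [apply is_derive_idR|apply (q_derive _ _ Hq)].
Qed.

Lemma qrhs'_cont (q : R -> R) (x : R) (Hq : painleveII q) : continuous (qrhs' q) x.
Proof. unfold qrhs'.
 apply (continuous_plus (V := R_NormedModule) (fun s => (6 * q s ^ 2 + s) * Derive q s) q); [|apply (q_cont _ _ Hq)].
 apply (continuous_mult (K := R_AbsRing) (fun s => 6 * q s ^ 2 + s) (Derive q)); [|apply (q'_cont _ _ Hq)].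
 apply (continuous_plus (V := R_NormedModule) (fun s => 6 * q s ^ 2) (fun s => s)); [|apply continuous_id].
 apply (ex_derive_continuous (fun s => 6 * q s ^ 2)).
 apply ex_derive_scal. apply (ex_derive_pow q 2 x). eexists; apply (q_derive _ _ Hq).
Qed.

(** Two integrations of the Lipschitz bound on [q''], available because the right-hand side of the
    equation is itself continuously differentiable. *)
Lemma q_second_difference (q : R -> R) (a b : R) : painleveII q -> exists C, 0 < C /\ forall x h, a <= x <= b -> 0 <= h <= 1 ->
 Rabs (q (x + h) + q (x - h) - 2 * q x - h ^ 2 * (qrhs q) x) <= C * h ^ 3.
Proof.
 intros Hq. destruct (continuous_bounded (qrhs' q) (a - 1) (b + 1) (fun x => qrhs'_cont q x Hq)) as [M [HM0 HM]].
 exists M. split; [exact HM0|]. intros x h Hx Hh.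
 assert (Hlip : forall s, 0 <= s <= 1 -> Rabs ((qrhs q) (x + s) - (qrhs q) x) <= M * s /\ Rabs ((qrhs q) (x - s) - (qrhs q) x) <= M * s).
 { intros s Hs. split.
  - destruct (MVT_gen (qrhs q) x (x + s) (qrhs' q)) as [c [Hc E]].
   + intros y _; apply (qrhs_derive _ _ Hq).
   + intros y _; apply continuity_pt_filterlim, (ex_derive_continuous (qrhs q) y). eexists; apply (qrhs_derive _ _ Hq).
   + rewrite Rmin_left, Rmax_right in Hc by lra. rewrite E, Rabs_mult.
    replace (x + s - x) with s by ring. rewrite (Rabs_right s) by lra. apply Rmult_le_compat_r; [lra|]. apply HM; lra.
  - destruct (MVT_gen (qrhs q) (x - s) x (qrhs' q)) as [c [Hc E]].
   + intros y _; apply (qrhs_derive _ _ Hq).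
   + intros y _; apply continuity_pt_filterlim, (ex_derive_continuous (qrhs q) y). eexists; apply (qrhs_derive _ _ Hq).
   + rewrite Rmin_left, Rmax_right in Hc by lra. rewrite Rabs_minus_sym, E, Rabs_mult.
    replace (x - (x - s)) with s by ring. rewrite (Rabs_right s) by lra.
    apply Rmult_le_compat_r; [lra|]. apply HM; lra. }
 assert (Hshift : forall (f df : R -> R) s, (forall y, is_derive f y (df y)) ->
  is_derive (fun s => f (x + s)) s (df (x + s)) /\ is_derive (fun s => f (x - s)) s (- df (x - s))).
 { intros f df s Hf. split.
  - replace (df (x + s)) with (1 * df (x + s)) by ring.
   apply (is_derive_comp f (fun s => x + s) s (df (x + s)) 1); [apply Hf|]. auto_derive; [exact I|ring].
  - replace (- df (x - s)) with (-1 * df (x - s)) by ring.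
   apply (is_derive_comp f (fun s => x - s) s (df (x - s)) (-1)); [apply Hf|]. auto_derive; [exact I|ring]. }
 set (D1 := fun s => Derive q (x + s) - Derive q (x - s) - 2 * s * (qrhs q) x).
 set (D0 := fun s => q (x + s) + q (x - s) - 2 * q x - s ^ 2 * (qrhs q) x).
 assert (HD1 : forall s, is_derive D1 s ((qrhs q) (x + s) - (- (qrhs q) (x - s)) - 2 * (qrhs q) x)).
 { intros s. destruct (Hshift (Derive q) (qrhs q) s (fun y => q_derive2 q y Hq)) as [H1 H2]. unfold D1.
  apply is_derive_minusR; [apply is_derive_minusR; assumption|]. auto_derive; [exact I|ring]. }
 assert (HD0 : forall s, is_derive D0 s (D1 s)).
 { intros s. destruct (Hshift q (Derive q) s (fun y => q_derive q y Hq)) as [H1 H2]. unfold D0, D1.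
  replace (Derive q (x + s) - Derive q (x - s) - 2 * s * (qrhs q) x) with
  (Derive q (x + s) + - Derive q (x - s) - 0 - 2 * s * (qrhs q) x) by ring.
  apply is_derive_minusR; [apply is_derive_minusR; [apply is_derive_plusR; assumption|apply is_derive_constR]|].
  auto_derive; [exact I|ring]. }
 assert (HM2 : forall s, 0 <= s <= 1 -> Rabs ((qrhs q) (x + s) - (- (qrhs q) (x - s)) - 2 * (qrhs q) x) <= 2 * M * s).
 { intros s Hs. destruct (Hlip s Hs) as [H1 H2]. replace ((qrhs q) (x + s) - - (qrhs q) (x - s) - 2 * (qrhs q) x) with
   (((qrhs q) (x + s) - (qrhs q) x) + ((qrhs q) (x - s) - (qrhs q) x)) by ring.
  eapply Rle_trans; [apply Rabs_triang|]. lra. }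
 assert (E1 : D1 0 = 0) by (unfold D1; rewrite Rplus_0_r, Rminus_0_r; ring).
 assert (E0 : D0 0 = 0) by (unfold D0; rewrite Rplus_0_r, Rminus_0_r; ring).
 assert (B1 : forall s, 0 <= s <= 1 -> Rabs (D1 s) <= M * s ^ 2). { intros s Hs. apply Rabs_le. split.
  - assert (H : D1 0 + M * 0 ^ 2 <= D1 s + M * s ^ 2); [|mono].
   apply (incr_le (fun s => D1 s + M * s ^ 2) (fun s => (qrhs q) (x + s) - (- (qrhs q) (x - s)) - 2 * (qrhs q) x + M * (2 * s))); [lra| |].
   + intros y _. apply is_derive_plusR; [apply HD1|]. auto_derive; [exact I|ring].
   + intros y Hy. specialize (HM2 y ltac:(lra)). absle HM2. lra.
  - assert (H : M * 0 ^ 2 - D1 0 <= M * s ^ 2 - D1 s); [|mono].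
   apply (incr_le (fun s => M * s ^ 2 - D1 s) (fun s => M * (2 * s) - ((qrhs q) (x + s) - (- (qrhs q) (x - s)) - 2 * (qrhs q) x))); [lra| |].
   + intros y _. apply is_derive_minusR; [|apply HD1]. auto_derive; [exact I|ring].
   + intros y Hy. specialize (HM2 y ltac:(lra)). absle HM2. lra. }
 change (Rabs (D0 h) <= M * h ^ 3). apply Rabs_le. split.
 - assert (H : D0 0 + M * 0 ^ 3 <= D0 h + M * h ^ 3); [|mono].
  apply (incr_le (fun s => D0 s + M * s ^ 3) (fun s => D1 s + M * (3 * s ^ 2))); [lra| |].
  + intros y _. apply is_derive_plusR; [apply HD0|]. auto_derive; [exact I|ring].
  + intros y Hy. specialize (B1 y ltac:(lra)). absle B1. lra.
 - assert (H : M * 0 ^ 3 - D0 0 <= M * h ^ 3 - D0 h); [|mono].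
  apply (incr_le (fun s => M * s ^ 3 - D0 s) (fun s => M * (3 * s ^ 2) - D1 s)); [lra| |].
  + intros y _. apply is_derive_minusR; [|apply HD0]. auto_derive; [exact I|ring].
  + intros y Hy. specialize (B1 y ltac:(lra)). absle B1. lra.
Qed.

(** * Gronwall comparison with [q] on the grid *)

Definition qk (q : R -> R) (h : R) (k : nat) : R := q (xk h k).

Definition sk (q : R -> R) (h : R) (k : nat) : R := (qk q) h k / ak h k.

Definition Vk (q : R -> R) (h : R) (k : nat) : R := ak h k * (qk q) h (S k) - ak h (S k) * (qk q) h k.

Lemma sk_step (q : R -> R) (h : R) (k : nat) : 0 < h -> (sk q) h (S k) - (sk q) h k = (Vk q) h k / (ak h k * ak h (S k)).
Proof. intros Hh. assert (H1 := ak_pos h k Hh). assert (H2 := ak_pos h (S k) Hh). unfold sk, Vk. field. lra. Qed.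

Lemma qk_sk (q : R -> R) (h : R) (k : nat) : 0 < h -> (qk q) h k = (sk q) h k * ak h k.
Proof. intros Hh. assert (H1 := ak_pos h k Hh). unfold sk. field. lra. Qed.

(** On the grid [a] and [q] satisfy the same equation up to [O(h ^ 3)], so their Casoratian changes
    only through the difference of the cubic terms. That difference is proportional to
    [s (s ^ 2 - 1)], hence small when the ratio [s] is near 1. *)
Lemma Vk_step (q : R -> R) (a b : R) : painleveII q -> exists C h1, 0 < C /\ 0 < h1 /\ forall h k, 0 < h <= h1 -> a <= xk h (S k) <= b ->
 Rabs ((Vk q) h (S k) - (Vk q) h k) <=
 2 * h ^ 2 * ak h (S k) ^ 4 * (Rabs ((sk q) h (S k)) * Rabs ((sk q) h (S k) ^ 2 - 1)) + C * h ^ 3.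
Proof. intros Hq. destruct (q_second_difference q a b Hq) as [C1 [HC1 H1]].
 destruct (continuous_bounded q a b (fun x => q_cont q x Hq)) as [Mq [HMq HMq']]. set (A := 27 * exp (- a)).
 assert (HA : 0 < A) by (unfold A; assert (H := exp_pos (- a)); lra). set (X := Rabs a + Rabs b).
 set (C2 := Mq * (A ^ 3 * (2 * (X + 2 * A ^ 2)))).
 assert (HX : 0 <= X) by (unfold X; assert (H := Rabs_pos a); assert (H' := Rabs_pos b); lra).
 assert (HA3 : 0 < A ^ 3) by pos. assert (HA2 := pow2_ge_0 A).
 assert (HC2 : 0 <= C2) by (unfold C2; apply Rmult_le_pos; [lra|]; apply Rmult_le_pos; lra).
 exists (A * C1 + C2), (Rmin (1 / 100) (/ (2 * A))). split; [assert (0 < A * C1) by pos; lra|].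
 split; [apply Rmin_glb_lt; [lra|pos]|]. intros h k [Hh0 Hh1] Hx.
 assert (Hh : 0 < h <= 1 / 100) by (split; [exact Hh0|eapply Rle_trans; [exact Hh1|apply Rmin_l]]).
 assert (HhA : h * A <= 1 / 2). { assert (H : h <= / (2 * A)) by (eapply Rle_trans; [exact Hh1|apply Rmin_r]).
  apply (Rmult_le_compat_r A) in H; [|lra]. replace (/ (2 * A) * A) with (1 / 2) in H by (field; lra). exact H. }
 assert (Ht := th_pos h ltac:(lra)). assert (Hd := one_minus_rs_sq k (th h) Ht).
 assert (Hrec := rs_rec k (th h) Ht). rewrite kappa_xk in Hrec by lra. assert (Hr := rs_pos (S k) (th h) Ht).
 assert (Ha := ak_exp h (S k) ltac:(lra)). assert (Hap := ak_pos h (S k) ltac:(lra)). assert (HaA : ak h (S k) <= A).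
 { eapply Rle_trans; [exact Ha|]. unfold A. mono. }
 rewrite (rs_ak h (S (S k))), (rs_ak h (S k)), (rs_ak h k) in Hrec by lra. rewrite (rs_ak h (S k)) in Hd by lra.
 assert (Ex : xk h (S (S k)) = xk h (S k) + h) by apply xk_S.
 assert (Ex' : xk h k = xk h (S k) - h) by (rewrite xk_S; ring).
 specialize (H1 (xk h (S k)) h Hx ltac:(lra)). rewrite <- Ex, <- Ex' in H1.
 fold ((qk q) h (S (S k))) ((qk q) h k) in H1. unfold qrhs in H1. fold ((qk q) h (S k)) in H1.
 specialize (HMq' (xk h (S k)) Hx). fold ((qk q) h (S k)) in HMq'. unfold Vk. assert (HXx : Rabs (xk h (S k)) <= X).
 { unfold X. apply Rabs_le. assert (P1 := Rle_abs (- a)). rewrite Rabs_Ropp in P1.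
  assert (P2 := Rle_abs b). assert (P3 := Rabs_pos a). assert (P4 := Rabs_pos b). lra. }
 assert (Eq := qk_sk q h (S k) ltac:(lra)). set (s := (sk q) h (S k)) in *.
 set (a2 := ak h (S (S k))) in *. set (a1 := ak h (S k)) in *. set (a0 := ak h k) in *.
 set (q2 := (qk q) h (S (S k))) in *. set (q1 := (qk q) h (S k)) in *. set (q0 := (qk q) h k) in *.
 set (x := xk h (S k)) in *. set (y := h ^ 2 * a1 ^ 2). assert (Hy : (h * a1) ^ 2 = y) by (unfold y; ring).
 rewrite Hy in *. assert (Hsum : a2 + a0 = (2 + x * h ^ 2) * a1 / (1 - y)).
 { apply (Rmult_eq_reg_l h); [|lra]. rewrite Rmult_plus_distr_l, Hrec. field. lra. }
 set (res := q2 + q0 - 2 * q1 - h ^ 2 * (2 * q1 ^ 3 + x * q1)) in *.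
 assert (E : a1 * q2 - a2 * q1 - (a0 * q1 - a1 * q0) =
  2 * h ^ 2 * (a1 * q1 * (q1 ^ 2 - a1 ^ 2)) + a1 * res - h ^ 4 * (q1 * (a1 ^ 3 * ((x + 2 * a1 ^ 2) / (1 - y))))).
 { replace (a1 * q2 - a2 * q1 - (a0 * q1 - a1 * q0)) with
   (a1 * (res + 2 * q1 + h ^ 2 * (2 * q1 ^ 3 + x * q1)) - q1 * (a2 + a0)) by (unfold res; ring).
  rewrite Hsum. unfold y in *. field. lra. }
 rewrite E. assert (Hh2 : 0 < h ^ 2) by pos. assert (Hh3 : 0 < h ^ 3) by pos. assert (Hh4 : 0 < h ^ 4 <= h ^ 3).
 { split; [pos|]. replace (h ^ 4) with (h * h ^ 3) by ring. nra. }
 assert (T1 : Rabs (2 * h ^ 2 * (a1 * q1 * (q1 ^ 2 - a1 ^ 2))) = 2 * h ^ 2 * a1 ^ 4 * (Rabs s * Rabs (s ^ 2 - 1))).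
 { rewrite Eq. replace (2 * h ^ 2 * (a1 * (s * a1) * ((s * a1) ^ 2 - a1 ^ 2))) with
   (2 * h ^ 2 * a1 ^ 4 * (s * (s ^ 2 - 1))) by ring. rewrite Rabs_mult, (Rabs_mult s), Rabs_right; [mono|].
  apply Rle_ge, Rmult_le_pos; [lra|pos]. }
 assert (T2 : Rabs (a1 * res) <= A * (C1 * h ^ 3)). { rewrite Rabs_mult, (Rabs_right a1) by lra. mono. }
 assert (T3 : Rabs (h ^ 4 * (q1 * (a1 ^ 3 * ((x + 2 * a1 ^ 2) / (1 - y))))) <= h ^ 3 * C2).
 { rewrite Rabs_mult, (Rabs_right (h ^ 4)) by lra. assert (Ha13 : 0 < a1 ^ 3 <= A ^ 3) by mono.
  assert (Ha12 : 0 < a1 ^ 2 <= A ^ 2) by mono. assert (Hyy : y <= 1 / 2).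
  { unfold y. rewrite <- Rpow_mult_distr. assert (0 < h * a1) by pos. assert (h * a1 <= h * A) by mono. nra. }
  apply Rmult_le_compat; [lra|mono|lra|].
  unfold C2. rewrite Rabs_mult. apply Rmult_le_compat; try apply Rabs_pos; [mono|].
  rewrite Rabs_mult, (Rabs_right (a1 ^ 3)) by lra. apply Rmult_le_compat; try lra; [mono|].
  replace (2 * (X + 2 * A ^ 2)) with ((X + 2 * A ^ 2) * 2) by ring.
  unfold Rdiv. rewrite Rabs_mult. apply Rmult_le_compat; try apply Rabs_pos.
  - eapply Rle_trans; [apply Rabs_triang|]. rewrite (Rabs_right (2 * a1 ^ 2)) by lra. lra.
  - rewrite Rabs_right; [|pos]. replace 2 with (/ (1 / 2)) by field. mono. }
 eapply Rle_trans; [apply Rabs_triang|]. rewrite Rabs_Ropp.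
 assert (Ht1 := Rabs_triang (2 * h ^ 2 * (a1 * q1 * (q1 ^ 2 - a1 ^ 2))) (a1 * res)). rewrite T1 in Ht1. lra.
Qed.

Lemma hm_equiv_eps (q : R -> R) (d : R) : hastings_mcleod q -> 0 < d ->
 exists M, forall x, M < x -> Rabs (Ai x - q x) <= d * Rabs (Ai x).
Proof. intros [_ He] Hd. destruct (He (mkposreal d Hd)) as [M HM]. exists M. intros x Hx. exact (HM x Hx). Qed.

(** Chains [r] to the Bessel function, the Bessel function to [h Ai], and [Ai] to [q]. The lower
    bound [c] on [a_k] converts the absolute error of the Airy limit into a relative one;
    [X >= 5832 / d] makes the first ratio accurate to [d]. *)
Lemma sk_right (q : R -> R) (d : R) : hastings_mcleod q -> 0 < d <= 1 / 4 ->
 exists X1, 1 <= X1 /\ forall X, X1 <= X -> exists h0, 0 < h0 /\ forall h, 0 < h <= h0 ->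
  forall k, X <= xk h k <= 2 * X + 3 -> Rabs (sk q h k - 1) <= 4 * d.
Proof. intros Hq Hd. destruct (hm_equiv_eps q d Hq ltac:(lra)) as [M HM]. exists (Rmax (Rmax 1 (M + 1)) (5832 / d)).
 split; [eapply Rle_trans; [apply Rmax_l|apply Rmax_l]|]. intros X HX.
 assert (HX1 : 1 <= X) by (eapply Rle_trans; [|exact HX]; eapply Rle_trans; [apply Rmax_l|apply Rmax_l]).
 assert (HXM : M + 1 <= X) by (eapply Rle_trans; [|exact HX]; eapply Rle_trans; [apply Rmax_r|apply Rmax_l]).
 assert (HXd : 5832 / d <= X) by (eapply Rle_trans; [|exact HX]; apply Rmax_r).
 destruct (ak_lower_right (2 * X + 3) ltac:(lra)) as [c [Hc Hlow]]. assert (Hdc : 0 < d * c) by mono.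
 destruct (bj_Ai_lim 0 (d * c) ltac:(lra) Hdc) as [h1 [Hh1 HAi]].
 exists (Rmin h1 (1 / 40)). split; [apply Rmin_glb_lt; lra|]. intros h [Hh Hhm] k Hk.
 assert (Hm1 := Rmin_l h1 (1 / 40)). assert (Hm2 := Rmin_r h1 (1 / 40)). assert (HD : 5832 * exp (- xk h k) <= d).
 { assert (H1 := exp_ineq1_le (xk h k)). rewrite exp_Ropp. apply (div_le_intro 5832); [mono|].
  apply (Rmult_le_compat_r d) in HXd; [|lra]. replace (5832 / d * d) with 5832 in HXd by (field; lra).
  assert (d * X <= d * exp (xk h k)) by mono. lra. }
 destruct (rs_bj_ratio h k ltac:(lra) ltac:(lra) ltac:(lra)) as [[HJ0 HJ1] HJ2].
 specialize (HAi h ltac:(lra) k ltac:(lra)). specialize (HM (xk h k) ltac:(lra)).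
 specialize (Hlow h ltac:(lra) k ltac:(lra)). rewrite rs_ak in HJ1, HJ2 by exact Hh.
 set (a := ak h k) in *. set (J := bj k (th h) / h) in *. set (A := Ai (xk h k)) in *.
 assert (EJ : bj k (th h) = h * J) by (unfold J; field; lra). rewrite EJ in *.
 assert (HJa : J <= a) by (apply (Rmult_le_reg_l h); lra). assert (HJb : a * (1 - d) <= J).
 { apply (Rmult_le_reg_l h); [lra|]. eapply Rle_trans; [|exact HJ2]. rewrite Rmult_assoc. mono. }
 assert (Hdca : d * c <= d * a) by mono. apply Rabs_le_between in HAi. assert (HAabs : Rabs A <= 3 / 2 * a).
 { apply Rabs_le. assert (d * a <= 1 / 4 * a) by mono. split; lra. }
 assert (HdA : d * Rabs A <= d * (3 / 2 * a)) by mono. apply Rabs_le_between in HM.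
 unfold sk. fold a. replace (qk q h k / a - 1) with ((qk q h k - a) / a) by (field; lra).
 unfold Rdiv. rewrite Rabs_mult, (Rabs_right (/ a)) by (left; apply Rinv_0_lt_compat; lra).
 apply (div_le_intro (Rabs (qk q h k - a))); [lra|]. unfold qk. apply Rabs_le. split; lra.
Qed.

(** A discrete mean value theorem. If every increment exceeded [dl] in modulus, then, as [V] hardly
    changes in one step, no two consecutive increments could have opposite signs; all of one sign,
    they would add up to more than the allowed total. *)
Lemma small_increment (s V a : nat -> R) (dl : R) (n0 n : nat) : 0 < dl -> (forall k, 0 < a k) ->
 (forall k, s (S k) - s k = V k / (a k * a (S k))) ->
 (forall k, (n0 <= k < n0 + n)%nat -> Rabs (V (S k) - V k) <= dl * (a k * a (S k))) ->
 Rabs (s (n0 + n)%nat - s n0) < INR n * dl -> (1 <= n)%nat ->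
 exists k, (n0 <= k < n0 + n)%nat /\ Rabs (s (S k) - s k) <= dl.
Proof. intros Hdl Ha Hs HV Htot Hn. assert (HVs : forall k, V k = (s (S k) - s k) * (a k * a (S k))).
 { intros k. rewrite Hs. field. assert (H1 := Ha k). assert (H2 := Ha (S k)). lra. }
 assert (Hind : forall m, (S m <= n)%nat -> (exists k, (n0 <= k < n0 + n)%nat /\ Rabs (s (S k) - s k) <= dl) \/
  (INR (S m) * dl <= s (n0 + S m)%nat - s n0 /\ dl < s (S (n0 + m)) - s (n0 + m)%nat) \/
  (s (n0 + S m)%nat - s n0 <= - (INR (S m) * dl) /\ s (S (n0 + m)) - s (n0 + m)%nat < - dl)).
 { induction m as [|m IH]; intros Hm.
  - destruct (Rle_lt_dec (Rabs (s (S n0) - s n0)) dl) as [H|H].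
   + left. exists n0. split; [lia|exact H].
   + right. simpl INR. rewrite Nat.add_0_r, Nat.add_1_r. unfold Rabs in H. destruct (Rcase_abs _); [right|left]; lra.
  - destruct (IH ltac:(lia)) as [H|H]; [left; exact H|].
   destruct (Rle_lt_dec (Rabs (s (S (n0 + S m)) - s (n0 + S m)%nat)) dl) as [Hle|Hgt].
   { left. exists (n0 + S m)%nat. split; [lia|exact Hle]. }
   right. assert (HVk := HV (n0 + m)%nat ltac:(lia)).
   assert (E1 := HVs (n0 + m)%nat). assert (E2 := HVs (S (n0 + m))).
   replace (n0 + S m)%nat with (S (n0 + m)) in * by lia. replace (n0 + S (S m))%nat with (S (S (n0 + m))) by lia.
   assert (P1 : 0 < a (n0 + m)%nat * a (S (n0 + m))) by (apply Rmult_lt_0_compat; apply Ha).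
   assert (P2 : 0 < a (S (n0 + m)) * a (S (S (n0 + m)))) by (apply Rmult_lt_0_compat; apply Ha).
   set (D1 := s (S (n0 + m)) - s (n0 + m)%nat) in *. set (D2 := s (S (S (n0 + m))) - s (S (n0 + m))) in *.
   rewrite (S_INR (S m)). apply Rabs_le_between in HVk. rewrite E1, E2 in HVk.
   assert (Htel : s (S (S (n0 + m))) - s n0 = D2 + (s (S (n0 + m)) - s n0)) by (unfold D2; ring).
   rewrite Htel. unfold Rabs in Hgt. destruct H as [[H1 H2]|[H1 H2]]; destruct (Rcase_abs D2).
   + exfalso. nra.
   + left. lra.
   + right. lra.
   + exfalso. nra. }
 destruct n as [|n]; [lia|]. destruct (Hind n ltac:(lia)) as [H|[[H _]|[H _]]]; [exact H| |]; exfalso.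
 - assert (H' := Rle_abs (s (n0 + S n)%nat - s n0)). lra.
 - assert (H' := Rle_abs (- (s (n0 + S n)%nat - s n0))). rewrite Rabs_Ropp in H'. lra.
Qed.

Lemma exp_neg2_step (x h : R) : 0 <= h <= 1 / 2 -> exp (-2 * (x + h)) + 2 * h * exp (-2 * (x + h)) <= exp (-2 * x) /\
 h * exp (-2 * x) <= exp (-2 * x) - exp (-2 * (x + h)).
Proof. intros Hh. assert (He := exp_pos (-2 * x)). assert (E : exp (-2 * x) = exp (-2 * (x + h)) * exp (2 * h)).
 { rewrite <- exp_plus. f_equal. ring. }
 assert (E' : exp (-2 * (x + h)) = exp (-2 * x) * exp (- (2 * h))). { rewrite <- exp_plus. f_equal. ring. }
 assert (H1 := exp_ineq1_le (2 * h)). assert (H2 := one_minus_exp_ge (2 * h) ltac:(lra)).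
 split; [rewrite E; nra|rewrite E'; nra].
Qed.

Lemma sk_cubic (s e : R) : Rabs (s - 1) <= e -> e <= 1 -> Rabs s * Rabs (s ^ 2 - 1) <= 6 * e.
Proof. intros Hs He. replace (s ^ 2 - 1) with ((s - 1) * (s + 1)) by ring. rewrite Rabs_mult.
 assert (H0 := Rabs_pos (s - 1)). apply Rabs_le_between in Hs as Hs'.
 assert (H1 : Rabs s <= 2) by (apply Rabs_le; lra). assert (H2 : Rabs (s + 1) <= 3) by (apply Rabs_le; lra).
 assert (H3 := Rabs_pos s). assert (H4 := Rabs_pos (s + 1)). apply Rle_trans with (2 * (e * 3)); [|lra]. mono.
Qed.

(* Discrete Gronwall estimate from the right, normalised by the decreasing sequence [ak]. *)
Lemma sk_backward (q : R -> R) (h x0 e e0 e1 C2 c : R) (K : nat) :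
 0 < h <= 1 / 100 -> 0 < c -> 0 <= C2 -> 0 <= e -> 0 <= e0 -> (forall k, (k <= S K)%nat -> c <= ak h k) ->
 (forall k, (k < K)%nat -> x0 <= xk h k -> Rabs (Vk q h (S k) - Vk q h k) <=
  2 * h ^ 2 * ak h (S k) ^ 4 * (Rabs (sk q h (S k)) * Rabs (sk q h (S k) ^ 2 - 1)) + C2 * h ^ 3) ->
 Rabs (sk q h K - 1) <= e -> Rabs (Vk q h K) <= ak h K * ak h (S K) * (h * e0) ->
 e0 + C2 / c ^ 2 * h * (xk h K - x0) <= e1 -> (e + (xk h K - x0) * e1) * exp (4374 * exp (-2 * x0)) <= 1 ->
 forall i, (i <= K)%nat -> x0 <= xk h (K - i) ->
 Rabs (sk q h (K - i) - 1) <= (e + (xk h K - xk h (K - i)) * e1) * exp (4374 * exp (-2 * xk h (K - i))) /\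
 Rabs (Vk q h (K - i)) <= ak h (K - i) * ak h (S (K - i)) * (h * (e0 + C2 / c ^ 2 * h * (xk h K - xk h (K - i)) +
  ((e + (xk h K - xk h (K - i)) * e1) * exp (4374 * exp (-2 * xk h (K - i)))) * (4374 * exp (-2 * xk h (K - i))))).
Proof. intros Hh Hc HC2 He He0 Hlow HV HK HVK He1 Hone. assert (HC5 : 0 <= C2 / c ^ 2) by mono.
 set (C5 := C2 / c ^ 2) in *. induction i as [|i IH]; intros Hi Hx.
 - rewrite Nat.sub_0_r in *. assert (Hbig : 1 <= exp (4374 * exp (-2 * xk h K))).
  { rewrite <- exp_0. apply exp_le_mono. assert (H := exp_pos (-2 * xk h K)). lra. }
  replace (xk h K - xk h K) with 0 by ring. split.
  + eapply Rle_trans; [exact HK|]. nra.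
  + eapply Rle_trans; [exact HVK|]. assert (Ha := ak_pos h K ltac:(lra)). assert (Ha' := ak_pos h (S K) ltac:(lra)).
   apply Rmult_le_compat_l; [mono|]. apply Rmult_le_compat_l; [lra|].
   assert (0 <= (e + 0 * e1) * exp (4374 * exp (-2 * xk h K)) * (4374 * exp (-2 * xk h K))); [|lra].
   assert (H := exp_pos (-2 * xk h K)). mono.
 - set (k := (K - S i)%nat) in *. replace (K - i)%nat with (S k) in IH by (unfold k; lia).
  assert (Ex : xk h (S k) = xk h k + h) by apply xk_S. destruct (IH ltac:(lia) ltac:(lra)) as [I1 I2]. clear IH.
  assert (HkK : (k < K)%nat) by (unfold k; lia). assert (HV' := HV k HkK Hx). assert (HxK : xk h (S k) <= xk h K).
  { replace K with (S k + i)%nat by (unfold k; lia). rewrite xk_add.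
   assert (H := pos_INR i). assert (0 <= INR i * h) by mono. lra. }
  assert (He10 : 0 <= e1). { assert (0 <= C5 * h * (xk h K - x0)) by mono. lra. }
  set (x1 := xk h (S k)) in *. set (x := xk h k) in *. set (xK := xk h K) in *. set (p1 := e + (xK - x1) * e1) in *.
  assert (Hp1 : 0 <= p1) by (unfold p1; assert (0 <= (xK - x1) * e1) by mono; lra).
  destruct (exp_neg2_step x h ltac:(lra)) as [S1 S2]. rewrite <- Ex in S1, S2.
  assert (Hg1 := exp_pos (-2 * x1)). assert (Hg := exp_pos (-2 * x)).
  set (g1 := exp (-2 * x1)) in *. set (g := exp (-2 * x)) in *. assert (HG1 := exp_pos (4374 * g1)).
  (* The smallness hypothesis keeps the ratio within distance 1 of 1, as [sk_cubic] requires for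
     linearising the source. *)
  set (Y1 := p1 * exp (4374 * g1)) in *. assert (HY0 : 0 <= Y1) by (apply Rmult_le_pos; lra). assert (HY1 : Y1 <= 1).
  { eapply Rle_trans; [|exact Hone]. apply Rmult_le_compat; [exact Hp1|lra| |].
   - unfold p1. assert ((xK - x1) * e1 <= (xK - x0) * e1) by mono. lra.
   - apply exp_le_mono. apply Rmult_le_compat_l; [lra|]. apply exp_le_mono. lra. }
  assert (Hcub := sk_cubic _ _ I1 HY1).
  assert (Ha0 := ak_pos h k ltac:(lra)). assert (Ha1 := ak_pos h (S k) ltac:(lra)).
  assert (Ha2 := ak_pos h (S (S k)) ltac:(lra)).
  assert (Hm01 : ak h (S k) <= ak h k) by (apply ak_antitone; [lra|lia]).
  assert (Hm12 : ak h (S (S k)) <= ak h (S k)) by (apply ak_antitone; [lra|lia]).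
  assert (Hexp := ak_exp h (S k) ltac:(lra)). fold x1 in Hexp.
  assert (Hl0 := Hlow k ltac:(lia)). assert (Hl1 := Hlow (S k) ltac:(lia)). assert (Hsq : ak h (S k) ^ 2 <= 729 * g1).
  { replace (729 * g1) with ((27 * exp (- x1)) ^ 2).
   - apply pow_incr; lra.
   - unfold g1. replace (-2 * x1) with (- x1 + - x1) by ring. rewrite exp_plus. ring. }
  set (a0 := ak h k) in *. set (a1 := ak h (S k)) in *. set (a2 := ak h (S (S k))) in *.
  assert (HC5' : C2 * h ^ 3 <= a0 * a1 * (h * (C5 * h * h))).
  { replace (a0 * a1 * (h * (C5 * h * h))) with (C5 * h ^ 3 * (a0 * a1)) by ring.
   replace (C2 * h ^ 3) with (C5 * h ^ 3 * (c * c)) by (unfold C5; field; lra). mono. }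
  assert (Ha4 : a1 ^ 4 <= 729 * g1 * (a0 * a1)). { replace (a1 ^ 4) with (a1 ^ 2 * (a1 * a1)) by ring. mono. }
  assert (Ha01 : 0 < a0 * a1) by mono. assert (Hh2 : 0 < h ^ 2) by mono.
  (* [8748 = 2 * 729 * 6], with 729 from [ak_exp] squared and 6 from [sk_cubic]. Summing
     [8748 h e ^ (-2 x)] from the right gives [4374 e ^ (-2 x)], the exponent of the Gronwall
     factor. *)
  assert (Hmain : 2 * h ^ 2 * a1 ^ 4 * (Rabs (sk q h (S k)) * Rabs (sk q h (S k) ^ 2 - 1)) <=
   a0 * a1 * (h * (8748 * h * g1 * Y1))). { apply Rle_trans with (2 * h ^ 2 * (729 * g1 * (a0 * a1)) * (6 * Y1)).
   - apply Rmult_le_compat.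
    + mono.
    + mono.
    + mono.
    + exact Hcub.
   - right. ring. }
  assert (Hin : 0 <= h * (e0 + C5 * h * (xK - x1) + Y1 * (4374 * g1))). { apply Rmult_le_pos; [lra|].
   assert (0 <= C5 * h * (xK - x1)) by mono. assert (0 <= Y1 * (4374 * g1)) by mono. lra. }
  assert (HVk : Rabs (Vk q h k) <= a0 * a1 * (h * (e0 + C5 * h * (xK - x) + Y1 * (4374 * g)))).
  { assert (Htr : Rabs (Vk q h k) <= Rabs (Vk q h (S k)) + Rabs (Vk q h (S k) - Vk q h k)).
   { replace (Vk q h k) with (Vk q h (S k) + - (Vk q h (S k) - Vk q h k)) at 1 by ring.
    eapply Rle_trans; [apply Rabs_triang|]. rewrite Rabs_Ropp. lra. }
   assert (Haa : a1 * a2 * (h * (e0 + C5 * h * (xK - x1) + Y1 * (4374 * g1))) <=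
          a0 * a1 * (h * (e0 + C5 * h * (xK - x1) + Y1 * (4374 * g1)))). { mono. }
   assert (Hsum : a0 * a1 * (h * (e0 + C5 * h * (xK - x1) + Y1 * (4374 * g1))) +
    a0 * a1 * (h * (8748 * h * g1 * Y1)) + a0 * a1 * (h * (C5 * h * h)) <=
    a0 * a1 * (h * (e0 + C5 * h * (xK - x) + Y1 * (4374 * g)))).
   { rewrite <- !Rmult_plus_distr_l. apply Rmult_le_compat_l; [lra|]. apply Rmult_le_compat_l; [lra|].
    replace (C5 * h * (xK - x)) with (C5 * h * (xK - x1) + C5 * h * h) by (rewrite Ex; ring).
    assert (Y1 * (4374 * (g1 + 2 * h * g1)) <= Y1 * (4374 * g)) by mono. lra. }
   lra. }
  set (p := e + (xK - x) * e1) in *. assert (Hpp : p = p1 + h * e1) by (unfold p, p1; rewrite Ex; ring).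
  assert (HG : exp (4374 * g1) * (1 + h * (4374 * g)) <= exp (4374 * g)).
  { replace (4374 * g) with (4374 * g1 + 4374 * (g - g1)) at 2 by ring. rewrite exp_plus.
   apply Rmult_le_compat_l; [lra|]. assert (H := exp_ineq1_le (4374 * (g - g1))). lra. }
  assert (HG1' : 1 <= exp (4374 * g)) by (rewrite <- exp_0; apply exp_le_mono; lra).
  assert (HYs : Y1 * (1 + h * (4374 * g)) + h * e1 <= p * exp (4374 * g)).
  { rewrite Hpp, Rmult_plus_distr_r. apply Rplus_le_compat.
   - unfold Y1. rewrite Rmult_assoc. mono.
   - assert (0 <= h * e1) by mono. nra. }
  split.
  + assert (Hst := sk_step q h k ltac:(lra)). fold a0 a1 in Hst.
   assert (Htr : Rabs (sk q h k - 1) <= Rabs (sk q h (S k) - 1) + Rabs (sk q h (S k) - sk q h k)).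
   { replace (sk q h k - 1) with ((sk q h (S k) - 1) + - (sk q h (S k) - sk q h k)) by ring.
    eapply Rle_trans; [apply Rabs_triang|]. rewrite Rabs_Ropp. lra. }
   assert (Hd : Rabs (sk q h (S k) - sk q h k) <= h * (e0 + C5 * h * (xK - x) + Y1 * (4374 * g))).
   { rewrite Hst. unfold Rdiv. rewrite Rabs_mult, (Rabs_right (/ (a0 * a1))) by (left; apply Rinv_0_lt_compat; lra).
    apply (div_le_intro (Rabs (Vk q h k))); [lra|]. mono. }
   assert (He1' : e0 + C5 * h * (xK - x) <= e1). { assert (C5 * h * (xK - x) <= C5 * h * (xK - x0)). { mono. } lra. }
   assert (h * (e0 + C5 * h * (xK - x) + Y1 * (4374 * g)) <= h * e1 + Y1 * (h * (4374 * g))).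
   { replace (h * e1 + Y1 * (h * (4374 * g))) with (h * (e1 + Y1 * (4374 * g))) by ring. mono. }
   lra.
  + eapply Rle_trans; [exact HVk|]. apply Rmult_le_compat_l; [lra|]. apply Rmult_le_compat_l; [lra|].
   assert (Y1 * (4374 * g) <= p * exp (4374 * g) * (4374 * g)); [|lra]. apply Rmult_le_compat_r; [lra|].
   assert (0 <= Y1 * (h * (4374 * g))) by mono. assert (0 <= h * e1) by mono. lra.
Qed.

Lemma ak_pow4_le (h : R) (k : nat) : 0 < h <= 1 / 2 -> 0 <= xk h (S k) ->
 ak h (S k) ^ 4 <= 729 * (ak h k * ak h (S k)).
Proof. intros Hh Hx. assert (Ha := ak_pos h (S k) ltac:(lra)). assert (He := ak_exp h (S k) ltac:(lra)).
 assert (exp (- xk h (S k)) <= 1) by (rewrite <- exp_0; apply exp_le_mono; lra).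
 assert (ak h (S k) <= ak h k) by (apply ak_antitone; [lra|lia]).
 replace (ak h (S k) ^ 4) with (ak h (S k) ^ 2 * (ak h (S k) * ak h (S k))) by ring.
 apply Rmult_le_compat; [mono|mono| |mono]. replace 729 with (27 ^ 2) by ring. apply pow_incr; lra.
Qed.

Lemma xk_mono (h : R) (n m : nat) : 0 < h -> (n <= m)%nat -> xk h n <= xk h m.
Proof. intros Hh H. replace m with (n + (m - n))%nat by lia. rewrite xk_add.
 assert (0 <= INR (m - n) * h) by mono. lra.
Qed.

(** On a window at the far right the ratio is within [4 d] of 1. [small_increment] finds an index
    [K] in that window with a small increment as well, and [sk_backward] transports both data down
    to [x0], with a factor that depends only on [x0]. *)
Theorem sk_conv (q : R -> R) (x0 B e : R) : hastings_mcleod q -> 0 < e ->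
 exists h0, 0 < h0 /\ forall h, 0 < h <= h0 -> forall k, x0 <= xk h k <= B -> Rabs (sk q h k - 1) <= e.
Proof. intros Hhm He. assert (Hq := proj1 Hhm).
 set (e' := Rmin e 1). assert (He'1 : e' <= 1) by apply Rmin_r. assert (He'e : e' <= e) by apply Rmin_l.
 assert (He' : 0 < e') by (unfold e'; apply Rmin_glb_lt; lra).
 set (G := exp (4374 * exp (-2 * x0))). assert (HG : 0 < G) by apply exp_pos.
 (* [49 + 9 |x0| = 4 + 9 (5 + |x0|)]: the window contributes [4 d], and the slope [e0 = 9 d / X]
    over the length [2 X + 3 - x0] at most [9 d (5 + |x0|)]. *)
 set (D := 49 + 9 * Rabs x0). assert (HD : 0 < D) by (unfold D; assert (H := Rabs_pos x0); lra).
 set (d := Rmin (1 / 4) (e' / (2 * G * D))). assert (Hd0 : 0 < e' / (2 * G * D)) by mono.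
 assert (Hd : 0 < d <= 1 / 4) by (unfold d; split; [apply Rmin_glb_lt; lra|apply Rmin_l]).
 assert (Hdd : d * D * G <= e' / 2). { assert (H : d <= e' / (2 * G * D)) by apply Rmin_r.
  apply (Rmult_le_compat_r (D * G)) in H; [|mono].
  replace (e' / (2 * G * D) * (D * G)) with (e' / 2) in H by (field; lra). lra. }
 destruct (sk_right q d Hhm Hd) as [X1 [HX1 HR]]. set (X := Rmax X1 (Rmax B x0)).
 assert (HXX1 : X1 <= X) by apply Rmax_l. assert (HXB : B <= X) by (eapply Rle_trans; [apply Rmax_l|apply Rmax_r]).
 assert (HXx0 : x0 <= X) by (eapply Rle_trans; [apply Rmax_r|apply Rmax_r]).
 destruct (HR X HXX1) as [hr [Hhr HRX]]. clear HR. destruct (ak_lower_right (2 * X + 3) ltac:(lra)) as [c [Hc Hlow]].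
 destruct (Vk_step q x0 (2 * X + 3) Hq) as [C2 [h1 [HC2 [Hh1 HV]]]].
 set (C5 := C2 / c ^ 2). assert (HC5 : 0 < C5) by (apply Rdiv_lt_0_compat; [lra|mono]).
 (* Across the window the ratio moves by at most [8 d] over a length exceeding [X], so some step has
    slope at most [9 d / X]. *)
 set (e0 := 9 * d / X). assert (He0 : 0 < e0) by (apply Rdiv_lt_0_compat; lra).
 set (L := 2 * X + 3 - x0). assert (HL : 0 < L) by (unfold L; lra). set (h2 := e' / (2 * (L * (C5 * L) * G))).
 assert (HLL : 0 < L * (C5 * L) * G). { mono. }
 assert (Hh2 : 0 < h2) by (apply Rdiv_lt_0_compat; lra).
 set (h3 := e0 / (8748 + C5)). assert (Hh3 : 0 < h3) by (apply Rdiv_lt_0_compat; lra).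
 exists (Rmin (Rmin hr h1) (Rmin (Rmin h2 h3) (1 / 100))). split; [repeat apply Rmin_glb_lt; lra|].
 intros h [Hh Hhmin] k Hk. assert (Q1 := Rmin_l (Rmin hr h1) (Rmin (Rmin h2 h3) (1 / 100))).
 assert (Q2 := Rmin_r (Rmin hr h1) (Rmin (Rmin h2 h3) (1 / 100))).
 assert (Q3 := Rmin_l hr h1). assert (Q4 := Rmin_r hr h1).
 assert (Q5 := Rmin_l (Rmin h2 h3) (1 / 100)). assert (Q6 := Rmin_r (Rmin h2 h3) (1 / 100)).
 assert (Q7 := Rmin_l h2 h3). assert (Q8 := Rmin_r h2 h3).
 assert (Hhr' : 0 < h <= hr) by lra. assert (Hh1' : 0 < h <= h1) by lra.
 assert (Hh2' : h <= h2) by lra. assert (Hh3' : h <= h3) by lra. assert (Hh100 : h <= 1 / 100) by lra.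
 clear Q1 Q2 Q3 Q4 Q5 Q6 Q7 Q8 Hhmin. specialize (HRX h Hhr').
 destruct (base_index h (- X - 1)) as [n0 Hn0]; [lra|assert (H := pow2_ge_0 h); nra|].
 destruct (nfloor_ex ((X + 1) / h)) as [n [Hn1 Hn2]]; [mono|].
 apply (Rmult_le_compat_r h) in Hn1; [|lra]. apply (Rmult_lt_compat_r h) in Hn2; [|lra].
 replace ((X + 1) / h * h) with (X + 1) in * by (field; lra). assert (Hn : (1 <= n)%nat).
 { destruct n; [simpl in Hn2; lra|lia]. }
 assert (Hxn : xk h (n0 + n) = xk h n0 + INR n * h) by apply xk_add.
 assert (HVbound : forall k, (n0 <= k < n0 + n)%nat ->
  Rabs (Vk q h (S k) - Vk q h k) <= h * e0 * (ak h k * ak h (S k))).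
 { intros i Hi. assert (Hxi := xk_mono h n0 i Hh ltac:(lia)).
  assert (Hxi' := xk_mono h (S i) (n0 + n) Hh ltac:(lia)). assert (Exi := xk_S h i).
  eapply Rle_trans; [apply HV; [mono|lra]|].
  assert (Hs := HRX (S i) ltac:(lra)). assert (Hcub := sk_cubic _ _ Hs ltac:(lra)).
  assert (H4 := ak_pow4_le h i ltac:(lra) ltac:(lra)).
  assert (Ha0 := ak_pos h i Hh). assert (Ha1 := ak_pos h (S i) Hh).
  assert (Hl0 := Hlow h ltac:(lra) i ltac:(lra)). assert (Hl1 := Hlow h ltac:(lra) (S i) ltac:(lra)).
  assert (Haa : c * c <= ak h i * ak h (S i)) by mono. set (w := ak h i * ak h (S i)) in *.
  assert (Hw : 0 < w) by (apply Rmult_lt_0_compat; lra). assert (Hhh : 0 < h ^ 2) by mono.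
  assert (B1 : 2 * h ^ 2 * ak h (S i) ^ 4 * (Rabs (sk q h (S i)) * Rabs (sk q h (S i) ^ 2 - 1)) <=
   2 * h ^ 2 * (729 * w) * 6). { apply Rmult_le_compat.
   - mono.
   - mono.
   - mono.
   - lra. }
  assert (B2 : C2 * h ^ 3 <= C5 * h ^ 2 * w).
  { replace (C2 * h ^ 3) with (C5 * h ^ 2 * (h * (c * c))) by (unfold C5; field; lra).
   apply Rmult_le_compat_l; [mono|]. assert (h * (c * c) <= 1 * (c * c)) by mono. lra. }
  assert (B3 : h * (8748 + C5) <= e0). { unfold h3 in Hh3'. apply (Rmult_le_compat_r (8748 + C5)) in Hh3'; [|lra].
   replace (e0 / (8748 + C5) * (8748 + C5)) with e0 in Hh3' by (field; lra). exact Hh3'. }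
  assert (B4 : h * w * (h * (8748 + C5)) <= h * w * e0). { mono. }
  lra. }
 destruct (small_increment (sk q h) (Vk q h) (ak h) (h * e0) n0 n) as [K [HK1 HK2]].
 - mono.
 - intros; apply ak_pos, Hh.
 - intros; apply sk_step, Hh.
 - exact HVbound.
 - assert (S1 := HRX n0 ltac:(lra)). assert (S2 := HRX (n0 + n)%nat ltac:(lra)). absle S1. absle S2.
  assert (HX9 : X * e0 = 9 * d) by (unfold e0; field; lra).
  assert (X * e0 < INR n * h * e0) by (apply Rmult_lt_compat_r; lra). apply Rabs_def1; lra.
 - exact Hn.
 - assert (HxK := xk_mono h n0 K Hh ltac:(lia)).
  assert (HxK' := xk_mono h (S K) (n0 + n) Hh ltac:(lia)). assert (ExK := xk_S h K). assert (HkK : (k <= K)%nat).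
  { destruct (le_lt_dec k K) as [H|H]; [exact H|exfalso]. assert (Hm := xk_mono h (S K) k Hh H). lra. }
  assert (Ha0 := ak_pos h K Hh). assert (Ha1 := ak_pos h (S K) Hh).
  assert (HL1 : xk h K - x0 <= L) by (unfold L; lra). set (e1 := e0 + C5 * h * L).
  assert (He1 : (4 * d + L * e1) * G <= e'). { assert (T1 : L * e0 <= 9 * d * (5 + Rabs x0)).
   { unfold L, e0. replace ((2 * X + 3 - x0) * (9 * d / X)) with (9 * d * ((2 * X + 3 - x0) / X)) by mono.
    apply Rmult_le_compat_l; [lra|]. apply div_le_intro; [lra|]. assert (H := Rle_abs (- x0)). rewrite Rabs_Ropp in H.
    assert (Rabs x0 * 1 <= Rabs x0 * X) by mono. lra. }
   assert (T2 : L * (C5 * h * L) * G <= e' / 2).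
   { unfold h2 in Hh2'. apply (Rmult_le_compat_r (L * (C5 * L) * G)) in Hh2'; [|lra].
    replace (e' / (2 * (L * (C5 * L) * G)) * (L * (C5 * L) * G)) with (e' / 2) in Hh2' by (field; lra). lra. }
   assert (T3 : (4 * d + L * e0) * G <= d * D * G) by (apply Rmult_le_compat_r; [lra|]; unfold D; lra).
   unfold e1. lra. }
  assert (He10 : 0 <= e1) by (unfold e1; assert (0 <= C5 * h * L) by mono; lra).
  assert (Hback : (4 * d + (xk h K - x0) * e1) * G <= e').
  { eapply Rle_trans; [|exact He1]. apply Rmult_le_compat_r; [lra|].
   assert ((xk h K - x0) * e1 <= L * e1) by mono. lra. }
  assert (Hres := sk_backward q h x0 (4 * d) e0 e1 C2 c K ltac:(lra) Hc ltac:(lra) ltac:(lra) ltac:(lra)).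
  destruct (Hres) with (i := (K - k)%nat) as [Hfin _].
  + intros i Hi. apply Hlow; [lra|]. assert (Hm := xk_mono h i (S K) Hh Hi). lra.
  + intros i Hi Hxi. apply HV; [mono|]. assert (Exi := xk_S h i). assert (Hm := xk_mono h (S i) K Hh ltac:(lia)). lra.
  + apply HRX. lra.
  + assert (Est := sk_step q h K Hh).
   assert (EV : Vk q h K = (sk q h (S K) - sk q h K) * (ak h K * ak h (S K))) by (rewrite Est; field; lra).
   rewrite EV, Rabs_mult, (Rabs_right (ak h K * ak h (S K))) by (left; apply Rmult_lt_0_compat; lra).
   rewrite Rmult_comm. mono.
  + fold C5. unfold e1. apply Rplus_le_compat_l. mono.
  + fold G. lra.
  + lia.
  + replace (K - (K - k))%nat with k by lia. lra.
  + replace (K - (K - k))%nat with k in Hfin by lia.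
   eapply Rle_trans; [exact Hfin|]. eapply Rle_trans; [|exact He'e]. eapply Rle_trans; [|exact Hback].
   apply Rmult_le_compat.
   * assert (0 <= (xk h K - xk h k) * e1) by mono. lra.
   * left; apply exp_pos.
   * assert ((xk h K - xk h k) * e1 <= (xk h K - x0) * e1) by mono. lra.
   * apply exp_le_mono. mono.
Qed.

Lemma grid_point (h x : R) : 0 < h -> -2 <= x * h ^ 2 -> exists k, x - h < xk h k <= x.
Proof. intros Hh Hx. destruct (nfloor_ex ((x + 2 / h ^ 2) / h)) as [k [H1 H2]]. { apply Rdiv_le_0_compat; [|exact Hh].
  assert (0 < h ^ 2) by mono. replace (x + 2 / h ^ 2) with ((x * h ^ 2 + 2) / h ^ 2) by (field; lra). mono. }
 exists k. apply (Rmult_le_compat_r h) in H1; [|lra]. apply (Rmult_lt_compat_r h) in H2; [|lra].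
 replace ((x + 2 / h ^ 2) / h * h) with (x + 2 / h ^ 2) in * by (field; lra). unfold xk. lra.
Qed.

Lemma grid_near (h0 x e : R) : 0 < h0 -> 0 < e -> exists h k, 0 < h <= h0 /\ h < e /\ x - e < xk h k <= x.
Proof. intros Hh He. set (h := Rmin (Rmin h0 (e / 2)) (/ (1 + Rabs x))). assert (Hx := Rabs_pos x).
 assert (0 < / (1 + Rabs x)) by mono. assert (H0 : 0 < h) by (unfold h; repeat apply Rmin_glb_lt; lra).
 assert (h <= h0) by (eapply Rle_trans; [apply Rmin_l|apply Rmin_l]).
 assert (h <= e / 2) by (eapply Rle_trans; [apply Rmin_l|apply Rmin_r]).
 assert (H3 : h <= / (1 + Rabs x)) by apply Rmin_r. destruct (grid_point h x H0) as [k Hk].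
 { apply (Rmult_le_compat_r (1 + Rabs x)) in H3; [|lra]. rewrite Rinv_l in H3 by lra.
  assert (H4 := Rle_abs (- x)). rewrite Rabs_Ropp in H4. nra. }
 exists h, k. lra.
Qed.

(** The bound on [a_k] passes to [q] at nearby grid points, where the ratio is at most 2, and then
    to [x] by continuity: [2 * 27 = 54], and the rest of 60 is room for moving off the grid. *)
Lemma q_abs_exp (q : R -> R) (x : R) : hastings_mcleod q -> Rabs (q x) <= 60 * exp (- x).
Proof. intros Hhm. assert (Hq := proj1 Hhm).
 destruct (Rle_lt_dec (Rabs (q x)) (60 * exp (- x))) as [H|H]; [exact H|exfalso]. assert (Hep := exp_pos (- x)).
 destruct (continuous_eps q x (exp (- x)) (q_cont q x Hq) Hep) as [d [Hd Hcont]].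
 destruct (sk_conv q (x - 1) x 1 Hhm ltac:(lra)) as [h0 [Hh0 Hs]].
 destruct (grid_near (Rmin h0 (1 / 100)) x (Rmin d (1 / 100))) as [h [k [[Hh Hhm'] [Hhe Hk]]]].
 { apply Rmin_glb_lt; lra. } { apply Rmin_glb_lt; lra. }
 assert (M1 := Rmin_l h0 (1 / 100)). assert (M3 := Rmin_l d (1 / 100)). assert (M4 := Rmin_r d (1 / 100)).
 specialize (Hs h ltac:(lra) k ltac:(lra)). specialize (Hcont (xk h k)). assert (Rabs (q (xk h k) - q x) < exp (- x)).
 { apply Hcont. rewrite Rabs_left1; lra. }
 assert (Ha := ak_exp h k ltac:(lra)). assert (Hap := ak_pos h k Hh). assert (Eq := qk_sk q h k Hh). unfold qk in Eq.
 assert (exp (- xk h k) <= exp (- x) * (101 / 100 + 1 / 100)). { apply Rle_trans with (exp (- x + 1 / 100)); [mono|].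
  rewrite exp_plus. apply Rmult_le_compat_l; [lra|].
  assert (H1 := exp_ineq1_le (- (1 / 100))). replace (1 / 100) with (- - (1 / 100)) at 1 by ring.
  rewrite exp_Ropp. apply Rle_trans with (/ (99 / 100)); [mono|lra]. }
 assert (Rabs (q (xk h k)) <= 2 * ak h k).
 { rewrite Eq, Rabs_mult, (Rabs_right (ak h k)) by lra. apply Rmult_le_compat_r; [lra|].
  absle Hs. apply Rabs_le; lra. }
 assert (Rabs (q x) <= Rabs (q (xk h k)) + Rabs (q (xk h k) - q x)).
 { replace (q x) with (q (xk h k) + - (q (xk h k) - q x)) at 1 by ring.
  eapply Rle_trans; [apply Rabs_triang|]. rewrite Rabs_Ropp. lra. }
 lra.
Qed.

(** * Riemann sums *)

(** [w a] dominates all integrals beyond [a]; completeness then yields convergence together with the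
    rate [w]. *)
Lemma improper_exists (f w : R -> R) (x : R) : (forall a b, ex_RInt f a b) ->
 (forall a b, x <= a -> a <= b -> Rabs (RInt f a b) <= w a) ->
 (forall e, 0 < e -> exists M, forall a, M <= a -> w a < e) ->
 forall b, x <= b -> Rabs (RInt f x b - int_to_pinfty f x) <= w b.
Proof. intros Hex Hw Hsmall. assert (Hdiff : forall a b, x <= a -> a <= b -> Rabs (RInt f x b - RInt f x a) <= w a).
 { intros a b Ha Hab. rewrite <- (RInt_chasles_R f x a b) by apply Hex.
  eapply Rle_trans; [|apply (Hw a b); assumption]. right; f_equal. mono. }
 set (u := fun n : nat => RInt f x (x + INR n)). assert (Hc : ex_finite_lim_seq u).
 { apply ex_lim_seq_cauchy_corr. intros e. destruct (Hsmall e (cond_pos e)) as [M HM].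
  destruct (nfloor_ex (Rabs (M - x)) (Rabs_pos _)) as [N [_ HN]]. exists (S N). assert (Hmx := Rle_abs (M - x)).
  assert (Hmon : forall n m, (S N <= n)%nat -> (n <= m)%nat -> Rabs (u m - u n) < e).
  { intros n m Hn Hnm. assert (INR N + 1 <= INR n) by (rewrite <- S_INR; apply le_INR, Hn).
   assert (INR n <= INR m) by (apply le_INR, Hnm). assert (H1 := HM (x + INR n) ltac:(lra)). assert (Hp := pos_INR n).
   eapply Rle_lt_trans; [|exact H1]. apply Hdiff; lra. }
  intros n m Hn Hm. destruct (le_lt_dec n m) as [H|H].
  - rewrite Rabs_minus_sym. apply Hmon; assumption.
  - apply Hmon; [assumption|lia]. }
 destruct Hc as [l Hl]. assert (Hlim : forall a, x <= a -> Rabs (RInt f x a - l) <= w a).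
 { intros a Ha. destruct (nfloor_ex (a - x) ltac:(lra)) as [N [_ HN]].
  assert (HL : is_lim_seq (fun n => Rabs (RInt f x a - u n)) (Rabs (RInt f x a - l))).
  { apply (is_lim_seq_abs (fun n => RInt f x a - u n) (RInt f x a - l)).
   apply is_lim_seq_minus'; [apply is_lim_seq_const|exact Hl]. }
  apply (is_lim_seq_incr_n _ (S N)) in HL. assert (HR : Rbar_le (Rabs (RInt f x a - l)) (w a)); [|exact HR].
  apply (is_lim_seq_le (fun n => Rabs (RInt f x a - u (n + S N)%nat)) (fun _ => w a));
   [|exact HL|apply is_lim_seq_const]. intros n. rewrite Rabs_minus_sym. apply Hdiff; [exact Ha|].
  assert (INR N + 1 <= INR (n + S N)) by (rewrite <- S_INR; apply le_INR; lia). lra. }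
 assert (HA : int_to_pinfty f x = l). { apply int_to_pinfty_lim.
  - intros; apply Hex.
  - intros e He. destruct (Hsmall e He) as [M HM]. exists M. intros b Hb Hxb.
   eapply Rle_lt_trans; [apply Hlim, Hxb|]. apply HM; lra. }
 rewrite HA. exact Hlim.
Qed.

Lemma exp_RInt_bound (f : R -> R) (C x a b : R) : (forall s, ex_derive f s) ->
 (forall s, x <= s -> Rabs (f s) <= C * exp (- s)) -> x <= a -> a <= b -> Rabs (RInt f a b) <= C * exp (- a).
Proof. intros Hf HC Ha Hab. assert (DK : forall s, is_derive (fun s => - (C * exp (- s))) s (C * exp (- s))).
 { intros s. auto_derive; [exact I|ring]. }
 assert (DH : forall s, is_derive (fun s => RInt f a s) s (f s)) by (intros s; apply RInt_derive_upper, Hf).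
 assert (H1 : - (C * exp (- a)) - RInt f a a <= - (C * exp (- b)) - RInt f a b).
 { apply (incr_le (fun s => - (C * exp (- s)) - RInt f a s) (fun s => C * exp (- s) - f s)); [exact Hab| |].
  - intros s _. apply is_derive_minusR; [apply DK|apply DH].
  - intros s Hs. specialize (HC s ltac:(lra)). absle HC. lra. }
 assert (H2 : - (C * exp (- a)) + RInt f a a <= - (C * exp (- b)) + RInt f a b).
 { apply (incr_le (fun s => - (C * exp (- s)) + RInt f a s) (fun s => C * exp (- s) + f s)); [exact Hab| |].
  - intros s _. apply is_derive_plusR; [apply DK|apply DH].
  - intros s Hs. specialize (HC s ltac:(lra)). absle HC. lra. }
 rewrite RInt_point in H1, H2. change (@zero R_CompleteNormedModule) with 0 in *.
 assert (Hb := HC b ltac:(lra)). assert (Hb' := Rabs_pos (f b)). apply Rabs_le. lra.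
Qed.

Lemma exp_small (C e : R) : 0 <= C -> 0 < e -> exists M, forall a, M <= a -> C * exp (- a) < e.
Proof. intros HC He. exists (C / e). intros a Ha. assert (H := exp_ineq1_le a). rewrite exp_Ropp.
 assert (Hp := exp_pos a). apply (Rmult_lt_reg_r (exp a)); [exact Hp|]. rewrite Rmult_assoc, Rinv_l by lra.
 apply (Rmult_le_compat_l e) in Ha; [|lra]. replace (e * (C / e)) with C in Ha by (field; lra). nra.
Qed.

Lemma exp_improper (f : R -> R) (C x : R) : (forall s, ex_derive f s) ->
 (forall s, x <= s -> Rabs (f s) <= C * exp (- s)) ->
 forall b, x <= b -> Rabs (RInt f x b - int_to_pinfty f x) <= C * exp (- b).
Proof. intros Hf HC. apply (improper_exists f (fun a => C * exp (- a)) x).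
 - intros; apply ex_RInt_derivable, Hf.
 - intros a b Ha Hab. apply (exp_RInt_bound f C x); assumption.
 - intros e He. apply exp_small; [|exact He].
  assert (H := HC x ltac:(lra)). assert (H' := Rabs_pos (f x)). assert (H2 := exp_pos (- x)).
  destruct (Rle_lt_dec 0 C); [mono|]. assert (C * exp (- x) < 0) by nra. lra.
Qed.

Lemma riemann_step (f df : R -> R) (y h M : R) : 0 <= h -> (forall s, is_derive f s (df s)) ->
 (forall s, y <= s <= y + h -> Rabs (df s) <= M) -> Rabs (h * f (y + h) - RInt f y (y + h)) <= M * h ^ 2.
Proof. intros Hh Hf HM. set (D := fun s => s * f (y + s) - RInt f y (y + s)).
 assert (DD : forall s, is_derive D s (s * df (y + s))). { intros s. unfold D.
  assert (D1 : is_derive (fun s => f (y + s)) s (df (y + s))). { replace (df (y + s)) with (1 * df (y + s)) by ring.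
   apply (is_derive_comp f (fun s => y + s) s (df (y + s)) 1); [apply Hf|]. auto_derive; [exact I|ring]. }
  assert (D2 : is_derive (fun s => RInt f y (y + s)) s (f (y + s))).
  { replace (f (y + s)) with (1 * f (y + s)) by ring.
   apply (is_derive_comp (fun s => RInt f y s) (fun s => y + s) s (f (y + s)) 1).
   - apply RInt_derive_upper. intros z; eexists; apply Hf.
   - auto_derive; [exact I|ring]. }
  replace (s * df (y + s)) with (1 * f (y + s) + s * df (y + s) - f (y + s)) by ring.
  apply is_derive_minusR; [|exact D2]. apply (is_derive_multR (fun s => s) (fun s => f (y + s))); [apply is_derive_idR|exact D1]. }
 assert (D0 : D 0 = 0).
 { unfold D. rewrite Rplus_0_r, RInt_point. change (@zero R_CompleteNormedModule) with 0. ring. }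
 assert (HM0 : 0 <= M) by (assert (H := HM y ltac:(lra)); assert (H' := Rabs_pos (df y)); lra).
 change (Rabs (D h) <= M * h ^ 2).
 assert (Hb : forall s, 0 <= s <= h -> - (M * (2 * s)) <= s * df (y + s) <= M * (2 * s)).
 { intros s Hs. specialize (HM (y + s) ltac:(lra)). absle HM. nra. }
 apply Rabs_le. split.
 - assert (H : D 0 + M * 0 ^ 2 <= D h + M * h ^ 2); [|mono].
  apply (incr_le (fun s => D s + M * s ^ 2) (fun s => s * df (y + s) + M * (2 * s))); [exact Hh| |].
  + intros s _. apply is_derive_plusR; [apply DD|]. auto_derive; [exact I|ring].
  + intros s Hs. specialize (Hb s Hs). lra.
 - assert (H : M * 0 ^ 2 - D 0 <= M * h ^ 2 - D h); [|mono].
  apply (incr_le (fun s => M * s ^ 2 - D s) (fun s => M * (2 * s) - s * df (y + s))); [exact Hh| |].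
  + intros s _. apply is_derive_minusR; [|apply DD]. auto_derive; [exact I|ring].
  + intros s Hs. specialize (Hb s Hs). lra.
Qed.

Lemma riemann_sum (f df : R -> R) (x h M : R) (m : nat) : 0 <= h -> (forall s, is_derive f s (df s)) ->
 (forall s, x <= s <= x + INR m * h -> Rabs (df s) <= M) ->
 Rabs (bsum (fun j => h * f (x + INR j * h)) m - RInt f x (x + INR m * h)) <= INR m * (M * h ^ 2).
Proof. intros Hh Hf. induction m as [|m IH]; intros HM.
 - simpl bsum. simpl INR. rewrite Rmult_0_l, Rplus_0_r, RInt_point.
  change (@zero R_CompleteNormedModule) with 0. rewrite Rminus_0_r, Rabs_R0. lra.
 - rewrite S_INR in HM. assert (0 <= INR m * h) by mono. assert (IH' := IH ltac:(intros s Hs; apply HM; lra)).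
  set (y := x + INR m * h) in *. assert (Ey : x + INR (S m) * h = y + h) by (rewrite S_INR; unfold y; ring).
  assert (Hst := riemann_step f df y h M Hh Hf ltac:(intros s Hs; apply HM; unfold y in Hs; lra)).
  assert (Hex : forall a b, ex_RInt f a b) by (intros; apply ex_RInt_derivable; intros z; eexists; apply Hf).
  rewrite Ey. rewrite <- (RInt_chasles_R f x y (y + h)) by apply Hex.
  simpl bsum. change (x + match m with O => 1 | S _ => INR m + 1 end * h) with (x + INR (S m) * h).
  rewrite Ey. rewrite (S_INR m). set (b := bsum (fun j => h * f (x + INR j * h)) m) in *.
  set (i1 := RInt f x y) in *. set (i2 := RInt f y (y + h)) in *.
  replace (b + h * f (y + h) - (i1 + i2)) with ((b - i1) + (h * f (y + h) - i2)) by mono.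
  eapply Rle_trans; [apply Rabs_triang|]. lra.
Qed.

Lemma exp_tail_sum (u : nat -> R) (C h y : R) (m : nat) : 0 <= C -> 0 <= h ->
 (forall j, (1 <= j <= m)%nat -> Rabs (u j) <= h * (C * exp (- (y + INR j * h)))) ->
 Rabs (bsum u m) <= C * (exp (- y) - exp (- (y + INR m * h))).
Proof. intros HC Hh. induction m as [|m IH]; intros Hu.
 - simpl. rewrite Rabs_R0, Rmult_0_l, Rplus_0_r. lra.
 - assert (IH' := IH ltac:(intros j Hj; apply Hu; lia)). specialize (Hu (S m) ltac:(lia)).
  simpl bsum. eapply Rle_trans; [apply Rabs_triang|]. set (z := y + INR m * h) in *.
  assert (Ez : y + INR (S m) * h = z + h) by (rewrite S_INR; unfold z; ring). rewrite Ez in *.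
  assert (E : exp (- z) = exp (- (z + h)) * exp h) by (rewrite <- exp_plus; f_equal; ring).
  assert (He := exp_ineq1_le h). assert (Hp := exp_pos (- (z + h))).
  assert (exp (- (z + h)) * (1 + h) <= exp (- z)) by (rewrite E; apply Rmult_le_compat_l; lra).
  assert (C * (h * exp (- (z + h))) <= C * (exp (- z) - exp (- (z + h)))) by mono. lra.
Qed.

(** A Riemann sum up to [X] and two exponential tails, one of the sum and one of the integral. The
    sum stops at some [y >= X - 1], whence a factor [e <= 3] for each tail and the total 6. *)
Lemma sum_conv (f df : R -> R) (u : nat -> R) (h x X C M e U : R) :
 0 < h <= 1 -> x <= X -> 0 <= e -> (forall s, is_derive f s (df s)) ->
 (forall s, x <= s <= X -> Rabs (df s) <= M) -> (forall s, x <= s -> Rabs (f s) <= C * exp (- s)) ->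
 (forall j, (1 <= j)%nat -> x + INR j * h <= X -> Rabs (u j - h * f (x + INR j * h)) <= h * e) ->
 (forall j, (1 <= j)%nat -> Rabs (u j) <= h * (C * exp (- (x + INR j * h)))) -> is_lim_seq (bsum u) U ->
 Rabs (U - int_to_pinfty f x) <= (X - x) * (e + M * h) + 6 * C * exp (- X).
Proof. intros Hh HxX He Hf HM HC Hu Htail Hlim. assert (HC0 : 0 <= C).
 { assert (H := HC x ltac:(lra)). assert (H' := Rabs_pos (f x)). assert (H2 := exp_pos (- x)).
  destruct (Rle_lt_dec 0 C); [mono|]. assert (C * exp (- x) < 0) by nra. lra. }
 assert (HM0 : 0 <= M) by (assert (H := HM x ltac:(lra)); assert (H' := Rabs_pos (df x)); lra).
 destruct (nfloor_ex ((X - x) / h)) as [m [Hm1 Hm2]]; [mono|].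
 apply (Rmult_le_compat_r h) in Hm1; [|lra]. apply (Rmult_lt_compat_r h) in Hm2; [|lra].
 replace ((X - x) / h * h) with (X - x) in * by (field; lra). set (y := x + INR m * h).
 assert (Hy : X - 1 <= y <= X) by (unfold y; lra). assert (Hmh : 0 <= INR m * h) by mono.
 assert (Hey : exp (- y) <= 3 * exp (- X)). { apply Rle_trans with (exp (1 + - X)); [mono|].
  rewrite exp_plus. apply Rmult_le_compat_r; [mono|apply exp_le_3]. }
 assert (B1 : Rabs (bsum u m - bsum (fun j => h * f (x + INR j * h)) m) <= INR m * (h * e)).
 { rewrite <- bsum_minus. eapply Rle_trans; [apply bsum_abs|]. rewrite <- bsum_const. apply bsum_le.
  intros j Hj. apply Hu; [lia|].
  assert (INR j * h <= INR m * h) by (apply Rmult_le_compat_r; [lra|apply le_INR; lia]). lra. }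
 assert (B2 := riemann_sum f df x h M m ltac:(lra) Hf ltac:(intros s Hs; apply HM; lra)). fold y in B2.
 assert (B3 := exp_improper f C x ltac:(intros s; eexists; apply Hf) HC y ltac:(unfold y; lra)).
 assert (B4 : Rabs (U - bsum u m) <= C * exp (- y)).
 { assert (HL : is_lim_seq (fun n => Rabs (bsum u (n + m) - bsum u m)) (Rabs (U - bsum u m))).
  { apply (is_lim_seq_abs (fun n => bsum u (n + m) - bsum u m) (U - bsum u m)).
   apply is_lim_seq_minus'; [apply (is_lim_seq_incr_n (bsum u)), Hlim|apply is_lim_seq_const]. }
  assert (HR : Rbar_le (Rabs (U - bsum u m)) (C * exp (- y))); [|exact HR].
  apply (is_lim_seq_le (fun n => Rabs (bsum u (n + m) - bsum u m)) (fun _ => C * exp (- y)));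
   [|exact HL|apply is_lim_seq_const]. intros n. rewrite Nat.add_comm, bsum_add.
  replace (bsum u m + bsum (fun k => u (m + k)%nat) n - bsum u m) with (bsum (fun k => u (m + k)%nat) n) by ring.
  apply Rle_trans with (C * (exp (- y) - exp (- (y + INR n * h)))).
  - apply exp_tail_sum; [exact HC0|lra|]. intros j Hj.
   assert (Hj' := Htail (m + j)%nat ltac:(lia)). rewrite plus_INR in Hj'.
   replace (x + (INR m + INR j) * h) with (y + INR j * h) in Hj' by (unfold y; ring). exact Hj'.
  - apply Rmult_le_compat_l; [exact HC0|]. assert (H := exp_pos (- (y + INR n * h))). lra. }
 assert (T1 : INR m * (h * e) <= (X - x) * e). { rewrite <- Rmult_assoc. mono. }
 assert (T2 : INR m * (M * h ^ 2) <= (X - x) * (M * h)).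
 { replace (INR m * (M * h ^ 2)) with (INR m * h * (M * h)) by ring. mono. }
 assert (T3 : C * exp (- y) <= C * (3 * exp (- X))) by mono.
 set (S1 := bsum u m) in *. set (S2 := bsum (fun j => h * f (x + INR j * h)) m) in *.
 set (I1 := RInt f x y) in *. set (I2 := int_to_pinfty f x) in *. absle B1. absle B2. absle B3. absle B4.
 apply Rabs_le. split; lra.
Qed.

(** * Convergence of the exact tails to the integrals *)

Lemma ln_one_plus_bounds (y : R) : 0 <= y -> y - y ^ 2 <= ln (1 + y) <= y.
Proof. intros Hy. split; [|assert (H := ln_le_sub_1 (1 + y) ltac:(lra)); lra].
 eapply Rle_trans; [|apply ln_ge_1_sub; lra]. assert (/ (1 + y) <= 1 - y + y ^ 2); [|lra].
 apply (Rmult_le_reg_l (1 + y)); [lra|]. rewrite Rinv_r by lra. assert (0 <= y ^ 3) by mono. lra.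
Qed.

Lemma ln_one_minus_bounds (p : R) : 0 <= p <= 1 / 2 -> p <= - ln (1 - p) <= p + 2 * p ^ 2.
Proof. intros Hp. split; [assert (H := ln_le_sub_1 (1 - p) ltac:(lra)); lra|].
 assert (H := ln_ge_1_sub (1 - p) ltac:(lra)). assert (/ (1 - p) <= 1 + p + 2 * p ^ 2); [|lra].
 apply (Rmult_le_reg_l (1 - p)); [lra|]. rewrite Rinv_r by lra. assert (0 <= p ^ 2 * (1 - 2 * p)) by mono. lra.
Qed.

(** By [tail_A] the quantity [t - sumA] is the sum of [ln (1 + h a_(n+j))] over [j >= 1]. Each term
    is [h q] up to [O(h ^ 2)] and the error of the ratio [sk], so this is a Riemann sum for the
    integral of [q]. *)
Lemma sumA_conv (q : R -> R) (x e : R) : hastings_mcleod q -> 0 < e ->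
 exists h0, 0 < h0 /\ forall h, 0 < h <= h0 -> forall n, x - 1 <= xk h n <= x ->
  Rabs (th h - sumA n (th h) - int_to_pinfty q (xk h n)) <= e.
Proof. intros Hhm He. assert (Hq := proj1 Hhm).
 destruct (exp_small (6 * 60) (e / 2) ltac:(lra) ltac:(lra)) as [X1 HX1].
 set (X := Rmax X1 x). assert (HXx : x <= X) by apply Rmax_r. assert (HXX1 : X1 <= X) by apply Rmax_l.
 destruct (continuous_bounded (Derive q) (x - 1) X (fun y => q'_cont q y Hq)) as [M [HM0 HM]].
 set (A := 27 * exp (1 - x)). assert (HA : 0 < A) by (unfold A; assert (H := exp_pos (1 - x)); lra).
 set (L := X - x + 1). assert (HL : 0 < L) by (unfold L; lra).
 set (es := e / (4 * (L * A))). assert (HLA : 0 < L * A) by mono.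
 assert (Hes : 0 < es) by (apply Rdiv_lt_0_compat; lra). destruct (sk_conv q (x - 1) X es Hhm Hes) as [h1 [Hh1 Hs]].
 set (Z := L * (A ^ 2 + M)). assert (HZ : 0 < Z).
 { unfold Z. apply Rmult_lt_0_compat; [lra|]. assert (H := pow2_ge_0 A). lra. }
 set (h2 := e / (4 * Z)). assert (Hh2 : 0 < h2) by (apply Rdiv_lt_0_compat; lra).
 exists (Rmin (Rmin h1 h2) (1 / 100)). split; [repeat apply Rmin_glb_lt; lra|]. intros h [Hh Hmin] n Hn.
 assert (Q1 := Rmin_l (Rmin h1 h2) (1 / 100)). assert (Q2 := Rmin_r (Rmin h1 h2) (1 / 100)).
 assert (Q3 := Rmin_l h1 h2). assert (Q4 := Rmin_r h1 h2). assert (Hh1' : 0 < h <= h1) by lra. specialize (Hs h Hh1').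
 assert (Ht := th_pos h Hh). set (u := fun j => ln (1 + rs (n + j) (th h))).
 assert (Hu : forall j, ln (1 + rs (n + j) (th h)) = ln (1 + h * ak h (n + j))).
 { intros j. rewrite rs_ak by exact Hh. reflexivity. }
 assert (HaA : forall j, ak h (n + j) <= A).
 { intros j. eapply Rle_trans; [apply ak_exp; lra|]. unfold A. apply Rmult_le_compat_l; [lra|].
  apply exp_le_mono. rewrite xk_add. assert (0 <= INR j * h) by mono. lra. }
 assert (Hmain := sum_conv q (Derive q) u h (xk h n) X 60 M (h * A ^ 2 + A * es) (th h - sumA n (th h))).
 assert (HA2 := pow2_ge_0 A). eapply Rle_trans; [apply Hmain|].
 - lra.
 - lra.
 - assert (0 <= h * A ^ 2) by mono. assert (0 <= A * es) by mono. lra.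
 - intros s; apply q_derive, Hq.
 - intros s Hs'. apply HM. lra.
 - intros s _. apply q_abs_exp, Hhm.
 - intros j Hj HjX. unfold u. rewrite Hu. rewrite <- xk_add in *. assert (Hxj := xk_mono h n (n + j) Hh ltac:(lia)).
  specialize (Hs (n + j)%nat ltac:(lra)). assert (Eq := qk_sk q h (n + j) Hh). unfold qk in Eq. rewrite Eq.
  assert (Ha := ak_pos h (n + j) Hh). specialize (HaA j).
  set (a := ak h (n + j)) in *. set (s := sk q h (n + j)) in *.
  assert (Hln := ln_one_plus_bounds (h * a) ltac:(apply Rmult_le_pos; lra)).
  assert (B1 : (h * a) ^ 2 <= h * (h * A ^ 2)). { replace ((h * a) ^ 2) with (h * (h * a ^ 2)) by ring. mono. }
  absle Hs. assert (B2 : - (h * (A * es)) <= h * a * (s - 1) <= h * (A * es)).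
  { assert (Hha : 0 <= h * a <= h * A) by mono. assert (h * a * es <= h * A * es) by mono. split; nra. }
  apply Rabs_le. split; lra.
 - intros j Hj. unfold u. rewrite Hu. rewrite <- xk_add.
  assert (Ha := ak_pos h (n + j) Hh). assert (Hln := ln_one_plus_bounds (h * ak h (n + j)) ltac:(apply Rmult_le_pos; lra)).
  assert (Hexp := ak_exp h (n + j) ltac:(lra)). assert (H0 : 0 <= ln (1 + h * ak h (n + j))).
  { rewrite <- ln_1. apply ln_le; [lra|]. assert (0 <= h * ak h (n + j)) by mono. lra. }
  rewrite Rabs_right by lra. eapply Rle_trans; [apply Hln|]. mono.
 - apply (is_lim_seq_ext (fun m => bsum (fun j => ln (1 + rs (n + j) (th h))) m)); [reflexivity|]. apply tail_A, Ht.
 - assert (HX2 := HX1 X HXX1). assert (HLX : 0 <= X - xk h n <= L) by (unfold L; lra).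
  assert (E1 : (X - xk h n) * (h * A ^ 2 + A * es + M * h) <= L * (h * A ^ 2 + A * es + M * h)).
  { apply Rmult_le_compat_r; [|lra]. assert (0 <= h * A ^ 2) by mono. assert (0 <= A * es) by mono.
   assert (0 <= M * h) by mono. lra. }
  assert (E2 : L * (A * es) = e / 4) by (unfold es; field; lra). assert (E3 : h * Z <= e / 4).
  { apply Rle_trans with (h2 * Z); [mono|]. unfold h2. right. field. lra. }
  unfold Z in E3. lra.
Qed.

(* By [tail_P], the value of [sum_(j >= 1) j ln (1 - r_(n+j) ^ 2)]. *)
Definition logP (n : nat) (t : R) : R :=
 - t ^ 2 + INR n * logbes t + bsum (fun k => (INR n - INR k) * ln (1 - rs k t ^ 2)) n.

Lemma mult_exp_neg_le (z : R) : 0 <= z -> z * exp (- z) <= 1.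
Proof. intros Hz. assert (H := exp_ineq1_le z). rewrite exp_Ropp. apply (div_le_intro z); [mono|lra]. Qed.

Lemma weighted_exp_le (y s : R) : y <= s -> (s - y) * exp (-2 * s) <= exp (- y) * exp (- s).
Proof. intros H. assert (H1 := mult_exp_neg_le (s - y) ltac:(lra)).
 replace (exp (-2 * s)) with (exp (- (s - y)) * (exp (- y) * exp (- s))).
 - rewrite <- Rmult_assoc. rewrite <- (Rmult_1_l (exp (- y) * exp (- s))) at 2. mono.
 - rewrite <- !exp_plus. f_equal. ring.
Qed.

(** The weight is [j = (x_(n+j) - x_n) / h] and [- ln (1 - r ^ 2)] is close to [h ^ 2 q ^ 2], so one
    factor [h] remains as the mesh of a Riemann sum for [(s - x_n) q(s) ^ 2]. *)
Lemma logP_conv (q : R -> R) (x e : R) : hastings_mcleod q -> 0 < e ->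
 exists h0, 0 < h0 /\ forall h, 0 < h <= h0 -> forall n, x - 1 <= xk h n <= x ->
  Rabs (- logP n (th h) - int_to_pinfty (fun s => (s - xk h n) * q s ^ 2) (xk h n)) <= e.
Proof. intros Hhm He. assert (Hq := proj1 Hhm).
 set (C := 3600 * exp (1 - x)). assert (HC : 0 < C) by (unfold C; assert (H := exp_pos (1 - x)); lra).
 destruct (exp_small (6 * C) (e / 2) ltac:(lra) ltac:(lra)) as [X1 HX1].
 set (X := Rmax X1 x). assert (HXx : x <= X) by apply Rmax_r. assert (HXX1 : X1 <= X) by apply Rmax_l.
 destruct (continuous_bounded (Derive q) (x - 1) X (fun y => q'_cont q y Hq)) as [M1 [HM10 HM1]].
 destruct (continuous_bounded q (x - 1) X (fun y => q_cont q y Hq)) as [M0 [HM00 HM00']].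
 set (A := 27 * exp (1 - x)). assert (HA : 0 < A) by (unfold A; assert (H := exp_pos (1 - x)); lra).
 set (L := X - x + 1). assert (HL : 0 < L) by (unfold L; lra). set (M := M0 ^ 2 + L * (2 * (M0 * M1))).
 assert (HM0M1 : 0 < M0 * M1) by mono. assert (HM : 0 < M).
 { unfold M. assert (0 < M0 ^ 2) by mono. assert (0 < L * (2 * (M0 * M1))) by mono. lra. }
 assert (HA2 : 0 < A ^ 2) by mono. assert (HA4 : 0 < A ^ 4) by mono.
 set (es := Rmin 1 (e / (4 * (L * (L * (3 * A ^ 2)))))). assert (HLA : 0 < L * (L * (3 * A ^ 2))) by mono.
 assert (Hes : 0 < es) by (unfold es; apply Rmin_glb_lt; [lra|mono]).
 assert (Hes1 : es <= 1) by apply Rmin_l. assert (Hes2 : es <= e / (4 * (L * (L * (3 * A ^ 2))))) by apply Rmin_r.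
 destruct (sk_conv q (x - 1) X es Hhm Hes) as [h1 [Hh1 Hs]].
 set (Z := L * (L * (2 * A ^ 4) + M)). assert (HZ : 0 < Z).
 { unfold Z. apply Rmult_lt_0_compat; [lra|]. assert (0 < L * (2 * A ^ 4)) by mono. lra. }
 set (h2 := e / (4 * Z)). assert (Hh2 : 0 < h2) by (apply Rdiv_lt_0_compat; lra).
 assert (Hi2A : 0 < / (2 * A)) by mono.
 exists (Rmin (Rmin h1 h2) (Rmin (1 / 100) (/ (2 * A)))). split; [repeat apply Rmin_glb_lt; lra|].
 intros h [Hh Hmin] n Hn. assert (Q1 := Rmin_l (Rmin h1 h2) (Rmin (1 / 100) (/ (2 * A)))).
 assert (Q2 := Rmin_r (Rmin h1 h2) (Rmin (1 / 100) (/ (2 * A)))).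
 assert (Q3 := Rmin_l h1 h2). assert (Q4 := Rmin_r h1 h2).
 assert (Q5 := Rmin_l (1 / 100) (/ (2 * A))). assert (Q6 := Rmin_r (1 / 100) (/ (2 * A))).
 assert (Hh1' : 0 < h <= h1) by lra. specialize (Hs h Hh1'). assert (Ht := th_pos h Hh). set (y := xk h n) in *.
 assert (HhA : h * A <= 1 / 2). { assert (H : h <= / (2 * A)) by lra. apply (Rmult_le_compat_r A) in H; [|lra].
  replace (/ (2 * A) * A) with (1 / 2) in H by (field; lra). exact H. }
 set (u := fun j => - (INR j * ln (1 - rs (n + j) (th h) ^ 2))). assert (HaA : forall j, 0 < ak h (n + j) <= A).
 { intros j. split; [apply ak_pos, Hh|]. eapply Rle_trans; [apply ak_exp; lra|]. unfold A. apply Rmult_le_compat_l; [lra|].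
  apply exp_le_mono. rewrite xk_add. fold y. assert (0 <= INR j * h) by mono. lra. }
 assert (Hp : forall j, 0 <= h ^ 2 * ak h (n + j) ^ 2 <= 1 / 4).
 { intros j. rewrite <- Rpow_mult_distr. specialize (HaA j). split; [mono|].
  replace (1 / 4) with ((1 / 2) ^ 2) by field. apply pow_incr. split; [mono|].
  apply Rle_trans with (h * A); [mono|exact HhA]. }
 assert (Hu : forall j, u j = INR j * - ln (1 - h ^ 2 * ak h (n + j) ^ 2)).
 { intros j. unfold u. rewrite rs_ak, Rpow_mult_distr by exact Hh. ring. }
 assert (Hey : exp (- y) <= exp (1 - x)) by mono.
 assert (Hmain := sum_conv (fun s => (s - y) * q s ^ 2) (fun s => 1 * q s ^ 2 + (s - y) * (INR 2 * Derive q s * q s ^ pred 2))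
  u h y X C M (L * (2 * A ^ 4) * h + L * (3 * A ^ 2) * es) (- logP n (th h))).
 assert (Pe1 : 0 < L * (2 * A ^ 4)) by mono. assert (Pe2 : 0 < L * (3 * A ^ 2)) by mono.
 assert (Pe3 : 0 <= L * (2 * A ^ 4) * h + L * (3 * A ^ 2) * es). { assert (0 <= L * (2 * A ^ 4) * h) by mono.
  assert (0 <= L * (3 * A ^ 2) * es) by mono. lra. }
 eapply Rle_trans; [apply Hmain|].
 - lra.
 - lra.
 - exact Pe3.
 - intros s. apply (is_derive_multR (fun s => s - y) (fun s => q s ^ 2)).
  + auto_derive; [exact I|ring].
  + apply (is_derive_pow q 2), (q_derive _ _ Hq).
 - intros s Hs'. specialize (HM1 s ltac:(lra)). specialize (HM00' s ltac:(lra)). simpl INR. simpl pred.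
  rewrite pow_1. unfold M. eapply Rle_trans; [apply Rabs_triang|]. apply Rplus_le_compat.
  + rewrite Rmult_1_l, <- RPow_abs. apply pow_incr. mono.
  + rewrite Rabs_mult, (Rabs_right (s - y)) by lra. apply Rmult_le_compat; [lra|mono|unfold L; lra|].
   rewrite !Rabs_mult, (Rabs_right (1 + 1)) by lra. replace (2 * (M0 * M1)) with ((1 + 1) * M1 * M0) by ring. mono.
 - intros s Hs'. rewrite Rabs_mult, (Rabs_right (s - y)) by lra.
  assert (Hqs := q_abs_exp q s Hhm). assert (Hw := weighted_exp_le y s Hs').
  assert (Hq2 : Rabs (q s ^ 2) <= 3600 * exp (-2 * s)).
  { rewrite <- RPow_abs. replace (3600 * exp (-2 * s)) with ((60 * exp (- s)) ^ 2).
   - apply pow_incr. mono.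
   - replace (-2 * s) with (- s + - s) by ring. rewrite exp_plus. ring. }
  apply Rle_trans with ((s - y) * (3600 * exp (-2 * s))); [mono|]. unfold C. assert (He2 := exp_pos (- s)).
  assert (exp (- y) * exp (- s) <= exp (1 - x) * exp (- s)) by mono. lra.
 - intros j Hj HjX. rewrite Hu. unfold y in *. rewrite <- xk_add in *.
  assert (Hxj := xk_mono h n (n + j) Hh ltac:(lia)).
  specialize (Hs (n + j)%nat ltac:(lra)). assert (Eq := qk_sk q h (n + j) Hh). unfold qk in Eq. rewrite Eq.
  specialize (HaA j). specialize (Hp j). assert (Hln := ln_one_minus_bounds (h ^ 2 * ak h (n + j) ^ 2) ltac:(lra)).
  assert (Hz : xk h (n + j) - xk h n = INR j * h) by (rewrite xk_add; ring).
  assert (HzL : 0 <= INR j * h <= L) by (rewrite <- Hz; unfold L; lra).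
  rewrite Hz. set (a := ak h (n + j)) in *. set (s := sk q h (n + j)) in *. set (z := INR j * h) in *.
  set (l := - ln (1 - h ^ 2 * a ^ 2)) in *.
  assert (Ej : INR j * l - h * (z * (s * a) ^ 2) = INR j * (l - h ^ 2 * a ^ 2) + h * (z * (a ^ 2 * (1 - s ^ 2)))) by (unfold z; ring).
  rewrite Ej. assert (Hj0 := pos_INR j). assert (Ha4 : a ^ 4 <= A ^ 4) by mono. assert (Ha40 : 0 <= a ^ 4) by mono.
  assert (Ha2 : 0 <= a ^ 2 <= A ^ 2) by mono.
  assert (C1 : 0 <= INR j * (l - h ^ 2 * a ^ 2) <= h * (L * (2 * A ^ 4) * h)). { split; [mono|].
   apply Rle_trans with (INR j * (2 * (h ^ 2 * a ^ 2) ^ 2)); [mono|].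
   replace (INR j * (2 * (h ^ 2 * a ^ 2) ^ 2)) with (h ^ 2 * (z * (h * (2 * a ^ 4)))) by (unfold z; ring).
   replace (h * (L * (2 * A ^ 4) * h)) with (h ^ 2 * (L * (1 * (2 * A ^ 4)))) by ring.
   apply Rmult_le_compat_l; [mono|]. apply Rmult_le_compat; [lra| |lra|].
   - mono.
   - mono. }
  assert (Hsq : Rabs (1 - s ^ 2) <= 3 * es).
  { replace (1 - s ^ 2) with (- (s - 1) * (s + 1)) by ring. rewrite Rabs_mult, Rabs_Ropp.
   assert (Hs2 := Hs). absle Hs2.
   rewrite Rmult_comm. apply Rmult_le_compat; try apply Rabs_pos; [apply Rabs_le; lra|exact Hs]. }
  assert (C2 : Rabs (h * (z * (a ^ 2 * (1 - s ^ 2)))) <= h * (L * (3 * A ^ 2) * es)).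
  { rewrite Rabs_mult, (Rabs_right h), Rabs_mult, (Rabs_right z), Rabs_mult, (Rabs_right (a ^ 2)) by lra.
   apply Rmult_le_compat_l; [lra|]. replace (L * (3 * A ^ 2) * es) with (L * (A ^ 2 * (3 * es))) by ring. mono. }
  eapply Rle_trans; [apply Rabs_triang|]. rewrite (Rabs_right (INR j * (l - h ^ 2 * a ^ 2))) by lra. lra.
 - intros j Hj. rewrite Hu. unfold y in *. rewrite <- xk_add. specialize (HaA j). specialize (Hp j).
  assert (Hln := ln_one_minus_bounds (h ^ 2 * ak h (n + j) ^ 2) ltac:(lra)).
  assert (Hexp := ak_exp h (n + j) ltac:(lra)). assert (Hj0 := pos_INR j). set (p := h ^ 2 * ak h (n + j) ^ 2) in *.
  rewrite Rabs_right by (apply Rle_ge, Rmult_le_pos; lra).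
  assert (Hpp : p + 2 * p ^ 2 <= 2 * p) by (assert (p ^ 2 <= p * (1 / 2)) by nra; lra).
  apply Rle_trans with (INR j * (2 * p)); [mono|].
  assert (Hxj := xk_mono h n (n + j) Hh ltac:(lia)). assert (Hw := weighted_exp_le (xk h n) (xk h (n + j)) Hxj).
  assert (Hz : xk h (n + j) - xk h n = INR j * h) by (rewrite xk_add; ring). rewrite Hz in Hw.
  set (s := xk h (n + j)) in *. assert (Ha2 : ak h (n + j) ^ 2 <= 729 * exp (-2 * s)).
  { replace (729 * exp (-2 * s)) with ((27 * exp (- s)) ^ 2).
   - apply pow_incr; lra.
   - replace (-2 * s) with (- s + - s) by ring. rewrite exp_plus. ring. }
  replace (INR j * (2 * p)) with (h * (2 * (INR j * h * ak h (n + j) ^ 2))) by (unfold p; ring).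
  apply Rmult_le_compat_l; [lra|]. assert (INR j * h * ak h (n + j) ^ 2 <= INR j * h * (729 * exp (-2 * s))).
  { mono. }
  assert (He2 := exp_pos (- s)). assert (exp (- xk h n) * exp (- s) <= exp (1 - x) * exp (- s)) by mono.
  unfold C. assert (0 < exp (1 - x) * exp (- s)) by mono. lra.
 - apply (is_lim_seq_ext (fun m => - bsum (fun j => INR j * ln (1 - rs (n + j) (th h) ^ 2)) m)).
  + intros m. unfold u. replace (- bsum (fun j => INR j * ln (1 - rs (n + j) (th h) ^ 2)) m) with
    ((-1) * bsum (fun j => INR j * ln (1 - rs (n + j) (th h) ^ 2)) m) by ring.
   rewrite <- bsum_scal. apply bsum_ext. intros; ring.
  + apply (is_lim_seq_opp _ (logP n (th h))). apply tail_P, Ht.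
 - assert (HX2 := HX1 X HXX1). assert (HLX : 0 <= X - y <= L) by (unfold L; lra).
  assert (E1 : (X - y) * (L * (2 * A ^ 4) * h + L * (3 * A ^ 2) * es + M * h) <=
   L * (L * (2 * A ^ 4) * h + L * (3 * A ^ 2) * es + M * h)).
  { apply Rmult_le_compat_r; [|lra]. assert (0 <= M * h) by mono. lra. }
  assert (E2 : L * (L * (3 * A ^ 2)) * es <= e / 4).
  { apply Rle_trans with (L * (L * (3 * A ^ 2)) * (e / (4 * (L * (L * (3 * A ^ 2)))))); [mono|]. right. field. lra. }
  assert (E3 : h * Z <= e / 4). { apply Rle_trans with (h2 * Z); [mono|]. unfold h2. right. field. lra. }
  unfold Z in E3. lra.
Qed.

(** * Euler--Maclaurin summation and the sums over [k <= n] *)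

Lemma deriv_bound_sym (f df w dw : R -> R) (b : R) : 0 <= b ->
 (forall x, 0 <= x <= b -> is_derive f x (df x)) -> (forall x, 0 <= x <= b -> is_derive w x (dw x)) ->
 (forall x, 0 <= x <= b -> Rabs (df x) <= dw x) -> f 0 = 0 -> w 0 = 0 -> forall x, 0 <= x <= b -> Rabs (f x) <= w x.
Proof. intros Hb Hf Hw H Hf0 Hw0 x Hx. assert (w 0 - f 0 <= w x - f x).
 { apply (incr_le (fun s => w s - f s) (fun s => dw s - df s)); [lra| |].
  - intros s Hs. apply is_derive_minusR; [apply Hw|apply Hf]; lra.
  - intros s Hs. specialize (H s ltac:(lra)). absle H. lra. }
 assert (w 0 + f 0 <= w x + f x). { apply (incr_le (fun s => w s + f s) (fun s => dw s + df s)); [lra| |].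
  - intros s Hs. apply is_derive_plusR; [apply Hw|apply Hf]; lra.
  - intros s Hs. specialize (H s ltac:(lra)). absle H. lra. }
 apply Rabs_le. lra.
Qed.

Lemma is_derive_shift (f df : R -> R) (a s : R) : is_derive f (a + s) (df (a + s)) ->
 is_derive (fun s => f (a + s)) s (df (a + s)).
Proof. intros H. replace (df (a + s)) with (1 * df (a + s)) by ring.
 apply (is_derive_comp f (fun s => a + s) s (df (a + s)) 1); [exact H|]. auto_derive; [exact I|ring].
Qed.

(** As a function of the width [s], the error vanishes at 0 with its first derivative, and its
    second derivative is [s / 2 * f2 (a + s)]; integrate twice. *)
Lemma trapezoid (F f f1 f2 : R -> R) (a d M : R) : 0 <= d ->
 (forall x, a <= x <= a + d -> is_derive F x (f x)) -> (forall x, a <= x <= a + d -> is_derive f x (f1 x)) ->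
 (forall x, a <= x <= a + d -> is_derive f1 x (f2 x)) -> (forall x, a <= x <= a + d -> Rabs (f2 x) <= M) ->
 Rabs (d / 2 * (f a + f (a + d)) - (F (a + d) - F a)) <= M * d ^ 3 / 12.
Proof. intros Hd DF Df Df1 HM.
 assert (SF : forall s, 0 <= s <= d -> is_derive (fun s => F (a + s)) s (f (a + s))) by (intros s Hs; apply is_derive_shift, DF; lra).
 assert (Sf : forall s, 0 <= s <= d -> is_derive (fun s => f (a + s)) s (f1 (a + s))) by (intros s Hs; apply is_derive_shift, Df; lra).
 assert (Sf1 : forall s, 0 <= s <= d -> is_derive (fun s => f1 (a + s)) s (f2 (a + s))) by (intros s Hs; apply is_derive_shift, Df1; lra).
 set (g := fun s => s / 2 * (f a + f (a + s)) - (F (a + s) - F a)).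
 set (g1 := fun s => 1 / 2 * (f a - f (a + s)) + s / 2 * f1 (a + s)).
 assert (Dg : forall s, 0 <= s <= d -> is_derive g s (g1 s)). { intros s Hs. unfold g, g1.
  replace (1 / 2 * (f a - f (a + s)) + s / 2 * f1 (a + s)) with
   (1 / 2 * (f a + f (a + s)) + s / 2 * (0 + f1 (a + s)) - (f (a + s) - 0)) by field. apply is_derive_minusR.
  - apply (is_derive_multR (fun s => s / 2) (fun s => f a + f (a + s))); [auto_derive; [exact I|field]|].
   apply is_derive_plusR; [apply is_derive_constR|apply Sf, Hs].
  - apply is_derive_minusR; [apply SF, Hs|apply is_derive_constR]. }
 assert (Dg1 : forall s, 0 <= s <= d -> is_derive g1 s (s / 2 * f2 (a + s))). { intros s Hs. unfold g1.
  replace (s / 2 * f2 (a + s)) with (0 * (f a - f (a + s)) + 1 / 2 * (0 - f1 (a + s)) + (1 / 2 * f1 (a + s) + s / 2 * f2 (a + s))) by field.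
  apply is_derive_plusR.
  - apply (is_derive_multR (fun _ => 1 / 2) (fun s => f a - f (a + s))); [apply is_derive_constR|].
   apply is_derive_minusR; [apply is_derive_constR|apply Sf, Hs].
  - apply (is_derive_multR (fun s => s / 2) (fun s => f1 (a + s))); [auto_derive; [exact I|field]|apply Sf1, Hs]. }
 assert (B1 : forall s, 0 <= s <= d -> Rabs (g1 s) <= M * s ^ 2 / 4).
 { apply (deriv_bound_sym g1 (fun s => s / 2 * f2 (a + s)) (fun s => M * s ^ 2 / 4) (fun s => s / 2 * M)); [lra|exact Dg1| | | |].
  - intros s _. auto_derive; [exact I|field].
  - intros s Hs. rewrite Rabs_mult, (Rabs_right (s / 2)) by lra. apply Rmult_le_compat_l; [lra|apply HM; lra].
  - unfold g1. rewrite Rplus_0_r. field.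
  - field. }
 apply (deriv_bound_sym g g1 (fun s => M * s ^ 3 / 12) (fun s => M * s ^ 2 / 4) d); [lra|exact Dg| |exact B1| | |lra].
 - intros s _. auto_derive; [exact I|field].
 - unfold g. rewrite Rplus_0_r. field.
 - field.
Qed.

(** As a function of the width [s], the error vanishes at 0 with two derivatives, and its third
    derivative is [- s ^ 2 / 12 * f4 (a + s)]. Three integrations turn 12 into
    [12 * 3 * 4 * 5 = 720]. *)
Lemma euler_maclaurin_step (F f f1 f2 f3 f4 : R -> R) (a M : R) :
 (forall x, a <= x <= a + 1 -> is_derive F x (f x)) -> (forall x, a <= x <= a + 1 -> is_derive f x (f1 x)) ->
 (forall x, a <= x <= a + 1 -> is_derive f1 x (f2 x)) -> (forall x, a <= x <= a + 1 -> is_derive f2 x (f3 x)) ->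
 (forall x, a <= x <= a + 1 -> is_derive f3 x (f4 x)) -> (forall x, a <= x <= a + 1 -> Rabs (f4 x) <= M) ->
 Rabs ((f a + f (a + 1)) / 2 - (F (a + 1) - F a) - (f1 (a + 1) - f1 a) / 12) <= M / 720.
Proof. intros DF Df Df1 Df2 Df3 HM.
 assert (SF : forall s, 0 <= s <= 1 -> is_derive (fun s => F (a + s)) s (f (a + s))) by (intros s Hs; apply is_derive_shift, DF; lra).
 assert (Sf : forall s, 0 <= s <= 1 -> is_derive (fun s => f (a + s)) s (f1 (a + s))) by (intros s Hs; apply is_derive_shift, Df; lra).
 assert (Sf1 : forall s, 0 <= s <= 1 -> is_derive (fun s => f1 (a + s)) s (f2 (a + s))) by (intros s Hs; apply is_derive_shift, Df1; lra).
 assert (Sf2 : forall s, 0 <= s <= 1 -> is_derive (fun s => f2 (a + s)) s (f3 (a + s))) by (intros s Hs; apply is_derive_shift, Df2; lra).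
 assert (Sf3 : forall s, 0 <= s <= 1 -> is_derive (fun s => f3 (a + s)) s (f4 (a + s))) by (intros s Hs; apply is_derive_shift, Df3; lra).
 set (g := fun s => s / 2 * (f a + f (a + s)) - (F (a + s) - F a) - s ^ 2 / 12 * (f1 (a + s) - f1 a)).
 set (g1 := fun s => 1 / 2 * (f a - f (a + s)) + s / 3 * f1 (a + s) + s / 6 * f1 a - s ^ 2 / 12 * f2 (a + s)).
 set (g2 := fun s => 1 / 6 * (f1 a - f1 (a + s)) + s / 6 * f2 (a + s) - s ^ 2 / 12 * f3 (a + s)).
 set (g3 := fun s => - (s ^ 2 / 12 * f4 (a + s))).
 assert (Dm : forall (c dc v dv : R -> R) s, is_derive c s (dc s) -> is_derive v s (dv s) ->
  is_derive (fun s => c s * v s) s (dc s * v s + c s * dv s)) by (intros; apply is_derive_multR; assumption).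
 assert (Dl : forall c s : R, is_derive (fun s => s / c) s (/ c)).
 { intros c s. unfold Rdiv. auto_derive; [exact I|ring]. }
 assert (Dq : forall s : R, is_derive (fun s => s ^ 2 / 12) s (s / 6)) by (intros s; auto_derive; [exact I|field]).
 assert (Dg : forall s, 0 <= s <= 1 -> is_derive g s (g1 s)). { intros s Hs. unfold g, g1.
  replace (1 / 2 * (f a - f (a + s)) + s / 3 * f1 (a + s) + s / 6 * f1 a - s ^ 2 / 12 * f2 (a + s)) with
   ((/ 2 * (f a + f (a + s)) + s / 2 * (0 + f1 (a + s))) - (f (a + s) - 0) - (s / 6 * (f1 (a + s) - f1 a) + s ^ 2 / 12 * (f2 (a + s) - 0))) by field.
  apply is_derive_minusR; [apply is_derive_minusR|].
  - apply (Dm (fun s => s / 2) (fun _ => / 2) (fun s => f a + f (a + s)) (fun s => 0 + f1 (a + s))); [apply Dl|].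
   apply is_derive_plusR; [apply is_derive_constR|apply Sf, Hs].
  - apply is_derive_minusR; [apply SF, Hs|apply is_derive_constR].
  - apply (Dm (fun s => s ^ 2 / 12) (fun s => s / 6) (fun s => f1 (a + s) - f1 a) (fun s => f2 (a + s) - 0)); [apply Dq|].
   apply is_derive_minusR; [apply Sf1, Hs|apply is_derive_constR]. }
 assert (Dg1 : forall s, 0 <= s <= 1 -> is_derive g1 s (g2 s)). { intros s Hs. unfold g1, g2.
  replace (1 / 6 * (f1 a - f1 (a + s)) + s / 6 * f2 (a + s) - s ^ 2 / 12 * f3 (a + s)) with
   (((0 * (f a - f (a + s)) + 1 / 2 * (0 - f1 (a + s))) + (/ 3 * f1 (a + s) + s / 3 * f2 (a + s)) + (/ 6 * f1 a + s / 6 * 0)) -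
   (s / 6 * f2 (a + s) + s ^ 2 / 12 * f3 (a + s))) by field.
  apply is_derive_minusR; [apply is_derive_plusR; [apply is_derive_plusR|]|].
  - apply (Dm (fun _ => 1 / 2) (fun _ => 0) (fun s => f a - f (a + s)) (fun s => 0 - f1 (a + s))); [apply is_derive_constR|].
   apply is_derive_minusR; [apply is_derive_constR|apply Sf, Hs].
  - apply (Dm (fun s => s / 3) (fun _ => / 3) (fun s => f1 (a + s)) (fun s => f2 (a + s))); [apply Dl|apply Sf1, Hs].
  - apply (Dm (fun s => s / 6) (fun _ => / 6) (fun s => f1 a) (fun s => 0)); [apply Dl|apply is_derive_constR].
  - apply (Dm (fun s => s ^ 2 / 12) (fun s => s / 6) (fun s => f2 (a + s)) (fun s => f3 (a + s))); [apply Dq|apply Sf2, Hs]. }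
 assert (Dg2 : forall s, 0 <= s <= 1 -> is_derive g2 s (g3 s)). { intros s Hs. unfold g2, g3.
  replace (- (s ^ 2 / 12 * f4 (a + s))) with
   (((0 * (f1 a - f1 (a + s)) + 1 / 6 * (0 - f2 (a + s))) + (/ 6 * f2 (a + s) + s / 6 * f3 (a + s))) -
   (s / 6 * f3 (a + s) + s ^ 2 / 12 * f4 (a + s))) by field. apply is_derive_minusR; [apply is_derive_plusR|].
  - apply (Dm (fun _ => 1 / 6) (fun _ => 0) (fun s => f1 a - f1 (a + s)) (fun s => 0 - f2 (a + s))); [apply is_derive_constR|].
   apply is_derive_minusR; [apply is_derive_constR|apply Sf1, Hs].
  - apply (Dm (fun s => s / 6) (fun _ => / 6) (fun s => f2 (a + s)) (fun s => f3 (a + s))); [apply Dl|apply Sf2, Hs].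
  - apply (Dm (fun s => s ^ 2 / 12) (fun s => s / 6) (fun s => f3 (a + s)) (fun s => f4 (a + s))); [apply Dq|apply Sf3, Hs]. }
 assert (B2 : forall s, 0 <= s <= 1 -> Rabs (g2 s) <= M * s ^ 3 / 36).
 { apply (deriv_bound_sym g2 g3 (fun s => M * s ^ 3 / 36) (fun s => s ^ 2 / 12 * M)); [lra|exact Dg2| | | |].
  - intros s _. auto_derive; [exact I|field].
  - intros s Hs. unfold g3. assert (H2 := pow2_ge_0 s).
   rewrite Rabs_Ropp, Rabs_mult, (Rabs_right (s ^ 2 / 12)) by lra. apply Rmult_le_compat_l; [lra|apply HM; lra].
  - unfold g2. rewrite Rplus_0_r. field.
  - field. }
 assert (B1 : forall s, 0 <= s <= 1 -> Rabs (g1 s) <= M * s ^ 4 / 144).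
 { apply (deriv_bound_sym g1 g2 (fun s => M * s ^ 4 / 144) (fun s => M * s ^ 3 / 36)); [lra|exact Dg1| |exact B2| |].
  - intros s _. auto_derive; [exact I|field].
  - unfold g1. rewrite Rplus_0_r. field.
  - field. }
 assert (B0 : forall s, 0 <= s <= 1 -> Rabs (g s) <= M * s ^ 5 / 720).
 { apply (deriv_bound_sym g g1 (fun s => M * s ^ 5 / 720) (fun s => M * s ^ 4 / 144)); [lra|exact Dg| |exact B1| |].
  - intros s _. auto_derive; [exact I|field].
  - unfold g. rewrite Rplus_0_r. field.
  - field. }
 specialize (B0 1 ltac:(lra)). unfold g in B0.
 replace ((f a + f (a + 1)) / 2 - (F (a + 1) - F a) - (f1 (a + 1) - f1 a) / 12) with
  (1 / 2 * (f a + f (a + 1)) - (F (a + 1) - F a) - 1 ^ 2 / 12 * (f1 (a + 1) - f1 a)) by field.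
 eapply Rle_trans; [exact B0|]. right. field.
Qed.

(** A telescoping majorant gives the existence of the limit and the rate of convergence at once. *)
Lemma telescoping_limit (u w : nat -> R) (n0 : nat) :
 (forall n, (n0 <= n)%nat -> Rabs (u (S n) - u n) <= w n - w (S n)) ->
 (forall n, (n0 <= n)%nat -> 0 <= w n) -> is_lim_seq w 0 ->
 exists l : R, forall n, (n0 <= n)%nat -> Rabs (u n - l) <= w n.
Proof. intros Hu Hw Hw0.
 assert (Hmon : forall n j, (n0 <= n)%nat -> Rabs (u (n + j)%nat - u n) <= w n - w (n + j)%nat).
 { intros n j Hn. induction j as [|j IH].
  - rewrite Nat.add_0_r, !Rminus_diag, Rabs_R0. lra.
  - rewrite Nat.add_succ_r. specialize (Hu (n + j)%nat ltac:(lia)).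
   replace (u (S (n + j)) - u n) with ((u (S (n + j)) - u (n + j)%nat) + (u (n + j)%nat - u n)) by ring.
   eapply Rle_trans; [apply Rabs_triang|]. lra. }
 assert (Hle : forall n j, (n0 <= n)%nat -> Rabs (u (n + j)%nat - u n) <= w n).
 { intros n j Hn. specialize (Hmon n j Hn). specialize (Hw (n + j)%nat ltac:(lia)). lra. }
 assert (Hc : ex_finite_lim_seq u).
 { apply ex_lim_seq_cauchy_corr. intros e. destruct (lim_0_eventually w (e / 2) Hw0) as [K HK]; [assert (H := cond_pos e); lra|].
  exists (max n0 K). intros n m Hn Hm. assert (H1 := HK (max n0 K) ltac:(lia)). assert (H2 := Rle_abs (w (max n0 K))).
  assert (H3 := Hle (max n0 K) (n - max n0 K)%nat ltac:(lia)). assert (H4 := Hle (max n0 K) (m - max n0 K)%nat ltac:(lia)).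
  replace (max n0 K + (n - max n0 K))%nat with n in H3 by lia.
  replace (max n0 K + (m - max n0 K))%nat with m in H4 by lia.
  replace (u n - u m) with ((u n - u (max n0 K)) - (u m - u (max n0 K))) by ring.
  eapply Rle_lt_trans; [apply Rabs_triang|]. rewrite Rabs_Ropp. lra. }
 destruct Hc as [l Hl]. exists l. intros n Hn.
 assert (HL : is_lim_seq (fun j => Rabs (u (j + n)%nat - u n)) (Rabs (l - u n))).
 { apply (is_lim_seq_abs (fun j => u (j + n)%nat - u n) (l - u n)).
  apply is_lim_seq_minus'; [|apply is_lim_seq_const]. apply (is_lim_seq_incr_n u n), Hl. }
 rewrite Rabs_minus_sym.
 apply (is_lim_seq_le (fun j => Rabs (u (j + n)%nat - u n)) (fun _ => w n) (Rabs (l - u n)) (w n));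
  [|exact HL|apply is_lim_seq_const]. intros j. rewrite Nat.add_comm. apply Hle, Hn.
Qed.

Lemma inv_INR_lim (c : R) : is_lim_seq (fun n => c * / INR n) 0.
Proof. apply lim_scal_0. apply (is_lim_seq_inv _ p_infty); [apply is_lim_seq_INR|discriminate]. Qed.

Lemma inv_INR_sq_lim (c : R) : is_lim_seq (fun n => c * / INR n ^ 2) 0.
Proof. apply lim_scal_0. apply (is_lim_seq_incr_1 (fun n => / INR n ^ 2)).
 apply (squeeze_0 _ (fun n => 1 * / INR (S n))).
 - intros n. rewrite S_INR. assert (H := pos_INR n). split.
  + left. mono.
  + rewrite Rmult_1_l. apply Rinv_le_contravar; [lra|]. nra.
 - apply (is_lim_seq_incr_1 (fun n => 1 * / INR n)), inv_INR_lim.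
Qed.

Lemma inv_sq_step (n : nat) : (1 <= n)%nat -> / INR n ^ 3 <= 2 * (/ INR n ^ 2 - / INR (S n) ^ 2).
Proof. intros Hn. apply le_INR in Hn. simpl (INR 1) in Hn. rewrite S_INR. set (x := INR n) in *.
 apply Rminus_le. replace (/ x ^ 3 - 2 * (/ x ^ 2 - / (x + 1) ^ 2)) with (((x + 1) ^ 2 - 2 * x * (2 * x + 1)) * / (x ^ 3 * (x + 1) ^ 2)) by (field; lra).
 assert (0 < / (x ^ 3 * (x + 1) ^ 2)) by pos. assert ((x + 1) ^ 2 - 2 * x * (2 * x + 1) <= 0) by nra. nra.
Qed.

Lemma euler_maclaurin (F f f1 f2 f3 f4 : R -> R) (w : nat -> R) :
 (forall x, 1 <= x -> is_derive F x (f x)) -> (forall x, 1 <= x -> is_derive f x (f1 x)) ->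
 (forall x, 1 <= x -> is_derive f1 x (f2 x)) -> (forall x, 1 <= x -> is_derive f2 x (f3 x)) ->
 (forall x, 1 <= x -> is_derive f3 x (f4 x)) ->
 (forall n x, (1 <= n)%nat -> INR n <= x -> Rabs (f4 x) <= 720 * (w n - w (S n))) ->
 (forall n, (1 <= n)%nat -> 0 <= w n) -> is_lim_seq w 0 -> exists l : R, forall n, (1 <= n)%nat ->
  Rabs (bsum (fun k => f (INR k)) n - (F (INR n) + f (INR n) / 2 + f1 (INR n) / 12) - l) <= w n.
Proof. intros DF Df Df1 Df2 Df3 H4 Hw Hw0.
 apply (telescoping_limit (fun n => bsum (fun k => f (INR k)) n - (F (INR n) + f (INR n) / 2 + f1 (INR n) / 12)));
  [|exact Hw|exact Hw0].
 intros n Hn. simpl bsum. change (match n with O => 1 | S _ => INR n + 1 end) with (INR (S n)). rewrite S_INR.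
 assert (Hn1 := le_INR _ _ Hn). simpl (INR 1) in Hn1.
 assert (H := euler_maclaurin_step F f f1 f2 f3 f4 (INR n) (720 * (w n - w (S n)))).
 set (x := INR n) in *. set (b := bsum (fun k => f (INR k)) n).
 replace (b + f (x + 1) - (F (x + 1) + f (x + 1) / 2 + f1 (x + 1) / 12) - (b - (F x + f x / 2 + f1 x / 12)))
  with ((f x + f (x + 1)) / 2 - (F (x + 1) - F x) - (f1 (x + 1) - f1 x) / 12) by field.
 eapply Rle_trans; [apply H|mono]; intros y Hy;
  [apply DF|apply Df|apply Df1|apply Df2|apply Df3|apply H4; [exact Hn|]]; unfold x in *; lra.
Qed.

Lemma inv_pow_antitone (x y : R) (m : nat) : 0 < x <= y -> / y ^ m <= / x ^ m.
Proof. intros H. mono. Qed.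

Ltac pos_derive :=
 auto_derive; [first [lra | apply Rgt_not_eq; unfold Rgt; repeat apply Rmult_lt_0_compat; lra] | field; lra].

Lemma stirling : exists S0 : R, forall n, (1 <= n)%nat -> Rabs (bsum (fun k => ln (INR k)) n -
  (INR n * ln (INR n) - INR n + ln (INR n) / 2 + / INR n / 12) - S0) <= / INR n ^ 2.
Proof. destruct (euler_maclaurin (fun x => x * ln x - x) ln (fun x => / x) (fun x => - / x ^ 2) (fun x => 2 * / x ^ 3)
  (fun x => - (6 * / x ^ 4)) (fun n => 1 * / INR n ^ 2)) as [l Hl].
 - intros x Hx. pos_derive.
 - intros x Hx. pos_derive.
 - intros x Hx. pos_derive.
 - intros x Hx. pos_derive.
 - intros x Hx. pos_derive.
 - intros n x Hn Hx. assert (H := inv_sq_step n Hn). assert (Hn1 := le_INR _ _ Hn). simpl (INR 1) in Hn1.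
  rewrite Rabs_Ropp, Rabs_right by pos. assert (H1 := inv_pow_antitone (INR n) x 4 ltac:(lra)).
  assert (/ INR n ^ 4 <= / INR n ^ 3). { apply Rinv_le_contravar; [pos|]. apply Rle_pow; [lra|lia]. }
  assert (0 < / INR n ^ 3) by pos. lra.
 - intros n Hn. assert (Hn1 := le_INR _ _ Hn). simpl (INR 1) in Hn1. rewrite Rmult_1_l. left. mono.
 - apply inv_INR_sq_lim.
 - exists l. intros n Hn. specialize (Hl n Hn). rewrite Rmult_1_l in Hl. exact Hl.
Qed.

(** Without the last [1 / 12] the limit would be the logarithm of the Glaisher--Kinkelin constant,
    [1 / 12 - zeta'(-1)]; the normalisation makes it [- zeta'(-1)]. *)
Definition hyperfactorial_defect (n : nat) : R := bsum (fun k => INR k * ln (INR k)) n -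
 ((INR n ^ 2 / 2 + INR n / 2 + 1 / 12) * ln (INR n) - INR n ^ 2 / 4 + 1 / 12).

Lemma hyperfactorial_limit : exists l : R, forall n, (1 <= n)%nat ->
 Rabs (hyperfactorial_defect n - l) <= / INR n ^ 2.
Proof.
 destruct (euler_maclaurin (fun x => x ^ 2 / 2 * ln x - x ^ 2 / 4) (fun x => x * ln x) (fun x => ln x + 1) (fun x => / x)
  (fun x => - / x ^ 2) (fun x => 2 * / x ^ 3) (fun n => 1 * / INR n ^ 2)) as [l Hl].
 - intros x Hx. pos_derive.
 - intros x Hx. pos_derive.
 - intros x Hx. pos_derive.
 - intros x Hx. pos_derive.
 - intros x Hx. pos_derive.
 - intros n x Hn Hx. assert (H := inv_sq_step n Hn). assert (Hn1 := le_INR _ _ Hn). simpl (INR 1) in Hn1.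
  rewrite Rabs_right by pos. assert (H1 := inv_pow_antitone (INR n) x 3 ltac:(lra)).
  assert (0 < / INR n ^ 3) by pos. lra.
 - intros n Hn. assert (Hn1 := le_INR _ _ Hn). simpl (INR 1) in Hn1. rewrite Rmult_1_l. left. mono.
 - apply inv_INR_sq_lim.
 - exists l. intros n Hn. specialize (Hl n Hn). rewrite Rmult_1_l in Hl. eapply Rle_trans; [|exact Hl].
  right. f_equal. unfold hyperfactorial_defect. field.
Qed.

(** * Expansions of the sums over [k <= n] *)

Lemma fine_bounds (h : R) (k : nat) : 0 < h <= 1 / 100 -> 1000 <= - xk h k ->
 Rabs (1 - rs k (th h) ^ 2 - uu h (- xk h k) * (1 + h ^ 2 * ((/ - xk h k) ^ 2 / 8)))
  <= uu h (- xk h k) * (h ^ 2 * (bB * (/ - xk h k) ^ 3)).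
Proof. intros Hh Hk. assert (H1 := ak_fine_upper h k Hh Hk). assert (H2 := ak_fine_lower h k Hh Hk).
 rewrite rs_ak, Rpow_mult_distr by lra. set (s := - xk h k) in *.
 assert (E1 := one_minus_vv 1 h s). assert (E2 := one_minus_vv (-1) h s).
 assert (Hh2 := pow2_ge_0 h). unfold ef in E1, E2.
 apply (Rmult_le_compat_l (h ^ 2)) in H1; [|exact Hh2]. apply (Rmult_le_compat_l (h ^ 2)) in H2; [|exact Hh2].
 apply Rabs_le. split; lra.
Qed.

Lemma th_surj (t : R) : 10 ^ 6 <= t -> exists h, 0 < h <= 1 / 100 /\ th h = t.
Proof. intros Ht. assert (H0 : 0 < t) by lra. exists (exp (- ln t / 3)). assert (E : exp (- ln t / 3) ^ 3 = / t).
 { simpl. rewrite Rmult_1_r, <- !exp_plus. replace (- ln t / 3 + (- ln t / 3 + - ln t / 3)) with (- ln t) by field.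
  rewrite exp_Ropp, exp_ln by exact H0. reflexivity. }
 assert (Hp := exp_pos (- ln t / 3)). split; [split; [exact Hp|]|].
 - destruct (Rle_lt_dec (exp (- ln t / 3)) (1 / 100)) as [H|H]; [exact H|exfalso].
  assert ((1 / 100) ^ 3 < exp (- ln t / 3) ^ 3). { set (y := exp (- ln t / 3)) in *.
   replace (y ^ 3) with (y * (y * y)) by ring. nra. }
  assert (/ t <= / 10 ^ 6) by mono. lra.
 - unfold th. rewrite E. apply Rinv_inv.
Qed.

(** The barriers at [k = 1], where [- x >= h ^ -2] makes them an expansion in [1 / t], take the
    place of the asymptotics of the Bessel quotient. The comparison value [p] is the Taylor
    polynomial of [sqrt (1 - z / 2)] in [z = 1 / t]. *)
Lemma r1_expansion (t : R) : 10 ^ 6 <= t -> Rabs (2 * r1 t - (2 - 1 / (2 * t) - 1 / (16 * t ^ 2))) <= 10 ^ 8 / t ^ 3.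
Proof. intros Ht. destruct (th_surj t Ht) as [h [Hh Et]]. assert (Hz0 : 0 < / t <= / 10 ^ 6) by mono.
 assert (Hh2 : 0 < h ^ 2 <= 1 / 10000) by (split; [pos|nra]). assert (Hih2 : 10000 <= / h ^ 2).
 { replace 10000 with (/ (1 / 10000)) by field. mono. }
 assert (Hs : / h ^ 2 <= - xk h 1). { unfold xk. simpl INR. mono. }
 assert (H := fine_bounds h 1 Hh ltac:(lra)). rewrite (uu_xk h 0) in H by lra. rewrite Et, rs_1 in H.
 simpl (INR 1) in H. replace (1 * h ^ 3 / 2) with (/ t / 2) in H by (rewrite <- Et; unfold th; rewrite Rinv_inv; field).
 set (w := / - xk h 1) in *. set (z := / t) in *.
 assert (Ez : z = h ^ 3) by (unfold z; rewrite <- Et; apply Rinv_inv). assert (Hw : 0 < w <= h ^ 2).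
 { split; [apply Rinv_0_lt_compat; lra|]. rewrite <- (Rinv_inv (h ^ 2)). apply Rinv_le_contravar; lra. }
 assert (Hw2 : w ^ 2 <= (h ^ 2) ^ 2) by mono. assert (P2 : h ^ 2 * w ^ 2 <= z ^ 2).
 { apply Rle_trans with (h ^ 2 * (h ^ 2) ^ 2); [mono|right; rewrite Ez; ring]. }
 assert (P3 : h ^ 2 * w ^ 3 <= z ^ 2 / 10000). { apply Rle_trans with (h ^ 2 * (h ^ 2) ^ 3); [mono|].
  replace (h ^ 2 * (h ^ 2) ^ 3) with (z ^ 2 * h ^ 2) by (rewrite Ez; ring).
  assert (Hz2 := pow2_ge_0 z). unfold Rdiv. mono. }
 assert (P2' : 0 <= h ^ 2 * w ^ 2) by pos. assert (Hr := r1_bounds t ltac:(lra)). set (r := r1 t) in *.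
 assert (Hz2 : z ^ 2 <= z / 1000) by nra. assert (Hmain : Rabs (1 - r ^ 2 - z / 2) <= 600000 * z ^ 3).
 { unfold bB in H. absle H. assert (Q : 0 <= z / 2 * (h ^ 2 * (w ^ 2 / 8)) <= z ^ 3).
  { split; [pos|]. replace (z ^ 3) with (z * z ^ 2) by ring.
   replace (z / 2 * (h ^ 2 * (w ^ 2 / 8))) with (z * (h ^ 2 * w ^ 2 / 16)) by field. mono. }
  assert (Q2 : z / 2 * (h ^ 2 * (5 * 1000 ^ 3 * w ^ 3)) <= 250000 * z ^ 3).
  { replace (z / 2 * (h ^ 2 * (5 * 1000 ^ 3 * w ^ 3))) with (z * (2500000000 * (h ^ 2 * w ^ 3))) by field.
   replace (250000 * z ^ 3) with (z * (250000 * z ^ 2)) by ring. mono. }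
  assert (0 <= z ^ 3) by pos. apply Rabs_le. split; lra. }
 replace (2 - 1 / (2 * t) - 1 / (16 * t ^ 2)) with (2 - z / 2 - z ^ 2 / 16) by (unfold z; field; lra).
 replace (10 ^ 8 / t ^ 3) with (10 ^ 8 * z ^ 3) by (unfold z; field; lra). set (p := 1 - z / 4 - z ^ 2 / 32).
 assert (Ep : 1 - p ^ 2 - z / 2 = - (z ^ 3 / 64 * (1 + z / 16))) by (unfold p; field).
 assert (Hp : 1 / 2 <= p <= 1) by (unfold p; lra).
 replace (2 * r - (2 - z / 2 - z ^ 2 / 16)) with (2 * (r - p)) by (unfold p; field).
 assert (Hd : Rabs (r ^ 2 - p ^ 2) <= 700000 * z ^ 3). { absle Hmain. apply Rabs_le.
  assert (0 <= z ^ 3 * z <= z ^ 3 * 1) by mono. split; lra. }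
 replace (r ^ 2 - p ^ 2) with ((r + p) * (r - p)) in Hd by ring.
 rewrite Rabs_mult, (Rabs_right (r + p)) in Hd by lra. rewrite Rabs_mult, (Rabs_right 2) by lra.
 assert (H0 := Rabs_pos (r - p)). assert (1 / 2 * Rabs (r - p) <= (r + p) * Rabs (r - p)) by mono. lra.
Qed.

(** Integrates [r1_expansion]. The constant [c] of integration stays open here; [stirling_bessel]
    relates it to Stirling's constant. *)
Lemma logbes_expansion : exists c : R, forall t, 10 ^ 6 <= t ->
 Rabs (logbes t - (2 * t - ln (2 * t) / 2 + 1 / (16 * t)) - c) <= 10 ^ 8 / t ^ 2.
Proof. set (g := fun t => logbes t - (2 * t - ln (2 * t) / 2 + 1 / (16 * t))).
 assert (Dg : forall t, 0 < t -> is_derive g t (2 * r1 t - (2 - 1 / (2 * t) - 1 / (16 * t ^ 2)))).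
 { intros t Ht. apply is_derive_minusR; [apply logbes_derive|]. auto_derive; [mono|field; lra]. }
 assert (Hg : forall a b, 10 ^ 6 <= a -> a <= b -> Rabs (g b - g a) <= 10 ^ 8 / 2 * (/ a ^ 2 - / b ^ 2)).
 { intros a b Ha Hab.
  assert (DW : forall t, a <= t <= b -> is_derive (fun t => 10 ^ 8 / 2 * / t ^ 2) t (- (10 ^ 8 / t ^ 3))).
  { intros t Ht. pos_derive. }
  assert (Hc : forall t, a <= t <= b -> - (10 ^ 8 / t ^ 3) <= 2 * r1 t - (2 - 1 / (2 * t) - 1 / (16 * t ^ 2)) <= 10 ^ 8 / t ^ 3).
  { intros t Ht. apply Rabs_le_between, r1_expansion. lra. }
  assert (H1 := incr_le (fun t => g t - 10 ^ 8 / 2 * / t ^ 2) (fun t => (2 * r1 t - (2 - 1 / (2 * t) - 1 / (16 * t ^ 2))) - - (10 ^ 8 / t ^ 3)) a b Hab).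
  assert (H2 := incr_le (fun t => - (10 ^ 8 / 2 * / t ^ 2) - g t) (fun t => - - (10 ^ 8 / t ^ 3) - (2 * r1 t - (2 - 1 / (2 * t) - 1 / (16 * t ^ 2)))) a b Hab).
  assert (g a - 10 ^ 8 / 2 * / a ^ 2 <= g b - 10 ^ 8 / 2 * / b ^ 2). { apply H1; intros t Ht.
   - apply is_derive_minusR; [apply Dg; lra|apply DW, Ht].
   - specialize (Hc t Ht). lra. }
  assert (- (10 ^ 8 / 2 * / a ^ 2) - g a <= - (10 ^ 8 / 2 * / b ^ 2) - g b). { apply H2; intros t Ht.
   - apply is_derive_minusR; [|apply Dg; lra]. apply (is_derive_opp (fun t => 10 ^ 8 / 2 * / t ^ 2)), DW, Ht.
   - specialize (Hc t Ht). lra. }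
  apply Rabs_le. lra. }
 destruct (telescoping_limit (fun n => g (INR n)) (fun n => 10 ^ 8 / 2 * / INR n ^ 2) (Z.to_nat 1000000)) as [c Hc].
 - intros n Hn. assert (10 ^ 6 <= INR n).
  { apply le_INR in Hn. rewrite INR_IZR_INZ, Z2Nat.id in Hn by lia. simpl IZR in Hn. lra. }
  eapply Rle_trans; [apply Hg; [mono|rewrite S_INR; lra]|]. right. ring.
 - intros n _. apply Rmult_le_pos; [lra|]. destruct n as [|n]; [simpl; rewrite Rmult_0_l, Rinv_0; lra|].
  left; apply Rinv_0_lt_compat, pow_lt, INR_S_pos.
 - apply inv_INR_sq_lim.
 - exists c. intros t Ht. change (Rabs (g t - c) <= 10 ^ 8 / t ^ 2). apply Rle_trans with (10 ^ 8 / 2 * / t ^ 2).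
  + apply le_epsilon. intros e He.
   destruct (lim_0_eventually (fun n => 10 ^ 8 / 2 * / INR n ^ 2) e (inv_INR_sq_lim _) He) as [K HK].
   destruct (nfloor_ex t ltac:(lra)) as [m [_ Hm]]. set (n := max (max K (S m)) (Z.to_nat 1000000)).
   assert (Hn1 : INR (S m) <= INR n) by (apply le_INR; unfold n; lia). rewrite S_INR in Hn1.
   specialize (HK n ltac:(unfold n; lia)). specialize (Hc n ltac:(unfold n; lia)).
   assert (HG := Hg t (INR n) Ht ltac:(lra)). assert (0 < / INR n ^ 2) by pos. rewrite Rabs_right in HK by lra.
   replace (g t - c) with ((g (INR n) - c) - (g (INR n) - g t)) by ring.
   eapply Rle_trans; [apply Rabs_triang|]. rewrite Rabs_Ropp. lra.
  + assert (0 < / t ^ 2) by pos. mono.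
Qed.

Lemma bsum_S (f : nat -> R) (n : nat) : bsum f (S n) = bsum f n + f (S n).
Proof. reflexivity. Qed.

Lemma xk_0 (h : R) : - xk h 0 = 2 / h ^ 2.
Proof. unfold xk. simpl INR. ring. Qed.

Lemma inv_sq_sum (h : R) (n : nat) : 0 < h <= 1 / 100 -> 1000 <= - xk h n ->
 / - xk h n - / - xk h 0 <= bsum (fun k => h * (/ - xk h k) ^ 2) n <= / (- xk h n - h).
Proof. intros Hh. induction n as [|n IH]; intros Hn.
 - simpl bsum. assert (0 < / (- xk h 0 - h)) by mono. lra.
 - rewrite xk_S in Hn. destruct (IH ltac:(lra)) as [I1 I2]. rewrite bsum_S, xk_S.
  set (y := - xk h n) in *. replace (- (xk h n + h)) with (y - h) in * by (unfold y; ring).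
  assert (/ (y - h) - / y <= h * (/ (y - h)) ^ 2).
  { apply Rminus_le. replace (/ (y - h) - / y - h * (/ (y - h)) ^ 2) with (- (h ^ 2 * / (y * (y - h) ^ 2))) by (field; lra).
   assert (0 <= h ^ 2 * / (y * (y - h) ^ 2)); [|lra]. mono. }
  assert (h * (/ (y - h)) ^ 2 <= / (y - h - h) - / (y - h)).
  { apply Rminus_le. replace (h * (/ (y - h)) ^ 2 - (/ (y - h - h) - / (y - h))) with (- (h ^ 2 * / ((y - h - h) * (y - h) ^ 2))) by (field; lra).
   assert (0 <= h ^ 2 * / ((y - h - h) * (y - h) ^ 2)); [|lra]. mono. }
  lra.
Qed.

Lemma inv_sq_sum_le (h : R) (n : nat) : 0 < h <= 1 / 100 -> 1000 <= - xk h n ->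
 bsum (fun k => h * (/ - xk h k) ^ 2) n <= 2 / - xk h n.
Proof. intros Hh Hn. eapply Rle_trans; [apply inv_sq_sum; assumption|]. set (s := - xk h n) in *.
 apply Rminus_le. replace (/ (s - h) - 2 / s) with (- ((s - 2 * h) * / (s * (s - h)))) by (field; lra).
 assert (0 <= (s - 2 * h) * / (s * (s - h))); [|lra]. mono.
Qed.

Lemma ln_ratio_bounds (y h : R) : 0 < h < y -> ln (y + h) - ln y <= h / y <= ln y - ln (y - h).
Proof. intros Hh. split.
 - rewrite <- ln_div by lra. eapply Rle_trans; [apply ln_le_sub_1; apply Rdiv_lt_0_compat; lra|]. right. field. lra.
 - assert (H := ln_le_sub_1 ((y - h) / y) ltac:(apply Rdiv_lt_0_compat; lra)). rewrite ln_div in H by lra.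
  replace ((y - h) / y - 1) with (- (h / y)) in H by (field; lra). lra.
Qed.

Lemma inv_sum (h : R) (n : nat) : 0 < h <= 1 / 100 -> 1000 <= - xk h n ->
 ln (- xk h 0) - ln (- xk h n) <= bsum (fun k => h * / - xk h k) n <= ln (- xk h 0 - h) - ln (- xk h n - h).
Proof. intros Hh. induction n as [|n IH]; intros Hn.
 - simpl bsum. lra.
 - rewrite xk_S in Hn. destruct (IH ltac:(lra)) as [I1 I2]. rewrite bsum_S, xk_S.
  set (y := - xk h n) in *. replace (- (xk h n + h)) with (y - h) in * by (unfold y; ring).
  assert (H := ln_ratio_bounds (y - h) h ltac:(lra)). replace (y - h + h) with y in H by ring. mono.
Qed.

(** With [y = - x_k] the weight [(n - k) h] is [y - s], so this is a Riemann sum of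
    [1 / y - s / y ^ 2] from [s] to [2 / h ^ 2]: the first part gives the logarithms, the second the
    1. *)
Lemma left_log_sum (h : R) (n : nat) : 0 < h <= 1 / 100 -> 1000 <= - xk h n ->
 Rabs (bsum (fun k => (INR n - INR k) * h ^ 2 * (/ - xk h k) ^ 2) n - (ln (2 / h ^ 2) - ln (- xk h n) - 1))
  <= h * - xk h n.
Proof. intros Hh Hn. assert (Hk : forall k, (1 <= k <= n)%nat -> 1000 <= - xk h k).
 { intros k Hk. assert (H := xk_mono h k n ltac:(lra) ltac:(lia)). lra. }
 assert (Hpos := xk_lower h n ltac:(lra)).
 rewrite (bsum_ext _ (fun k => h * / - xk h k - (- xk h n) * (h * (/ - xk h k) ^ 2))).
 2:{ intros k Hk'. specialize (Hk k Hk').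
   assert (Hz : (INR n - INR k) * h = - xk h k - - xk h n) by (unfold xk; ring).
   replace ((INR n - INR k) * h ^ 2 * (/ - xk h k) ^ 2) with ((INR n - INR k) * h * (h * (/ - xk h k) ^ 2)) by ring.
   rewrite Hz. field. lra. }
 rewrite bsum_minus, (bsum_scal (- xk h n)).
 destruct (inv_sq_sum h n Hh Hn) as [A1 A2]. destruct (inv_sum h n Hh Hn) as [B1 B2].
 rewrite xk_0 in *. set (s := - xk h n) in *. set (b1 := bsum (fun k => h * / - xk h k) n) in *.
 set (b2 := bsum (fun k => h * (/ - xk h k) ^ 2) n) in *. assert (Hih : 2 / h ^ 2 >= s).
 { assert (H2 : 0 < h ^ 2) by mono. apply Rle_ge. apply le_div_intro; [exact H2|]. unfold s. lra. }
 apply (Rmult_le_compat_l s) in A1; [|lra]. apply (Rmult_le_compat_l s) in A2; [|lra].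
 assert (C1 : ln (2 / h ^ 2 - h) <= ln (2 / h ^ 2)) by (apply ln_le; lra). assert (C2 : ln s - ln (s - h) <= h).
 { assert (H := ln_ge_1_sub ((s - h) / s) ltac:(apply Rdiv_lt_0_compat; lra)). rewrite ln_div in H by lra.
  assert (E : / ((s - h) / s) <= 1 + h); [|lra].
  replace (/ ((s - h) / s)) with (s / (s - h)) by (field; lra). apply div_le_intro; [lra|nra]. }
 replace (s * (/ s - / (2 / h ^ 2))) with (1 - s * h ^ 2 / 2) in A1 by (field; lra).
 assert (C3 : s * / (s - h) <= 1 + h) by (apply div_le_intro; [lra|nra]). assert (Hhs : h * 1000 <= h * s) by mono.
 assert (C4 : s * h ^ 2 <= h * s * (1 / 100)). { replace (s * h ^ 2) with (h * s * h) by ring. mono. }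
 apply Rabs_le. split; lra.
Qed.

Lemma ln_one_plus_lip (a b : R) : 0 <= a -> 0 <= b -> Rabs (ln (1 + a) - ln (1 + b)) <= Rabs (a - b).
Proof. assert (H : forall a b, 0 <= a -> a <= b -> 0 <= ln (1 + b) - ln (1 + a) <= b - a).
 { intros x y Hx Hy. split; [assert (ln (1 + x) <= ln (1 + y)) by (apply ln_le; lra); lra|].
  rewrite <- ln_div by lra. eapply Rle_trans; [apply ln_le_sub_1, Rdiv_lt_0_compat; lra|].
  replace ((1 + y) / (1 + x) - 1) with ((y - x) / (1 + x)) by (field; lra). apply div_le_intro; nra. }
 intros Ha Hb. destruct (Rle_lt_dec a b) as [Hab|Hab].
 - specialize (H a b Ha Hab). rewrite !Rabs_left1 by lra. lra.
 - specialize (H b a Hb ltac:(lra)). rewrite !Rabs_right by lra. lra.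
Qed.

(** Passing from [r ^ 2] to [r] divides by [r + sqrt y >= h] and so costs one power of [h], which
    the summable factor [(/ - x_k) ^ 2] can afford. *)
Lemma r_fine (h : R) (k : nat) : 0 < h <= 1 / 100 -> 1000 <= - xk h k ->
 Rabs (rs k (th h) - sqrt (- xk h k * h ^ 2 / 2)) <= 6 * 10 ^ 6 * (h * (/ - xk h k) ^ 2).
Proof. intros Hh Hk. assert (H := fine_bounds h k Hh Hk). assert (Hl := xk_lower h k ltac:(lra)).
 assert (Hu := uu_bounds h (- xk h k) ltac:(lra) ltac:(lra)). assert (Hr := rs_pos k (th h) (th_pos h ltac:(lra))).
 set (r := rs k (th h)) in *. set (s := - xk h k) in *. set (y := s * h ^ 2 / 2) in *.
 replace (uu h s) with (1 - y) in * by (unfold uu, y; reflexivity).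
 set (w := / s) in *. assert (0 < w <= / 1000) by (split; [apply Rinv_0_lt_compat|apply Rinv_le_contravar]; lra).
 assert (Hw2 := pow2_ge_0 w). assert (Hh2 := pow2_ge_0 h).
 assert (w ^ 3 <= w ^ 2 / 1000) by (replace (w ^ 3) with (w ^ 2 * w) by ring; unfold Rdiv; apply Rmult_le_compat_l; lra).
 
 assert (0 <= h ^ 2 * w ^ 3 <= h ^ 2 * w ^ 2 / 1000). { split; [mono|]. unfold Rdiv. rewrite Rmult_assoc. mono. }
 assert (Hd : Rabs (r ^ 2 - y) <= 6 * 10 ^ 6 * (h ^ 2 * w ^ 2)).
 { assert (0 <= (1 - y) * (h ^ 2 * w ^ 2) <= 1 * (h ^ 2 * w ^ 2)) by mono.
  assert (0 <= (1 - y) * (h ^ 2 * w ^ 3) <= 1 * (h ^ 2 * w ^ 3)) by mono.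
  unfold bB in H. absle H. apply Rabs_le. split; lra. }
 assert (Hy : h ^ 2 <= y) by (unfold y; nra). assert (h <= sqrt y).
 { rewrite <- (sqrt_pow2 h) by lra. apply sqrt_le_1_alt, Hy. }
 assert (sqrt y * sqrt y = y) by (apply sqrt_sqrt; lra).
 replace (r ^ 2 - y) with ((r + sqrt y) * (r - sqrt y)) in Hd by mono.
 rewrite Rabs_mult, (Rabs_right (r + sqrt y)) in Hd by lra.
 assert (h * Rabs (r - sqrt y) <= (r + sqrt y) * Rabs (r - sqrt y)) by mono.
 apply (Rmult_le_reg_l h); [lra|]. eapply Rle_trans; [eassumption|]. eapply Rle_trans; [exact Hd|]. right; ring.
Qed.

(** The primitive of [ln (1 + sqrt y)] that vanishes at 0; its value [1 / 2] at 1 is what cancels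
    [t] in [left_A]. *)
Definition phi (y : R) : R := (y - 1) * ln (1 + sqrt y) + sqrt y - y / 2.

Lemma phi_derive (y : R) : 0 < y -> is_derive phi y (ln (1 + sqrt y)).
Proof. intros Hy. assert (Hs := sqrt_lt_R0 y Hy). unfold phi. auto_derive.
 - repeat split; lra.
 - assert (E : y = sqrt y * sqrt y) by (symmetry; apply sqrt_sqrt; lra).
  set (r := sqrt y) in *. rewrite E. field. lra.
Qed.

Lemma phi_small (r : R) : 0 <= r -> Rabs (phi (r ^ 2) - 2 / 3 * r ^ 3) <= r ^ 4 / 2.
Proof. intros Hr. unfold phi. rewrite sqrt_pow2 by exact Hr.
 apply (deriv_bound_sym (fun r => (r ^ 2 - 1) * ln (1 + r) + r - r ^ 2 / 2 - 2 / 3 * r ^ 3) (fun r => 2 * r * (ln (1 + r) - r))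
  (fun r => r ^ 4 / 2) (fun r => 2 * r ^ 3) r); [exact Hr| | | | | |lra].
 - intros x Hx. auto_derive; [lra|field; lra].
 - intros x Hx. auto_derive; [exact I|field].
 - intros x Hx. assert (H := ln_one_plus_bounds x ltac:(lra)).
  rewrite Rabs_mult, (Rabs_right (2 * x)) by lra. replace (2 * x ^ 3) with (2 * x * x ^ 2) by ring.
  apply Rmult_le_compat_l; [lra|]. apply Rabs_le. lra.
 - cbv beta. rewrite (Rplus_0_r 1), ln_1. field.
 - field.
Qed.

Lemma phi_trapezoid (a d : R) : 0 < a -> 0 <= d -> a + d <= 1 ->
 Rabs (d / 2 * (ln (1 + sqrt a) + ln (1 + sqrt (a + d))) - (phi (a + d) - phi a)) <= / (a * sqrt a) * d ^ 3 / 12.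
Proof. intros Ha Hd Had. apply (trapezoid phi (fun y => ln (1 + sqrt y)) (fun y => / (2 * (sqrt y + y)))
  (fun y => - ((/ (2 * sqrt y) + 1) / (2 * (sqrt y + y) ^ 2))) a d); [exact Hd| | | |].
 - intros x Hx. apply phi_derive; lra.
 - intros x Hx. assert (Hs := sqrt_lt_R0 x ltac:(lra)). auto_derive; [mono|].
  assert (E : x = sqrt x * sqrt x) by (symmetry; apply sqrt_sqrt; lra).
  set (r := sqrt x) in *. rewrite E. field. mono.
 - intros x Hx. assert (Hs := sqrt_lt_R0 x ltac:(lra)). auto_derive.
  + mono.
  + field. lra.
 - intros x Hx. assert (Hs := sqrt_lt_R0 x ltac:(lra)). assert (Hsa := sqrt_lt_R0 a Ha).
  assert (E : x = sqrt x * sqrt x) by (symmetry; apply sqrt_sqrt; lra).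
  assert (a * sqrt a <= x * sqrt x) by (apply Rmult_le_compat; [lra|lra|lra|apply sqrt_le_1_alt; lra]).
  apply Rle_trans with (/ (x * sqrt x)); [|mono]. rewrite E at 3 4. set (r := sqrt x) in *.
  assert (H2 : 0 < 2 * (r + r * r) ^ 2) by mono. assert (0 < / (2 * r)) by mono.
  rewrite Rabs_Ropp, Rabs_right by (apply Rle_ge, Rdiv_le_0_compat; lra). apply div_le_intro; [exact H2|].
  apply Rminus_le. replace (/ (2 * r) + 1 - / (r * r * r) * (2 * (r + r * r) ^ 2)) with
   ((1 + 2 * r - 4 * (1 + r) ^ 2) * / (2 * r)) by (field; lra). nra.
Qed.

(** Equal to [1 - k / (2 t)], the leading value of [r_k ^ 2]. *)
Definition yk (h : R) (k : nat) : R := - xk h k * h ^ 2 / 2.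

Lemma yk_0 (h : R) : 0 < h -> yk h 0 = 1.
Proof. intros H. unfold yk. rewrite xk_0. field. lra. Qed.

Lemma yk_S (h : R) (k : nat) : yk h k = yk h (S k) + h ^ 3 / 2.
Proof. unfold yk. rewrite xk_S. field. Qed.

Lemma yk_le_1 (h : R) (k : nat) : 0 < h -> yk h k <= 1.
Proof. intros H. assert (H1 := xk_lower h k H). unfold yk. lra. Qed.

Lemma sqrt_yk_ge (h : R) (k : nat) : 0 < h -> 2 <= - xk h k -> h <= sqrt (yk h k).
Proof. intros Hh Hk. rewrite <- (sqrt_pow2 h) at 1 by lra. apply sqrt_le_1_alt. unfold yk.
 assert (2 * h ^ 2 <= - xk h k * h ^ 2) by mono. lra.
Qed.

(** Trapezoidal rule in [y], with step [h ^ 3 / 2], from [y = 1] at [k = 0]. The sum omits [k = 0]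
    and counts [k = n] fully, hence the boundary correction with [ln 2]. *)
Lemma left_trapezoid_sum (h s : R) (n : nat) : 0 < h -> 1000 <= s -> s <= - xk h n ->
 Rabs (bsum (fun k => ln (1 + sqrt (yk h k))) n -
  (2 / h ^ 3 * (1 / 2 - phi (yk h n)) + (ln (1 + sqrt (yk h n)) - ln 2) / 2)) <= INR n * (h ^ 3 / s).
Proof. intros Hh Hs. assert (0 < h ^ 3) by pos. induction n as [|n IH]; intros Hn.
 - rewrite yk_0 by exact Hh. unfold phi. rewrite sqrt_1. simpl bsum. simpl INR. replace (1 + 1) with 2 by ring.
  replace (0 - _) with 0 by mono. rewrite Rabs_R0. lra.
 - rewrite xk_S in Hn. specialize (IH ltac:(lra)). rewrite bsum_S, S_INR.
  assert (s <= - xk h (S n)) by (rewrite xk_S; exact Hn).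
  assert (Hq := sqrt_yk_ge h (S n) Hh ltac:(lra)). assert (H1 := yk_le_1 h n Hh).
  rewrite (yk_S h n) in *. set (a := yk h (S n)) in *. assert (s * h ^ 2 / 2 <= a).
  { unfold a, yk. assert (H2 := pow2_ge_0 h). assert (s * h ^ 2 <= - xk h (S n) * h ^ 2) by mono. lra. }
  assert (0 < s * h ^ 2) by pos. assert (HT := phi_trapezoid a (h ^ 3 / 2) ltac:(lra) ltac:(lra) H1).
  assert (/ (a * sqrt a) <= 2 / (s * h ^ 3)).
  { replace (2 / (s * h ^ 3)) with (/ (s * h ^ 2 / 2 * h)) by (field; lra). mono. }
  set (f1 := ln (1 + sqrt a)) in *. set (f0 := ln (1 + sqrt (a + h ^ 3 / 2))) in *.
  set (p1 := phi a) in *. set (p0 := phi (a + h ^ 3 / 2)) in *.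
  set (b := bsum (fun k => ln (1 + sqrt (yk h k))) n) in *.
  assert (Rabs ((f1 + f0) / 2 - 2 / h ^ 3 * (p0 - p1)) <= h ^ 3 / s).
  { replace ((f1 + f0) / 2 - 2 / h ^ 3 * (p0 - p1)) with (2 / h ^ 3 * (h ^ 3 / 2 / 2 * (f1 + f0) - (p0 - p1))) by (field; lra).
   assert (0 < 2 / h ^ 3) by pos. rewrite Rabs_mult, (Rabs_right (2 / h ^ 3)) by lra.
   apply Rle_trans with (2 / h ^ 3 * (2 / (s * h ^ 3) * (h ^ 3 / 2) ^ 3 / 12)).
   - apply Rmult_le_compat_l; [lra|]. eapply Rle_trans; [exact HT|].
    assert (/ (a * sqrt a) * (h ^ 3 / 2) ^ 3 <= 2 / (s * h ^ 3) * (h ^ 3 / 2) ^ 3) by mono. lra.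
   - assert (0 < h ^ 3 / s) by pos.
    replace (2 / h ^ 3 * (2 / (s * h ^ 3) * (h ^ 3 / 2) ^ 3 / 12)) with (h ^ 3 / s * (1 / 24)) by (field; lra). lra. }
  replace (b + f1 - (2 / h ^ 3 * (1 / 2 - p1) + (f1 - ln 2) / 2)) with
   ((b - (2 / h ^ 3 * (1 / 2 - p0) + (f0 - ln 2) / 2)) + ((f1 + f0) / 2 - 2 / h ^ 3 * (p0 - p1))) by mono.
  eapply Rle_trans; [apply Rabs_triang|]. lra.
Qed.

Lemma INR_le_left (h : R) (n : nat) : 0 < h -> 0 <= - xk h n -> INR n <= 2 / h ^ 3.
Proof. intros Hh Hn. apply le_div_intro; [pos|]. unfold xk in Hn. apply (Rmult_le_compat_r (h ^ 2)) in Hn; [|mono].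
 replace (- (INR n * h - 2 / h ^ 2) * h ^ 2) with (2 - INR n * h ^ 3) in Hn by (field; lra). lra.
Qed.

(** The integral of [ln (1 + sqrt y)] over [[0, 1]] cancels [t], the part near [y = 0] gives
    [4 / 3 (s / 2) ^ (3 / 2)] through [phi_small], and [ln 2 / 2] is the trapezoidal correction at
    [y = 1]. *)
Lemma left_A (h : R) (n : nat) : 0 < h <= 1 / 100 -> 1000 <= - xk h n ->
 Rabs (th h - sumA n (th h) - (4 / 3 * sqrt (- xk h n / 2) ^ 3 + ln 2 / 2))
  <= 2 * 10 ^ 7 / - xk h n + h * (- xk h n) ^ 2.
Proof. intros Hh Hn. set (s := - xk h n) in *. assert (0 < h ^ 3) by pos.
 assert (B1 : Rabs (sumA n (th h) - bsum (fun k => ln (1 + sqrt (yk h k))) n) <= 6 * 10 ^ 6 * (2 / s)).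
 { unfold sumA. rewrite <- bsum_minus. eapply Rle_trans; [apply bsum_abs|].
  apply Rle_trans with (bsum (fun k => 6 * 10 ^ 6 * (h * (/ - xk h k) ^ 2)) n).
  - apply bsum_le. intros k Hk. assert (Hmk := xk_mono h k n ltac:(lra) ltac:(lia)).
   assert (1000 <= - xk h k) by (unfold s in Hn; lra).
   eapply Rle_trans; [apply ln_one_plus_lip|apply r_fine; assumption].
   + left. apply rs_pos, th_pos. lra.
   + apply sqrt_pos.
  - rewrite bsum_scal. apply Rmult_le_compat_l; [lra|]. apply inv_sq_sum_le; assumption. }
 assert (B2 := left_trapezoid_sum h s n ltac:(lra) Hn ltac:(unfold s; lra)).
 assert (HN := INR_le_left h n ltac:(lra) ltac:(unfold s in Hn; lra)). assert (INR n * (h ^ 3 / s) <= 2 / s).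
 { apply Rle_trans with (2 / h ^ 3 * (h ^ 3 / s)).
  - mono.
  - right. field. split; lra. }
 set (g := sqrt (s / 2)) in *. assert (Hg := sqrt_pos (s / 2)). fold g in Hg.
 assert (Eg : g * g = s / 2) by (apply sqrt_sqrt; lra).
 assert (Ey : yk h n = (h * g) ^ 2) by (unfold yk; fold s; replace ((h * g) ^ 2) with (h ^ 2 * (g * g)) by ring; rewrite Eg; field).
 assert (Hhg : 0 <= h * g) by pos. assert (B4 := phi_small (h * g) Hhg). rewrite <- Ey in B4.
 assert (Es : sqrt (yk h n) = h * g) by (rewrite Ey; apply sqrt_pow2, Hhg). rewrite Es in B2.
 assert (B5 := ln_one_plus_bounds (h * g) Hhg). assert (0 <= ln (1 + h * g)) by (rewrite <- ln_1; apply ln_le; lra).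
 assert (g <= s / 2) by nra. assert (B6 : Rabs (2 / h ^ 3 * (phi (yk h n) - 2 / 3 * (h * g) ^ 3)) <= h * s ^ 2 / 4).
 { rewrite Rabs_mult, (Rabs_right (2 / h ^ 3)) by pos. apply Rle_trans with (2 / h ^ 3 * ((h * g) ^ 4 / 2)); [mono|].
  right. replace (h * s ^ 2 / 4) with (h * (s / 2) ^ 2) by field. rewrite <- Eg. field. lra. }
 assert (h * g <= h * s ^ 2 / 4) by (assert (g <= s ^ 2 / 4) by nra; assert (h * g <= h * (s ^ 2 / 4)) by mono; lra).
 replace (2 / h ^ 3 * (phi (yk h n) - 2 / 3 * (h * g) ^ 3)) with (2 / h ^ 3 * phi (yk h n) - 4 / 3 * g ^ 3) in B6 by (field; lra).
 replace (2 / h ^ 3 * (1 / 2 - phi (yk h n))) with (th h - 2 / h ^ 3 * phi (yk h n)) in B2 by (unfold th; field; lra).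
 unfold Rdiv in *. absle B1. absle B2. absle B6. apply Rabs_le. split; lra.
Qed.

(** The term of size [h ^ 2 / s ^ 2] has to be kept: summed with the weights [n - k] it produces the
    logarithm [ln s / 8]. *)
Lemma ln_fine (h : R) (k : nat) : 0 < h <= 1 / 100 -> 1000 <= - xk h (S k) ->
 Rabs (ln (1 - rs (S k) (th h) ^ 2) - ln (INR (S k) * h ^ 3 / 2) - h ^ 2 * (/ - xk h (S k)) ^ 2 / 8)
  <= 10 ^ 10 * (h ^ 2 * (/ - xk h (S k)) ^ 3).
Proof. intros Hh Hk. assert (H := fine_bounds h (S k) Hh Hk). rewrite uu_xk in H by lra.
 set (w := / - xk h (S k)) in *. assert (Hw : 0 < w <= / 1000) by (split; [apply Rinv_0_lt_compat|apply Rinv_le_contravar]; lra).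
 set (u := INR (S k) * h ^ 3 / 2) in *. assert (Hu : 0 < u).
 { assert (H1 := INR_S_pos k). assert (H2 : 0 < h ^ 3) by mono. unfold u.
  assert (0 < INR (S k) * h ^ 3) by mono. lra. }
 assert (H1r := one_minus_rs_sq k (th h) (th_pos h ltac:(lra))). set (v := 1 - rs (S k) (th h) ^ 2) in *.
 set (p := h ^ 2 * w ^ 2). set (r3 := h ^ 2 * w ^ 3). assert (Hh2 : 0 < h ^ 2 <= 1 / 10000) by (split; [mono|nra]).
 assert (Hw2 : 0 < w ^ 2 <= w / 1000) by (split; [mono|nra]). assert (Hp : 0 < p) by (apply Rmult_lt_0_compat; lra).
 assert (Hr3 : 0 < r3) by (apply Rmult_lt_0_compat; [lra|mono]).
 assert (Hw3 : w ^ 3 <= w ^ 2 / 1000) by (replace (w ^ 3) with (w ^ 2 * w) by ring; unfold Rdiv; apply Rmult_le_compat_l; lra).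
 assert (Hr3b : r3 <= 1 / 10 ^ 13). { unfold r3. apply Rle_trans with (1 / 10000 * (1 / 10 ^ 9)); [mono|lra]. }
 assert (Hpp : p ^ 2 <= r3). { unfold p, r3. replace ((h ^ 2 * w ^ 2) ^ 2) with (h ^ 2 * w ^ 3 * (h ^ 2 * w)) by ring.
  rewrite <- (Rmult_1_r (h ^ 2 * w ^ 3)) at 2. apply Rmult_le_compat_l; [mono|].
  apply Rle_trans with (1 * 1); [mono|lra]. }
 replace (h ^ 2 * (w ^ 2 / 8)) with (p / 8) in H by (unfold p; field).
 replace (h ^ 2 * (bB * w ^ 3)) with (bB * r3) in H by (unfold r3; ring).
 replace (h ^ 2 * w ^ 2 / 8) with (p / 8) by (unfold p; field). unfold bB in H. absle H.
 set (z := v / u). assert (Ez : v = u * z) by (unfold z; field; lra).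
 assert (Hz : 0 < z) by (apply Rdiv_lt_0_compat; lra).
 assert (Hz1 : 1 + p / 8 - 5 * 1000 ^ 3 * r3 <= z <= 1 + p / 8 + 5 * 1000 ^ 3 * r3).
 { rewrite Ez in H. split; apply (Rmult_le_reg_l u); lra. }
 rewrite Ez, ln_mult by assumption. assert (L1 := ln_le_sub_1 z Hz). assert (L2 := ln_ge_1_sub z Hz).
 assert (Hpb : p <= 1 / 10000 * (1 / 1000)) by (unfold p; apply Rmult_le_compat; lra).
 assert (L3 : 1 - / z >= z - 1 - 2 * (z - 1) ^ 2). { apply Rle_ge. assert (Hzi : / z * z = 1) by (field; lra).
  apply Rminus_le. replace (z - 1 - 2 * (z - 1) ^ 2 - (1 - / z)) with ((z - 1) ^ 2 * (1 - 2 * z) * / z) by (field; lra).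
  assert (0 < / z) by mono. assert (H2 := pow2_ge_0 (z - 1)). assert ((z - 1) ^ 2 * (1 - 2 * z) <= 0) by nra. nra. }
 assert (L4 : (z - 1) ^ 2 <= 2 * (p / 8) ^ 2 + 2 * (5 * 1000 ^ 3 * r3) ^ 2).
 { set (e := z - 1 - p / 8). assert (He : - (5 * 1000 ^ 3 * r3) <= e <= 5 * 1000 ^ 3 * r3) by (unfold e; lra).
  replace (z - 1) with (p / 8 + e) by (unfold e; ring). set (f := 5 * 1000 ^ 3 * r3) in *.
  assert (e ^ 2 <= f ^ 2) by nra. assert (Hsq := pow2_ge_0 (p / 8 - e)). lra. }
 assert (L5 : (5 * 1000 ^ 3 * r3) ^ 2 <= 5 * 1000 ^ 3 * r3 * (1 / 1000)).
 { set (f := 5 * 1000 ^ 3 * r3). assert (0 <= f <= 1 / 1000) by (unfold f; lra). replace (f ^ 2) with (f * f) by ring. mono. }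
 apply Rabs_le. split; lra.
Qed.

(** By [tail_B] this is the part [k > n] of the exact sum. Its terms are [O(h ^ 2 e ^ (-2 x))], so
    on [x >= -1002] the total is [O(h)]. *)
Lemma sumB_tail (h : R) (n : nat) : 0 < h <= 1 / (40 * exp 1002) -> -1002 <= xk h n ->
 Rabs (- logbes (th h) - sumB n (th h)) <= h * (1458 * exp 1002 ^ 2).
Proof. set (A := exp 1002). intros Hh Hn.
 assert (HA : 1 <= A) by (unfold A; rewrite <- exp_0; apply exp_le_mono; lra). assert (HhA : h * A <= 1 / 40).
 { replace (1 / 40) with (1 / (40 * A) * A) by (field; lra). mono. }
 assert (Hh2 : h <= 1 / 40) by nra. assert (Hlim := tail_B n (th h) (th_pos h ltac:(lra))).
 set (u := fun j => ln (1 - rs (n + j) (th h) ^ 2)) in *.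
 assert (Hb : forall m, Rabs (bsum u m) <= h * (1458 * A ^ 2)). { intros m. assert (HC : 0 <= h * (1458 * A)) by mono.
  assert (H := exp_tail_sum u (h * (1458 * A)) h (xk h n) m HC ltac:(lra)). eapply Rle_trans; [apply H|].
  - intros j Hj. unfold u. rewrite <- xk_add, rs_ak by lra. set (x := xk h (n + j)).
   assert (Hx : -1002 <= x). { assert (Hm := xk_mono h n (n + j) ltac:(lra) ltac:(lia)). unfold x. lra. }
   assert (Ha := ak_exp h (n + j) ltac:(lra)). fold x in Ha. assert (Ha0 := ak_pos h (n + j) ltac:(lra)).
   assert (He : exp (- x) <= A) by (apply exp_le_mono; lra). set (a := ak h (n + j)) in *. set (e := exp (- x)) in *.
   assert (Hae : h * a <= 27 * (h * e)) by (replace (27 * (h * e)) with (h * (27 * e)) by ring; apply Rmult_le_compat_l; lra).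
   assert (Hhe : 0 <= h * e <= h * A) by mono. assert (Hsq : (h * a) ^ 2 <= (27 * (h * e)) ^ 2) by mono.
   assert (Hsq2 : (27 * (h * e)) ^ 2 <= (27 / 40) ^ 2) by mono. assert (Hp0 := pow2_ge_0 (h * a)).
   assert (Hl := ln_one_minus_bounds ((h * a) ^ 2) ltac:(lra)).
   assert (Rabs (ln (1 - (h * a) ^ 2)) <= 2 * (h * a) ^ 2).
   { set (p := (h * a) ^ 2) in *. assert (p ^ 2 <= p * (1 / 2)) by nra. rewrite Rabs_left1; lra. }
   apply Rle_trans with (2 * (27 * (h * e)) ^ 2); [lra|].
   replace (2 * (27 * (h * e)) ^ 2) with (h * (h * 1458 * (e * e))) by ring.
   replace (h * (h * (1458 * A) * e)) with (h * (h * 1458 * (A * e))) by ring. mono.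
  - assert (He : exp (- xk h n) <= A) by (apply exp_le_mono; lra). assert (He2 := exp_pos (- (xk h n + INR m * h))).
   replace (h * (1458 * A ^ 2)) with (h * (1458 * A) * A) by ring. mono. }
 apply (is_lim_seq_le (fun m => Rabs (bsum u m)) (fun _ => h * (1458 * A ^ 2))
  (Rabs (- logbes (th h) - sumB n (th h))) (h * (1458 * A ^ 2))).
 - exact Hb.
 - apply (is_lim_seq_abs (bsum u) (- logbes (th h) - sumB n (th h))). exact Hlim.
 - apply is_lim_seq_const.
Qed.

Lemma eq_0_of_small (c K h0 : R) : 0 < h0 -> (forall h, 0 < h <= h0 -> Rabs c <= K * h) -> c = 0.
Proof. intros Hh0 H. destruct (Req_dec c 0) as [E|E]; [exact E|exfalso].
 assert (Hc : 0 < Rabs c) by (apply Rabs_pos_lt, E).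
 assert (H0 := H h0 ltac:(lra)). assert (HK : 0 < K) by (destruct (Rlt_le_dec 0 K); [mono|nra]).
 assert (Hm : 0 < Rabs c / (2 * K)) by mono. specialize (H (Rmin h0 (Rabs c / (2 * K)))).
 assert (H1 := Rmin_l h0 (Rabs c / (2 * K))). assert (H2 := Rmin_r h0 (Rabs c / (2 * K))).
 assert (H3 : 0 < Rmin h0 (Rabs c / (2 * K))) by (apply Rmin_glb_lt; lra).
 specialize (H ltac:(lra)). apply (Rmult_le_compat_l K) in H2; [|lra].
 replace (K * (Rabs c / (2 * K))) with (Rabs c / 2) in H2 by (field; lra). lra.
Qed.

Lemma INR_left_eq (h : R) (n : nat) : 0 < h -> INR n = 2 / h ^ 3 * (1 - - xk h n * h ^ 2 / 2).
Proof. intros H. unfold xk. field. lra. Qed.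

(** The constants of Stirling's formula and of [ln I_0] are opposite. By the exact sum, [ln I_0] is
    minus the sum of [ln (1 - r_k ^ 2)], which up to [x] near [-1001] equals the sum of
    [ln (k / (2 t))] within [O(h)]. So [c + S0], which does not depend on [h], is [O(h)] and
    vanishes. *)
Lemma stirling_bessel : exists S0 : R, (forall n, (1 <= n)%nat -> Rabs (bsum (fun k => ln (INR k)) n -
  (INR n * ln (INR n) - INR n + ln (INR n) / 2 + / INR n / 12) - S0) <= / INR n ^ 2) /\
 (forall t, 10 ^ 6 <= t -> Rabs (logbes t - (2 * t - ln (2 * t) / 2 + 1 / (16 * t)) + S0) <= 10 ^ 8 / t ^ 2).
Proof. destruct stirling as [S0 HS]. destruct logbes_expansion as [c Hc].
 exists S0. split; [exact HS|]. intros t Ht. replace S0 with (- c); [unfold Rminus in *; apply Hc, Ht|].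
 set (A := exp 1002). assert (1 <= A) by (unfold A; rewrite <- exp_0; apply exp_le_mono; lra).
 assert (c + S0 = 0); [|lra]. assert (Hm : 0 < 1 / (40 * A)) by mono.
 apply (eq_0_of_small (c + S0) (1458 * A ^ 2 + 10 ^ 8 + 10 ^ 10) (Rmin (1 / 100) (1 / (40 * A)))); [apply Rmin_glb_lt; lra|].
 intros h [Hh Hm']. assert (H1 := Rmin_l (1 / 100) (1 / (40 * A))). assert (H2 := Rmin_r (1 / 100) (1 / (40 * A))).
 assert (Hh1 : 0 < h <= 1 / 100) by lra. assert (0 < h ^ 2 <= h / 100) by (split; [mono|nra]).
 assert (0 < h ^ 3 <= h / 10000) by (split; [mono|nra]). destruct (base_index h 1001 ltac:(lra) ltac:(lra)) as [n Hn].
 assert (T1 := sumB_tail h n ltac:(fold A; lra) ltac:(lra)). fold A in T1. assert (Ht6 : 10 ^ 6 <= th h).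
 { unfold th. replace (10 ^ 6) with (/ (1 / 10 ^ 6)) by field. mono. }
 specialize (Hc (th h) Ht6). set (N := 2 * th h) in *. assert (EN : N = 2 / h ^ 3) by (unfold N, th; field; lra).
 set (s := - xk h n) in *. assert (Hs : 1001 <= s <= 1002) by (unfold s; lra).
 assert (En := INR_left_eq h n ltac:(lra)). fold s in En. rewrite <- EN in En.
 assert (10 ^ 6 <= N) by (unfold N; lra). assert (0 < s * h ^ 2 / 2 <= 1 / 10).
 { assert (0 < s * h ^ 2) by mono. assert (s * h ^ 2 <= 1002 * h ^ 2) by mono. lra. }
 assert (9 / 10 * N <= INR n <= N).
 { rewrite En. split; [|rewrite <- (Rmult_1_r N) at 2; apply Rmult_le_compat_l; lra]. rewrite Rmult_comm. mono. }
 assert (Hn1 : (1 <= n)%nat) by (apply INR_le; simpl (INR 1); lra). specialize (HS n Hn1).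
 assert (T2 : Rabs (sumB n (th h) - (bsum (fun k => ln (INR k)) n - INR n * ln N)) <= 10 ^ 9 * h).
 { rewrite <- bsum_const. unfold sumB. rewrite <- !bsum_minus. eapply Rle_trans; [apply bsum_abs|].
  apply Rle_trans with (bsum (fun k => 2 * 10 ^ 7 * h * (h * (/ - xk h k) ^ 2)) n).
  - apply bsum_le. intros k Hk. destruct k as [|k]; [lia|].
   assert (Hmk := xk_mono h (S k) n ltac:(lra) ltac:(lia)). assert (Hsk : 1000 <= - xk h (S k)) by mono.
   assert (HF := ln_fine h k Hh1 Hsk). assert (El : ln (INR (S k) * h ^ 3 / 2) = ln (INR (S k)) - ln N).
   { rewrite <- ln_div; [|apply INR_S_pos|lra]. f_equal. rewrite EN. field. lra. }
   rewrite El in HF. set (w := / - xk h (S k)) in *.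
   assert (0 < w <= / 1000) by (split; [apply Rinv_0_lt_compat|apply Rinv_le_contravar]; lra).
   assert (0 < w ^ 2) by mono.
   assert (w ^ 3 <= w ^ 2 / 1000) by (replace (w ^ 3) with (w ^ 2 * w) by ring; unfold Rdiv; apply Rmult_le_compat_l; lra).
   assert (h ^ 2 * w ^ 3 <= h ^ 2 * w ^ 2 / 1000) by (unfold Rdiv; rewrite Rmult_assoc; apply Rmult_le_compat_l; lra).
   absle HF. apply Rabs_le. split; lra.
  - rewrite bsum_scal. assert (HI := inv_sq_sum_le h n Hh1 ltac:(unfold s in Hs; lra)). fold s in HI.
   assert (2 / s <= 2 / 1001) by (unfold Rdiv; apply Rmult_le_compat_l; [lra|mono]).
   apply Rle_trans with (2 * 10 ^ 7 * h * 1); [mono|lra]. }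
 assert (0 < / INR n <= 2 * / N). { split; [mono|]. replace (2 * / N) with (/ (N / 2)) by (field; lra). mono. }
 assert (0 < / N <= h) by (split; [mono|rewrite EN; replace (/ (2 / h ^ 3)) with (h ^ 3 / 2) by (field; lra); lra]).
 assert (/ INR n ^ 2 <= 2 * h) by (rewrite <- pow_inv; assert (/ INR n <= 1) by lra; nra).
 assert (T4 : 1 / (16 * th h) <= h). { replace (1 / (16 * th h)) with (/ N / 8) by (unfold N; field; lra). lra. }
 assert (0 <= 1 / (16 * th h)) by mono. assert (10 ^ 8 / th h ^ 2 <= 10 ^ 8 * h).
 { unfold th. replace (10 ^ 8 / (/ h ^ 3) ^ 2) with (10 ^ 8 * (h ^ 3 * h ^ 3)) by (field; lra). nra. }
 assert (0 <= ln N - ln (INR n) <= 2 * 1002 * h).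
 { split; [assert (ln (INR n) <= ln N) by (apply ln_le; lra); lra|]. rewrite <- ln_div by lra.
  eapply Rle_trans; [apply ln_le_sub_1, Rdiv_lt_0_compat; lra|]. apply Rle_trans with ((N - INR n) * (2 * / N)).
  - replace (N / INR n - 1) with ((N - INR n) * / INR n) by (field; lra). mono.
  - rewrite En. replace ((N - N * (1 - s * h ^ 2 / 2)) * (2 * / N)) with (s * h ^ 2) by (field; lra). mono. }
 assert (T7 : - (10 ^ 6 * h) <= INR n - N + INR n * (ln N - ln (INR n)) <= 0).
 { rewrite <- ln_div by lra. assert (Hp : 0 < N / INR n) by mono.
  assert (J1 := ln_le_sub_1 _ Hp). assert (J2 := ln_ge_1_sub _ Hp).
  apply (Rmult_le_compat_l (INR n)) in J1; [|lra]. apply (Rmult_le_compat_l (INR n)) in J2; [|lra].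
  replace (INR n * (N / INR n - 1)) with (N - INR n) in J1 by (field; lra).
  replace (INR n * (1 - / (N / INR n))) with (N - INR n - (N - INR n) ^ 2 / N) in J2 by (field; lra).
  assert ((N - INR n) ^ 2 / N <= 10 ^ 6 * h).
  { rewrite En. replace ((N - N * (1 - s * h ^ 2 / 2)) ^ 2 / N) with (N * (s * h ^ 2 / 2) ^ 2) by (field; lra).
   rewrite EN. replace (2 / h ^ 3 * (s * h ^ 2 / 2) ^ 2) with (s ^ 2 / 2 * h) by (field; lra).
   apply Rmult_le_compat_r; [lra|]. nra. }
  lra. }
 set (b := bsum (fun k => ln (INR k)) n) in *. set (L := logbes (th h)) in *. set (sb := sumB n (th h)) in *.
 absle T1. absle T2. absle HS. absle Hc.
 set (lN := ln N) in *. set (ln' := ln (INR n)) in *. set (nr := INR n) in *. set (m1 := nr * lN) in *.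
 replace (nr - N + nr * (lN - ln')) with (nr - N + (m1 - nr * ln')) in T7 by (unfold m1; ring).
 set (m2 := nr * ln') in *. apply Rabs_le. split; lra.
Qed.

(** The function collects the terms of order [t ^ 2] in [logP] when [n = 2 t (1 - w)]. It vanishes
    to third order at [w = 0], and its coefficient [- 1 / 6] becomes the [- s ^ 3 / 12] of
    [left_P]. *)
Lemma cubic_cancellation (w : R) : 0 <= w <= 1 / 2 ->
 Rabs (w / 2 - 3 / 4 * w ^ 2 + (1 - w) ^ 2 * ln (1 - w) / 2 + w ^ 3 / 6) <= w ^ 4 / 6.
Proof. intros Hw.
 assert (B1 : forall x, 0 <= x <= 1 / 2 -> Rabs (- x + x ^ 2 / 2 - (1 - x) * ln (1 - x)) <= 2 / 3 * x ^ 3).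
 { apply (deriv_bound_sym (fun x => - x + x ^ 2 / 2 - (1 - x) * ln (1 - x)) (fun x => x + ln (1 - x))
   (fun x => 2 / 3 * x ^ 3) (fun x => 2 * x ^ 2)); [lra| | | | |].
  - intros x Hx. auto_derive; [lra|]. unfold Rminus. field. lra.
  - intros x Hx. auto_derive; [exact I|field].
  - intros x Hx. assert (H := ln_one_minus_bounds x Hx). apply Rabs_le. lra.
  - cbv beta. rewrite Rminus_0_r, ln_1. field.
  - field. }
 apply (deriv_bound_sym (fun w => w / 2 - 3 / 4 * w ^ 2 + (1 - w) ^ 2 * ln (1 - w) / 2 + w ^ 3 / 6)
  (fun x => - x + x ^ 2 / 2 - (1 - x) * ln (1 - x)) (fun w => w ^ 4 / 6) (fun x => 2 / 3 * x ^ 3) (1 / 2)); [lra| | |exact B1| | |exact Hw].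
 - intros x Hx. auto_derive; [lra|]. unfold Rminus. field. lra.
 - intros x Hx. auto_derive; [exact I|field].
 - cbv beta. rewrite Rminus_0_r, ln_1. field.
 - field.
Qed.

Lemma bsum_INR (n : nat) : bsum INR n = INR n * (INR n + 1) / 2.
Proof. induction n as [|n IH]; [simpl; field|]. rewrite bsum_S, IH, S_INR. field. Qed.

(** Inserts [ln (1 - r_k ^ 2) = ln (k / (2 t)) + h ^ 2 / (8 x_k ^ 2) + ...] with weights [n - k].
    The first part reduces to the sums of [ln k] and of [k ln k], the second to [left_log_sum]; the
    constant [l] enters through the hyperfactorial. *)
Lemma left_P (l h : R) (n : nat) : (forall m, (1 <= m)%nat -> Rabs (hyperfactorial_defect m - l) <= / INR m ^ 2) ->
 0 < h <= 1 / 100 -> 1000 <= - xk h n -> - xk h n * h <= 1 ->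
 Rabs (logP n (th h) - (- (- xk h n) ^ 3 / 12 - ln (- xk h n) / 8 + ln 2 / 24 - l))
  <= 10 ^ 11 / - xk h n + 10 ^ 10 * h * (- xk h n) ^ 4.
Proof. intros Hl Hh Hn Hsh. destruct stirling_bessel as [S0 [HS HL]].
 assert (HnP : forall k, (1 <= k <= n)%nat -> - xk h n <= - xk h k).
 { intros k Hk. assert (H := xk_mono h k n ltac:(lra) ltac:(lia)). lra. }
 assert (HD : Rabs (bsum (fun k => (INR n - INR k) * ln (1 - rs k (th h) ^ 2)) n -
  (bsum (fun k => (INR n - INR k) * ln (INR k * h ^ 3 / 2)) n +
   bsum (fun k => (INR n - INR k) * h ^ 2 * (/ - xk h k) ^ 2) n / 8)) <= 10 ^ 10 * (2 / - xk h n)).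
 { replace (bsum (fun k => (INR n - INR k) * h ^ 2 * (/ - xk h k) ^ 2) n / 8) with
   (/ 8 * bsum (fun k => (INR n - INR k) * h ^ 2 * (/ - xk h k) ^ 2) n) by field.
  rewrite <- bsum_scal, <- bsum_plus, <- bsum_minus. eapply Rle_trans; [apply bsum_abs|].
  apply Rle_trans with (bsum (fun k => 10 ^ 10 * (h * (/ - xk h k) ^ 2)) n).
  - apply bsum_le. intros k Hk. specialize (HnP k Hk). destruct k as [|k]; [lia|].
   assert (HF := ln_fine h k Hh ltac:(lra)).
   assert (Hnk : (INR n - INR (S k)) * h = - xk h (S k) - - xk h n) by (unfold xk; ring).
   assert (Hnk0 : 0 <= INR n - INR (S k)) by (assert (H := le_INR (S k) n ltac:(lia)); lra).
   set (s := - xk h (S k)) in *. set (m := INR n - INR (S k)) in *.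
   match goal with |- Rabs (m * ?a - (m * ?b + / 8 * (m * h ^ 2 * (/ s) ^ 2))) <= _ =>
    replace (m * a - (m * b + / 8 * (m * h ^ 2 * (/ s) ^ 2))) with (m * (a - b - h ^ 2 * (/ s) ^ 2 / 8)) by mono end.
   rewrite Rabs_mult, (Rabs_right m) by lra. eapply Rle_trans; [apply Rmult_le_compat_l; [exact Hnk0|exact HF]|].
   replace (m * (10 ^ 10 * (h ^ 2 * (/ s) ^ 3))) with (10 ^ 10 * (h * (/ s) ^ 2 * (m * h * / s))) by ring.
   apply Rmult_le_compat_l; [lra|]. rewrite <- (Rmult_1_r (h * (/ s) ^ 2)) at 2. apply Rmult_le_compat_l.
   + mono.
   + rewrite Hnk. apply div_le_intro; lra.
  - rewrite bsum_scal. apply Rmult_le_compat_l; [lra|]. apply inv_sq_sum_le; assumption. }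
 assert (HLS := left_log_sum h n Hh Hn). set (s := - xk h n) in *. unfold logP.
 set (B1 := bsum (fun k => (INR n - INR k) * ln (1 - rs k (th h) ^ 2)) n) in *.
 set (B2 := bsum (fun k => (INR n - INR k) * h ^ 2 * (/ - xk h k) ^ 2) n) in *.
 assert (Hh2 : 0 < h ^ 2 <= h / 100) by (split; [pos|nra]).
 assert (Hh3 : 0 < h ^ 3 <= h / 10000) by (split; [pos|nra]). assert (Ht6 : 10 ^ 6 <= th h).
 { unfold th. replace (10 ^ 6) with (/ (1 / 10 ^ 6)) by field. mono. }
 specialize (HL (th h) Ht6). set (N := 2 / h ^ 3).
 assert (EN : th h = N / 2) by (unfold N, th; field; lra). rewrite EN in *.
 assert (En := INR_left_eq h n ltac:(lra)). fold s N in En. set (w := s * h ^ 2 / 2) in *.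
 assert (Hw : 0 < w <= h / 2). { unfold w. replace (s * h ^ 2 / 2) with (s * h * (h / 2)) by field. split; [pos|].
  rewrite <- (Rmult_1_l (h / 2)) at 2. mono. }
 assert (HnN : 9 / 10 * N <= INR n <= N).
 { rewrite En. split; [|rewrite <- (Rmult_1_r N) at 2; apply Rmult_le_compat_l; lra]. rewrite Rmult_comm. mono. }
 assert (Hn1 : (1 <= n)%nat) by (apply INR_le; simpl (INR 1); lra).
 specialize (HS n Hn1). specialize (Hl n Hn1). unfold hyperfactorial_defect in Hl.
 assert (E3 : bsum (fun k => (INR n - INR k) * ln (INR k * h ^ 3 / 2)) n =
  INR n * bsum (fun k => ln (INR k)) n - bsum (fun k => INR k * ln (INR k)) n - INR n * (INR n - 1) / 2 * ln N).
 { rewrite (bsum_ext _ (fun k => (INR n * ln (INR k) - INR k * ln (INR k)) - (ln N * INR n - ln N * INR k))).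
  - rewrite !bsum_minus, bsum_const, (bsum_scal (INR n)), (bsum_scal (ln N)), bsum_INR. field.
  - intros k Hk. destruct k as [|k]; [lia|]. assert (El : ln (INR (S k) * h ^ 3 / 2) = ln (INR (S k)) - ln N).
   { rewrite <- ln_div; [|apply INR_S_pos|lra]. f_equal. unfold N. field. lra. }
   rewrite El. ring. }
 rewrite E3 in HD. set (b := bsum (fun k => ln (INR k)) n) in *. set (H := bsum (fun k => INR k * ln (INR k)) n) in *.
 set (L := logbes (N / 2)) in *. assert (HC := cubic_cancellation w ltac:(lra)).
 assert (Elam : ln (1 - w) = ln (INR n) - ln N). { rewrite En, ln_mult by lra. ring. }
 assert (Elam1 := ln_one_minus_bounds w ltac:(lra)). rewrite Elam in HC, Elam1.
 assert (ElnN : ln N = ln 2 - 3 * ln h) by (unfold N; rewrite ln_div, ln_pow by lra; simpl INR; ring).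
 assert (Elnh : ln (2 / h ^ 2) = ln 2 - 2 * ln h) by (rewrite ln_div, ln_pow by lra; simpl INR; ring).
 rewrite Elnh in HLS. set (e1 := b - (INR n * ln (INR n) - INR n + ln (INR n) / 2 + / INR n / 12) - S0) in *.
 set (e2 := H - ((INR n ^ 2 / 2 + INR n / 2 + 1 / 12) * ln (INR n) - INR n ^ 2 / 4 + 1 / 12) - l) in *.
 set (e3 := L - (2 * (N / 2) - ln (2 * (N / 2)) / 2 + 1 / (16 * (N / 2))) + S0) in *.
 set (e4 := B1 - (INR n * b - H - INR n * (INR n - 1) / 2 * ln N + B2 / 8)) in *.
 set (e5 := B2 - (ln 2 - 2 * ln h - ln s - 1)) in *.
 set (e6 := w / 2 - 3 / 4 * w ^ 2 + (1 - w) ^ 2 * (ln (INR n) - ln N) / 2 + w ^ 3 / 6) in *.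
 (* An exact identity with [N = 2 t]: Stirling's constant, all logarithms of [N] and the rational
    constants cancel. Writing [ln h = (ln 2 - ln N) / 3] in [(ln 2 - 2 ln h) / 8] leaves
    [ln 2 / 24]. *)
 assert (Emain : - (N / 2) ^ 2 + INR n * L + B1 - (- s ^ 3 / 12 - ln s / 8 + ln 2 / 24 - l) =
  INR n * e1 - e2 + INR n * e3 + e4 + e5 / 8 + N ^ 2 * e6 - w / 8 - (ln (INR n) - ln N) / 12).
 { assert (Es3 : s ^ 3 / 12 = N ^ 2 * w ^ 3 / 6) by (unfold N, w; field; lra).
  replace (- s ^ 3 / 12) with (- (s ^ 3 / 12)) by field. rewrite Es3.
  unfold e1, e2, e3, e4, e5, e6. replace (2 * (N / 2)) with N by field.
  replace (ln h) with ((ln 2 - ln N) / 3) by mono.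
  clearbody b H L B1 B2 N w. clear e1 e2 e3 e4 e5 e6 HD HLS HL HS Hl HC E3 Es3 ElnN Elnh.
  set (lnn := ln (INR n)) in *. clearbody lnn. rewrite En. field. split; lra. }
 rewrite Emain. assert (Hni : 0 < / INR n <= 2 * / N).
 { split; [pos|]. replace (2 * / N) with (/ (N / 2)) by (field; lra). mono. }
 assert (HNi : 0 < / N <= h / 10000) by (split; [pos|unfold N; replace (/ (2 / h ^ 3)) with (h ^ 3 / 2) by (field; lra); lra]).
 assert (G1 : Rabs (INR n * e1) <= h).
 { rewrite Rabs_mult, (Rabs_right (INR n)) by lra. apply Rle_trans with (INR n * / INR n ^ 2); [mono|].
  replace (INR n * / INR n ^ 2) with (/ INR n) by (field; lra). lra. }
 assert (G2 : Rabs e2 <= h). { eapply Rle_trans; [exact Hl|]. rewrite <- pow_inv. nra. }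
 assert (G3 : Rabs (INR n * e3) <= 10 ^ 5 * h).
 { rewrite Rabs_mult, (Rabs_right (INR n)) by lra. apply Rle_trans with (N * (10 ^ 8 / (N / 2) ^ 2)).
  - mono.
  - replace (N * (10 ^ 8 / (N / 2) ^ 2)) with (4 * 10 ^ 8 * / N) by (field; lra). lra. }
 assert (G6 : Rabs (N ^ 2 * e6) <= h * s ^ 4).
 { assert (HN2 : 0 <= N ^ 2) by apply pow2_ge_0. rewrite Rabs_mult, (Rabs_right (N ^ 2)) by lra.
  apply Rle_trans with (N ^ 2 * (w ^ 4 / 6)); [mono|].
  replace (N ^ 2 * (w ^ 4 / 6)) with (h ^ 2 * (s ^ 4 / 24)) by (unfold N, w; field; lra).
  assert (0 <= s ^ 4) by pos. mono. }
 assert (Hs4 : s <= s ^ 4).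
 { replace (s ^ 4) with (s * s ^ 3) by ring. rewrite <- (Rmult_1_r s) at 1. apply Rmult_le_compat_l; [lra|]. apply pow_R1_Rle; lra. }
 assert (Hhs4 : h * s <= h * s ^ 4) by mono.
 assert (Hhs1 : h <= h * s) by (rewrite <- (Rmult_1_r h) at 1; apply Rmult_le_compat_l; lra).
 assert (Hw22 : w ^ 2 <= w * (1 / 2)) by (replace (w ^ 2) with (w * w) by ring; apply Rmult_le_compat_l; lra).
 unfold Rdiv in HD. absle G1. absle G2. absle G3. absle G6. absle HD. absle HLS.
 assert (G4 : Rabs e4 <= 2 * 10 ^ 10 * / s) by (apply Rabs_le; lra). absle G4. clearbody e4. apply Rabs_le. mono.
Qed.

(** * Asymptotics of the integrals at [- oo] *)

Lemma improper_split (f : R -> R) (C x : R) : (forall s, ex_derive f s) ->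
 (forall s, x <= s -> Rabs (f s) <= C * exp (- s)) ->
 forall y, x <= y -> int_to_pinfty f y = int_to_pinfty f x - RInt f x y.
Proof. intros Hf HC y Hy. apply int_to_pinfty_lim.
 - intros; apply ex_RInt_derivable, Hf.
 - intros e He. assert (HC0 : 0 <= C).
  { assert (H := HC x ltac:(lra)). assert (H' := Rabs_pos (f x)). assert (H2 := exp_pos (- x)).
   destruct (Rle_lt_dec 0 C); [mono|]. assert (C * exp (- x) < 0) by nra. lra. }
  destruct (exp_small C e HC0 He) as [M HM]. exists M. intros b Hb Hyb.
  assert (H := exp_improper f C x Hf HC b ltac:(lra)). specialize (HM b ltac:(lra)).
  rewrite <- (RInt_chasles_R f x y b) in H by (apply ex_RInt_derivable, Hf).
  replace (RInt f y b - (int_to_pinfty f x - RInt f x y)) with (RInt f x y + RInt f y b - int_to_pinfty f x) by mono.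
  lra.
Qed.

Lemma improper_derive (f : R -> R) : (forall s, ex_derive f s) ->
 (forall x, exists C, forall s, x <= s -> Rabs (f s) <= C * exp (- s)) ->
 forall x, is_derive (int_to_pinfty f) x (- f x).
Proof. intros Hf HC x. destruct (HC (x - 1)) as [C HC'].
 apply (is_derive_ext_loc (fun y => int_to_pinfty f (x - 1) - RInt f (x - 1) y)).
 - exists (mkposreal 1 Rlt_0_1). intros y Hy. symmetry. apply (improper_split f C); [exact Hf|exact HC'|].
  assert (Hy' : Rabs (y - x) < 1) by exact Hy. apply Rabs_def2 in Hy'. lra.
 - replace (- f x) with (0 - f x) by ring. apply is_derive_minusR; [apply is_derive_constR|].
  apply RInt_derive_upper, Hf.
Qed.

Lemma improper_abs (f : R -> R) (C x : R) : (forall s, ex_derive f s) ->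
 (forall s, x <= s -> Rabs (f s) <= C * exp (- s)) -> forall y, x <= y -> Rabs (int_to_pinfty f y) <= C * exp (- y).
Proof. intros Hf HC y Hy. assert (H := exp_improper f C y Hf ltac:(intros s Hs; apply HC; lra) y ltac:(lra)).
 rewrite RInt_point in H. change (@zero R_CompleteNormedModule) with 0 in H.
 rewrite Rminus_0_l, Rabs_Ropp in H. exact H.
Qed.

(** For small [h] the discrete quantity [Q] approximates [J] arbitrarily well, and [G] up to
    [C / - x]. Choosing grid points that tend to [x] as [h -> 0], continuity of [J] and [G] removes
    the grid. *)
Lemma grid_asymptotic (Q : R -> nat -> R) (J G : R -> R) (x C K : R) : x <= -1000 -> 0 <= C -> 0 <= K ->
 (forall e, 0 < e -> exists h0, 0 < h0 /\ forall h, 0 < h <= h0 -> forall n, x - 1 <= xk h n <= x ->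
  Rabs (Q h n - J (xk h n)) <= e) -> (exists h0, 0 < h0 /\ forall h, 0 < h <= h0 -> forall n, x - 1 <= xk h n <= x ->
  Rabs (Q h n - G (xk h n)) <= C / - xk h n + K * h) ->
 continuous J x -> continuous G x -> Rabs (J x - G x) <= C / - x.
Proof. intros Hx HC HK HJ HG CJ CG. apply le_epsilon. intros e He.
 destruct (HJ (e / 4) ltac:(lra)) as [h1 [Hh1 H1]]. destruct HG as [h2 [Hh2 H2]].
 destruct (continuous_eps J x (e / 4) CJ ltac:(lra)) as [d1 [Hd1 D1]].
 destruct (continuous_eps G x (e / 4) CG ltac:(lra)) as [d2 [Hd2 D2]]. assert (0 < e / (4 * (K + 1))) by mono.
 set (h0 := Rmin (Rmin h1 h2) (e / (4 * (K + 1)))). set (d := Rmin 1 (Rmin d1 d2)).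
 assert (I1 := Rmin_l (Rmin h1 h2) (e / (4 * (K + 1)))). assert (I2 := Rmin_r (Rmin h1 h2) (e / (4 * (K + 1)))).
 assert (I3 := Rmin_l h1 h2). assert (I4 := Rmin_r h1 h2).
 assert (I5 := Rmin_l 1 (Rmin d1 d2)). assert (I6 := Rmin_r 1 (Rmin d1 d2)).
 assert (I7 := Rmin_l d1 d2). assert (I8 := Rmin_r d1 d2). fold h0 in I1, I2. fold d in I5, I6.
 assert (Hh0 : 0 < h0) by (unfold h0; repeat apply Rmin_glb_lt; lra).
 assert (Hd : 0 < d) by (unfold d; repeat apply Rmin_glb_lt; lra).
 destruct (grid_near h0 x d Hh0 Hd) as [h [n [Hh [_ Hn]]]].
 specialize (H1 h ltac:(lra) n ltac:(lra)). specialize (H2 h ltac:(lra) n ltac:(lra)).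
 assert (Rabs (xk h n - x) < d) by (apply Rabs_def1; lra).
 specialize (D1 (xk h n) ltac:(lra)). specialize (D2 (xk h n) ltac:(lra)).
 assert (C / - xk h n <= C / - x) by (unfold Rdiv; apply Rmult_le_compat_l; [lra|mono]). assert (K * h <= e / 4).
 { apply Rle_trans with ((K + 1) * (e / (4 * (K + 1)))); [mono|right; field; lra]. }
 apply Rabs_def2 in D1. apply Rabs_def2 in D2. absle H1. absle H2. apply Rabs_le. lra.
Qed.

Lemma q_exp_bound (q : R -> R) (Hhm : hastings_mcleod q) (x : R) : exists C, forall s, x <= s -> Rabs (q s) <= C * exp (- s).
Proof. exists 60. intros s _. apply q_abs_exp, Hhm. Qed.

Lemma q_ex_derive (q : R -> R) (Hhm : hastings_mcleod q) (s : R) : ex_derive q s.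
Proof. apply (proj1 Hhm s). Qed.

Lemma q_sq_ex_derive (q : R -> R) (Hhm : hastings_mcleod q) (s : R) : ex_derive (fun s => q s ^ 2) s.
Proof. apply ex_derive_pow, (q_ex_derive q Hhm). Qed.

Lemma q_sq_exp_bound (q : R -> R) (Hhm : hastings_mcleod q) (x : R) : exists C, forall s, x <= s -> Rabs (q s ^ 2) <= C * exp (- s).
Proof. exists (3600 * exp (- x)). intros s Hs. assert (H := q_abs_exp q s Hhm). rewrite <- RPow_abs.
 apply Rle_trans with ((60 * exp (- s)) ^ 2); [mono|].
 replace ((60 * exp (- s)) ^ 2) with (3600 * (exp (- s) * exp (- s))) by ring. rewrite Rmult_assoc. mono.
Qed.

Lemma int_q_derive (q : R -> R) (Hhm : hastings_mcleod q) (x : R) : is_derive (int_to_pinfty q) x (- q x).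
Proof. apply improper_derive; [exact (q_ex_derive q Hhm)|exact (q_exp_bound q Hhm)]. Qed.

Lemma hmR_derive (q : R -> R) (Hhm : hastings_mcleod q) (x : R) : is_derive (hmR q) x (- q x ^ 2).
Proof. apply (improper_derive (fun s => q s ^ 2)); [exact (q_sq_ex_derive q Hhm)|exact (q_sq_exp_bound q Hhm)]. Qed.

Lemma hmR_exp_bound (q : R -> R) (Hhm : hastings_mcleod q) (x : R) : exists C, forall s, x <= s -> Rabs (hmR q s) <= C * exp (- s).
Proof. destruct ((q_sq_exp_bound q Hhm) x) as [C HC]. exists C. intros s Hs.
 apply (improper_abs (fun s => q s ^ 2) C x); [exact (q_sq_ex_derive q Hhm)|exact HC|exact Hs].
Qed.

Lemma hmR_ex_derive (q : R -> R) (Hhm : hastings_mcleod q) (s : R) : ex_derive (hmR q) s.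
Proof. eexists; apply (hmR_derive q Hhm). Qed.

Lemma int_hmR_derive (q : R -> R) (Hhm : hastings_mcleod q) (x : R) : is_derive (int_to_pinfty (hmR q)) x (- hmR q x).
Proof. apply improper_derive; [exact (hmR_ex_derive q Hhm)|exact (hmR_exp_bound q Hhm)]. Qed.

Lemma int_hmR_by_parts (q : R -> R) (Hhm : hastings_mcleod q) (x b : R) :
 RInt (hmR q) x b = (b - x) * hmR q b + RInt (fun s => (s - x) * q s ^ 2) x b.
Proof. set (w := fun s => (s - x) * q s ^ 2). assert (Dw : forall s, ex_derive w s).
 { intros s. apply (ex_derive_mult (fun s => s - x) (fun s => q s ^ 2)); [auto_derive; exact I|apply (q_sq_ex_derive q Hhm)]. }
 set (D := fun b => RInt (hmR q) x b - ((b - x) * hmR q b + RInt w x b)). assert (DD : forall s, is_derive D s 0).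
 { intros s. unfold D. replace 0 with (hmR q s - ((1 * hmR q s + (s - x) * (- q s ^ 2)) + w s)) by (unfold w; ring).
  apply is_derive_minusR; [apply RInt_derive_upper, (hmR_ex_derive q Hhm)|].
  apply is_derive_plusR; [|apply RInt_derive_upper, Dw].
  apply (is_derive_multR (fun s => s - x) (hmR q)); [auto_derive; [exact I|ring]|apply (hmR_derive q Hhm)]. }
 assert (E : D b = D x). { apply Rle_antisym; destruct (Rle_lt_dec b x) as [H|H].
  - apply (incr_le D (fun _ => 0)); [exact H|intros; apply DD|intros; lra].
  - assert (- D x <= - D b); [|lra].
   apply (incr_le (fun s => - D s) (fun _ => - 0)); [lra|intros s _; apply (is_derive_opp D s 0), DD|intros; lra].
  - assert (- D b <= - D x); [|lra].
   apply (incr_le (fun s => - D s) (fun _ => - 0)); [lra|intros s _; apply (is_derive_opp D s 0), DD|intros; lra].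
  - apply (incr_le D (fun _ => 0)); [lra|intros; apply DD|intros; lra]. }
 unfold D in E. rewrite !RInt_point in E. change (@zero R_CompleteNormedModule) with 0 in E. lra.
Qed.

(** Integration by parts, the boundary term [(b - x) R(b)] decaying exponentially. The single
    integral is the one that [logP] approximates. *)
Lemma int_hmR_eq (q : R -> R) (Hhm : hastings_mcleod q) (x : R) : int_to_pinfty (fun s => (s - x) * q s ^ 2) x = int_to_pinfty (hmR q) x.
Proof. destruct ((hmR_exp_bound q Hhm) x) as [C HC]. assert (HC0 : 0 <= C).
 { assert (H := HC x ltac:(lra)). assert (H' := Rabs_pos (hmR q x)). assert (H2 := exp_pos (- x)).
  destruct (Rle_lt_dec 0 C); [mono|]. assert (C * exp (- x) < 0) by nra. lra. }
 apply int_to_pinfty_lim.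
 - intros b _. apply ex_RInt_derivable. intros s.
  apply (ex_derive_mult (fun s => s - x) (fun s => q s ^ 2)); [auto_derive; exact I|apply (q_sq_ex_derive q Hhm)].
 - intros e He. assert (HK : 0 <= 2 * C * exp (- x / 2)) by mono.
  destruct (exp_small C (e / 2) HC0 ltac:(lra)) as [M1 HM1].
  destruct (exp_small (2 * C * exp (- x / 2)) (e / 2) HK ltac:(lra)) as [M2 HM2].
  exists (Rmax M1 (2 * M2)). intros b Hb Hxb. assert (Hb1 : M1 <= b) by (assert (H := Rmax_l M1 (2 * M2)); lra).
  assert (Hb2 : M2 <= b / 2) by (assert (H := Rmax_r M1 (2 * M2)); lra).
  specialize (HM1 b Hb1). specialize (HM2 (b / 2) Hb2).
  assert (H := exp_improper (hmR q) C x (hmR_ex_derive q Hhm) HC b Hxb). rewrite (int_hmR_by_parts q Hhm) in H.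
  set (I := RInt (fun s => (s - x) * q s ^ 2) x b) in *.
  assert (HB : Rabs ((b - x) * hmR q b) <= 2 * C * exp (- x / 2) * exp (- (b / 2))).
  { rewrite Rabs_mult, (Rabs_right (b - x)) by lra.
   apply Rle_trans with ((b - x) * (C * exp (- b))); [apply Rmult_le_compat_l; [lra|apply HC, Hxb]|].
   assert (Hm := mult_exp_neg_le ((b - x) / 2) ltac:(lra)).
   replace (exp (- b)) with (exp (- ((b - x) / 2)) * (exp (- x / 2) * exp (- (b / 2)))) by (rewrite <- !exp_plus; f_equal; field).
   set (ee := exp (- x / 2) * exp (- (b / 2))). assert (0 <= ee) by (left; apply Rmult_lt_0_compat; apply exp_pos).
   replace (2 * C * exp (- x / 2) * exp (- (b / 2))) with (2 * C * ee * 1) by (unfold ee; ring).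
   replace ((b - x) * (C * (exp (- ((b - x) / 2)) * ee))) with (2 * C * ee * ((b - x) / 2 * exp (- ((b - x) / 2)))) by field.
   mono. }
  set (z := (b - x) * hmR q b) in *. absle HB. absle H. apply Rabs_def1; lra.
Qed.

Lemma int_q_asymptotic (q : R -> R) (Hhm : hastings_mcleod q) (x : R) : x <= -1000 ->
 Rabs (int_to_pinfty q x - (4 / 3 * sqrt (- x / 2) ^ 3 + ln 2 / 2)) <= 2 * 10 ^ 7 / - x.
Proof. intros Hx. apply (grid_asymptotic (fun h n => th h - sumA n (th h)) (int_to_pinfty q)
  (fun x => 4 / 3 * sqrt (- x / 2) ^ 3 + ln 2 / 2) x (2 * 10 ^ 7) ((1 - x) ^ 2)); [exact Hx|lra|mono| | | |].
 - intros e He. apply sumA_conv; assumption.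
 - exists (1 / 100). split; [lra|]. intros h Hh n Hn. eapply Rle_trans; [apply left_A; lra|].
  apply Rplus_le_compat_l. rewrite Rmult_comm. mono.
 - apply (ex_derive_continuous (int_to_pinfty q) x). eexists; apply (int_q_derive q Hhm).
 - apply (ex_derive_continuous (fun x => 4 / 3 * sqrt (- x / 2) ^ 3 + ln 2 / 2) x). auto_derive. lra.
Qed.

Lemma int_hmR_asymptotic (q : R -> R) (Hhm : hastings_mcleod q) (l x : R) :
 (forall m, (1 <= m)%nat -> Rabs (hyperfactorial_defect m - l) <= / INR m ^ 2) -> x <= -1000 ->
 Rabs (int_to_pinfty (hmR q) x - ((- x) ^ 3 / 12 + ln (- x) / 8 - ln 2 / 24 + l)) <= 10 ^ 11 / - x.
Proof. intros Hl Hx. apply (grid_asymptotic (fun h n => - logP n (th h)) (int_to_pinfty (hmR q))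
  (fun x => (- x) ^ 3 / 12 + ln (- x) / 8 - ln 2 / 24 + l) x (10 ^ 11) (10 ^ 10 * (1 - x) ^ 4)); [exact Hx|lra| | | | |].
 - mono.
 - intros e He. destruct (logP_conv q x e Hhm He) as [h0 [Hh0 H]]. exists h0. split; [exact Hh0|].
  intros h Hh n Hn. specialize (H h Hh n Hn). rewrite (int_hmR_eq q Hhm) in H. exact H.
 - exists (Rmin (1 / 100) (/ (1 - x))). assert (Hi : 0 < / (1 - x)) by mono.
  split; [apply Rmin_glb_lt; lra|]. intros h Hh n Hn.
  assert (H1 := Rmin_l (1 / 100) (/ (1 - x))). assert (H2 := Rmin_r (1 / 100) (/ (1 - x))).
  assert (Hsh : - xk h n * h <= 1). { apply Rle_trans with ((1 - x) * / (1 - x)); [mono|right; field; lra]. }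
  assert (H := left_P l h n Hl ltac:(lra) ltac:(lra) Hsh).
  rewrite <- Rabs_Ropp. eapply Rle_trans; [|eapply Rle_trans; [exact H|]].
  + right. f_equal. field.
  + apply Rplus_le_compat_l. replace (10 ^ 10 * (1 - x) ^ 4 * h) with (10 ^ 10 * h * (1 - x) ^ 4) by ring. mono.
 - apply (ex_derive_continuous (int_to_pinfty (hmR q)) x). eexists; apply (int_hmR_derive q Hhm).
 - apply (ex_derive_continuous (fun x => (- x) ^ 3 / 12 + ln (- x) / 8 - ln 2 / 24 + l) x). auto_derive. lra.
Qed.

(** The integrands of the theorem have explicit primitives built from the integrals over [(x, oo)];
    a limit of the primitive at [- oo] gives both convergence and value. *)
Lemma int_from_minfty_of_primitive (f P : R -> R) (x L C : R) : x < 0 -> 0 <= C ->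
 (forall y, y < 0 -> is_derive P y (f y)) -> (forall y, y < 0 -> continuous f y) ->
 (forall y, y <= -1000 -> Rabs (P y - L) <= C / - y) -> int_from_minfty f x = P x - L.
Proof. intros Hx HC DP Cf HL. assert (HI : forall b, b <= x -> is_RInt f b x (P x - P b)).
 { intros b Hb. apply (is_RInt_derive P f b x); intros y Hy; rewrite Rmax_right in Hy by exact Hb;
   [apply DP|apply Cf]; lra. }
 apply int_from_minfty_lim.
 - intros b Hb. eexists; apply HI, Hb.
 - intros e He. exists (Rmin (-1000) (- (C / e) - 1)). intros b Hb Hbx.
  assert (H1 := Rmin_l (-1000) (- (C / e) - 1)). assert (H2 := Rmin_r (-1000) (- (C / e) - 1)).
  rewrite (is_RInt_unique f b x _ (HI b Hbx)). specialize (HL b ltac:(lra)).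
  replace (P x - P b - (P x - L)) with (- (P b - L)) by ring. rewrite Rabs_Ropp. eapply Rle_lt_trans; [exact HL|].
  apply (Rmult_lt_reg_r (- b)); [lra|]. unfold Rdiv. rewrite Rmult_assoc, Rinv_l by lra.
  assert (H3 : C / e < - b) by lra. apply (Rmult_lt_compat_r e) in H3; [|exact He].
  replace (C / e * e) with C in H3 by (field; lra). lra.
Qed.

Lemma theorem_of_zeta (q : R -> R) (l z : R) : hastings_mcleod q ->
 (forall m, (1 <= m)%nat -> Rabs (hyperfactorial_defect m - l) <= / INR m ^ 2) -> z = - l -> forall x, x < 0 ->
  hmF q x = Rpower 2 (1 / 48) * exp (1 / 2 * z)
   * (exp (- (1 / 24) * Rabs x ^ 3) / Rpower (Rabs x) (1 / 16))
   * exp (1 / 2 * int_from_minfty (fun y => hmR q y - 1 / 4 * y ^ 2 + 1 / (8 * y)) x) /\ hmE q x =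
   1 / Rpower 2 (1 / 4)
   * exp (- (1 / (3 * sqrt 2)) * Rpower (Rabs x) (3 / 2))
   * exp (1 / 2 * int_from_minfty (fun y => q y - sqrt (Rabs y / 2)) x).
Proof. intros Hhm Hl Hz x Hx. split.
 (* [P] is [2 ln F] with its growing terms removed, a primitive of the integrand; its limit at
    [- oo] is [ln 2 / 24 - l]. *)
 - set (P := fun y => - int_to_pinfty (hmR q) y + (- y) ^ 3 / 12 + ln (- y) / 8).
  rewrite (int_from_minfty_of_primitive (fun y => hmR q y - 1 / 4 * y ^ 2 + 1 / (8 * y)) P x (ln 2 / 24 - l) (10 ^ 11)); [|exact Hx|lra| | |].
  + unfold hmF, P. rewrite Rabs_left by exact Hx. unfold Rdiv, Rpower. rewrite <- exp_Ropp, <- !exp_plus.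
   f_equal. rewrite Hz. field.
  + intros y Hy. unfold P.
   replace (hmR q y - 1 / 4 * y ^ 2 + 1 / (8 * y)) with (- - hmR q y + (- (1 / 4 * y ^ 2)) + 1 / (8 * y)) by ring.
   apply is_derive_plusR; [apply is_derive_plusR|].
   * apply (is_derive_opp (int_to_pinfty (hmR q)) y (- hmR q y)), int_hmR_derive, Hhm.
   * auto_derive; [exact I|field].
   * auto_derive; [lra|field; lra].
  + intros y Hy. apply (continuous_plus (fun y => hmR q y - 1 / 4 * y ^ 2) (fun y => 1 / (8 * y))).
   * apply (continuous_minus (hmR q) (fun y => 1 / 4 * y ^ 2)).
    -- apply (ex_derive_continuous (hmR q)), hmR_ex_derive, Hhm.
    -- apply (ex_derive_continuous (fun y => 1 / 4 * y ^ 2)). auto_derive. exact I.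
   * apply (ex_derive_continuous (fun y => 1 / (8 * y))). auto_derive. lra.
  + intros y Hy. assert (H := int_hmR_asymptotic q Hhm l y Hl Hy). rewrite <- Rabs_Ropp.
   eapply Rle_trans; [|exact H]. right. f_equal. unfold P. field.
 (* [2 ln E] with its growing term removed; its limit [- ln 2 / 2] at [- oo] produces the factor
    [2 ^ (- 1 / 4)]. *)
 - set (P := fun y => - int_to_pinfty q y + 4 / 3 * sqrt (- y / 2) ^ 3).
  rewrite (int_from_minfty_of_primitive (fun y => q y - sqrt (Rabs y / 2)) P x (- (ln 2 / 2)) (2 * 10 ^ 7)); [|exact Hx|lra| | |].
  + unfold hmE, P. rewrite Rabs_left by exact Hx.
   assert (E : sqrt (- x / 2) ^ 3 = Rpower (- x) (3 / 2) / (2 * sqrt 2)).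
   { assert (Hs2 := sqrt_lt_R0 2 ltac:(lra)). assert (E2 : sqrt 2 * sqrt 2 = 2) by (apply sqrt_sqrt; lra).
    rewrite sqrt_div_alt by lra.
    replace (3 / 2) with (/ 2 + 1) by field. rewrite Rpower_plus, Rpower_1, Rpower_sqrt by lra.
    assert (Ex : sqrt (- x) * sqrt (- x) = - x) by (apply sqrt_sqrt; lra).
    rewrite <- Ex at 3. rewrite <- E2 at 2. field. lra. }
   rewrite E. set (r := Rpower (- x) (3 / 2)).
   assert (E4 : 1 / Rpower 2 (1 / 4) = exp (- (1 / 4 * ln 2))) by (unfold Rpower; rewrite exp_Ropp; field; apply Rgt_not_eq, exp_pos).
   rewrite E4, <- !exp_plus. f_equal. field. apply Rgt_not_eq, sqrt_lt_R0. lra.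
  + intros y Hy. unfold P. rewrite Rabs_left by exact Hy.
   replace (q y - sqrt (- y / 2)) with (- - q y + - sqrt (- y / 2)) by ring. apply is_derive_plusR.
   * apply (is_derive_opp (int_to_pinfty q) y (- q y)), int_q_derive, Hhm.
   * assert (Hs := sqrt_lt_R0 (- y / 2) ltac:(lra)). auto_derive; [lra|]. simpl. unfold Rdiv in *.
    set (r := sqrt (- y * / 2)) in *. field. lra.
  + intros y Hy. apply (continuous_minus q (fun y => sqrt (Rabs y / 2))).
   * apply (ex_derive_continuous q), q_ex_derive, Hhm.
   * apply (continuous_ext_loc _ (fun y => sqrt (- y / 2))).
    -- exists (mkposreal (- y) ltac:(lra)). intros w Hw. assert (Hw' : Rabs (w - y) < - y) by exact Hw.
     apply Rabs_def2 in Hw'. rewrite Rabs_left by lra. reflexivity.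
    -- apply (ex_derive_continuous (fun y => sqrt (- y / 2))). auto_derive. lra.
  + intros y Hy. assert (H := int_q_asymptotic q Hhm y Hy). rewrite <- Rabs_Ropp.
   eapply Rle_trans; [|exact H]. right. f_equal. unfold P. field.
Qed.

(** * Goursat's lemma, maximum principle and identity theorem *)

(** Differentiability of a function of two real variables at one point, with gradient [(a, b)].
    Goursat's argument asks for no continuity of the gradient. *)
Definition rdiff (P : R -> R -> R) (x y a b : R) : Prop :=
 forall e, 0 < e -> exists d, 0 < d /\ forall u v, Rabs u < d -> Rabs v < d ->
  Rabs (P (x + u) (y + v) - P x y - a * u - b * v) <= e * (Rabs u + Rabs v).

Lemma rdiff_continuous_fst (P : R -> R -> R) (x y a b : R) : rdiff P x y a b -> continuous (fun s => P s y) x.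
Proof. intros H. apply (ex_derive_continuous (fun s => P s y) x). exists a. apply is_derive_Reals.
 intros e He. destruct (H (e / 2) ltac:(lra)) as [d [Hd HD]]. exists (mkposreal d Hd). intros u Hu Hud. simpl in Hud.
 specialize (HD u 0 Hud ltac:(rewrite Rabs_R0; exact Hd)). rewrite Rabs_R0, !Rplus_0_r, Rmult_0_r, Rminus_0_r in HD.
 replace ((P (x + u) y - P x y) / u - a) with ((P (x + u) y - P x y - a * u) / u) by (field; exact Hu).
 unfold Rdiv. rewrite Rabs_mult, Rabs_inv. assert (Hp : 0 < Rabs u) by (apply Rabs_pos_lt, Hu).
 apply (Rmult_lt_reg_r (Rabs u)); [exact Hp|]. rewrite Rmult_assoc, Rinv_l by lra. nra.
Qed.

Lemma rdiff_swap (P : R -> R -> R) (x y a b : R) : rdiff P x y a b -> rdiff (fun s t => P t s) y x b a.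
Proof. intros H e He. destruct (H e He) as [d [Hd HD]]. exists d. split; [exact Hd|]. intros u v Hu Hv.
 specialize (HD v u Hv Hu). rewrite (Rplus_comm (Rabs u)).
 replace (P (x + v) (y + u) - P x y - b * u - a * v) with (P (x + v) (y + u) - P x y - a * v - b * u) by ring. exact HD.
Qed.

Lemma rdiff_continuous_snd (P : R -> R -> R) (x y a b : R) : rdiff P x y a b -> continuous (P x) y.
Proof. intros H. apply (rdiff_continuous_fst (fun s t => P t s) y x b a), rdiff_swap, H. Qed.

(** The circulation of [P dx + Q dy] around the rectangle, counterclockwise. *)
Definition flux (P Q : R -> R -> R) (x y w h : R) : R :=
 RInt (fun s => P s y - P s (y + h)) x (x + w) + RInt (fun t => Q (x + w) t - Q x t) y (y + h).

Definition exact_at (P Q : R -> R -> R) (x y : R) : Prop := exists a b c, rdiff P x y a b /\ rdiff Q x y b c.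

Definition exact_on (P Q : R -> R -> R) (x y w h : R) : Prop :=
 forall s t, x <= s <= x + w -> y <= t <= y + h -> exact_at P Q s t.

Lemma exact_ex_RInt_P (P Q : R -> R -> R) (x y w h x' w' t : R) : exact_on P Q x y w h ->
 x <= x' -> 0 <= w' -> x' + w' <= x + w -> y <= t <= y + h -> ex_RInt (fun s => P s t) x' (x' + w').
Proof. intros H H1 H2 H3 Ht. apply (ex_RInt_continuous (V := R_CompleteNormedModule)). intros z Hz.
 rewrite Rmin_left, Rmax_right in Hz by lra.
 destruct (H z t ltac:(lra) Ht) as [a [b [c [HP HQ]]]]. apply (rdiff_continuous_fst P z t a b HP).
Qed.

Lemma exact_ex_RInt_Q (P Q : R -> R -> R) (x y w h y' h' s : R) : exact_on P Q x y w h ->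
 y <= y' -> 0 <= h' -> y' + h' <= y + h -> x <= s <= x + w -> ex_RInt (fun t => Q s t) y' (y' + h').
Proof. intros H H1 H2 H3 Hs. apply (ex_RInt_continuous (V := R_CompleteNormedModule)). intros z Hz.
 rewrite Rmin_left, Rmax_right in Hz by lra.
 destruct (H s z Hs ltac:(lra)) as [a [b [c [HP HQ]]]]. apply (rdiff_continuous_snd Q s z b c HQ).
Qed.

Lemma RInt_minus_R (f g : R -> R) (a b : R) : ex_RInt f a b -> ex_RInt g a b ->
 RInt (fun x => f x - g x) a b = RInt f a b - RInt g a b.
Proof. intros Hf Hg. exact (RInt_minus f g a b Hf Hg). Qed.

Lemma flux_expand (P Q : R -> R -> R) (x y w h : R) : 0 <= w -> 0 <= h -> exact_on P Q x y w h ->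
 flux P Q x y w h = (RInt (fun s => P s y) x (x + w) - RInt (fun s => P s (y + h)) x (x + w)) +
  (RInt (fun t => Q (x + w) t) y (y + h) - RInt (fun t => Q x t) y (y + h)).
Proof. intros Hw Hh H. unfold flux.
 rewrite RInt_minus_R; [|apply (exact_ex_RInt_P P Q x y w h); auto; lra|apply (exact_ex_RInt_P P Q x y w h); auto; lra].
 rewrite RInt_minus_R; [reflexivity| |]; apply (exact_ex_RInt_Q P Q x y w h); auto; lra.
Qed.

Lemma exact_on_sub (P Q : R -> R -> R) (x y w h x' y' w' h' : R) : exact_on P Q x y w h ->
 x <= x' -> x' + w' <= x + w -> y <= y' -> y' + h' <= y + h -> exact_on P Q x' y' w' h'.
Proof. intros H H1 H2 H3 H4 s t Hs Ht. apply H; lra. Qed.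

Lemma flux_quarter (P Q : R -> R -> R) (x y w h : R) : 0 <= w -> 0 <= h -> exact_on P Q x y (2 * w) (2 * h) ->
 flux P Q x y (2 * w) (2 * h) = flux P Q x y w h + flux P Q (x + w) y w h + flux P Q x (y + h) w h + flux P Q (x + w) (y + h) w h.
Proof. intros Hw Hh H.
 assert (S : forall x' y', x <= x' -> x' + w <= x + 2 * w -> y <= y' -> y' + h <= y + 2 * h -> exact_on P Q x' y' w h).
 { intros x' y' H1 H2 H3 H4. apply (exact_on_sub P Q x y (2 * w) (2 * h)); assumption. }
 rewrite !flux_expand; try lra; try (apply S; lra); [|exact H].
 replace (x + w + w) with (x + 2 * w) by ring. replace (y + h + h) with (y + 2 * h) by ring.
 assert (CP : forall t, y <= t <= y + 2 * h -> RInt (fun s => P s t) x (x + 2 * w) = RInt (fun s => P s t) x (x + w) + RInt (fun s => P s t) (x + w) (x + 2 * w)).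
 { intros t Ht. symmetry. apply RInt_chasles_R.
  - apply (exact_ex_RInt_P P Q x y (2 * w) (2 * h)); auto; lra.
  - replace (x + 2 * w) with (x + w + w) by ring. apply (exact_ex_RInt_P P Q x y (2 * w) (2 * h)); auto; lra. }
 assert (CQ : forall s, x <= s <= x + 2 * w -> RInt (fun t => Q s t) y (y + 2 * h) = RInt (fun t => Q s t) y (y + h) + RInt (fun t => Q s t) (y + h) (y + 2 * h)).
 { intros s Hs. symmetry. apply RInt_chasles_R.
  - apply (exact_ex_RInt_Q P Q x y (2 * w) (2 * h)); auto; lra.
  - replace (y + 2 * h) with (y + h + h) by ring. apply (exact_ex_RInt_Q P Q x y (2 * w) (2 * h)); auto; lra. }
 rewrite (CP y), (CP (y + 2 * h)), (CQ x), (CQ (x + 2 * w)) by lra. ring.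
Qed.

(** The affine parts of [P] and [Q] contribute nothing, because the cross derivatives coincide in
    [exact_at]; only the [o] terms of differentiability remain. *)
Lemma flux_local (P Q : R -> R -> R) (x0 y0 e : R) : exact_at P Q x0 y0 -> 0 < e ->
 exists d, 0 < d /\ forall x y w h, 0 < w < d -> 0 < h < d -> Rabs (x - x0) <= w -> Rabs (y - y0) <= h ->
  exact_on P Q x y w h -> Rabs (flux P Q x y w h) <= e * (w + h) ^ 2.
Proof. intros [a [b [c [HP HQ]]]] He.
 destruct (HP (e / 4) ltac:(lra)) as [d1 [Hd1 D1]]. destruct (HQ (e / 4) ltac:(lra)) as [d2 [Hd2 D2]].
 exists (Rmin d1 d2 / 3). assert (M1 := Rmin_l d1 d2). assert (M2 := Rmin_r d1 d2).
 assert (0 < Rmin d1 d2) by (apply Rmin_glb_lt; lra). split; [lra|].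
 intros x y w h Hw Hh Hx Hy HK. absle Hx. absle Hy.
 assert (BP : forall s t, x <= s <= x + w -> y <= t <= y + h -> Rabs (P s t - P x0 y0 - a * (s - x0) - b * (t - y0)) <= e / 2 * (w + h)).
 { intros s t Hs Ht. assert (Hu : Rabs (s - x0) <= 2 * w) by (apply Rabs_le; lra). assert (Hv : Rabs (t - y0) <= 2 * h) by (apply Rabs_le; lra).
  specialize (D1 (s - x0) (t - y0) ltac:(lra) ltac:(lra)).
  replace (x0 + (s - x0)) with s in D1 by ring. replace (y0 + (t - y0)) with t in D1 by ring.
  eapply Rle_trans; [exact D1|]. assert (e / 4 * (Rabs (s - x0) + Rabs (t - y0)) <= e / 4 * (2 * w + 2 * h)) by mono. lra. }
 assert (BQ : forall s t, x <= s <= x + w -> y <= t <= y + h -> Rabs (Q s t - Q x0 y0 - b * (s - x0) - c * (t - y0)) <= e / 2 * (w + h)).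
 { intros s t Hs Ht. assert (Rabs (s - x0) <= 2 * w) by (apply Rabs_le; lra). assert (Rabs (t - y0) <= 2 * h) by (apply Rabs_le; lra).
  specialize (D2 (s - x0) (t - y0) ltac:(lra) ltac:(lra)).
  replace (x0 + (s - x0)) with s in D2 by ring. replace (y0 + (t - y0)) with t in D2 by ring.
  eapply Rle_trans; [exact D2|]. assert (e / 4 * (Rabs (s - x0) + Rabs (t - y0)) <= e / 4 * (2 * w + 2 * h)) by mono. lra. }
 unfold flux.
 assert (E1 := RInt_bounds (fun s => P s y - P s (y + h)) x (x + w) (- b * h - e * (w + h)) (- b * h + e * (w + h)) ltac:(lra)).
 assert (E2 := RInt_bounds (fun t => Q (x + w) t - Q x t) y (y + h) (b * w - e * (w + h)) (b * w + e * (w + h)) ltac:(lra)).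
 assert ((- b * h - e * (w + h)) * (x + w - x) <= RInt (fun s => P s y - P s (y + h)) x (x + w) <= (- b * h + e * (w + h)) * (x + w - x)).
 { apply E1.
  - apply (ex_RInt_minus (V := R_NormedModule)); apply (exact_ex_RInt_P P Q x y w h); auto; lra.
  - intros s Hs. assert (G1 := BP s y ltac:(lra) ltac:(lra)). assert (G2 := BP s (y + h) ltac:(lra) ltac:(lra)).
   absle G1. absle G2. lra. }
 assert ((b * w - e * (w + h)) * (y + h - y) <= RInt (fun t => Q (x + w) t - Q x t) y (y + h) <= (b * w + e * (w + h)) * (y + h - y)).
 { apply E2.
  - apply (ex_RInt_minus (V := R_NormedModule)); apply (exact_ex_RInt_Q P Q x y w h); auto; lra.
  - intros t Ht. assert (G1 := BQ (x + w) t ltac:(lra) ltac:(lra)). assert (G2 := BQ x t ltac:(lra) ltac:(lra)).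
   absle G1. absle G2. lra. }
 apply Rabs_le. split; lra.
Qed.

(** Lower left corner of the [n]-th rectangle of Goursat's subdivision: among the four quarters, one
    whose circulation exceeds [e] times its area. The last branch needs no test, since some quarter
    must qualify. *)
Fixpoint corner (P Q : R -> R -> R) (x0 y0 w h e : R) (n : nat) : R * R := match n with
 | O => (x0, y0)
 | S m => let p := corner P Q x0 y0 w h e m in let w' := w * / 2 ^ S m in let h' := h * / 2 ^ S m in
  let test := fun q : R * R => Rlt_dec (e * (w' * h')) (Rabs (flux P Q (fst q) (snd q) w' h')) in if test p then p
  else if test (fst p + w', snd p) then (fst p + w', snd p) else if test (fst p, snd p + h') then (fst p, snd p + h')
  else (fst p + w', snd p + h') end.

(** Goursat's lemma. With [e] half the ratio of circulation to area, each rectangle of the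
    subdivision keeps circulation above [e] times its area, which contradicts [flux_local] at the
    point to which they shrink. *)
Lemma flux_zero (P Q : R -> R -> R) (x0 y0 w h : R) : 0 < w -> 0 < h -> exact_on P Q x0 y0 w h ->
 flux P Q x0 y0 w h = 0.
Proof. intros Hw Hh HK. destruct (Req_dec (flux P Q x0 y0 w h) 0) as [E|E]; [exact E|exfalso].
 assert (HA := Rabs_pos_lt _ E). set (A := Rabs (flux P Q x0 y0 w h)) in *. assert (0 < w * h) by mono.
 set (e := A / (2 * (w * h))). assert (0 < e) by (apply Rdiv_lt_0_compat; lra).
 set (p := corner P Q x0 y0 w h e). set (dim := fun n : nat => / 2 ^ n).
 assert (Hdim : forall n, 0 < dim n) by (intros n; apply Rinv_0_lt_compat, pow_lt; lra).
 assert (HdS : forall n, dim n = 2 * dim (S n)). { intros n. unfold dim. simpl. field. apply pow_nonzero. lra. }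
 assert (Hinv : forall n, (x0 <= fst (p n) /\ fst (p n) + w * dim n <= x0 + w) /\
  (y0 <= snd (p n) /\ snd (p n) + h * dim n <= y0 + h) /\
  e * (w * dim n * (h * dim n)) < Rabs (flux P Q (fst (p n)) (snd (p n)) (w * dim n) (h * dim n)) /\
  (fst (p n) <= fst (p (S n)) <= fst (p n) + w * dim (S n)) /\ (snd (p n) <= snd (p (S n)) <= snd (p n) + h * dim (S n))).
 { assert (Hstep : forall n, fst (p n) <= fst (p (S n)) <= fst (p n) + w * dim (S n) /\ snd (p n) <= snd (p (S n)) <= snd (p n) + h * dim (S n)).
  { intros n. assert (0 < w * dim (S n)) by (apply Rmult_lt_0_compat; [lra|apply Hdim]).
   assert (0 < h * dim (S n)) by (apply Rmult_lt_0_compat; [lra|apply Hdim]).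
   unfold p. simpl corner. fold p. change (/ (2 * 2 ^ n)) with (dim (S n)).
   repeat (match goal with |- context [if ?c then _ else _] => destruct c end); cbn [fst snd]; lra. }
  intros n. split; [|split; [|split; [|apply Hstep]]]; revert n.
  - induction n as [|n IH]; [unfold p; simpl; unfold dim; simpl; lra|]. destruct (Hstep n) as [H1 H2]. rewrite HdS in IH. lra.
  - induction n as [|n IH]; [unfold p; simpl; unfold dim; simpl; lra|]. destruct (Hstep n) as [H1 H2]. rewrite HdS in IH. lra.
  - assert (Hx : forall n, x0 <= fst (p n) /\ fst (p n) + w * dim n <= x0 + w).
   { induction n as [|n IH]; [unfold p; simpl; unfold dim; simpl; lra|]. destruct (Hstep n) as [H1 H2]. rewrite HdS in IH. lra. }
   assert (Hy : forall n, y0 <= snd (p n) /\ snd (p n) + h * dim n <= y0 + h).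
   { induction n as [|n IH]; [unfold p; simpl; unfold dim; simpl; lra|]. destruct (Hstep n) as [H1 H2]. rewrite HdS in IH. lra. }
   induction n as [|n IH].
   + unfold p. simpl corner. cbn [fst snd]. replace (dim 0%nat) with 1 by (unfold dim; simpl; field). rewrite !Rmult_1_r.
    fold A. unfold e. replace (A / (2 * (w * h)) * (w * h)) with (A / 2) by (field; lra). lra.
   + specialize (Hx n). specialize (Hy n). assert (Hd1 := Hdim (S n)). assert (P1 : 0 < w * dim (S n)) by mono.
    assert (P2 : 0 < h * dim (S n)) by mono. rewrite HdS in IH, Hx, Hy.
    unfold p. simpl corner. fold p. change (/ (2 * 2 ^ n)) with (dim (S n)).
    set (x := fst (p n)) in *. set (y := snd (p n)) in *.
    replace (w * (2 * dim (S n))) with (2 * (w * dim (S n))) in * by ring. replace (h * (2 * dim (S n))) with (2 * (h * dim (S n))) in * by ring.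
    set (w' := w * dim (S n)) in *. set (h' := h * dim (S n)) in *.
    rewrite (flux_quarter P Q x y w' h') in IH by first [lra | apply (exact_on_sub P Q x0 y0 w h); [exact HK|lra|lra|lra|lra]].
    cbn [fst snd]. fold x y.
    repeat (match goal with |- context [if ?c then _ else _] => destruct c end); cbn [fst snd]; fold x y; try assumption.
    set (f1 := flux P Q x y w' h') in *. set (f2 := flux P Q (x + w') y w' h') in *.
    set (f3 := flux P Q x (y + h') w' h') in *. set (f4 := flux P Q (x + w') (y + h') w' h') in *.
    assert (T1 := Rabs_triang (f1 + f2 + f3) f4). assert (T2 := Rabs_triang (f1 + f2) f3). assert (T3 := Rabs_triang f1 f2).
    replace (e * (2 * w' * (2 * h'))) with (4 * (e * (w' * h'))) in IH by ring. lra. }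
 assert (Hdl : is_lim_seq dim 0).
 { apply (is_lim_seq_ext (fun n => (/ 2) ^ n)); [intros n; unfold dim; apply pow_inv|]. apply is_lim_seq_geom. rewrite Rabs_right; lra. }
 assert (Hlim : forall (u : nat -> R) (c lo : R), 0 < c -> (forall n, u n <= u (S n) <= u n + c * dim (S n)) ->
   (forall n, lo <= u n /\ u n + c * dim n <= lo + c) -> exists l, (forall n, Rabs (u n - l) <= c * dim n) /\ lo <= l <= lo + c).
 { intros u c lo Hc H1 H2. destruct (telescoping_limit u (fun n => c * dim n) 0) as [l Hl].
  - intros n _. specialize (H1 n). rewrite HdS. apply Rabs_le. lra.
  - intros n _. apply Rmult_le_pos; [lra|left; apply Hdim].
  - apply lim_scal_0, Hdl.
  - exists l. split; [intros n; apply Hl; lia|]. assert (HL : is_lim_seq u l).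
   { apply (is_lim_seq_le_le (fun n => l - c * dim n) u (fun n => l + c * dim n)).
    - intros n. specialize (Hl n ltac:(lia)). absle Hl. lra.
    - replace (Finite l) with (Finite (l - 0)) by (f_equal; ring). apply is_lim_seq_minus'; [apply is_lim_seq_const|apply lim_scal_0, Hdl].
    - replace (Finite l) with (Finite (l + 0)) by (f_equal; ring). apply is_lim_seq_plus'; [apply is_lim_seq_const|apply lim_scal_0, Hdl]. }
   split.
   + apply (is_lim_seq_le (fun _ => lo) u lo l); [apply H2|apply is_lim_seq_const|exact HL].
   + apply (is_lim_seq_le u (fun _ => lo + c) l (lo + c)); [|exact HL|apply is_lim_seq_const].
    intros n. specialize (H2 n). assert (0 < c * dim n) by (apply Rmult_lt_0_compat; [lra|apply Hdim]). lra. }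
 destruct (Hlim (fun n => fst (p n)) w x0 Hw) as [xs [Hxs Hxr]]; [intros n; apply Hinv|intros n; apply Hinv|].
 destruct (Hlim (fun n => snd (p n)) h y0 Hh) as [ys [Hys Hyr]]; [intros n; apply Hinv|intros n; apply Hinv|].
 set (e1 := e * (w * h) / (w + h) ^ 2). assert (0 < (w + h) ^ 2) by mono.
 assert (He1 : 0 < e1) by (apply Rdiv_lt_0_compat; [mono|lra]).
 destruct (flux_local P Q xs ys e1 (HK xs ys Hxr Hyr) He1) as [d [Hd HD]].
 destruct (lim_0_eventually dim (d / (w + h)) Hdl) as [n Hn]; [mono|].
 specialize (Hn n ltac:(lia)). assert (Hdn := Hdim n). rewrite Rabs_right in Hn by lra.
 apply (Rmult_lt_compat_r (w + h)) in Hn; [|lra]. replace (d / (w + h) * (w + h)) with d in Hn by (field; lra).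
 destruct (Hinv n) as (I1 & I2 & I3 & _). assert (0 < w * dim n) by mono. assert (0 < h * dim n) by mono.
 specialize (HD (fst (p n)) (snd (p n)) (w * dim n) (h * dim n) ltac:(lra) ltac:(lra) (Hxs n) (Hys n)).
 assert (HF := HD ltac:(apply (exact_on_sub P Q x0 y0 w h); [exact HK|lra|lra|lra|lra])).
 replace (e1 * (w * dim n + h * dim n) ^ 2) with (e * (w * dim n * (h * dim n))) in HF by (unfold e1; field; lra). lra.
Qed.

(** * Complex differentiability, the exponential and the maximum principle *)

(** Complex differentiability in plain epsilon form; [Cderiv_of_is_derive] connects it with
    [is_derive]. *)
Definition Cderiv (f : C -> C) (z l : C) : Prop := forall e, 0 < e -> exists d, 0 < d /\ forall k, Cmod k < d ->
  Cmod (f (z + k) - f z - l * k)%C <= e * Cmod k.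

Definition Cholo (f : C -> C) (z : C) : Prop := exists l, Cderiv f z l.

Lemma Cmod_le_sum (z : C) : Cmod z <= Rabs (fst z) + Rabs (snd z).
Proof. destruct z as [x y]. unfold Cmod. cbn [fst snd]. assert (Hx := Rabs_pos x). assert (Hy := Rabs_pos y).
 rewrite <- (sqrt_pow2 (Rabs x + Rabs y)) by lra. apply sqrt_le_1_alt.
 assert (Ex : x ^ 2 = Rabs x ^ 2) by (symmetry; apply pow2_abs). assert (Ey : y ^ 2 = Rabs y ^ 2) by (symmetry; apply pow2_abs).
 rewrite Ex, Ey. nra.
Qed.

Lemma im_le_Cmod (z : C) : Rabs (Im z) <= Cmod z.
Proof. eapply Rle_trans; [|apply Rmax_Cmod]. apply Rmax_r. Qed.

Lemma Cmod_triangle_3 (x y z : C) : Cmod (x + y + z)%C <= Cmod x + Cmod y + Cmod z.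
Proof. eapply Rle_trans; [apply Cmod_triangle|]. assert (H := Cmod_triangle x y). lra. Qed.

Lemma Cderiv_const (c z : C) : Cderiv (fun _ => c) z 0.
Proof. intros e He. exists 1. split; [lra|]. intros k _. replace (c - c - 0 * k)%C with (RtoC 0) by ring.
 rewrite Cmod_0. apply Rmult_le_pos; [lra|apply Cmod_ge_0].
Qed.

Lemma Cderiv_id (z : C) : Cderiv (fun s => s) z 1.
Proof. intros e He. exists 1. split; [lra|]. intros k _. replace (z + k - z - 1 * k)%C with (RtoC 0) by ring.
 rewrite Cmod_0. apply Rmult_le_pos; [lra|apply Cmod_ge_0].
Qed.

Lemma Cderiv_plus (f g : C -> C) (z a b : C) : Cderiv f z a -> Cderiv g z b -> Cderiv (fun s => f s + g s)%C z (a + b)%C.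
Proof.
 intros Hf Hg e He. destruct (Hf (e / 2) ltac:(lra)) as [d1 [Hd1 H1]]. destruct (Hg (e / 2) ltac:(lra)) as [d2 [Hd2 H2]].
 exists (Rmin d1 d2). split; [apply Rmin_glb_lt; assumption|]. intros k Hk.
 assert (M1 := Rmin_l d1 d2). assert (M2 := Rmin_r d1 d2). specialize (H1 k ltac:(lra)). specialize (H2 k ltac:(lra)).
 replace (f (z + k) + g (z + k) - (f z + g z) - (a + b) * k)%C with ((f (z + k) - f z - a * k) + (g (z + k) - g z - b * k))%C by ring.
 eapply Rle_trans; [apply Cmod_triangle|]. lra.
Qed.

Lemma Cderiv_incr (f : C -> C) (z l : C) : Cderiv f z l ->
 exists d, 0 < d /\ forall k, Cmod k < d -> Cmod (f (z + k) - f z)%C <= (Cmod l + 1) * Cmod k.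
Proof.
 intros H. destruct (H 1 Rlt_0_1) as [d [Hd HD]]. exists d. split; [exact Hd|]. intros k Hk. specialize (HD k Hk).
 replace (f (z + k) - f z)%C with ((f (z + k) - f z - l * k) + l * k)%C by ring.
 eapply Rle_trans; [apply Cmod_triangle|]. rewrite Cmod_mult. lra.
Qed.

Lemma Cholo_continuous (f : C -> C) (z : C) (e : R) : Cholo f z -> 0 < e ->
 exists d, 0 < d /\ forall k, Cmod k < d -> Cmod (f (z + k) - f z)%C <= e.
Proof. intros [l H] He. destruct (Cderiv_incr f z l H) as [d [Hd HD]]. assert (Hl := Cmod_ge_0 l).
 assert (0 < e / (Cmod l + 1)) by mono.
 exists (Rmin d (e / (Cmod l + 1))). split; [apply Rmin_glb_lt; assumption|]. intros k Hk.
 assert (M1 := Rmin_l d (e / (Cmod l + 1))). assert (M2 := Rmin_r d (e / (Cmod l + 1))).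
 eapply Rle_trans; [apply HD; lra|]. apply Rle_trans with ((Cmod l + 1) * (e / (Cmod l + 1))).
 - mono.
 - right. field. lra.
Qed.

Lemma Cderiv_mult (f g : C -> C) (z a b : C) : Cderiv f z a -> Cderiv g z b ->
 Cderiv (fun s => f s * g s)%C z (a * g z + f z * b)%C.
Proof. intros Hf Hg e He. assert (Gz := Cmod_ge_0 (g z)). assert (Fz := Cmod_ge_0 (f z)).
 set (K := Cmod (g z) + Cmod (f z) + 1). assert (0 < K) by (unfold K; lra). assert (He2 : 0 < e / (2 * K)) by mono.
 destruct (Hf (e / (2 * K)) He2) as [d1 [Hd1 H1]]. destruct (Hg (e / (2 * K)) He2) as [d2 [Hd2 H2]].
 destruct (Cderiv_incr f z a Hf) as [d3 [Hd3 H3]]. assert (Ha := Cmod_ge_0 a).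
 assert (He3 : 0 < e / (2 * (Cmod a + 1))) by mono.
 destruct (Cholo_continuous g z (e / (2 * (Cmod a + 1))) (ex_intro _ b Hg) He3) as [d4 [Hd4 H4]].
 exists (Rmin (Rmin d1 d2) (Rmin d3 d4)). split; [repeat apply Rmin_glb_lt; assumption|]. intros k Hk.
 assert (M1 := Rmin_l (Rmin d1 d2) (Rmin d3 d4)). assert (M2 := Rmin_r (Rmin d1 d2) (Rmin d3 d4)).
 assert (M3 := Rmin_l d1 d2). assert (M4 := Rmin_r d1 d2). assert (M5 := Rmin_l d3 d4). assert (M6 := Rmin_r d3 d4).
 specialize (H1 k ltac:(lra)). specialize (H2 k ltac:(lra)). specialize (H3 k ltac:(lra)). specialize (H4 k ltac:(lra)).
 replace (f (z + k) * g (z + k) - f z * g z - (a * g z + f z * b) * k)%C with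
  ((f (z + k) - f z - a * k) * g z + f z * (g (z + k) - g z - b * k) + (f (z + k) - f z) * (g (z + k) - g z))%C by ring.
 eapply Rle_trans; [apply Cmod_triangle_3|]. rewrite !Cmod_mult.
 assert (Hk0 := Cmod_ge_0 k). set (e2 := e / (2 * K)) in *. set (e3 := e / (2 * (Cmod a + 1))) in *.
 
 assert (Cmod (f (z + k) - f z)%C * Cmod (g (z + k) - g z)%C <= (Cmod a + 1) * Cmod k * e3) by (apply Rmult_le_compat; try apply Cmod_ge_0; lra).
 assert ((Cmod a + 1) * Cmod k * e3 = e / 2 * Cmod k) by (unfold e3; field; lra).
 assert (E2 : e2 * Cmod k * K = e / 2 * Cmod k) by (unfold e2; field; lra). unfold K in E2. nra.
Qed.

Lemma Cderiv_comp (f g : C -> C) (z a b : C) : Cderiv f (g z) a -> Cderiv g z b -> Cderiv (fun s => f (g s)) z (a * b)%C.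
Proof. intros Hf Hg e He. assert (Ha := Cmod_ge_0 a). assert (Hb := Cmod_ge_0 b).
 assert (He1 : 0 < e / (2 * (Cmod b + 1))) by mono. assert (He2 : 0 < e / (2 * (Cmod a + 1))) by mono.
 destruct (Hf _ He1) as [d1 [Hd1 H1]]. destruct (Hg _ He2) as [d2 [Hd2 H2]].
 destruct (Cderiv_incr g z b Hg) as [d3 [Hd3 H3]].
 destruct (Cholo_continuous g z (d1 / 2) (ex_intro _ b Hg) ltac:(lra)) as [d4 [Hd4 H4]].
 exists (Rmin d2 (Rmin d3 d4)). split; [repeat apply Rmin_glb_lt; assumption|]. intros k Hk.
 assert (M1 := Rmin_l d2 (Rmin d3 d4)). assert (M2 := Rmin_r d2 (Rmin d3 d4)). assert (M5 := Rmin_l d3 d4). assert (M6 := Rmin_r d3 d4).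
 specialize (H2 k ltac:(lra)). specialize (H3 k ltac:(lra)). specialize (H4 k ltac:(lra)).
 set (m := (g (z + k) - g z)%C) in *. specialize (H1 m ltac:(lra)).
 replace (g z + m)%C with (g (z + k)%C) in H1 by (unfold m; ring).
 replace (f (g (z + k)) - f (g z) - a * b * k)%C with ((f (g (z + k)) - f (g z) - a * m) + a * (m - b * k))%C by ring.
 eapply Rle_trans; [apply Cmod_triangle|]. rewrite Cmod_mult.
 set (e1 := e / (2 * (Cmod b + 1))) in *. set (e2 := e / (2 * (Cmod a + 1))) in *.
 assert (e1 * Cmod m <= e1 * ((Cmod b + 1) * Cmod k)) by mono.
 assert (Cmod a * Cmod (m - b * k)%C <= (Cmod a + 1) * (e2 * Cmod k)) by (apply Rmult_le_compat; try apply Cmod_ge_0; lra).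
 assert (e1 * ((Cmod b + 1) * Cmod k) = e / 2 * Cmod k) by (unfold e1; field; lra).
 assert ((Cmod a + 1) * (e2 * Cmod k) = e / 2 * Cmod k) by (unfold e2; field; lra). lra.
Qed.

Lemma Cexp_plus (z w : C) : Cexp (z + w) = (Cexp z * Cexp w)%C.
Proof. destruct z as [a b], w as [c d]. unfold Cexp, Cplus, Cmult, Re, Im. cbn [fst snd].
 rewrite exp_plus, cos_plus, sin_plus. apply injective_projections; cbn [fst snd]; ring.
Qed.

Lemma Cmod_Cexp (z : C) : Cmod (Cexp z) = exp (Re z).
Proof. unfold Cmod, Cexp. cbn [fst snd]. set (t := Im z). assert (H := sin2_cos2 t). unfold Rsqr in H.
 replace ((exp (Re z) * cos t) ^ 2 + (exp (Re z) * sin t) ^ 2) with (exp (Re z) ^ 2 * (sin t * sin t + cos t * cos t)) by ring.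
 rewrite H, Rmult_1_r. apply sqrt_pow2. left. apply exp_pos.
Qed.

Lemma exp_quadratic (a : R) : Rabs a <= 1 -> Rabs (exp a - 1 - a) <= 3 * a ^ 2.
Proof. intros Ha. absle Ha. assert (H1 := exp_ineq1_le a). assert (H2 := exp_ineq1_le (- a)).
 assert (exp a <= 3) by (apply Rle_trans with (exp 1); [mono|apply exp_le_3]).
 assert (E : exp a * exp (- a) = 1) by (rewrite <- exp_plus, Rplus_opp_r; apply exp_0).
 assert (exp a * (1 - a) <= 1) by (rewrite <- E; apply Rmult_le_compat_l; lra). rewrite Rabs_right by lra.
 destruct (Rle_lt_dec 0 a) as [Hs|Hs].
 - assert (a * exp a <= a * 3) by mono. assert (a * (exp a - 1) <= a * (3 * a)); [|lra]. mono.
 - assert (a * (exp a - 1) <= a * a); [|nra]. nra.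
Qed.

Lemma Cexp_deriv_0 (k : C) : Cmod k <= 1 -> Cmod (Cexp k - 1 - k)%C <= 20 * Cmod k ^ 2.
Proof.
 intros Hk. assert (Ha := re_le_Cmod k). assert (Hb := im_le_Cmod k). destruct k as [a b]. unfold Re, Im in *. cbn [fst snd] in *.
 set (r := Cmod (a, b)) in *. assert (Hr : 0 <= r) by apply Cmod_ge_0. assert (He := exp_quadratic a ltac:(lra)).
 assert (Ha2 : a ^ 2 <= r ^ 2) by (rewrite <- pow2_abs; apply pow_incr; split; [mono|lra]).
 assert (Hb2 : b ^ 2 <= r ^ 2) by (rewrite <- pow2_abs; apply pow_incr; split; [mono|lra]).
 assert (Hc : Rabs (cos b - 1) <= b ^ 2).
 { assert (H1 := cos_2a_sin (b / 2)). replace (2 * (b / 2)) with b in H1 by field.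
  assert (Hs : Rabs (sin (b / 2)) <= Rabs (b / 2)). { destruct (MVT_gen sin 0 (b / 2) cos) as [c [_ Hc]].
   - intros x _. apply is_derive_sin.
   - intros x _. apply continuity_pt_filterlim, (ex_derive_continuous sin). eexists; apply is_derive_sin.
   - rewrite sin_0, !Rminus_0_r in Hc. rewrite Hc, Rabs_mult. rewrite <- (Rmult_1_l (Rabs (b / 2))) at 2.
    apply Rmult_le_compat_r; [mono|]. apply Rabs_le. destruct (COS_bound c). lra. }
  assert (Hs2 : sin (b / 2) ^ 2 <= (b / 2) ^ 2) by (rewrite <- (pow2_abs (sin (b / 2))), <- (pow2_abs (b / 2)); apply pow_incr; split; [mono|exact Hs]).
  rewrite H1. apply Rabs_le. split; nra. }
 assert (Hs : Rabs (sin b - b) <= b ^ 2).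
 { destruct (MVT_gen (fun x => sin x - x) 0 b (fun x => cos x - 1)) as [c [Hcb Hc']].
  - intros x _. auto_derive; [exact I|ring].
  - intros x _. apply continuity_pt_filterlim, (ex_derive_continuous (fun x => sin x - x)). auto_derive. exact I.
  - rewrite sin_0, !Rminus_0_r in Hc'. rewrite Hc', Rabs_mult. assert (Hsc : Rabs (cos c - 1) <= Rabs c).
   { destruct (MVT_gen cos 0 c (fun x => - sin x)) as [c2 [_ Hc2]].
    - intros x _. apply is_derive_cos.
    - intros x _. apply continuity_pt_filterlim, (ex_derive_continuous cos). eexists; apply is_derive_cos.
    - rewrite cos_0, Rminus_0_r in Hc2. rewrite Hc2, Rabs_mult. rewrite <- (Rmult_1_l (Rabs c)) at 2.
     apply Rmult_le_compat_r; [mono|]. apply Rabs_le. destruct (SIN_bound c2). lra. }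
   assert (Hcb' : Rabs c <= Rabs b).
   { unfold Rmin, Rmax in Hcb. unfold Rabs. destruct (Rle_dec 0 b), (Rcase_abs c), (Rcase_abs b); lra. }
   rewrite <- (pow2_abs b). replace (Rabs b ^ 2) with (Rabs b * Rabs b) by ring. mono. }
 assert (He3 : exp a <= 3) by (apply Rle_trans with (exp 1); [apply exp_le_mono; absle Ha; lra|apply exp_le_3]).
 assert (Hep := exp_pos a).
 eapply Rle_trans; [apply Cmod_le_sum|]. unfold Cexp, Cminus, Cplus, Copp, RtoC, Re, Im. cbn [fst snd].
 replace (exp a * cos b + - (1) + - a) with ((exp a - 1 - a) + exp a * (cos b - 1)) by ring.
 replace (exp a * sin b + - 0 + - b) with ((exp a - 1 - a) * sin b + a * sin b + (sin b - b)) by ring.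
 assert (T1 : Rabs (exp a * (cos b - 1)) <= 3 * r ^ 2). { rewrite Rabs_mult, (Rabs_right (exp a)) by lra. mono. }
 assert (Hsb : Rabs (sin b) <= 1) by (apply Rabs_le; destruct (SIN_bound b); lra).
 assert (Hsb2 : Rabs (sin b) <= 2 * r).
 { replace (sin b) with ((sin b - b) + b) by ring. eapply Rle_trans; [apply Rabs_triang|]. nra. }
 assert (T2 : Rabs ((exp a - 1 - a) * sin b) <= 3 * r ^ 2).
 { rewrite Rabs_mult. rewrite <- (Rmult_1_r (3 * r ^ 2)). mono. }
 assert (T3 : Rabs (a * sin b) <= 2 * r ^ 2).
 { rewrite Rabs_mult. replace (2 * r ^ 2) with (r * (2 * r)) by ring. mono. }
 assert (U1 := Rabs_triang (exp a - 1 - a) (exp a * (cos b - 1))).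
 assert (U2 := Rabs_triang ((exp a - 1 - a) * sin b + a * sin b) (sin b - b)).
 assert (U3 := Rabs_triang ((exp a - 1 - a) * sin b) (a * sin b)).
 eapply Rle_trans; [apply Rplus_le_compat; [exact U1|exact U2]|]. eapply Rle_trans; [apply Rplus_le_compat_l, Rplus_le_compat_r; exact U3|].
 assert (0 <= r ^ 2) by apply pow2_ge_0. lra.
Qed.

Lemma Cderiv_Cexp (z : C) : Cderiv Cexp z (Cexp z).
Proof.
 intros e He. assert (Hm : 0 < Cmod (Cexp z)) by (rewrite Cmod_Cexp; apply exp_pos). set (M := Cmod (Cexp z)) in *.
 assert (Hq : 0 < e / (20 * M)) by mono.
 exists (Rmin 1 (e / (20 * M))). split; [apply Rmin_glb_lt; lra|]. intros k Hk.
 assert (M1 := Rmin_l 1 (e / (20 * M))). assert (M2 := Rmin_r 1 (e / (20 * M))).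
 rewrite Cexp_plus. replace (Cexp z * Cexp k - Cexp z - Cexp z * k)%C with (Cexp z * (Cexp k - 1 - k))%C by ring.
 rewrite Cmod_mult. fold M. assert (H := Cexp_deriv_0 k ltac:(lra)). assert (Hk0 := Cmod_ge_0 k).
 apply Rle_trans with (M * (20 * Cmod k ^ 2)); [mono|].
 replace (M * (20 * Cmod k ^ 2)) with (20 * M * Cmod k * Cmod k) by ring. apply Rmult_le_compat_r; [lra|].
 apply Rle_trans with (20 * M * (e / (20 * M))); [mono|right; field; lra].
Qed.

(** [Im f dx + Re f dy] is the imaginary part of [f dz], and the Cauchy--Riemann equations say that
    it is closed. *)
Lemma Cderiv_exact (f : C -> C) (x y : R) : Cholo f (x, y) ->
 exact_at (fun x y => Im (f (x, y))) (fun x y => Re (f (x, y))) x y.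
Proof. intros [[lr li] H]. assert (HD : forall e, 0 < e -> exists d, 0 < d /\ forall u v, Rabs u < d -> Rabs v < d ->
  Cmod (f (x + u, y + v)%R - f (x, y) - (lr, li) * (u, v))%C <= e * (Rabs u + Rabs v)).
 { intros e He. destruct (H e He) as [d [Hd HD]]. exists (d / 2). split; [lra|]. intros u v Hu Hv.
  assert (Hk := Cmod_le_sum (u, v)). cbn [fst snd] in Hk. specialize (HD (u, v) ltac:(lra)).
  eapply Rle_trans; [exact HD|]. mono. }
 exists li, lr, (- li). split; intros e He; destruct (HD e He) as [d [Hd HD']]; exists d; (split; [exact Hd|]); intros u v Hu Hv;
  specialize (HD' u v Hu Hv); eapply Rle_trans; try exact HD'.
 - eapply Rle_trans; [|apply im_le_Cmod]. right. f_equal. unfold Cminus, Cplus, Copp, Cmult, Im. cbn [fst snd]. ring.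
 - eapply Rle_trans; [|apply re_le_Cmod]. right. f_equal. unfold Cminus, Cplus, Copp, Cmult, Re. cbn [fst snd]. ring.
Qed.

Lemma Cholo_comp (f g : C -> C) (z : C) : Cholo f (g z) -> Cholo g z -> Cholo (fun s => f (g s)) z.
Proof. intros [a Ha] [b Hb]. eexists. apply Cderiv_comp; eassumption. Qed.

Lemma Cholo_mult (f g : C -> C) (z : C) : Cholo f z -> Cholo g z -> Cholo (fun s => f s * g s)%C z.
Proof. intros [a Ha] [b Hb]. eexists. apply Cderiv_mult; eassumption. Qed.

Lemma Cholo_plus (f g : C -> C) (z : C) : Cholo f z -> Cholo g z -> Cholo (fun s => f s + g s)%C z.
Proof. intros [a Ha] [b Hb]. eexists. apply Cderiv_plus; eassumption. Qed.

Lemma Cholo_const (c z : C) : Cholo (fun _ => c) z.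
Proof. eexists. apply Cderiv_const. Qed.

Lemma Cholo_id (z : C) : Cholo (fun s => s) z.
Proof. eexists. apply Cderiv_id. Qed.

Lemma Cholo_Cexp (z : C) : Cholo Cexp z.
Proof. eexists. apply Cderiv_Cexp. Qed.

(* The integral of [Re (c f(p + e^w))] over a vertical period in [w] does not depend on [Re w]. *)
Lemma max_modulus (f : C -> C) (p : C) (rho B : R) : 0 < rho ->
 (forall z, Cmod (z - p)%C <= rho -> Cholo f z) -> (forall t, 0 <= t <= 2 * PI -> Cmod (f (p + Cexp (ln rho, t)))%C <= B) ->
 Cmod (f p) <= B.
Proof. intros Hrho Hf HB. destruct (Rle_lt_dec (Cmod (f p)) B) as [H|H]; [exact H|exfalso]. assert (0 <= B).
 { assert (HPI := PI_RGT_0). assert (H1 := HB 0 ltac:(lra)). assert (H2 := Cmod_ge_0 (f (p + Cexp (ln rho, 0%R))%C)). lra. }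
 set (m := Cmod (f p)) in *. set (eta := (m - B) / 2). assert (Heta : 0 < eta) by (unfold eta; lra).
 assert (Hfp : Cholo f p) by (apply Hf; replace (p - p)%C with (RtoC 0) by ring; rewrite Cmod_0; lra).
 destruct (Cholo_continuous f p eta Hfp Heta) as [d [Hd HD]].
 set (r := Rmin (d / 2) (rho / 2)). assert (M1 := Rmin_l (d / 2) (rho / 2)). assert (M2 := Rmin_r (d / 2) (rho / 2)).
 (* Multiplication by the unimodular [c] makes [f p] real and positive, so that real parts
    suffice. *)
 assert (0 < r) by (apply Rmin_glb_lt; lra). fold r in M1, M2. set (c := (Cconj (f p) / RtoC m)%C).
 assert (Hm0 : RtoC m <> RtoC 0) by (intros E; injection E; lra). assert (Hc : Cmod c = 1).
 { unfold c. rewrite Cmod_div by exact Hm0. rewrite Cmod_conj, Cmod_R, Rabs_right by lra. fold m. field. lra. }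
 assert (Hcf : (c * f p)%C = RtoC m).
 { unfold c. replace (Cconj (f p) / RtoC m * f p)%C with ((f p * Cconj (f p)) / RtoC m)%C by (field; exact Hm0).
  rewrite <- Cmod2_conj. fold m. rewrite RtoC_pow. field. exact Hm0. }
 set (G := fun w : C => (c * f (p + Cexp w))%C). assert (HG : forall x y, x <= ln rho -> Cholo G (x, y)).
 { intros x y Hx. apply Cholo_mult; [apply Cholo_const|]. apply (Cholo_comp f (fun w => p + Cexp w)%C).
  - apply Hf. replace (p + Cexp (x, y) - p)%C with (Cexp (x, y)) by ring. rewrite Cmod_Cexp. simpl Re.
   rewrite <- (exp_ln rho) by exact Hrho. apply exp_le_mono, Hx.
  - apply Cholo_plus; [apply Cholo_const|apply Cholo_Cexp]. }
 set (P := fun x y => Im (G (x, y))). set (Q := fun x y => Re (G (x, y))).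
 assert (ln r < ln rho) by (apply ln_increasing; lra). set (w := ln rho - ln r). assert (HPI := PI_RGT_0).
 assert (HK : exact_on P Q (ln r) 0 w (2 * PI)).
 { intros s t Hs Ht. apply (Cderiv_exact G s t). apply HG. unfold w in Hs. lra. }
 assert (HF := flux_zero P Q (ln r) 0 w (2 * PI) ltac:(unfold w; lra) ltac:(lra) HK). unfold flux in HF.
 (* The two horizontal sides cancel, since the exponential has period [2 PI i]. *)
 rewrite (RInt_ext _ (fun _ => 0)) in HF.
 2:{ intros x _. unfold P, G. replace (Cexp (x, 0 + 2 * PI)) with (Cexp (x, 0)); [mono|].
   unfold Cexp. simpl Re. simpl Im. rewrite Rplus_0_l, sin_2PI, cos_2PI, sin_0, cos_0. reflexivity. }
 rewrite RInt_const in HF. change (scal (ln r + w - ln r) 0) with ((ln r + w - ln r) * 0) in HF. rewrite Rmult_0_r, Rplus_0_l in HF.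
 replace (ln r + w) with (ln rho) in HF by (unfold w; ring).
 assert (HQ1 : forall t, 0 <= t <= 2 * PI -> Rabs (Q (ln rho) t) <= B).
 { intros t Ht. eapply Rle_trans; [apply re_le_Cmod|]. unfold G. rewrite Cmod_mult, Hc, Rmult_1_l. apply HB, Ht. }
 assert (HQ2 : forall t, Rabs (Q (ln r) t - m) <= eta).
 { intros t. replace (Q (ln r) t - m) with (Re (c * (f (p + Cexp (ln r, t)) - f p))%C).
  - eapply Rle_trans; [apply re_le_Cmod|]. rewrite Cmod_mult, Hc, Rmult_1_l. apply HD.
   rewrite Cmod_Cexp. simpl Re. rewrite exp_ln; lra.
  - replace (c * (f (p + Cexp (ln r, t)) - f p))%C with (c * f (p + Cexp (ln r, t)) - c * f p)%C by ring. rewrite Hcf. reflexivity. }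
 assert (HI := RInt_bounds (fun t => Q (ln rho) t - Q (ln r) t) 0 (0 + 2 * PI) (- B - (m + eta)) (B - (m - eta)) ltac:(lra)).
 assert (HI2 : (- B - (m + eta)) * (0 + 2 * PI - 0) <= RInt (fun t => Q (ln rho) t - Q (ln r) t) 0 (0 + 2 * PI) <= (B - (m - eta)) * (0 + 2 * PI - 0)).
 { apply HI.
  - apply (ex_RInt_minus (V := R_NormedModule)); apply (exact_ex_RInt_Q P Q (ln r) 0 w (2 * PI)); auto; unfold w; lra.
  - intros t Ht. specialize (HQ1 t ltac:(lra)). specialize (HQ2 t). absle HQ1. absle HQ2. lra. }
 change (RInt (fun t => Q (ln rho) t - Q (ln r) t) 0 (0 + 2 * PI) = 0) in HF. rewrite HF in HI2.
 assert (Hneg : B - (m - eta) = - eta) by (unfold eta; field). rewrite Hneg in HI2. assert (0 < eta * PI) by pos. lra.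
Qed.

(** Uniform limits of holomorphic functions on a disc. The identity theorem is proved for this class
    directly, so that no theorem on holomorphy of limits enters. *)
Definition holo_limit_on (d : C -> C) (a : C) (R0 : R) : Prop :=
 forall e, 0 < e -> exists f, forall z, Cmod (z - a)%C < R0 -> Cholo f z /\ Cmod (f z - d z)%C <= e.

Lemma exp_neg_small (delta e B : R) : 0 < delta -> 0 < e -> 0 <= B -> exists n : nat, B * exp (- (INR n * delta)) <= e.
Proof. intros Hd He HB. destruct (nfloor_ex (B / (e * delta))) as [n [_ Hn]]. { mono. }
 exists (S n). rewrite S_INR. set (N := INR n + 1) in *. assert (Hed : 0 < e * delta) by pos.
 apply (Rmult_lt_compat_r (e * delta)) in Hn; [|exact Hed].
 replace (B / (e * delta) * (e * delta)) with B in Hn by (field; lra).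
 assert (H1 := exp_ineq1_le (N * delta)). assert (Hp := exp_pos (N * delta)).
 rewrite exp_Ropp. apply (Rmult_le_reg_r (exp (N * delta))); [exact Hp|]. rewrite Rmult_assoc, Rinv_l by lra.
 assert (e * (1 + N * delta) <= e * exp (N * delta)) by mono. lra.
Qed.

(** On the circle of radius [rho] around [p], a point outside the ball has [x >= - r / 80]. When [x]
    is near 0, [y ^ 2] is close to [rho ^ 2] and the quadratic term is about [- r / 32], which
    outweighs [- x]; for larger [x] the linear term takes over. *)
Lemma weight_bound (r e x y rho : R) : 0 < r -> rho = r / 16 -> 0 <= e <= r / 100 -> x ^ 2 + y ^ 2 = rho ^ 2 ->
 r ^ 2 <= (r + e + x) ^ 2 + y ^ 2 -> - x + 8 / r * (x ^ 2 - y ^ 2) <= - (r / 200).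
Proof. intros Hr Hrho He Hc Hout. assert (Hy : y ^ 2 = rho ^ 2 - x ^ 2) by lra. rewrite Hy in Hout |- *.
 assert (Hx1 : - rho <= x <= rho) by (assert (Hy0 := pow2_ge_0 y); nra).
 assert (E : rho ^ 2 = r ^ 2 / 256) by (rewrite Hrho; field). assert (- (r / 80) <= x).
 { destruct (Rle_lt_dec (- (r / 80)) x) as [H|H]; [exact H|exfalso]. nra. }
 replace (8 / r * (x ^ 2 - (rho ^ 2 - x ^ 2))) with (16 * x ^ 2 / r - r / 32) by (rewrite E; field; lra).
 assert (16 * x ^ 2 <= r * (x + r / 32 - r / 200)); [|apply (Rmult_le_reg_l r); [exact Hr|];
  replace (r * (- x + (16 * x ^ 2 / r - r / 32))) with (16 * x ^ 2 - r * x - r ^ 2 / 32) by (field; lra); lra].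
 rewrite Hrho in Hx1. nra.
Qed.

(* For [phi = - s + (8 / r) s ^ 2], [s = (z - p) / u], the weight [e ^ (n phi)] is [1] at [p] and exponentially small
 on the part of the circle around [p] where [d] is not known to vanish. *)
Lemma zero_ball_step (d : C -> C) (a : C) (r R0 : R) : 0 < r -> 11 / 10 * r < R0 -> holo_limit_on d a R0 ->
 (forall z, Cmod (z - a)%C < r -> d z = 0) -> forall z, Cmod (z - a)%C < 101 / 100 * r -> d z = 0.
Proof. intros Hr HR Hlim Hz p Hp. destruct (Rlt_le_dec (Cmod (p - a)%C) r) as [H|H]; [apply Hz, H|].
 set (l := Cmod (p - a)%C) in *. set (e := l - r). assert (Hl0 : RtoC l <> RtoC 0) by (intros E; injection E; lra).
 set (u := ((p - a) / RtoC l)%C).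
 assert (Hu : Cmod u = 1) by (unfold u; rewrite Cmod_div by exact Hl0; fold l; rewrite Cmod_R, Rabs_right by lra; field; lra).
 assert (Hu0 : u <> RtoC 0) by (intros E; rewrite E, Cmod_0 in Hu; lra).
 assert (Epa : (p - a)%C = (RtoC l * u)%C) by (unfold u; field; exact Hl0).
 set (rho := r / 16). assert (Hrho : 0 < rho) by (unfold rho; lra).
 assert (Hin : forall z, Cmod (z - p)%C <= rho -> Cmod (z - a)%C < R0).
 { intros z Hzp. replace (z - a)%C with ((z - p) + (p - a))%C by ring. eapply Rle_lt_trans; [apply Cmod_triangle|]. fold l. unfold rho in Hzp. lra. }
 assert (Hcirc : forall t, Cmod (p + Cexp (ln rho, t) - p)%C = rho).
 { intros t. replace (p + Cexp (ln rho, t) - p)%C with (Cexp (ln rho, t)) by ring. rewrite Cmod_Cexp. simpl Re. apply exp_ln, Hrho. }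
 (* A bound for [d] on the circle comes from one approximant [f], which is continuous along the
    circle and within 1 of [d]. *)
 assert (HBex : exists B, 0 <= B /\ forall t, 0 <= t <= 2 * PI -> Cmod (d (p + Cexp (ln rho, t)))%C <= B).
 { destruct (Hlim 1 Rlt_0_1) as [f Hf].
  assert (HE : forall t, exact_at (fun x y => Im (f (p + Cexp (x, y))%C)) (fun x y => Re (f (p + Cexp (x, y))%C)) (ln rho) t).
  { intros t. apply (Cderiv_exact (fun w => f (p + Cexp w)%C)). apply (Cholo_comp f (fun w => p + Cexp w)%C).
   - apply Hf, Hin. rewrite Hcirc. lra.
   - apply Cholo_plus; [apply Cholo_const|apply Cholo_Cexp]. }
  destruct (continuous_bounded (fun t => Im (f (p + Cexp (ln rho, t))%C)) 0 (2 * PI)) as [B1 [HB1 HB1']].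
  { intros t. destruct (HE t) as [b1 [b2 [b3 [H1 H2]]]]. apply (rdiff_continuous_snd (fun x y => Im (f (p + Cexp (x, y))%C)) (ln rho) t _ _ H1). }
  destruct (continuous_bounded (fun t => Re (f (p + Cexp (ln rho, t))%C)) 0 (2 * PI)) as [B2 [HB2 HB2']].
  { intros t. destruct (HE t) as [b1 [b2 [b3 [H1 H2]]]]. apply (rdiff_continuous_snd (fun x y => Re (f (p + Cexp (x, y))%C)) (ln rho) t _ _ H2). }
  exists (B1 + B2 + 1). split; [lra|]. intros t Ht. set (z := (p + Cexp (ln rho, t))%C).
  destruct (Hf z) as [_ Hfz]; [apply Hin; unfold z; rewrite Hcirc; lra|].
  replace (d z) with (f z - (f z - d z))%C by ring. eapply Rle_trans; [apply Cmod_triangle|]. rewrite Cmod_opp.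
  assert (H1 := Cmod_le_sum (f z)). specialize (HB1' t Ht). specialize (HB2' t Ht). unfold Re, Im in *. fold z in HB1', HB2'. lra. }
 destruct HBex as [B [HB0 HB]].
 set (phi := fun z : C => let s := ((z - p) / u)%C in (- s + RtoC (8 / r) * (s * s))%C).
 apply Cmod_eq_0. apply Rle_antisym; [|apply Cmod_ge_0]. apply le_epsilon. intros eps Heps. rewrite Rplus_0_l.
 (* [n] is fixed first, to make the weighted function small on the outer arc; only afterwards the
    approximation error [e1], small against the bound [W] of the weight on the inner arc. *)
 destruct (exp_neg_small (r / 200) (eps / 4) (B + 1) ltac:(lra) ltac:(lra) ltac:(lra)) as [n Hn].
 set (W := exp (INR n * (rho + 8 / r * rho ^ 2))). assert (0 < W) by apply exp_pos.
 set (e1 := Rmin (eps / (4 * (W + 1))) 1). assert (He1 : 0 < e1) by (apply Rmin_glb_lt; [pos|lra]).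
 assert (e1 <= eps / (4 * (W + 1))) by apply Rmin_l. assert (e1 <= 1) by apply Rmin_r.
 assert (e1 * (W + 1) <= eps / 4). { apply Rle_trans with (eps / (4 * (W + 1)) * (W + 1)); [mono|right; field; lra]. }
 destruct (Hlim e1 He1) as [f Hf]. set (E := fun z => Cexp (RtoC (INR n) * phi z)%C).
 assert (HE : forall z, Cmod (E z) = exp (INR n * Re (phi z))).
 { intros z. unfold E. rewrite Cmod_Cexp. f_equal. unfold Cmult, RtoC, Re. cbn [fst snd]. ring. }
 assert (Hmain : Cmod (f p * E p)%C <= eps / 2). { apply (max_modulus (fun z => f z * E z)%C p rho); [exact Hrho| |].
  - intros z Hzp. apply Cholo_mult; [apply Hf, Hin, Hzp|].
   apply (Cholo_comp Cexp (fun z => RtoC (INR n) * phi z)%C); [apply Cholo_Cexp|].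
   apply Cholo_mult; [apply Cholo_const|]. assert (Hs : forall z, Cholo (fun z => (z - p) / u)%C z).
   { intros z'. apply Cholo_mult; [|apply Cholo_const]. apply Cholo_plus; [apply Cholo_id|apply Cholo_const]. }
   apply (Cholo_comp (fun s => - s + RtoC (8 / r) * (s * s))%C (fun z => (z - p) / u)%C); [|apply Hs].
   apply Cholo_plus.
   + destruct (Cholo_mult (fun _ => RtoC (-1)) (fun s => s) ((z - p) / u)%C (Cholo_const _ _) (Cholo_id _)) as [b Hb].
    exists b. intros ee Hee. destruct (Hb ee Hee) as [dd [Hdd HDD]]. exists dd. split; [exact Hdd|]. intros k Hk.
    specialize (HDD k Hk). eapply Rle_trans; [|exact HDD]. right. f_equal.
    replace (RtoC (-1)) with (- (1))%C by (apply injective_projections; simpl; ring). ring.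
   + apply Cholo_mult; [apply Cholo_const|]. apply Cholo_mult; apply Cholo_id.
  - intros t Ht. assert (Hzp := Hcirc t). specialize (HB t Ht). set (z := (p + Cexp (ln rho, t))%C) in *. set (s := ((z - p) / u)%C).
   assert (Hs : Cmod s = rho) by (unfold s; rewrite Cmod_div by exact Hu0; rewrite Hu, Hzp; field).
   assert (Ezs : (z - a)%C = (u * (RtoC l + s))%C).
   { replace (z - a)%C with ((z - p) + (p - a))%C by ring. rewrite Epa. unfold s. field. exact Hu0. }
   assert (Hphi : Re (phi z) = - Re s + 8 / r * (Re s ^ 2 - Im s ^ 2)).
   { unfold phi. fold s. destruct s as [x y]. unfold Cplus, Copp, Cmult, RtoC, Re, Im. cbn [fst snd]. ring. }
   assert (Hxy : Re s ^ 2 + Im s ^ 2 = rho ^ 2) by (rewrite <- Cmod2_alt, Hs; reflexivity).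
   destruct (Hf z (Hin z ltac:(lra))) as [_ Hfd]. assert (Hfz : Cmod (f z) <= Cmod (d z) + e1).
   { replace (f z) with ((f z - d z) + d z)%C by ring. eapply Rle_trans; [apply Cmod_triangle|]. lra. }
   rewrite Cmod_mult, HE. assert (Hep := exp_pos (INR n * Re (phi z))).
   destruct (Rlt_le_dec (Cmod (z - a)%C) r) as [Hin'|Hout].
   + rewrite (Hz z Hin'), Cmod_0 in Hfz. assert (exp (INR n * Re (phi z)) <= W).
    { apply exp_le_mono. apply Rmult_le_compat_l; [mono|]. rewrite Hphi.
     assert (Hx := re_le_Cmod s). rewrite Hs in Hx. absle Hx. assert (Hy := pow2_ge_0 (Im s)).
     assert (8 / r * (Re s ^ 2 - Im s ^ 2) <= 8 / r * rho ^ 2) by mono. lra. }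
    apply Rle_trans with (e1 * (W + 1)); [|lra]. apply Rmult_le_compat; try apply Cmod_ge_0; lra.
   + assert (Hwb := weight_bound r e (Re s) (Im s) rho Hr eq_refl ltac:(unfold e; lra) Hxy).
    assert (Re (phi z) <= - (r / 200)). { rewrite Hphi. apply Hwb. rewrite Ezs, Cmod_mult, Hu, Rmult_1_l in Hout.
     assert (Hsq : r ^ 2 <= Cmod (RtoC l + s)%C ^ 2) by mono.
     rewrite Cmod2_alt in Hsq. eapply Rle_trans; [exact Hsq|]. right.
     destruct s as [x y]. unfold Cplus, RtoC, Re, Im. cbn [fst snd]. unfold e. ring. }
    apply Rle_trans with ((B + 1) * exp (- (INR n * (r / 200)))); [|lra].
    apply Rmult_le_compat; [apply Cmod_ge_0|lra|lra|]. apply exp_le_mono.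
    assert (INR n * Re (phi z) <= INR n * (- (r / 200))) by mono. lra. }
 rewrite Cmod_mult, HE in Hmain. assert (Hphip : Re (phi p) = 0).
 { unfold phi. replace (p - p)%C with (RtoC 0) by ring. replace (RtoC 0 / u)%C with (RtoC 0) by (field; exact Hu0).
  unfold Cplus, Copp, Cmult, RtoC, Re. cbn [fst snd]. ring. }
 rewrite Hphip, Rmult_0_r, exp_0, Rmult_1_r in Hmain. destruct (Hf p) as [_ Hfp]; [fold l; lra|].
 replace (d p) with (f p - (f p - d p))%C by ring. eapply Rle_trans; [apply Cmod_triangle|]. rewrite Cmod_opp.
 assert (e1 * 1 <= e1 * (W + 1)) by mono. lra.
Qed.

(** Each step enlarges the radius by the factor [101 / 100] and is possible while [11 / 10] of the
    radius stays below [R0]; hence the [10 / 11]. *)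
Lemma zero_ball (d : C -> C) (a : C) (r R0 : R) : 0 < r -> holo_limit_on d a R0 ->
 (forall z, Cmod (z - a)%C < r -> d z = 0) -> forall z, Cmod (z - a)%C < 10 / 11 * R0 -> d z = 0.
Proof. intros Hr Hlim Hz z Hza.
 assert (HG : forall n : nat, forall y, Cmod (y - a)%C < r * (101 / 100) ^ n -> Cmod (y - a)%C < 10 / 11 * R0 -> d y = 0).
 { induction n as [|n IH]; intros y Hy Hy2; [apply Hz; simpl in Hy; lra|].
  assert (Hpw : 0 < r * (101 / 100) ^ n) by pos.
  destruct (Rlt_le_dec (Cmod (y - a)%C) (r * (101 / 100) ^ n)) as [H|H]; [apply IH; assumption|].
  apply (zero_ball_step d a (r * (101 / 100) ^ n) R0); [exact Hpw|lra|exact Hlim| |].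
  - intros x Hx. apply IH; [exact Hx|lra].
  - simpl in Hy. lra. }
 destruct (Pow_x_infinity (101 / 100) ltac:(rewrite Rabs_right; lra) ((Cmod (z - a)%C + 1) / r)) as [n Hn].
 specialize (Hn n (le_n n)). rewrite Rabs_right in Hn by pos.
 apply (HG n); [|exact Hza]. apply Rge_le in Hn. apply (Rmult_le_compat_l r) in Hn; [|lra].
 replace (r * ((Cmod (z - a)%C + 1) / r)) with (Cmod (z - a)%C + 1) in Hn by (field; lra). lra.
Qed.

(** * The constant [zeta'(-1)] *)

Definition rCpow (x : R) (s : C) : C := Cexp (- (s * RtoC (ln x)))%C.

(** Real part of [c x ^ (- s)]. By [phiC_derive] the family is closed under differentiation in [x],
    so the real Euler--Maclaurin formula handles complex exponents. *)
Definition phiC (c s : C) (x : R) : R := Re (c * rCpow x s)%C.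

Lemma Cmod_rCpow (x : R) (s : C) : Cmod (rCpow x s) = exp (- (Re s * ln x)).
Proof.
 unfold rCpow. rewrite Cmod_Cexp. f_equal. destruct s as [a b]. unfold Copp, Cmult, RtoC, Re. cbn [fst snd]. ring.
Qed.

Lemma phiC_abs (c s : C) (x : R) : Rabs (phiC c s x) <= Cmod c * exp (- (Re s * ln x)).
Proof. unfold phiC. eapply Rle_trans; [apply re_le_Cmod|]. rewrite Cmod_mult, Cmod_rCpow. lra. Qed.

Lemma phiC_expand (a b sg ta x : R) :
 phiC (a, b) (sg, ta) x = exp (- (sg * ln x)) * (a * cos (ta * ln x) + b * sin (ta * ln x)).
Proof. unfold phiC, rCpow, Cexp, Copp, Cmult, RtoC, Re, Im. cbn [fst snd].
 replace (- (sg * ln x - ta * 0)) with (- (sg * ln x)) by ring.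
 replace (- (sg * 0 + ta * ln x)) with (- (ta * ln x)) by ring. rewrite cos_neg, sin_neg. ring.
Qed.

Lemma phiC_derive (c s : C) (x : R) : 0 < x -> is_derive (phiC c s) x (phiC (- s * c)%C (s + 1)%C x).
Proof. intros Hx. destruct c as [a b], s as [sg ta].
 apply (is_derive_ext (fun x => exp (- (sg * ln x)) * (a * cos (ta * ln x) + b * sin (ta * ln x)))).
 { intros t. symmetry. apply phiC_expand. }
 replace (phiC (- (sg, ta) * (a, b))%C ((sg, ta) + 1)%C x) with
  (exp (- (sg * ln x)) * / x * ((- (sg * a) + ta * b) * cos (ta * ln x) + (- (sg * b) - ta * a) * sin (ta * ln x))).
 - auto_derive; [lra|]. field. lra.
 - unfold Copp, Cmult, Cplus, RtoC. cbn [fst snd]. rewrite phiC_expand.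
  replace (- ((sg + 1) * ln x)) with (- (sg * ln x) + - ln x) by ring. rewrite exp_plus, (exp_Ropp (ln x)), exp_ln by exact Hx.
  rewrite Rplus_0_r. ring.
Qed.

Lemma inv_step (n : nat) : (1 <= n)%nat -> / INR n ^ 2 <= 2 * (/ INR n - / INR (S n)).
Proof. intros Hn. apply le_INR in Hn. simpl (INR 1) in Hn. rewrite S_INR. set (x := INR n) in *.
 apply Rminus_le. replace (/ x ^ 2 - 2 * (/ x - / (x + 1))) with (- ((x - 1) * / (x ^ 2 * (x + 1)))) by (field; lra).
 assert (0 <= (x - 1) * / (x ^ 2 * (x + 1))); [|lra]. mono.
Qed.

Fixpoint csum (f : nat -> C) (n : nat) : C := match n with O => RtoC 0 | S m => (csum f m + f (S m))%C end.

(* Euler--Maclaurin approximation of [(s - 1) zeta(s)], valid for [Re s > -3]. *)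
Definition zT (n : nat) (s : C) : C :=
 ((s - 1) * csum (fun k => rCpow (INR k) s) n + RtoC (- (1 / 2)) * ((s - 1) * rCpow (INR n) s) +
 rCpow (INR n) (s - 1) + RtoC (1 / 12) * ((s * (s - 1)) * rCpow (INR n) (s + 1)))%C.

Lemma Re_plus (z w : C) : Re (z + w)%C = Re z + Re w.
Proof. reflexivity. Qed.

Lemma Re_scal (r : R) (z : C) : Re (RtoC r * z)%C = r * Re z.
Proof. unfold Re, RtoC, Cmult. cbn [fst snd]. ring. Qed.

Lemma bsum_phiC (c s : C) (n : nat) : bsum (fun k => phiC c s (INR k)) n = Re (c * csum (fun k => rCpow (INR k) s) n)%C.
Proof. induction n as [|n IH].
 - simpl. ring.
 - change (bsum (fun k => phiC c s (INR k)) (S n)) with (bsum (fun k => phiC c s (INR k)) n + phiC c s (INR (S n))).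
  rewrite IH. cbn [csum]. unfold phiC. rewrite <- Re_plus. f_equal. ring.
Qed.

Lemma zT_Re (c s : C) (n : nat) : Re (c * zT n s)%C = bsum (fun k => phiC (c * (s - 1))%C s (INR k)) n -
  (phiC (- c)%C (s - 1)%C (INR n) + phiC (c * (s - 1))%C s (INR n) / 2 + phiC (- s * (c * (s - 1)))%C (s + 1)%C (INR n) / 12).
Proof. rewrite bsum_phiC. unfold phiC. set (a := csum (fun k => rCpow (INR k) s) n). unfold zT. fold a.
 set (u := rCpow (INR n) s). set (v := rCpow (INR n) (s - 1)%C). set (w := rCpow (INR n) (s + 1)%C).
 replace (c * ((s - 1) * a + RtoC (- (1 / 2)) * ((s - 1) * u) + v + RtoC (1 / 12) * (s * (s - 1) * w)))%C with
  (c * (s - 1) * a + RtoC (- (1 / 2)) * (c * (s - 1) * u) + RtoC (-1) * (- c * v) + RtoC (- (1 / 12)) * (- s * (c * (s - 1)) * w))%C.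
 - rewrite !Re_plus, !Re_scal. field.
 - replace (RtoC (-1)) with (- (1))%C by (apply injective_projections; simpl; ring). rewrite (RtoC_opp (1 / 12)). ring.
Qed.

(** The fourth derivative decays like [x ^ (- Re s - 4)], at most [x ^ -2] since [Re s >= -2], which
    gives an error [O(1 / n)]. The unimodular [c] selects a direction in the plane, as the formula
    is applied to real functions. *)
Lemma zT_Re_limit (c s : C) : -2 <= Re s -> Cmod c = 1 -> Cmod s <= 5 ->
 exists l, forall n, (1 <= n)%nat -> Rabs (Re (c * zT n s)%C - l) <= 100 * / INR n.
Proof. intros Hs Hc Hs4.
 set (c0 := (c * (s - 1))%C). set (c1 := (- s * c0)%C). set (c2 := (- (s + 1) * c1)%C). set (c3 := (- (s + 1 + 1) * c2)%C).
 (* The bound 36000 is [720 * 100 / 2], the size that [inv_step] turns into the majorant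
    [100 / n]. *)
 set (c4 := (- (s + 1 + 1 + 1) * c3)%C). assert (Hc4 : Cmod c4 <= 36000).
 { assert (Cmod c0 <= 6) by (unfold c0; rewrite Cmod_mult, Hc, Rmult_1_l; unfold Cminus; eapply Rle_trans; [apply Cmod_triangle|]; rewrite Cmod_m1; lra).
  assert (Cmod (s + 1)%C <= 6) by (eapply Rle_trans; [apply Cmod_triangle|]; rewrite Cmod_1; lra).
  assert (Cmod (s + 1 + 1)%C <= 7) by (eapply Rle_trans; [apply Cmod_triangle|]; rewrite Cmod_1; lra).
  assert (Cmod (s + 1 + 1 + 1)%C <= 8) by (eapply Rle_trans; [apply Cmod_triangle|]; rewrite Cmod_1; lra).
  assert (Cmod c1 <= 5 * 6) by (unfold c1; rewrite Cmod_mult, Cmod_opp; apply Rmult_le_compat; try apply Cmod_ge_0; lra).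
  assert (Cmod c2 <= 6 * (5 * 6)) by (unfold c2; rewrite Cmod_mult, Cmod_opp; apply Rmult_le_compat; try apply Cmod_ge_0; lra).
  assert (Cmod c3 <= 7 * (6 * (5 * 6))) by (unfold c3; rewrite Cmod_mult, Cmod_opp; apply Rmult_le_compat; try apply Cmod_ge_0; lra).
  unfold c4; rewrite Cmod_mult, Cmod_opp. apply Rle_trans with (8 * (7 * (6 * (5 * 6)))); [apply Rmult_le_compat; try apply Cmod_ge_0; lra|lra]. }
 destruct (euler_maclaurin (phiC (- c)%C (s - 1)%C) (phiC c0 s) (phiC c1 (s + 1)%C) (phiC c2 (s + 1 + 1)%C)
  (phiC c3 (s + 1 + 1 + 1)%C) (phiC c4 (s + 1 + 1 + 1 + 1)%C) (fun n => 100 * / INR n)) as [l Hl].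
 - intros x Hx. replace (phiC c0 s x) with (phiC (- (s - 1) * - c)%C (s - 1 + 1)%C x); [apply phiC_derive; lra|].
  f_equal; [unfold c0; ring|ring].
 - intros x Hx. apply phiC_derive. lra.
 - intros x Hx. apply phiC_derive. lra.
 - intros x Hx. apply phiC_derive. lra.
 - intros x Hx. apply phiC_derive. lra.
 - intros n x Hn Hx. eapply Rle_trans; [apply phiC_abs|].
  assert (H := inv_step n Hn). assert (Hn1 := le_INR _ _ Hn). simpl (INR 1) in Hn1.
  assert (He : exp (- (Re (s + 1 + 1 + 1 + 1)%C * ln x)) <= / INR n ^ 2). { apply Rle_trans with (/ x ^ 2); [|mono].
   replace (/ x ^ 2) with (exp (- (2 * ln x))).
   - apply exp_le_mono. assert (H0 : 0 <= ln x) by (rewrite <- ln_1; apply ln_le; lra).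
    assert (2 * ln x <= Re (s + 1 + 1 + 1 + 1)%C * ln x); [|lra]. apply Rmult_le_compat_r; [exact H0|].
    rewrite !Re_plus. simpl (Re (RtoC 1)). lra.
   - rewrite exp_Ropp. f_equal. replace (2 * ln x) with (ln x + ln x) by ring. rewrite exp_plus, exp_ln by lra. ring. }
  apply Rle_trans with (36000 * / INR n ^ 2); [apply Rmult_le_compat; [apply Cmod_ge_0|mono|exact Hc4|exact He]|].
  cbv beta. lra.
 - intros n Hn. assert (Hn1 := le_INR _ _ Hn). simpl (INR 1) in Hn1. mono.
 - apply inv_INR_lim.
 - exists l. intros n Hn. rewrite zT_Re. apply Hl, Hn.
Qed.

Lemma is_lim_seq_of_bound (u w : nat -> R) (l : R) : (forall n, (1 <= n)%nat -> Rabs (u n - l) <= w n) ->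
 is_lim_seq w 0 -> is_lim_seq u l.
Proof. intros H Hw. apply is_lim_seq_incr_1. apply is_lim_seq_incr_1 in Hw.
 apply (is_lim_seq_le_le (fun n => l - w (S n)) (fun n => u (S n)) (fun n => l + w (S n))).
 - intros n. specialize (H (S n) ltac:(lia)). absle H. lra.
 - replace (Finite l) with (Finite (l - 0)) by (f_equal; ring). apply is_lim_seq_minus'; [apply is_lim_seq_const|exact Hw].
 - replace (Finite l) with (Finite (l + 0)) by (f_equal; ring). apply is_lim_seq_plus'; [apply is_lim_seq_const|exact Hw].
Qed.

(** Built from the total [Lim_seq]; its values are genuine limits where [zT_limit] applies. *)
Definition zG (s : C) : C := (real (Lim_seq (fun n => Re (zT n s))), real (Lim_seq (fun n => Im (zT n s)))).

(** The directions [c = 1] and [c = - i] give the real and the imaginary part. *)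
Lemma zT_limit (s : C) (n : nat) : -2 <= Re s -> Cmod s <= 5 -> (1 <= n)%nat ->
 Cmod (zT n s - zG s)%C <= 200 * / INR n.
Proof. intros Hs Hs4 Hn. destruct (zT_Re_limit 1 s Hs Cmod_1 Hs4) as [l1 H1].
 destruct (zT_Re_limit (- Ci)%C s Hs ltac:(rewrite Cmod_opp; apply Cmod_Ci) Hs4) as [l2 H2].
 assert (E1 : forall m, Re (1 * zT m s)%C = Re (zT m s)) by (intros m; f_equal; ring).
 assert (E2 : forall m, Re (- Ci * zT m s)%C = Im (zT m s)).
 { intros m. destruct (zT m s) as [a b]. unfold Ci, Copp, Cmult, Re, Im. cbn [fst snd]. ring. }
 assert (L1 : Lim_seq (fun n => Re (zT n s)) = l1).
 { apply is_lim_seq_unique. apply (is_lim_seq_of_bound _ (fun n => 100 * / INR n)); [|apply inv_INR_lim].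
  intros m Hm. rewrite <- E1. apply H1, Hm. }
 assert (L2 : Lim_seq (fun n => Im (zT n s)) = l2).
 { apply is_lim_seq_unique. apply (is_lim_seq_of_bound _ (fun n => 100 * / INR n)); [|apply inv_INR_lim].
  intros m Hm. rewrite <- E2. apply H2, Hm. }
 eapply Rle_trans; [apply Cmod_le_sum|]. unfold zG. rewrite L1, L2.
 specialize (H1 n Hn). specialize (H2 n Hn). rewrite E1 in H1. rewrite E2 in H2.
 unfold Cminus, Cplus, Copp, Re, Im in *. cbn [fst snd real] in *. unfold Rminus in *. lra.
Qed.

Lemma Cholo_ext (f g : C -> C) (z : C) : (forall s, f s = g s) -> Cholo f z -> Cholo g z.
Proof. intros H [l Hl]. exists l. intros e He. destruct (Hl e He) as [d [Hd HD]]. exists d. split; [exact Hd|].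
 intros k Hk. rewrite <- !H. apply HD, Hk.
Qed.

Lemma Cholo_rCpow (x : R) (z : C) : Cholo (rCpow x) z.
Proof. apply (Cholo_comp Cexp (fun s => - (s * RtoC (ln x)))%C); [apply Cholo_Cexp|].
 apply (Cholo_ext (fun s => s * - RtoC (ln x))%C); [intros s; ring|].
 apply Cholo_mult; [apply Cholo_id|apply Cholo_const].
Qed.

Lemma Cholo_csum (f : nat -> C -> C) (z : C) (n : nat) : (forall k, Cholo (f k) z) -> Cholo (fun s => csum (fun k => f k s) n) z.
Proof.
 intros H. induction n as [|n IH]; simpl csum; [apply Cholo_const|]. apply (Cholo_plus (fun s => csum (fun k => f k s) n) (f (S n))); [exact IH|apply H].
Qed.

Lemma Cholo_zT (n : nat) (z : C) : Cholo (zT n) z.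
Proof. assert (Hm1 : Cholo (fun s => s - 1)%C z) by (apply Cholo_plus; [apply Cholo_id|apply Cholo_const]).
 unfold zT. apply Cholo_plus; [apply Cholo_plus; [apply Cholo_plus|]|].
 - apply Cholo_mult; [exact Hm1|]. apply (Cholo_csum (fun k s => rCpow (INR k) s)). intros k. apply Cholo_rCpow.
 - apply Cholo_mult; [apply Cholo_const|]. apply Cholo_mult; [exact Hm1|apply Cholo_rCpow].
 - apply (Cholo_comp (rCpow (INR n)) (fun s => s - 1)%C); [apply Cholo_rCpow|exact Hm1].
 - apply Cholo_mult; [apply Cholo_const|]. apply Cholo_mult.
  + apply Cholo_mult; [apply Cholo_id|exact Hm1].
  + apply (Cholo_comp (rCpow (INR n)) (fun s => s + 1)%C); [apply Cholo_rCpow|]. apply Cholo_plus; [apply Cholo_id|apply Cholo_const].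
Qed.

Lemma Cderiv_of_is_derive (f : C -> C) (z l : C) :
 is_derive (K := C_AbsRing) (V := C_NormedModule) f z l -> Cderiv f z l.
Proof. intros [_ H] e He. specialize (H z (fun P HP => HP) (mkposreal e He)).
 destruct H as [d Hd]. exists d. split; [apply cond_pos|]. intros k Hk.
 assert (Hb : ball (M := AbsRing_UniformSpace C_AbsRing) z d (z + k)%C).
 { change (Cmod (z + k - z)%C < d). replace (z + k - z)%C with k by ring. exact Hk. }
 specialize (Hd (z + k)%C Hb). change (Cmod (f (z + k) - f z - (z + k - z) * l)%C <= e * Cmod (z + k - z)%C) in Hd.
 replace (z + k - z)%C with k in Hd by ring. replace (k * l)%C with (l * k)%C in Hd by ring. exact Hd.
Qed.

Lemma sum_n_csum (s : C) (n : nat) :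
 sum_n (G := C_AbelianMonoid) (fun n : nat => nat_Cpow_opp (S n) s) n = csum (fun k => rCpow (INR k) s) (S n).
Proof. induction n as [|n IH].
 - rewrite sum_O. symmetry. apply Cplus_0_l.
 - rewrite sum_Sn, IH. reflexivity.
Qed.

Lemma inv_INR_S_small (e : R) : 0 < e -> exists N, forall n, (N <= n)%nat -> / INR (S n) < e.
Proof. intros He. destruct (nfloor_ex (/ e)) as [N [_ HN]]; [mono|].
 exists N. intros n Hn. apply le_INR in Hn. assert (Hp := pos_INR N). rewrite S_INR.
 rewrite <- (Rinv_inv e). apply Rinv_lt_contravar; [|lra]. mono.
Qed.

Lemma rCpow_small (s : C) (e : R) : 0 < Re s -> 0 < e -> exists N, forall n, (N <= n)%nat -> Cmod (rCpow (INR (S n)) s) <= e.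
Proof. intros Hs He. destruct (exp_neg_small (Re s) e 1 Hs He ltac:(lra)) as [m Hm].
 destruct (inv_INR_S_small (exp (- INR m)) (exp_pos _)) as [N HN]. exists N. intros n Hn. specialize (HN n Hn).
 rewrite Cmod_rCpow. assert (Hp := INR_S_pos n). assert (INR m <= ln (INR (S n))).
 { rewrite <- (ln_exp (INR m)). apply ln_le; [mono|]. left.
  rewrite exp_Ropp in HN. apply Rinv_lt_cancel in HN; [exact HN|exact Hp]. }
 eapply Rle_trans; [|exact Hm]. rewrite Rmult_1_l. apply exp_le_mono.
 assert (INR m * Re s <= ln (INR (S n)) * Re s) by mono. lra.
Qed.

(** For [Re s > 1] the three correction terms of [zT] tend to 0, which leaves [s - 1] times the
    partial sums of the Dirichlet series. *)
Lemma zG_zeta_half_plane (zeta : C -> C) (Hzeta : riemann_zeta zeta) (s : C) : 1 < Re s -> Cmod s <= 5 -> ((s - 1) * zeta s - zG s)%C = 0.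
Proof.
 intros Hs Hs5. apply Cmod_eq_0. apply Rle_antisym; [|apply Cmod_ge_0]. apply le_epsilon. intros e He. rewrite Rplus_0_l.
 assert (Hser := proj2 Hzeta s Hs). unfold is_series in Hser.
 set (e1 := e / 200). assert (He1 : 0 < e1) by (unfold e1; lra).
 destruct (proj1 (filterlim_locally _ _) Hser (mkposreal e1 He1)) as [N1 HN1].
 destruct (rCpow_small s e1 ltac:(lra) He1) as [N2 HN2].
 destruct (rCpow_small (s - 1)%C e1 ltac:(unfold Re, Cminus, Cplus, Copp, RtoC in *; simpl in *; lra) He1) as [N3 HN3].
 destruct (rCpow_small (s + 1)%C e1 ltac:(rewrite Re_plus; simpl (Re (RtoC 1)); lra) He1) as [N4 HN4].
 destruct (inv_INR_S_small (e1 / 10) ltac:(lra)) as [N5 HN5]. set (n := max (max N1 N2) (max (max N3 N4) N5)).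
 specialize (HN1 n ltac:(unfold n; lia)). specialize (HN2 n ltac:(unfold n; lia)). specialize (HN3 n ltac:(unfold n; lia)).
 specialize (HN4 n ltac:(unfold n; lia)). specialize (HN5 n ltac:(unfold n; lia)).
 assert (HT := zT_limit s (S n) ltac:(lra) Hs5 ltac:(lia)).
 assert (Cmod (csum (fun k => rCpow (INR k) s) (S n) - zeta s)%C <= 2 * e1).
 { rewrite <- sum_n_csum. destruct HN1 as [HA HB]. eapply Rle_trans; [apply Cmod_le_sum|].
  change (Rabs (fst (sum_n (G := C_AbelianMonoid) (fun n : nat => nat_Cpow_opp (S n) s) n) - fst (zeta s)) < e1) in HA.
  change (Rabs (snd (sum_n (G := C_AbelianMonoid) (fun n : nat => nat_Cpow_opp (S n) s) n) - snd (zeta s)) < e1) in HB.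
  unfold Cminus, Cplus, Copp. cbn [fst snd]. unfold Rminus in *. lra. }
 assert (Cmod (s - 1)%C <= 6) by (unfold Cminus; eapply Rle_trans; [apply Cmod_triangle|]; rewrite Cmod_m1; lra).
 unfold zT in HT. set (a := csum (fun k => rCpow (INR k) s) (S n)) in *.
 set (u := rCpow (INR (S n)) s) in *. set (v := rCpow (INR (S n)) (s - 1)%C) in *. set (w := rCpow (INR (S n)) (s + 1)%C) in *.
 replace ((s - 1) * zeta s - zG s)%C with
  (((s - 1) * a + RtoC (- (1 / 2)) * ((s - 1) * u) + v + RtoC (1 / 12) * (s * (s - 1) * w) - zG s) +
   (- ((s - 1) * (a - zeta s)) + - (RtoC (- (1 / 2)) * ((s - 1) * u)) + (- v + - (RtoC (1 / 12) * (s * (s - 1) * w)))))%C by ring.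
 eapply Rle_trans; [apply Cmod_triangle|].
 assert (T3 := Cmod_triangle_3 (- ((s - 1) * (a - zeta s)))%C (- (RtoC (- (1 / 2)) * ((s - 1) * u)))%C (- v + - (RtoC (1 / 12) * (s * (s - 1) * w)))%C).
 assert (T4 := Cmod_triangle (- v)%C (- (RtoC (1 / 12) * (s * (s - 1) * w)))%C).
 rewrite !Cmod_opp, !Cmod_mult in T3. rewrite !Cmod_opp, !Cmod_mult in T4. rewrite !Cmod_R in *.
 rewrite (Rabs_left (- (1 / 2))) in T3 by lra. rewrite (Rabs_right (1 / 12)) in T4 by lra.
 assert (Cmod (s - 1)%C * Cmod (a - zeta s)%C <= 6 * (2 * e1)) by (apply Rmult_le_compat; try apply Cmod_ge_0; lra).
 assert (Cmod (s - 1)%C * Cmod u <= 6 * e1) by (apply Rmult_le_compat; try apply Cmod_ge_0; lra).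
 assert (Cmod s * Cmod (s - 1)%C <= 5 * 6) by (apply Rmult_le_compat; try apply Cmod_ge_0; lra).
 assert (Cmod s * Cmod (s - 1)%C * Cmod w <= 30 * e1) by (apply Rmult_le_compat; try apply Cmod_ge_0; try lra; apply Rmult_le_pos; apply Cmod_ge_0).
 unfold e1 in *. lra.
Qed.

(** Off the pole [(s - 1) zeta(s)] is holomorphic by hypothesis, and [zG] is a uniform limit of the
    entire functions [zT n]. *)
Lemma zeta_limit_on (zeta : C -> C) (Hzeta : riemann_zeta zeta) (a : C) (R0 : R) :
 (forall z, Cmod (z - a)%C < R0 -> -2 <= Re z /\ Cmod z <= 5 /\ z <> RtoC 1) ->
 holo_limit_on (fun s => (s - 1) * zeta s - zG s)%C a R0.
Proof. intros H e He. destruct (inv_INR_S_small (e / 200) ltac:(lra)) as [n Hn]. specialize (Hn n (le_n n)).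
 exists (fun s => (s - 1) * zeta s + RtoC (-1) * zT (S n) s)%C. intros z Hz. destruct (H z Hz) as [H1 [H2 H3]]. split.
 - apply Cholo_plus; [apply Cholo_mult|apply Cholo_mult].
  + apply Cholo_plus; [apply Cholo_id|apply Cholo_const].
  + destruct (proj1 Hzeta z H3) as [l Hl]. exists l. apply Cderiv_of_is_derive, Hl.
  + apply Cholo_const.
  + apply Cholo_zT.
 - replace ((z - 1) * zeta z + RtoC (-1) * zT (S n) z - ((z - 1) * zeta z - zG z))%C with (- (zT (S n) z - zG z))%C.
  + rewrite Cmod_opp. eapply Rle_trans; [apply zT_limit; [exact H1|exact H2|lia]|]. lra.
  + replace (RtoC (-1)) with (- (1))%C by (apply injective_projections; simpl; ring). ring.
Qed.

Lemma Cmod_sq_lt (z : C) (r : R) : 0 < r -> Re z ^ 2 + Im z ^ 2 < r ^ 2 -> Cmod z < r.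
Proof. intros Hr H. rewrite <- Cmod2_alt in H. nra. Qed.

(* The discs avoid the pole [1]; the second one contains [-1]. *)
Lemma zeta_zG (zeta : C -> C) (Hzeta : riemann_zeta zeta) (s : C) : Cmod (s + 1)%C < 1 / 10 -> ((s - 1) * zeta s - zG s)%C = 0.
Proof. intros Hs. set (d := fun s => ((s - 1) * zeta s - zG s)%C).
 set (a1 := (12 / 10, 2) : C). set (a2 := (- (4 / 10), 12 / 10) : C).
 assert (Hgeo : forall (a z : C) (R0 : R), Cmod (z - a)%C < R0 ->
  (Re z - Re a) ^ 2 + (Im z - Im a) ^ 2 < R0 ^ 2 /\ Rabs (Re z - Re a) < R0 /\ Rabs (Im z - Im a) < R0).
 { intros a z R0 Hz. assert (H1 := re_le_Cmod (z - a)%C). assert (H2 := im_le_Cmod (z - a)%C). assert (H3 := Cmod2_alt (z - a)%C).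
  assert (H0 := Cmod_ge_0 (z - a)%C).
  change (Re (z - a)%C) with (Re z - Re a) in *. change (Im (z - a)%C) with (Im z - Im a) in *.
  split; [rewrite <- H3; nra|mono]. }
 assert (Z1 : forall z, Cmod (z - a1)%C < 10 / 11 * 2 -> d z = 0). { apply (zero_ball d a1 (2 / 10) 2); [lra| |].
  - apply (zeta_limit_on zeta Hzeta). intros z Hz. destruct (Hgeo a1 z 2 Hz) as [G1 [G2 G3]]. unfold a1, a2 in G1, G2, G3; simpl in G1, G2, G3.
   apply Rabs_def2 in G2. apply Rabs_def2 in G3. split; [lra|split].
   + left. apply Cmod_sq_lt; [lra|]. nra.
   + intros E. rewrite E in G1. simpl in G1. lra.
  - intros z Hz. destruct (Hgeo a1 z (2 / 10) Hz) as [G1 [G2 G3]]. unfold a1, a2 in G1, G2, G3; simpl in G1, G2, G3.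
   apply Rabs_def2 in G2. apply Rabs_def2 in G3. apply (zG_zeta_half_plane zeta Hzeta); [lra|].
   left. apply Cmod_sq_lt; [lra|]. nra. }
 assert (Z2 : forall z, Cmod (z - a2)%C < 10 / 11 * (16 / 10) -> d z = 0).
 { apply (zero_ball d a2 (1 / 100) (16 / 10)); [lra| |].
  - apply (zeta_limit_on zeta Hzeta). intros z Hz. destruct (Hgeo a2 z (16 / 10) Hz) as [G1 [G2 G3]]. unfold a1, a2 in G1, G2, G3; simpl in G1, G2, G3.
   apply Rabs_def2 in G2. apply Rabs_def2 in G3. split; [lra|split].
   + left. apply Cmod_sq_lt; [lra|]. nra.
   + intros E. rewrite E in G1. simpl in G1. lra.
  - intros z Hz. apply Z1. replace (z - a1)%C with ((z - a2) + (a2 - a1))%C by ring.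
   eapply Rle_lt_trans; [apply Cmod_triangle|].
   assert (Cmod (a2 - a1)%C < 179 / 100) by (apply Cmod_sq_lt; [lra|]; unfold a1, a2, Cminus, Cplus, Copp, Re, Im; simpl; lra). lra. }
 apply Z2. replace (s - a2)%C with ((s + 1) + (- (1) - a2))%C by ring. eapply Rle_lt_trans; [apply Cmod_triangle|].
 assert (Cmod (- (1) - a2)%C < 135 / 100) by (apply Cmod_sq_lt; [lra|]; unfold a2, RtoC, Cminus, Cplus, Copp, Re, Im; simpl; lra). lra.
Qed.

(** * The derivative at [-1] along the real axis *)

Definition rpw (p x : R) : R := exp (p * ln x).

Lemma rpw_derive (p x : R) : 0 < x -> is_derive (rpw p) x (p * rpw (p - 1) x).
Proof. intros Hx. unfold rpw. replace (p * exp ((p - 1) * ln x)) with (p * exp (p * ln x) * / x).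
 - auto_derive; [lra|]. field. lra.
 - replace ((p - 1) * ln x) with (p * ln x + - ln x) by ring. rewrite exp_plus, exp_Ropp, exp_ln by exact Hx. ring.
Qed.

Lemma rpw_0 (x : R) : rpw 0 x = 1.
Proof. unfold rpw. rewrite Rmult_0_l. apply exp_0. Qed.

Lemma rpw_1_l (p : R) : rpw p 1 = 1.
Proof. unfold rpw. rewrite ln_1, Rmult_0_r. apply exp_0. Qed.

Lemma rpw_succ (p x : R) : 0 < x -> rpw (p + 1) x = x * rpw p x.
Proof.
 intros Hx. unfold rpw. replace ((p + 1) * ln x) with (ln x + p * ln x) by ring. rewrite exp_plus, exp_ln by exact Hx. reflexivity.
Qed.

Lemma phiC_real (c s x : R) : phiC (RtoC c) (RtoC s) x = c * rpw (- s) x.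
Proof.
 unfold RtoC. rewrite phiC_expand, !Rmult_0_l, cos_0. unfold rpw. replace (- (s * ln x)) with (- s * ln x) by ring. ring.
Qed.

(** [zT n s / (s - 1)] at the real point [s = -1 + d]. *)
Definition zA (d : R) (n : nat) : R := bsum (fun k => rpw (1 - d) (INR k)) n -
 (rpw (2 - d) (INR n) / (2 - d) + rpw (1 - d) (INR n) / 2 + (1 - d) * rpw (- d) (INR n) / 12).

Lemma zA_lim (zeta : C -> C) (Hzeta : riemann_zeta zeta) (d : R) : 0 <= d <= 1 / 20 ->
 is_lim_seq (zA d) (Re (zeta (RtoC (-1 + d)))).
Proof. intros Hd. set (s := -1 + d). assert (Hs : ((RtoC s - 1) * zeta (RtoC s) - zG (RtoC s))%C = 0).
 { apply zeta_zG; [exact Hzeta|]. rewrite <- RtoC_plus, Cmod_R. unfold s. rewrite Rabs_right; lra. }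
 assert (Hs0 : RtoC (s - 1) <> RtoC 0) by (intros E; injection E; unfold s; lra). set (c := / (s - 1)).
 assert (Ec : (RtoC c * (RtoC s - 1))%C = RtoC 1).
 { rewrite <- RtoC_minus, <- RtoC_mult. f_equal. unfold c, s. field. lra. }
 assert (EG : (RtoC c * zG (RtoC s))%C = zeta (RtoC s)).
 { replace (zG (RtoC s)) with ((RtoC s - 1) * zeta (RtoC s) - ((RtoC s - 1) * zeta (RtoC s) - zG (RtoC s)))%C by ring.
  rewrite Hs. replace (RtoC c * ((RtoC s - 1) * zeta (RtoC s) - 0))%C with (RtoC c * (RtoC s - 1) * zeta (RtoC s))%C by ring.
  rewrite Ec. ring. }
 assert (EA : forall n, zA d n = Re (RtoC c * zT n (RtoC s))%C). { intros n. rewrite zT_Re, Ec. unfold zA.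
  replace (bsum (fun k => phiC 1 (RtoC s) (INR k)) n) with (bsum (fun k => rpw (1 - d) (INR k)) n).
  2:{ apply bsum_ext. intros k _. rewrite phiC_real. unfold s. rewrite Rmult_1_l. f_equal. ring. }
  replace (- RtoC s * 1)%C with (RtoC (- s)) by (rewrite RtoC_opp; ring).
  rewrite <- RtoC_opp, <- RtoC_plus, <- RtoC_minus, !phiC_real.
  replace (- (s - 1)) with (2 - d) by (unfold s; ring). replace (- (s + 1)) with (- d) by (unfold s; ring).
  replace (- s) with (1 - d) by (unfold s; ring). unfold c, s. field. lra. }
 assert (HT : forall n, (1 <= n)%nat -> Rabs (zA d n - Re (zeta (RtoC s))) <= 200 * / INR n).
 { intros n Hn. rewrite EA, <- EG.
  replace (Re (RtoC c * zT n (RtoC s))%C - Re (RtoC c * zG (RtoC s))%C) with (Re (RtoC c * (zT n (RtoC s) - zG (RtoC s)))%C).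
  - eapply Rle_trans; [apply re_le_Cmod|]. rewrite Cmod_mult.
   assert (H := zT_limit (RtoC s) n ltac:(simpl; unfold s; lra) ltac:(rewrite Cmod_R; unfold s; rewrite Rabs_left; lra) Hn).
   assert (Hc : Cmod (RtoC c) <= 1).
   { rewrite Cmod_R. unfold c. rewrite Rabs_inv. rewrite <- Rinv_1. apply Rinv_le_contravar; [lra|]. unfold s. rewrite Rabs_left; lra. }
   rewrite <- (Rmult_1_l (200 * / INR n)). apply Rmult_le_compat; try apply Cmod_ge_0; assumption.
  - replace (RtoC c * (zT n (RtoC s) - zG (RtoC s)))%C with (RtoC c * zT n (RtoC s) + - (RtoC c * zG (RtoC s)))%C by ring.
   rewrite Re_plus. reflexivity. }
 apply (is_lim_seq_of_bound _ (fun n => 200 * / INR n)); [exact HT|apply inv_INR_lim].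
Qed.

(** The terms of first order in [d] cancel. What is left involves [1 - x ^ (- d) <= d x], which
    gains a second factor [d] at the price of one power of [x]. *)
Lemma psi4_bound (d x : R) : 0 < d <= 1 / 20 -> 1 <= x ->
 Rabs (- ((1 - d) * d * (1 + d) * (2 + d) * rpw (- d - 3) x) + 2 * d * / x ^ 3) <= 5 * d ^ 2 * / x ^ 2.
Proof. intros Hd Hx. assert (E : rpw (- d - 3) x = rpw (- d) x * / x ^ 3).
 { replace (rpw (- d) x) with (x * (x * (x * rpw (- d - 3) x))).
  - field. lra.
  - rewrite <- !rpw_succ by lra. f_equal. ring. }
 rewrite E. set (q := rpw (- d) x). assert (0 <= ln x) by (rewrite <- ln_1; apply ln_le; lra).
 assert (ln x <= x - 1) by (apply ln_le_sub_1; lra). assert (q <= 1).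
 { unfold q, rpw. rewrite <- exp_0. apply exp_le_mono. assert (0 <= d * ln x) by pos. lra. }
 assert (1 - d * x <= q).
 { unfold q, rpw. eapply Rle_trans; [|apply exp_ineq1_le]. assert (d * ln x <= d * x) by mono. lra. }
 assert (0 < / x ^ 3) by pos. replace (- ((1 - d) * d * (1 + d) * (2 + d) * (q * / x ^ 3)) + 2 * d * / x ^ 3) with
  (/ x ^ 3 * (d * (2 * (1 - q) - d * (1 - 2 * d - d ^ 2) * q))) by ring.
 replace (5 * d ^ 2 * / x ^ 2) with (/ x ^ 3 * (d * (5 * d * x))) by (field; lra).
 rewrite !Rabs_mult, (Rabs_right (/ x ^ 3)), (Rabs_right d) by lra.
 apply Rmult_le_compat_l; [lra|]. apply Rmult_le_compat_l; [lra|]. assert (0 < q) by apply exp_pos.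
 assert (0 <= 1 - 2 * d - d ^ 2 <= 1) by nra. assert (0 <= (1 - 2 * d - d ^ 2) * q <= 1 * 1) by mono.
 assert (0 <= d * ((1 - 2 * d - d ^ 2) * q) <= d * 1) by mono. assert (d * 1 <= d * x) by mono.
 apply Rabs_le. split; lra.
Qed.

(** Euler--Maclaurin for [x ^ (1 - d) - x + d x ln x], the second-order remainder in [d] of
    [x ^ (1 - d)]. By [psi4_bound] its fourth derivative is [O(d ^ 2 x ^ -2)], so the error is
    [O(d ^ 2)] uniformly in [n]. *)
Lemma zA_second_order (d : R) : 0 < d <= 1 / 20 -> forall n, (1 <= n)%nat ->
 Rabs (zA d n - zA 0 n + d * hyperfactorial_defect n) <= 3 * d ^ 2.
Proof. intros Hd. assert (Hd2 : 0 < d ^ 2) by pos. destruct (euler_maclaurin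
  (fun x => rpw (2 - d) x / (2 - d) - x ^ 2 / 2 + d * (x ^ 2 / 2 * ln x - x ^ 2 / 4))
  (fun x => rpw (1 - d) x - x + d * (x * ln x)) (fun x => (1 - d) * rpw (- d) x - 1 + d * (ln x + 1))
  (fun x => - ((1 - d) * d * rpw (- d - 1) x) + d * / x)
  (fun x => (1 - d) * d * (1 + d) * rpw (- d - 2) x + - (d * / x ^ 2))
  (fun x => - ((1 - d) * d * (1 + d) * (2 + d) * rpw (- d - 3) x) + 2 * d * / x ^ 3)
  (fun n => d ^ 2 * / INR n)) as [l Hl].
 - intros x Hx. apply is_derive_plusR; [apply is_derive_minusR|].
  + replace (rpw (1 - d) x) with ((2 - d) * rpw (2 - d - 1) x * / (2 - d)) by (replace (2 - d - 1) with (1 - d) by ring; field; lra).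
   apply (is_derive_ext (fun x => / (2 - d) * rpw (2 - d) x)); [intros t; unfold Rdiv; apply Rmult_comm|].
   rewrite Rmult_comm. apply (is_derive_scal (rpw (2 - d)) x (/ (2 - d))), rpw_derive. lra.
  + auto_derive; [exact I|field].
  + auto_derive; [lra|field; lra].
 - intros x Hx. apply is_derive_plusR; [apply is_derive_minusR|].
  + replace (- d) with (1 - d - 1) by ring. apply rpw_derive. lra.
  + auto_derive; [exact I|ring].
  + auto_derive; [lra|field; lra].
 - intros x Hx. apply is_derive_plusR.
  + replace (- ((1 - d) * d * rpw (- d - 1) x)) with ((1 - d) * (- d * rpw (- d - 1) x) - 0) by ring.
   apply is_derive_minusR; [|apply is_derive_constR]. apply (is_derive_scal (rpw (- d)) x (1 - d)), rpw_derive. lra.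
  + auto_derive; [lra|mono].
 - intros x Hx. apply is_derive_plusR.
  + replace ((1 - d) * d * (1 + d) * rpw (- d - 2) x) with (- ((1 - d) * d) * ((- d - 1) * rpw (- d - 1 - 1) x)).
   * apply (is_derive_ext (fun x => - ((1 - d) * d) * rpw (- d - 1) x)); [intros t; apply Ropp_mult_distr_l_reverse|].
    apply (is_derive_scal (rpw (- d - 1)) x (- ((1 - d) * d))), rpw_derive. lra.
   * replace (- d - 1 - 1) with (- d - 2) by ring. ring.
  + auto_derive; [lra|field; lra].
 - intros x Hx. apply is_derive_plusR.
  + replace (- ((1 - d) * d * (1 + d) * (2 + d) * rpw (- d - 3) x)) with ((1 - d) * d * (1 + d) * ((- d - 2) * rpw (- d - 2 - 1) x)).
   * apply (is_derive_scal (rpw (- d - 2)) x ((1 - d) * d * (1 + d))), rpw_derive. lra.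
   * replace (- d - 2 - 1) with (- d - 3) by ring. ring.
  + pos_derive.
 - intros n x Hn Hx. assert (Hn1 := le_INR _ _ Hn). simpl (INR 1) in Hn1. assert (H := inv_step n Hn).
  eapply Rle_trans; [apply psi4_bound; lra|].
  assert (H2 := inv_pow_antitone (INR n) x 2 ltac:(lra)). assert (0 < / INR n ^ 2) by pos.
  apply Rle_trans with (d ^ 2 * (720 * (/ INR n - / INR (S n)))); [|mono].
  replace (5 * d ^ 2 * / x ^ 2) with (d ^ 2 * (5 * / x ^ 2)) by ring. mono.
 - intros n Hn. assert (Hn1 := le_INR _ _ Hn). simpl (INR 1) in Hn1. mono.
 - apply inv_INR_lim.
 - assert (EU : forall n, (1 <= n)%nat -> bsum (fun k => rpw (1 - d) (INR k) - INR k + d * (INR k * ln (INR k))) n -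
    (rpw (2 - d) (INR n) / (2 - d) - INR n ^ 2 / 2 + d * (INR n ^ 2 / 2 * ln (INR n) - INR n ^ 2 / 4) +
    (rpw (1 - d) (INR n) - INR n + d * (INR n * ln (INR n))) / 2 +
    ((1 - d) * rpw (- d) (INR n) - 1 + d * (ln (INR n) + 1)) / 12) = zA d n - zA 0 n + d * hyperfactorial_defect n).
  { intros n Hn. apply le_INR in Hn. simpl (INR 1) in Hn.
   unfold zA, hyperfactorial_defect. rewrite bsum_plus, bsum_minus, (bsum_scal d).
   replace (bsum (fun k => rpw (1 - 0) (INR k)) n) with (bsum (fun k => INR k) n).
   - rewrite !Rminus_0_r, Ropp_0, rpw_0. change (bsum (fun k => INR k) n) with (bsum INR n). replace (rpw 1 (INR n)) with (INR n); [replace (rpw 2 (INR n)) with (INR n ^ 2); [mono|]|].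
    + replace 2 with (0 + 1 + 1) by ring. rewrite !rpw_succ, rpw_0 by lra. ring.
    + replace 1 with (0 + 1) by ring. rewrite rpw_succ, rpw_0 by lra. ring.
   - apply bsum_ext. intros k Hk. rewrite Rminus_0_r. replace 1 with (0 + 1) by ring.
    rewrite rpw_succ, rpw_0; [ring|]. apply lt_0_INR. lia. }
  (* At [n = 1] all powers are 1 and all logarithms 0, so this case bounds the unnamed constant [l]
     by a multiple of [d ^ 2]. *)
  intros n Hn. assert (H1 := Hl 1%nat (le_n 1)). assert (Hn' := Hl n Hn). cbv beta in Hn', H1. rewrite EU in Hn' by exact Hn.
  simpl (INR 1) in H1. simpl bsum in H1. rewrite !rpw_1_l, ln_1, Rinv_1 in H1.
  assert (Hn1 := le_INR _ _ Hn). simpl (INR 1) in Hn1.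
  assert (Hin : / INR n <= 1) by (rewrite <- Rinv_1; apply Rinv_le_contravar; lra).
  assert (Hdn : d ^ 2 * / INR n <= d ^ 2 * 1) by mono.
  match type of H1 with Rabs (?a - l) <= _ => assert (E1 : a = - (d ^ 2 / (4 * (2 - d)))) by (field; lra); rewrite E1 in H1 end.
  assert (Hb : 0 <= d ^ 2 / (4 * (2 - d)) <= d ^ 2). { split; [pos|]. apply div_le_intro; [lra|]. nra. }
  absle H1. absle Hn'. apply Rabs_le. split; lra.
Qed.

(** Letting [n -> oo] in [zA_second_order] gives [zeta(-1 + d) = zeta(-1) - d l + O(d ^ 2)] for
    small [d > 0], in real parts. As the complex derivative exists, this one-sided real direction
    determines its real part. *)
Lemma zeta_prime_eq (zeta : C -> C) (l : R) : riemann_zeta zeta ->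
 (forall m, (1 <= m)%nat -> Rabs (hyperfactorial_defect m - l) <= / INR m ^ 2) -> zeta_prime_m1 zeta = - l.
Proof. intros Hzeta Hl. assert (HlL : is_lim_seq hyperfactorial_defect l).
 { apply (is_lim_seq_of_bound _ (fun n => 1 * / INR n ^ 2)); [intros n Hn; rewrite Rmult_1_l; apply Hl, Hn|apply inv_INR_sq_lim]. }
 assert (HB : forall d, 0 < d <= 1 / 20 -> Rabs (Re (zeta (RtoC (-1 + d))) - Re (zeta (RtoC (-1))) + d * l) <= 3 * d ^ 2).
 { intros d Hd.
  assert (L1 := zA_lim zeta Hzeta d ltac:(lra)). assert (L0 := zA_lim zeta Hzeta 0 ltac:(lra)). rewrite Rplus_0_r in L0.
  assert (L : is_lim_seq (fun n => Rabs (zA d n - zA 0 n + d * hyperfactorial_defect n))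
   (Rabs (Re (zeta (RtoC (-1 + d))) - Re (zeta (RtoC (-1))) + d * l))).
  { apply (is_lim_seq_abs (fun n => zA d n - zA 0 n + d * hyperfactorial_defect n)
    (Re (zeta (RtoC (-1 + d))) - Re (zeta (RtoC (-1))) + d * l)).
   apply is_lim_seq_plus'; [apply is_lim_seq_minus'; assumption|].
   apply (is_lim_seq_scal_l hyperfactorial_defect d l HlL). }
  apply is_lim_seq_incr_1 in L.
  assert (HR : Rbar_le (Rabs (Re (zeta (RtoC (-1 + d))) - Re (zeta (RtoC (-1))) + d * l)) (3 * d ^ 2)); [|exact HR].
  apply (is_lim_seq_le (fun n => Rabs (zA d (S n) - zA 0 (S n) + d * hyperfactorial_defect (S n))) (fun _ => 3 * d ^ 2));
   [|exact L|apply is_lim_seq_const]. intros n. apply zA_second_order; [exact Hd|lia]. }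
 destruct (proj1 Hzeta (RtoC (-1)) ltac:(intros E; injection E; lra)) as [D HD].
 unfold zeta_prime_m1. rewrite (is_C_derive_unique zeta (RtoC (-1)) D HD).
 assert (HC := Cderiv_of_is_derive zeta (RtoC (-1)) D HD). assert (E : Re D + l = 0); [|lra].
 destruct (Req_dec (Re D + l) 0) as [E|E]; [exact E|exfalso].
 assert (Hp := Rabs_pos_lt _ E). set (m := Rabs (Re D + l)) in *. destruct (HC (m / 4) ltac:(lra)) as [dl [Hdl HDL]].
 set (d := Rmin (Rmin (dl / 2) (1 / 20)) (m / 12)).
 assert (M1 := Rmin_l (Rmin (dl / 2) (1 / 20)) (m / 12)). assert (M2 := Rmin_r (Rmin (dl / 2) (1 / 20)) (m / 12)).
 assert (M3 := Rmin_l (dl / 2) (1 / 20)). assert (M4 := Rmin_r (dl / 2) (1 / 20)). fold d in M1, M2.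
 assert (0 < d) by (unfold d; repeat apply Rmin_glb_lt; lra).
 specialize (HDL (RtoC d) ltac:(rewrite Cmod_R, Rabs_right; lra)). rewrite Cmod_R, (Rabs_right d) in HDL by lra.
 specialize (HB d ltac:(lra)). rewrite <- RtoC_plus in HDL.
 assert (HRe := re_le_Cmod (zeta (RtoC (-1 + d)) - zeta (RtoC (-1)) - D * RtoC d)%C).
 replace (Re (zeta (RtoC (-1 + d)) - zeta (RtoC (-1)) - D * RtoC d)%C) with (Re (zeta (RtoC (-1 + d))) - Re (zeta (RtoC (-1))) - d * Re D) in HRe.
 2:{ unfold Cminus, Cplus, Copp, Cmult, RtoC, Re. cbn [fst snd]. ring. }
 set (A := Re (zeta (RtoC (-1 + d))) - Re (zeta (RtoC (-1)))) in *.
 assert (Hf : Rabs (d * (Re D + l)) <= 3 * d ^ 2 + m / 4 * d).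
 { replace (d * (Re D + l)) with ((A + d * l) - (A - d * Re D)) by ring. eapply Rle_trans; [apply Rabs_triang|]. rewrite Rabs_Ropp. lra. }
 rewrite Rabs_mult, (Rabs_right d) in Hf by lra. fold m in Hf.
 assert (3 * d ^ 2 <= d * (m / 4)) by (replace (3 * d ^ 2) with (d * (3 * d)) by ring; apply Rmult_le_compat_l; lra).
 assert (0 < d * m) by pos. lra.
Qed.

Theorem theorem1p1 (q : R -> R) (zeta : C -> C)
    (hq : hastings_mcleod q) (hzeta : riemann_zeta zeta) :
  forall x : R, x < 0 ->
    hmF q x =
      Rpower 2 (1 / 48) * exp (1 / 2 * zeta_prime_m1 zeta)
      * (exp (- (1 / 24) * Rabs x ^ 3) / Rpower (Rabs x) (1 / 16))
      * exp (1 / 2 *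
             int_from_minfty (fun y => hmR q y - 1 / 4 * y ^ 2 + 1 / (8 * y)) x)
    /\
    hmE q x =
      1 / Rpower 2 (1 / 4)
      * exp (- (1 / (3 * sqrt 2)) * Rpower (Rabs x) (3 / 2))
      * exp (1 / 2 * int_from_minfty (fun y => q y - sqrt (Rabs y / 2)) x).
Proof.
  destruct hyperfactorial_limit as [l Hl].
  exact (theorem_of_zeta q l (zeta_prime_m1 zeta) hq Hl (zeta_prime_eq zeta l hzeta Hl)).
Qed.
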